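(* Let $A$ and $B$ be essential square matrices with entries in $\mathbb{N}$, indexed by finite sets $V$ and $W$ respectively. Then $A$ and $B$ are shift equivalent if and only if $\mathcal{O}_A$ and $\mathcal{O}_B$ are stably equivariantly homotopy equivalent.
   Context: $\mathbb{N}=\{0,1,2,\dots\}$. A matrix is essential if it has no zero row and no zero column. Shift equivalence: $A$ and $B$ are shift equivalent with lag $m\in\mathbb{N}\setminus\{0\}$ if there are rectangular matrices $R$ ($V\times W$) and $S$ ($W\times V$) with entries in $\mathbb{N}$ such that $A^m=RS$, $B^m=SR$, $BS=SA$, $AR=RB$. They are shift equivalent if this holds for some $m\geq 1$. Graph C*-algebra: for a finite square matrix $A=[A_{vw}]$ over $V$ with entries in $\mathbb{N}$, $G_A$ is the directed graph with vertex set $V$ and edge set $E_A=\{(v,k,w): v,w\in V,\ 0\le k<A_{vw}\}$, with source $s(v,k,w)=v$ and range $r(v,k,w)=w$. $\mathcal{O}_A=C^*(G_A)$ is the universal C*-algebra generated by mutually orthogonal projections $\{P_v\}_{v\in V}$ and partial isometries $\{S_e\}_{e\in E_A}$ with $S_e^*S_e=P_{r(e)}$ for all $e$ and $P_v=\sum_{s(e)=v}S_eS_e^*$ for all $v$. The gauge action $\gamma^A$ of the circle $\mathbb{T}$ is given by $\gamma^A_z(P_v)=P_v$, $\gamma^A_z(S_e)=zS_e$. $\mathbb{K}$ denotes the compact operators on a separable infinite-dimensional Hilbert space; $\mathcal{O}_A\otimes\mathbb{K}$ carries the action $\gamma^A\otimes\mathrm{id}$ (again called the gauge action). $\mathcal{O}_A$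 and $\mathcal{O}_B$ are stably equivariantly homotopy equivalent if there are gauge-preserving ($\mathbb{T}$-equivariant) $*$-homomorphisms $\tau:\mathcal{O}_A\otimes\mathbb{K}\to\mathcal{O}_B\otimes\mathbb{K}$ and $\rho:\mathcal{O}_B\otimes\mathbb{K}\to\mathcal{O}_A\otimes\mathbb{K}$ such that $\tau\circ\rho$ and $\rho\circ\tau$ are homotopic to the respective identity automorphisms through (point-norm continuous paths, indexed by $[0,1]$, of) $\mathbb{T}$-equivariant $*$-homomorphisms. *)

(* Defs.v *)
From HB Require Import structures.
From mathcomp Require Import all_boot all_order all_algebra.
From mathcomp Require Import complex.
From mathcomp Require Import sesquilinear.
From mathcomp Require Import all_classical all_reals all_analysis.

Set Implicit Arguments.
Unset Strict Implicit.
Unset Printing Implicit Defensive.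

Import Order.TTheory GRing.Theory Num.Theory Num.Def.
Import numFieldNormedType.Exports.

Local Open Scope classical_set_scope.
Local Open Scope ring_scope.

(* A matrix over N indexed by finite sets V and W is a function V -> W -> nat;
   equality of matrices is pointwise equality =2. *)
Section Matrices.
Local Open Scope nat_scope.

Definition matmul (U V W : finType) (A : U -> V -> nat) (B : V -> W -> nat)
    : U -> W -> nat :=
  fun u w => \sum_(v : V) A u v * B v w.

Definition matpow (V : finType) (A : V -> V -> nat) (m : nat) : V -> V -> nat :=
  iter m (matmul A) (fun v w => (v == w) : nat).

Definition essential (V : finType) (A : V -> V -> nat) : Prop :=
  (forall v, exists w, A v w != 0) /\ (forall w, exists v, A v w != 0).

Definition shift_equivalent_lag (m : nat) (V W : finType)
    (A : V -> V -> nat) (B : W -> W -> nat) : Prop :=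
  exists (R : V -> W -> nat) (S : W -> V -> nat),
    [/\ matpow A m =2 matmul R S, matpow B m =2 matmul S R,
        matmul B S =2 matmul S A & matmul A R =2 matmul R B].

Definition shift_equivalent (V W : finType)
    (A : V -> V -> nat) (B : W -> W -> nat) : Prop :=
  exists2 m, 0 < m & shift_equivalent_lag m A B.

(* The edge (v, k, w), with k < A v w, is the dependent pair of (v, w) and
   k : 'I_(A v w). *)
Definition edge (V : finType) (A : V -> V -> nat) : finType :=
  {vw : V * V & 'I_(A vw.1 vw.2)}.

Definition edge_source (V : finType) (A : V -> V -> nat) (e : edge A) : V :=
  (tag e).1.

Definition edge_range (V : finType) (A : V -> V -> nat) (e : edge A) : V :=
  (tag e).2.

End Matrices.

(* C*-algebras are not required to be unital (and may be zero). The norm of a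
   normed module over R[i] takes its values in R[i], in the nonnegative
   reals. *)
HB.mixin Record isCStarAlgebra (R : realType) (T : Type)
    of CompleteNormedModule R[i] T := {
  amul : T -> T -> T;
  adj : T -> T;
  amulA : associative amul;
  amul_linearl : forall y, linear (amul^~ y);
  amul_linearr : forall x, linear (amul x);
  adj_semilinear : forall (a : R[i]) x y,
    adj (a *: x + y) = (conjC a) *: adj x + adj y;
  adjK : involutive adj;
  adjM : forall x y, adj (amul x y) = amul (adj y) (adj x);
  norm_amul_le : forall x y, `|amul x y| <= `|x| * `|y|;
  cstar_identity : forall x, `|amul (adj x) x| = `|x| ^+ 2 }.

#[short(type="cstarAlgType")]
HB.structure Definition CStarAlgebra (R : realType) :=
  {T of CompleteNormedModule R[i] T & isCStarAlgebra R T}.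

Notation "x ** y" := (amul x y) (at level 40, left associativity).

Definition star_hom (R : realType) (T T' : cstarAlgType R) (f : T -> T') : Prop :=
  [/\ linear f, {morph f : x y / x ** y} & {morph f : x / adj x}].

Definition projection (R : realType) (T : cstarAlgType R) (p : T) : Prop :=
  p ** p = p /\ adj p = p.

Definition partial_isometry (R : realType) (T : cstarAlgType R) (s : T) : Prop :=
  s ** adj s ** s = s.

Definition closed_star_subalgebra (R : realType) (T : cstarAlgType R)
    (X : set T) : Prop :=
  [/\ closed X, X 0,
      forall (a : R[i]) x y, X x -> X y -> X (a *: x + y),
      forall x y, X x -> X y -> X (x ** y) &
      forall x, X x -> X (adj x)].

Definition cuntz_krieger_family (V : finType) (A : V -> V -> nat)
    (R : realType) (T : cstarAlgType R) (P : V -> T) (S : edge A -> T) : Prop :=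
  [/\ forall v, projection (P v),
      forall v w, v != w -> P v ** P w = 0,
      forall e, partial_isometry (S e),
      forall e, adj (S e) ** S e = P (edge_range e) &
      forall v, P v = \sum_(e : edge A | edge_source e == v) S e ** adj (S e)].

(* The graph C*-algebra O_A, given by its universal property, together with its
   gauge action. The maps [gauge z] are constrained for |z| = 1 only, where they
   are determined by their values on the generators. *)
Record graph_algebra (R : realType) (V : finType) (A : V -> V -> nat) := {
  graph_alg :> cstarAlgType R;
  vertex_proj : V -> graph_alg;
  edge_isom : edge A -> graph_alg;
  graph_family : cuntz_krieger_family vertex_proj edge_isom;
  graph_generated : forall X : set graph_alg, closed_star_subalgebra X ->
    (forall v, X (vertex_proj v)) -> (forall e, X (edge_isom e)) ->
    forall x, X x;
  graph_universal : forall (T : cstarAlgType R) (P : V -> T) (S : edge A -> T),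
    cuntz_krieger_family P S ->
    exists f : graph_alg -> T, [/\ star_hom f,
      forall v, f (vertex_proj v) = P v & forall e, f (edge_isom e) = S e];
  gauge : R[i] -> graph_alg -> graph_alg;
  gaugeP : forall z : R[i], `|z| = 1 -> [/\ star_hom (gauge z),
    forall v, gauge z (vertex_proj v) = vertex_proj v &
    forall e, gauge z (edge_isom e) = z *: edge_isom e] }.

Definition linearly_independent (K : fieldType) (E : lmodType K) (n : nat)
    (x : 'I_n -> E) : Prop :=
  forall c : 'I_n -> K, \sum_(i < n) c i *: x i = 0 -> forall i, c i = 0.

Definition compact_operator (R : realType) (H : normedModType R[i])
    (f : H -> H) : Prop :=
  linear f /\ precompact (f @` [set x | `|x| <= 1]).

(* The C*-algebra of compact operators on a separable infinite-dimensional
   Hilbert space H (with inner product linear in the first variable), as a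
   C*-algebra identified with them through a faithful *-representation on H;
   such a representation is isometric for the operator norm. *)
Record compact_operators (R : realType) := {
  compact_alg :> cstarAlgType R;
  hilbert : completeNormedModType R[i];
  inner : {dot hilbert for (@conjC R[i])};
  inner_norm : forall x, inner x x = `|x| ^+ 2;
  hilbert_separable : exists2 D : set hilbert, countable D & dense D;
  hilbert_infinite : forall n, exists x : 'I_n -> hilbert,
    linearly_independent x;
  rep : compact_alg -> hilbert -> hilbert;
  rep_linear : forall (a : R[i]) k l x, rep (a *: k + l) x = a *: rep k x + rep l x;
  rep_mul : forall k l x, rep (k ** l) x = rep k (rep l x);
  rep_adj : forall k x y, inner (rep k x) y = inner x (rep (adj k) y);
  rep_inj : injective rep;
  rep_compact : forall f : hilbert -> hilbert,
    compact_operator f <-> exists k, rep k = f }.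

(* T is a C*-completion of the algebraic tensor product of A and K, via the
   elementary tensors t a k; this is the C*-tensor product as soon as A or K is
   nuclear (such as the compact operators), C*-norms being then unique.
   The fourth condition says that the linear map from the algebraic tensor
   product to T induced by t is injective. *)
Definition cstar_tensor_product (R : realType) (A K T : cstarAlgType R)
    (t : A -> K -> T) : Prop :=
  [/\ (forall k, linear (t^~ k)) /\ (forall a, linear (t a)),
      forall a b k l, t a k ** t b l = t (a ** b) (k ** l),
      forall a k, adj (t a k) = t (adj a) (adj k),
      forall n (a : 'I_n -> A) (k : 'I_n -> K), linearly_independent k ->
        \sum_(i < n) t (a i) (k i) = 0 -> forall i, a i = 0 &
      dense [set x | exists n (a : 'I_n -> A) (k : 'I_n -> K),
        x = \sum_(i < n) t (a i) (k i)]].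

(* O_A tensor K, with the gauge action gamma tensor id (again constrained on
   the circle only, where it is determined by its values on elementary
   tensors). *)
Record stabilization (R : realType) (V : finType) (A : V -> V -> nat)
    (OA : graph_algebra R A) (K : compact_operators R) := {
  stab_alg :> cstarAlgType R;
  tensor : OA -> K -> stab_alg;
  tensorP : cstar_tensor_product tensor;
  stab_gauge : R[i] -> stab_alg -> stab_alg;
  stab_gaugeP : forall z : R[i], `|z| = 1 -> star_hom (stab_gauge z) /\
    forall a k, stab_gauge z (tensor a k) = tensor (gauge z a) k }.

Definition equivariant_star_hom (R : realType) (T T' : cstarAlgType R)
    (act : R[i] -> T -> T) (act' : R[i] -> T' -> T') (f : T -> T') : Prop :=
  star_hom f /\
  forall z : R[i], `|z| = 1 -> forall x, f (act z x) = act' z (f x).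

(* The path h is parametrized by [0, 1], its values elsewhere being irrelevant. *)
Definition equivariantly_homotopic (R : realType) (T T' : cstarAlgType R)
    (act : R[i] -> T -> T) (act' : R[i] -> T' -> T') (f g : T -> T') : Prop :=
  exists h : R -> T -> T',
    [/\ forall s, 0 <= s <= 1 -> equivariant_star_hom act act' (h s),
        forall x, {within `[0, 1], continuous (fun s : R => h s x)},
        h 0 =1 f & h 1 =1 g].

Definition stably_equivariantly_homotopy_equivalent (R : realType)
    (V W : finType) (A : V -> V -> nat) (B : W -> W -> nat)
    (OA : graph_algebra R A) (OB : graph_algebra R B)
    (K : compact_operators R)
    (OAK : stabilization OA K) (OBK : stabilization OB K) : Prop :=
  let actA := @stab_gauge _ _ _ _ _ OAK in
  let actB := @stab_gauge _ _ _ _ _ OBK in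
  exists (tau : OAK -> OBK) (rho : OBK -> OAK),
    [/\ equivariant_star_hom actA actB tau,
        equivariant_star_hom actB actA rho,
        equivariantly_homotopic actB actB (tau \o rho) id &
        equivariantly_homotopic actA actA (rho \o tau) id].

(* Main.v *)
(* Fix matrix units of K, so that O_A (x) K contains the elements mu i j a, the
   matrices with one nonzero entry a. Both directions compare gauge-equivariant
   homomorphisms through their effect on the projections p_v = mu 0 0 P_v.

   From shift to homotopy equivalence. If A M = M B, a bijection theta between
   the paths (edge of A, edge of M) and (edge of M, edge of B) defines a
   Cuntz-Krieger family in O_B (x) K: S_e is the sum over the edges f of M that
   can follow e of y_f' T_e' y_f^*, where (f', e') = theta (e, f) and the y_f are
   isometries of degree 0. Up to homotopy the homomorphism obtained depends only
   on M: the isometries y_f are moved by rotations, after making room in K, and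
   theta is changed by transpositions, which the unitaries z p + 1 - p, |z| = 1,
   connect to the identity. Composition corresponds to the product of matrices.
   The homomorphism of A itself is the conjugation by isometries of degree -1,
   hence is invertible up to homotopy, the inverse being a conjugation by
   isometries of degree 1. So if R S = A^m and S R = B^m, then the homomorphisms
   of R and S compose to invertible ones in both orders.

   From homotopy to shift equivalence. A projection of degree 0 can be
   approximated by combinations of products s_x s_y^* of paths of the same length
   n, so it is equivalent, by elements of degree n, to a direct sum of p_w's.
   Applied to the images of the p_v this gives the matrices R and S, and p_v is
   equivalent, by elements of degree n, to the direct sum of the p_w's with
   multiplicities (A^n)_vw. Homotopic homomorphisms have equivalent values on
   p_v. Finally, if sums of p_w's with multiplicities x and y are equivalent by
   elements of degree 0, then x A^k = y A^k for large k: approximating the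
   equivalence by combinations of s_x s_y^* with x, y of length k yields scalar
   matrices, whose kernels must vanish. *)
From HB Require Import structures.
Require Import Defs.
From mathcomp Require Import all_boot all_order all_fingroup all_algebra.
From mathcomp Require Import complex sesquilinear spectral.
From mathcomp Require Import all_classical all_reals all_analysis.
From mathcomp Require Import ring lra zify.

Set Implicit Arguments.
Unset Strict Implicit.
Unset Printing Implicit Defensive.

Import Order.TTheory GRing.Theory Num.Theory Num.Def.
Import numFieldNormedType.Exports.

Local Open Scope classical_set_scope.
Local Open Scope ring_scope.
Local Open Scope complex_scope.

(** * C*-algebras *)

(** The algebras are known only through their axioms; functional calculus, unitizations and
    integrals over the circle are avoided. Norm information comes from one equation, 2 c = x + c^2,
    solved by iteration: 1 - c is then a square root of 1 - x. It yields that homomorphisms are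
    contractive, hence extend by continuity, and that injective ones are isometric. The latter
    matters for O_A (x) K, of which only algebraic conditions and a density are given: the maps a
    |-> mu i i a are isometric, so the matrices of a fixed size form a closed subalgebra, and a
    homomorphism given by a formula on them is automatically bounded.

    Degrees are what makes A visible: p_v is equivalent to the direct sum of the p_w with
    multiplicities A_vw by elements of degree 1. Once the degree is recorded, multiplicities are
    determined up to multiplication by a power of A, and this ambiguity is harmless because such a
    power can be absorbed into the lag. Counting requires p_v to be nonzero, which the universal
    property does not show directly; a concrete representation does. *)

Section RealNorm.
Context {R : realType}.

(** Norms take their values in R[i]; [cabs] and [nrm] are real-valued versions, to which [lra] and
    suprema apply. *)
Definition cabs (a : R[i]) : R := complex.Re `|a|.

Lemma cabsE a : `|a| = (cabs a)%:C.
Proof. by rewrite /cabs RRe_real // normr_real. Qed.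

Lemma cabs_ge0 a : 0 <= cabs a.
Proof. by rewrite -lecR -cabsE normr_ge0. Qed.

Lemma cabsM a b : cabs (a * b) = cabs a * cabs b.
Proof. by apply: complexI; rewrite rmorphM /= -!cabsE normrM. Qed.

Lemma cabsN a : cabs (- a) = cabs a.
Proof. by rewrite /cabs normrN. Qed.

Lemma cabsC (r : R) : cabs r%:C = `|r|.
Proof. by rewrite /cabs normc_def /= expr0n addr0 sqrtr_sqr. Qed.

Lemma cabs0 : cabs 0 = 0. Proof. by rewrite /cabs normr0. Qed.

Lemma cabs_eq0 a : cabs a = 0 -> a = 0.
Proof. by move=> h; apply/eqP; rewrite -normr_eq0 cabsE h. Qed.

Lemma cabs_inv a : cabs a^-1 = (cabs a)^-1.
Proof. by apply: complexI; rewrite fmorphV /= -!cabsE normfV. Qed.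

Lemma cabsD a b : cabs (a + b) <= cabs a + cabs b.
Proof. by rewrite -lecR rmorphD /= -!cabsE ler_normD. Qed.

Lemma cabs_i : cabs 'i = 1.
Proof. by rewrite /cabs normCi. Qed.

Context {T : normedModType R[i]}.
Implicit Types x y z : T.

Definition nrm x : R := complex.Re `|x|.

Lemma nrmE x : `|x| = (nrm x)%:C.
Proof. by rewrite /nrm RRe_real // normr_real. Qed.

Lemma nrm_ge0 x : 0 <= nrm x.
Proof. by rewrite -lecR -nrmE normr_ge0. Qed.

Lemma nrm0 : nrm 0 = 0. Proof. by rewrite /nrm normr0. Qed.

Lemma nrm_eq0 x : nrm x = 0 -> x = 0.
Proof. by move=> h; apply/eqP; rewrite -normr_eq0 nrmE h. Qed.

Lemma nrm_le0 x : nrm x <= 0 -> x = 0.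
Proof. by move=> h; apply: nrm_eq0; apply/eqP; rewrite eq_le h nrm_ge0. Qed.

Lemma nrmN x : nrm (- x) = nrm x. Proof. by rewrite /nrm normrN. Qed.

Lemma nrmD x y : nrm (x + y) <= nrm x + nrm y.
Proof. by rewrite -lecR rmorphD /= -!nrmE ler_normD. Qed.

Lemma nrmBC x y : nrm (x - y) = nrm (y - x).
Proof. by rewrite -nrmN opprB. Qed.

Lemma nrmB x y : nrm (x - y) <= nrm x + nrm y.
Proof. by rewrite -(nrmN y) nrmD. Qed.

Lemma nrm_tri z x y : nrm (x - y) <= nrm (x - z) + nrm (z - y).
Proof. by rewrite -{1}(subrK z x) -addrA nrmD. Qed.

Lemma nrm_sub_le x y : nrm x <= nrm (x - y) + nrm y.
Proof. by rewrite -{1}(subrK y x) nrmD. Qed.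

Lemma nrmZ (a : R[i]) x : nrm (a *: x) = cabs a * nrm x.
Proof. by apply: complexI; rewrite rmorphM /= -!nrmE -cabsE normrZ. Qed.

Lemma nrm_sum (I : Type) (r : seq I) (P : pred I) (F : I -> T) :
  nrm (\sum_(i <- r | P i) F i) <= \sum_(i <- r | P i) nrm (F i).
Proof.
elim/big_rec2: _ => [|i y x _ h]; first by rewrite nrm0.
by rewrite (le_trans (nrmD _ _)) // lerD2l.
Qed.

Lemma nrm_small x : (forall e : R, 0 < e -> nrm x <= e) -> x = 0.
Proof.
move=> h; apply: nrm_le0; apply/ler_addgt0Pl => e e0.
by rewrite addr0; exact: h.
Qed.

(** The metric form of closure, through which closed and dense sets are handled below. *)
Definition adh (X : set T) x := forall e : R, 0 < e -> exists2 y, X y & nrm (x - y) < e.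

Lemma nbhs_nrm x (A : set T) :
  nbhs x A <-> exists2 e : R, 0 < e & forall y, nrm (x - y) < e -> A y.
Proof.
split.
  move=> /nbhs_ballP[e /= e0 h]; exists (complex.Re e).
    by move: e0; rewrite ltcE /= => /andP[].
  move=> y hy; apply: h; rewrite -ball_normE /= nrmE.
  have -> : e = (complex.Re e)%:C by rewrite RRe_real // gtr0_real.
  by rewrite ltcR.
case=> e e0 h; apply/nbhs_ballP; exists e%:C => /=; first by rewrite ltcR.
by move=> y; rewrite -ball_normE /= nrmE ltcR => /h.
Qed.

Lemma closureE_adh (X : set T) x : closure X x <-> adh X x.
Proof.
split=> [h e e0|h B /nbhs_nrm[e e0 hB]].
  have [|y [Xy hy]] := h [set y | nrm (x - y) < e].
    by apply/nbhs_nrm; exists e.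
  by exists y.
by have [y Xy hy] := h e e0; exists y; split => //; exact: hB.
Qed.

Lemma closedE_adh (X : set T) : closed X <-> forall x, adh X x -> X x.
Proof.
split=> [h x /closureE_adh|h]; first exact: h.
by move=> x /closureE_adh; exact: h.
Qed.

Lemma denseE_adh (X : set T) : dense X <-> forall x, adh X x.
Proof.
split.
  move=> h x e e0.
  have := h [set y | nrm (x - y) < e]; case.
  - by exists x; rewrite /= subrr nrm0.
  - rewrite openE => y /= hy; rewrite /interior; apply/nbhs_nrm.
    exists (e - nrm (x - y)); first by rewrite subr_gt0.
    move=> z hz /=; rewrite (le_lt_trans (nrm_tri y _ _)) //; lra.
  - by move=> y [/= hy Xy]; exists y.
move=> h O [x Ox]; rewrite openE => oO; have /nbhs_nrm[e e0 he] := oO _ Ox.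
by have [y Xy /he Oy] := h x e e0; exists y.
Qed.

Definition tends (u : nat -> T) l :=
  forall e : R, 0 < e -> exists N, forall n, (N <= n)%N -> nrm (l - u n) < e.

Lemma tends_adh (X : set T) u l : (forall n, X (u n)) -> tends u l -> adh X l.
Proof. by move=> hX h e e0; have [N /(_ N (leqnn _))] := h e e0; exists (u N). Qed.

Lemma adh_tends (X : set T) l : adh X l -> exists2 u, (forall n, X (u n)) & tends u l.
Proof.
move=> h; have h' n : exists y, X y /\ nrm (l - y) < n.+1%:R^-1.
  by have [|y] := h n.+1%:R^-1; [rewrite invr_gt0 ltr0n|exists y].
have [u hu] := choice h'; exists u; first by move=> n; have [] := hu n.
move=> e e0; have [N hN] : exists N : nat, e^-1 < N%:R.
  have := archi_boundP (ltW (_ : 0 < e^-1)); rewrite invr_gt0 => /(_ e0) ?.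
  by exists (archi_bound e^-1).
exists N => n Nn; have [_] := hu n; move/lt_trans; apply.
rewrite invf_plt ?posrE ?ltr0n // (lt_le_trans hN) // ler_nat.
exact: leq_trans Nn _.
Qed.

Lemma tends_unique u l l' : tends u l -> tends u l' -> l = l'.
Proof.
move=> h h'; apply/eqP; rewrite -subr_eq0; apply/eqP; apply: nrm_small => e e0.
have e2 : 0 < e / 2 by lra.
have [N hN] := h _ e2; have [N' hN'] := h' _ e2.
have := hN (maxn N N') (leq_maxl _ _); have := hN' (maxn N N') (leq_maxr _ _).
move: (u _) => y h1 h2; rewrite (le_trans (nrm_tri y _ _)) //.
rewrite (nrmBC y); lra.
Qed.

End RealNorm.

Section Complete.
Context {R : realType} {T : completeNormedModType R[i]}.

Lemma cauchy_tends (u : nat -> T) :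
  (forall e : R, 0 < e -> exists N, forall n m, (N <= n)%N -> (N <= m)%N -> nrm (u n - u m) < e) ->
  exists l, tends u l.
Proof.
move=> h.
have /cauchy_cvg : cauchy (u @ \oo).
  apply: cauchy_exP => e e0.
  have e0' : 0 < complex.Re e by move: e0; rewrite ltcE /= => /andP[].
  have [N hN] := h _ e0'; exists (u N); exists N => // n /= Nn.
  rewrite -ball_normE /= nrmE.
  have -> : e = (complex.Re e)%:C by rewrite RRe_real // gtr0_real.
  by rewrite ltcR; exact: hN.
move=> /cvg_ex[l hl]; exists l => e e0.
have := hl [set y | nrm (l - y) < e]; case.
  by apply/nbhs_nrm; exists e.
by move=> N _ hN; exists N => n Nn; apply: (hN n).
Qed.

End Complete.

(** * A reflexive tactic for linear identities in modules *)

Fixpoint eqvar (m n : nat) : bool :=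
  match m, n with
  | O, O => true
  | S m', S n' => eqvar m' n'
  | _, _ => false
  end.

Lemma eqvarE m n : eqvar m n = (m == n).
Proof. by elim: m n => [|m IH] [|n] //=; rewrite IH eqSS. Qed.

Section LinearNormalization.
Context {K : comNzRingType} {M : lmodType K}.

Inductive lexp :=
  | LVar of nat | LAdd of lexp & lexp | LOpp of lexp | LScale of K & lexp
  | LMuln of lexp & nat | LZero.

Fixpoint leval (env : seq M) e : M :=
  match e with
  | LVar n => nth 0 env n
  | LAdd a b => leval env a + leval env b
  | LOpp a => - leval env a
  | LScale k a => k *: leval env a
  | LMuln a n => leval env a *+ n
  | LZero => 0
  end.

Fixpoint lcoef e (k : nat) : K :=
  match e with
  | LVar n => if eqvar n k then 1 else 0
  | LAdd a b => lcoef a k + lcoef b k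
  | LOpp a => - lcoef a k
  | LScale c a => c * lcoef a k
  | LMuln a n => n%:R * lcoef a k
  | LZero => 0
  end.

Fixpoint lall (n : nat) (P : nat -> Prop) : Prop :=
  if n is m.+1 then lall m P /\ P m else True.

Lemma levalE env e : leval env e = \sum_(k < size env) lcoef e k *: nth 0 env k.
Proof.
elim: e => [n|a IHa b IHb|a IHa|c a IHa|a IHa n|] /=; rewrite ?IHa ?IHb.
- have [ns|sn] := ltnP n (size env).
    rewrite (bigD1 (Ordinal ns)) //= eqvarE eqxx scale1r big1 ?addr0 // => i.
    by rewrite -val_eqE /= eqvarE eq_sym => /negPf ->; rewrite scale0r.
  rewrite nth_default // big1 // => i _; rewrite eqvarE.
  by rewrite (gtn_eqF (leq_trans (ltn_ord i) sn)) scale0r.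
- by rewrite -big_split; apply: eq_bigr => i _; rewrite scalerDl.
- by rewrite -sumrN; apply: eq_bigr => i _; rewrite scaleNr.
- by rewrite scaler_sumr; apply: eq_bigr => i _; rewrite scalerA.
- by rewrite -scaler_nat scaler_sumr; apply: eq_bigr => i _; rewrite scalerA.
- by rewrite big1 // => i _; rewrite scale0r.
Qed.

(** An identity between linear combinations of atoms, products in the algebra included, reduces to
    one scalar identity per atom. [lall] and [eqvar] are plain fixpoints so that [cbn] unfolds them
    and leaves goals for [ring]. *)
Lemma lmodP env e1 e2 :
  lall (size env) (fun k => lcoef e1 k = lcoef e2 k) -> leval env e1 = leval env e2.
Proof.
move=> h; rewrite !levalE; apply: eq_bigr => i _; congr (_ *: _).
have : forall n P, lall n P -> forall k, (k < n)%N -> P k.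
  elim=> [//|n IH] P /= [hP Pn] k; rewrite ltnS leq_eqVlt => /orP[/eqP -> //|].
  exact: IH.
by move=> /(_ _ _ h) H; exact: H (ltn_ord i).
Qed.

End LinearNormalization.

Ltac lfind x env :=
  lazymatch env with
  | @nil _ => constr:(@None nat)
  | x :: _ => constr:(Some O)
  | _ :: ?e => lazymatch lfind x e with
              | Some ?n => constr:(Some (S n)) | None => constr:(@None nat) end
  end.
Ltac ladd x env :=
  lazymatch lfind x env with
  | Some _ => env
  | None => constr:(x :: env)
  end.
Ltac lcollect e env :=
  lazymatch e with
  | GRing.add ?a ?b => let env' := lcollect a env in lcollect b env'
  | Algebra.add ?a ?b => let env' := lcollect a env in lcollect b env'
  | GRing.opp ?a => lcollect a env
  | Algebra.opp ?a => lcollect a env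
  | GRing.scale _ ?a => lcollect a env
  | GRing.natmul ?a _ => lcollect a env
  | Algebra.natmul ?a _ => lcollect a env
  | GRing.zero => env
  | Algebra.zero => env
  | ?x => ladd x env
  end.
Ltac lreify K e env :=
  lazymatch e with
  | Algebra.add ?a ?b => let a' := lreify K a env in let b' := lreify K b env in constr:(@LAdd K a' b')
  | Algebra.opp ?a => let a' := lreify K a env in constr:(@LOpp K a')
  | GRing.scale ?k ?a => let a' := lreify K a env in constr:(@LScale K k a')
  | Algebra.natmul ?a ?n => let a' := lreify K a env in constr:(@LMuln K a' n)
  | Algebra.zero => constr:(@LZero K)
  | ?x => lazymatch lfind x env with Some ?n => constr:(@LVar K n) end
  end.
Ltac lmod_with K M :=
  lazymatch goal with
  | |- @eq _ ?a ?b =>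
    let env0 := lcollect a (@nil M) in
    let env := lcollect b env0 in
    let ea := lreify K a env in let eb := lreify K b env in
    change (leval env ea = leval env eb); apply: lmodP;
    cbn [lall lcoef size eqvar]; repeat split; try (first [ring | field])
  end.

(** * Algebraic rules in a C*-algebra *)

Section CStarBasics.
Context {R : realType} {T : cstarAlgType R}.
Implicit Types (x y z : T) (a b : R[i]).

Lemma amulDl x y z : (x + y) ** z = x ** z + y ** z.
Proof. by have := amul_linearl z 1 x y; rewrite !scale1r. Qed.
Lemma amulDr x y z : z ** (x + y) = z ** x + z ** y.
Proof. by have := amul_linearr z 1 x y; rewrite !scale1r. Qed.
Lemma amul0l z : (0 : T) ** z = 0.
Proof. by apply: (@addrI _ (0 ** z)); rewrite -amulDl !addr0. Qed.
Lemma amul0r z : z ** (0 : T) = 0.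
Proof. by apply: (@addrI _ (z ** 0)); rewrite -amulDr !addr0. Qed.
Lemma amulZl a x z : (a *: x) ** z = a *: (x ** z).
Proof. by have := amul_linearl z a x 0; rewrite /= !addr0 amul0l addr0. Qed.
Lemma amulZr a x z : z ** (a *: x) = a *: (z ** x).
Proof. by have := amul_linearr z a x 0; rewrite /= !addr0 amul0r addr0. Qed.
Lemma amulNl x z : (- x) ** z = - (x ** z).
Proof. by rewrite -scaleN1r amulZl scaleN1r. Qed.
Lemma amulNr x z : z ** (- x) = - (z ** x).
Proof. by rewrite -scaleN1r amulZr scaleN1r. Qed.
Lemma amulBl x y z : (x - y) ** z = x ** z - y ** z.
Proof. by rewrite amulDl amulNl. Qed.
Lemma amulBr x y z : z ** (x - y) = z ** x - z ** y.
Proof. by rewrite amulDr amulNr. Qed.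
Lemma amul_suml (I : Type) (r : seq I) (P : pred I) (F : I -> T) z :
  (\sum_(i <- r | P i) F i) ** z = \sum_(i <- r | P i) (F i ** z).
Proof. by elim/big_rec2: _ => [|i u v _ <-]; rewrite ?amul0l ?amulDl. Qed.
Lemma amul_sumr (I : Type) (r : seq I) (P : pred I) (F : I -> T) z :
  z ** (\sum_(i <- r | P i) F i) = \sum_(i <- r | P i) (z ** F i).
Proof. by elim/big_rec2: _ => [|i u v _ <-]; rewrite ?amul0r ?amulDr. Qed.

Lemma adjD x y : adj (x + y) = adj x + adj y.
Proof. by have := adj_semilinear 1 x y; rewrite scale1r conjC1 scale1r. Qed.
Lemma adj0 : adj (0 : T) = 0.
Proof. by apply: (@addrI _ (adj 0)); rewrite -adjD !addr0. Qed.
Lemma adjZ a x : adj (a *: x) = conjC a *: adj x.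
Proof. by have := adj_semilinear a x 0; rewrite adj0 !addr0. Qed.
Lemma adjN x : adj (- x) = - adj x.
Proof. by rewrite -scaleN1r adjZ rmorphN1 scaleN1r. Qed.
Lemma adjB x y : adj (x - y) = adj x - adj y.
Proof. by rewrite adjD adjN. Qed.
Lemma adj_sum (I : Type) (r : seq I) (P : pred I) (F : I -> T) :
  adj (\sum_(i <- r | P i) F i) = \sum_(i <- r | P i) adj (F i).
Proof. by elim/big_rec2: _ => [|i u v _ <-]; rewrite ?adj0 ?adjD. Qed.

Lemma nrmM x y : nrm (x ** y) <= nrm x * nrm y.
Proof. by have := norm_amul_le x y; rewrite !nrmE -rmorphM /= lecR. Qed.

Lemma nrm_cstar x : nrm (adj x ** x) = nrm x ^+ 2.
Proof. by apply: complexI; rewrite rmorphXn /= -!nrmE cstar_identity. Qed.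

Lemma nrm_adj x : nrm (adj x) = nrm x.
Proof.
have aux y : nrm y <= nrm (adj y).
  have [->|y0] := eqVneq y 0; first by rewrite adj0.
  have yp : 0 < nrm y.
    rewrite lt_neqAle nrm_ge0 andbT eq_sym; apply/eqP => /nrm_eq0 h.
    by rewrite h eqxx in y0.
  by rewrite -(ler_pM2r yp) -expr2 -nrm_cstar nrmM.
by apply/eqP; rewrite eq_le aux andbT; have := aux (adj x); rewrite adjK.
Qed.

Lemma adjM_eq0 x : adj x ** x = 0 -> x = 0.
Proof.
move=> h; apply: nrm_eq0; apply/eqP; rewrite -sqrf_eq0 -nrm_cstar h nrm0.
exact: eqxx.
Qed.

End CStarBasics.

Ltac amul_expand := rewrite ?(amulDl, amulDr, amulNl, amulNr, amulZl, amulZr,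
  adjD, adjN, adjZ, adjM, adjK, amul0l, amul0r, adj0, amulA).

Ltac lmod :=
  lazymatch goal with
  | R : realType |- @eq ?M _ _ => lmod_with (R[i]) M
  end.

(** * Square roots by iteration *)

Section SquareRoot.
Context {R : realType} {T : cstarAlgType R}.

Definition lips {T1 T2 : normedModType R[i]} (f : T1 -> T2) :=
  exists2 k : R, 0 < k & forall x y, nrm (f x - f y) <= k * nrm (x - y).

Lemma lips_adh {T1 T2 : normedModType R[i]} (f : T1 -> T2) (X : set T1) x :
  lips f -> adh X x -> adh (f @` X) (f x).
Proof.
case=> k k0 hf hx e e0; have [|y Xy hy] := hx (e / k); first by rewrite divr_gt0.
exists (f y); first by exists y.
by rewrite (le_lt_trans (hf _ _)) // mulrC -ltr_pdivlMr.
Qed.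

Lemma closed_lips_eq {T1 T2 : normedModType R[i]} (f g : T1 -> T2) :
  lips f -> lips g -> closed [set x | f x = g x].
Proof.
case=> k k0 hf [l l0 hg]; apply/closedE_adh => x hx /=.
apply/eqP; rewrite -subr_eq0; apply/eqP; apply: nrm_small => e e0.
have [|y /= fgy hy] := hx (e / (k + l)); first by rewrite divr_gt0 ?addr_gt0.
rewrite (le_trans (nrm_tri (f y) _ _)) // {2}fgy (nrmBC (g y)).
rewrite (le_trans (lerD (hf _ _) (hg _ _))) // -mulrDl mulrC -ler_pdivlMr ?addr_gt0 //.
exact: ltW.
Qed.

Lemma closed_preim_lips {T1 T2 : normedModType R[i]} (f : T1 -> T2) (X : set T2) :
  lips f -> closed X -> closed [set x | X (f x)].
Proof.
move=> hf /closedE_adh cX; apply/closedE_adh => x /(lips_adh hf) h.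
by apply: cX => e /h[y [z Xz <-]]; exists (f z).
Qed.

Lemma lips_id : lips (@id T). Proof. by exists 1 => // x y; rewrite mul1r. Qed.
Lemma lips_adj : lips (@adj R T).
Proof. by exists 1 => // x y; rewrite mul1r -adjB nrm_adj. Qed.
Lemma lips_mull (z : T) : lips (fun x : T => z ** x).
Proof.
exists (nrm z + 1) => [|x y]; first by rewrite ltr_wpDl ?nrm_ge0.
by rewrite -amulBr (le_trans (nrmM _ _)) // ler_wpM2r ?nrm_ge0 // lerDl.
Qed.
Lemma lips_mulr (z : T) : lips (fun x : T => x ** z).
Proof.
exists (nrm z + 1) => [|x y]; first by rewrite ltr_wpDl ?nrm_ge0.
by rewrite -amulBl (le_trans (nrmM _ _)) // mulrC ler_wpM2r ?nrm_ge0 // lerDl.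
Qed.
Lemma lips_comp {T1 T2 T3 : normedModType R[i]} (f : T1 -> T2) (g : T2 -> T3) :
  lips f -> lips g -> lips (g \o f).
Proof.
case=> k k0 hf [l l0 hg]; exists (l * k); first exact: mulr_gt0.
move=> x y; rewrite (le_trans (hg _ _)) // -mulrA ler_wpM2l ?hf // ltW //.
Qed.

Let step (x y : T) := (2^-1 : R[i]) *: (x + y ** y).

Lemma cabs_half : cabs (2^-1 : R[i]) = 2^-1.
Proof.
rewrite cabs_inv; congr (_^-1).
by rewrite (_ : 2 = (2 : R)%:C) ?cabsC ?ger0_norm // rmorph_nat.
Qed.

Lemma halfD (x : T) : (2^-1 : R[i]) *: (x + x) = x.
Proof. by lmod. Qed.

(** In a unitization the equation reads (1 - c)^2 = 1 - x. The iteration y |-> (x + y^2) / 2 from 0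
    is dominated by the scalar one for x = 1; that sequence is increasing and bounded, which gives
    the Cauchy property even for |x| = 1, where no contraction constant is available. The last
    clause is an induction principle: c inherits every closed property of 0 that is stable under the
    iteration. *)
Lemma quadratic_root (x : T) : nrm x <= 1 ->
  exists c : T, [/\ c + c = x + c ** c, nrm c <= nrm x &
    forall X : set T, closed X -> X 0 -> (forall y, X y -> X ((2^-1 : R[i]) *: (x + y ** y))) -> X c].
Proof.
move=> x1; pose u n := iter n (step x) 0.
pose r n : R := iter n (fun t => (1 + t ^+ 2) / 2) 0.
have uS n : u n.+1 = step x (u n) by [].
have rS n : r n.+1 = (1 + r n ^+ 2) / 2 by [].
have r01 n : 0 <= r n <= 1.
  elim: n => [|n /andP[IH1 IH2]]; first by rewrite /r /= lexx ler01.
  have : r n ^+ 2 <= 1 by rewrite expr_le1.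
  by rewrite rS; have := sqr_ge0 (r n); lra.
have rmono n : r n <= r n.+1 by rewrite rS; have := sqr_ge0 (1 - r n); rewrite !expr2; lra.
have rle n k : r n <= r (n + k)%N.
  by elim: k => [|k IH]; rewrite ?addn0 // addnS (le_trans IH) // rmono.
have ur n : nrm (u n) <= r n.
  elim: n => [|n IH]; first by rewrite nrm0.
  rewrite uS rS /step nrmZ cabs_half.
  have := nrmD x (u n ** u n); have := nrmM (u n) (u n).
  have := nrm_ge0 (u n); have := r01 n; nra.
have ux n : nrm (u n) <= nrm x.
  elim: n => [|n IH]; first by rewrite nrm0 nrm_ge0.
  rewrite uS /step nrmZ cabs_half.
  have := nrmD x (u n ** u n); have := nrmM (u n) (u n).
  have := nrm_ge0 (u n); have := ur n; have := r01 n; nra.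
have du n : nrm (u n.+1 - u n) <= r n.+1 - r n.
  elim: n => [|n IH].
    have u0 : u 0%N = 0 by []. have r0 : r 0%N = 0 by [].
    by rewrite u0 r0 !subr0; exact: ur.
  (* This splitting of a difference of squares is valid without commutation. *)
  have -> : u n.+2 - u n.+1 =
      (2^-1 : R[i]) *: (u n.+1 ** (u n.+1 - u n) + (u n.+1 - u n) ** u n).
    by rewrite {1}uS {2}uS /step; amul_expand; lmod.
  rewrite nrmZ cabs_half.
  have -> : r n.+2 - r n.+1 = (r n.+1 ^+ 2 - r n ^+ 2) / 2.
    by rewrite {1}(rS n.+1) {2}(rS n); lra.
  move: (ur n) (ur n.+1) (nrm_ge0 (u n)) (nrm_ge0 (u n.+1)) IH.
  move: (nrmD (u n.+1 ** (u n.+1 - u n)) ((u n.+1 - u n) ** u n)).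
  move: (nrmM (u n.+1) (u n.+1 - u n)) (nrmM (u n.+1 - u n) (u n)).
  move: (nrm_ge0 (u n.+1 - u n)).
  set d := nrm (_ - _); set a := nrm (u n.+1); set b := nrm (u n).
  set A := nrm (_ + _); set B := nrm (_ ** _); set D := nrm (_ ** _).
  move: (r n) (r n.+1) => s t d0 BB DD AA bs at_ b0 a0 ds.
  have h1 : a * d <= t * (t - s) by apply: ler_pM.
  have h2 : d * b <= (t - s) * s by apply: ler_pM.
  nra.
have duk n k : nrm (u (n + k)%N - u n) <= r (n + k)%N - r n.
  elim: k => [|k IH]; first by rewrite addn0 !subrr nrm0.
  rewrite addnS (le_trans (nrm_tri (u (n + k)%N) _ _)) //.
  have := du (n + k)%N; lra.
have hs : has_sup [set r n | n in [set: nat]].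
  split; first by exists (r 0%N), 0%N.
  by exists 1 => _ [n _ <-]; have /andP[] := r01 n.
have [c hc] : exists c, tends u c.
  apply: cauchy_tends => e e0.
  have e2 : 0 < e / 2 by lra.
  have [_ [N _ <-] hN] := sup_adherent e2 hs.
  have hle n : r n <= sup [set r n | n in [set: nat]].
    by apply: ub_le_sup; [case: hs|exists n].
  exists N => n m Nn Nm; rewrite -(subnKC Nn) -(subnKC Nm).
  rewrite (le_lt_trans (nrm_tri (u N) _ _)) // (nrmBC (u N)).
  have := duk N (n - N)%N; have := duk N (m - N)%N.
  have := hle (N + (n - N))%N; have := hle (N + (m - N))%N; lra.
exists c; split.
- apply/eqP; rewrite -subr_eq0; apply/eqP; apply: nrm_small => e e0.
  have e4 : 0 < e / 4 by lra.
  have [N hN] := hc _ e4.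
  have hN0 := hN N (leqnn _); have hN1 := hN N.+1 (leqnSn _).
  have -> : c + c - (x + c ** c) =
    ((c - u N.+1) + (c - u N.+1)) - (c ** (c - u N) + (c - u N) ** u N).
    by rewrite uS /step; amul_expand; lmod.
  have c1 : nrm c <= 1.
    apply/ler_addgt0Pl => d d0; have [M hM] := hc _ d0.
    have := hM M (leqnn _); have := nrm_sub_le c (u M); have := ur M.
    have := r01 M; lra.
  have u1 : nrm (u N) <= 1 by have := ur N; have := r01 N; lra.
  have := nrmB ((c - u N.+1) + (c - u N.+1)) (c ** (c - u N) + (c - u N) ** u N).
  have := nrmD (c - u N.+1) (c - u N.+1).
  have := nrmD (c ** (c - u N)) ((c - u N) ** u N).
  have := nrmM c (c - u N); have := nrmM (c - u N) (u N).
  have : nrm c * nrm (c - u N) <= nrm (c - u N).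
    by rewrite -[leRHS]mul1r ler_wpM2r ?nrm_ge0.
  have : nrm (c - u N) * nrm (u N) <= nrm (c - u N).
    by rewrite -[leRHS]mulr1 ler_wpM2l ?nrm_ge0.
  lra.
- apply/ler_addgt0Pl => d d0; have [M hM] := hc _ d0.
  have := hM M (leqnn _); have := nrm_sub_le c (u M); have := ux M; lra.
- move=> X /closedE_adh cX X0 XS; apply: cX; apply: tends_adh hc.
  by elim=> [//|n IH]; rewrite uS; exact: XS.
Qed.

Lemma nrm_eq_cstar (x y : T) : adj x ** x = adj y ** y -> nrm x = nrm y.
Proof.
move=> h; have : nrm x ^+ 2 = nrm y ^+ 2 by rewrite -!nrm_cstar h.
by move/eqP; rewrite eqrXn2 ?nrm_ge0 // => /eqP.
Qed.

Lemma adj_i (z : T) : adj ('i *: z) = - ('i *: adj z).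
Proof. by rewrite adjZ conjCi scaleNr. Qed.

Lemma sqi : 'i * 'i = -1 :> R[i].
Proof. by rewrite -expr2 sqrCi. Qed.

(* With [u := h + i (1 - c)] in the unitization, [u] is unitary and [h = (u + u^* ) / 2]. *)
Lemma selfadj_contraction (h c : T) : adj h = h -> adj c = c -> h ** c = c ** h ->
  c + c = h ** h + c ** c -> nrm h <= 1.
Proof.
move=> hh hc hcom hq.
(* In the absence of a unit, the two unitaries are applied to z: [u] and [v] have the norm of z, and
   h z is their mean. Taking z = h then gives |h|^2 <= |h|. *)
have key z : nrm (h ** z) <= nrm z.
  pose w := z - c ** z; pose u := h ** z + 'i *: w; pose v := h ** z - 'i *: w.
  have aw : adj w = adj z - adj z ** c by rewrite adjB adjM hc.
  have cross : adj z ** h ** w = adj w ** (h ** z).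
    by rewrite aw /w; amul_expand; rewrite -(amulA _ h c) hcom; amul_expand.
  have sum : adj z ** h ** (h ** z) + adj w ** w = adj z ** z.
    have : adj z ** (h ** h + c ** c) ** z = adj z ** (c + c) ** z by rewrite hq.
    rewrite aw /w; amul_expand => E.
    apply/eqP; rewrite -subr_eq0; move/eqP: E; rewrite -subr_eq0 => /eqP E.
    by apply/eqP; rewrite -[RHS]E; lmod.
  clearbody w.
  have uu : adj u ** u = adj z ** z.
    rewrite -sum /u adjD adj_i adjM hh.
    rewrite amulDl !amulDr !amulNl !amulZl !amulZr cross scalerA sqi.
    by lmod.
  have vv : adj v ** v = adj z ** z.
    rewrite -sum /v adjB adj_i adjM hh.
    rewrite opprK amulDl !amulDr !amulNr !amulZl !amulZr cross scalerA sqi.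
    by lmod.
  have -> : h ** z = (2^-1 : R[i]) *: (u + v) by rewrite /u /v; lmod.
  rewrite nrmZ cabs_half; have := nrmD u v.
  rewrite (nrm_eq_cstar uu) (nrm_eq_cstar vv); lra.
have := key h; have : nrm (h ** h) = nrm h ^+ 2 by rewrite -nrm_cstar hh.
have := nrm_ge0 h; nra.
Qed.

(** By commutation, x + i y and x - i y both have x^2 + y^2 as the product of their adjoint with
    themselves, so the C*-identity makes both vanish. This replaces the order on positive
    elements. *)
Lemma sum_sq_eq0 (x y : T) : adj x = x -> adj y = y -> x ** y = y ** x ->
  x ** x + y ** y = 0 -> x = 0.
Proof.
move=> ax ay xy h.
have u0 : x + 'i *: y = 0.
  apply: adjM_eq0; rewrite adjD adj_i ax ay; amul_expand.
  by rewrite scalerA sqi xy -[RHS]h; lmod.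
have v0 : x - 'i *: y = 0.
  apply: adjM_eq0; rewrite adjB adj_i ax ay opprK; amul_expand.
  by rewrite scalerA sqi xy -[RHS]h; lmod.
have : (x + 'i *: y) + (x - 'i *: y) = x + x by lmod.
by rewrite u0 v0 addr0 => h2; rewrite -(halfD x) -h2 scaler0.
Qed.

End SquareRoot.

Lemma conjC_re {R : realType} (r : R) : conjC (r%:C : R[i]) = r%:C.
Proof. by apply: conj_Creal; rewrite complex_real. Qed.

Section SelfAdjointRoot.
Context {R : realType} {T : cstarAlgType R}.

Lemma commM (a b z : T) : a ** z = z ** a -> b ** z = z ** b ->
  (a ** b) ** z = z ** (a ** b).
Proof. by move=> az bz; rewrite -amulA bz amulA az amulA. Qed.

Lemma commMM (a z : T) : a ** z = z ** a -> a ** z ** (a ** z) = a ** a ** z ** z.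
Proof. by move=> az; rewrite -[LHS]amulA [z ** _]amulA -az !amulA. Qed.

(** All clauses on c are instances of the induction principle of [quadratic_root], each applied to a
    closed condition. *)
Lemma cstar_sqrt (x : T) : adj x = x -> nrm x <= 1 ->
  exists c : T, [/\ c + c = x + c ** c /\ nrm c <= nrm x, adj c = c,
    (forall z, x ** z = z ** x -> c ** z = z ** c),
    (forall X, closed_star_subalgebra X -> X x -> X c) &
    forall e, (e ** x = x -> e ** c = c) /\ (x ** e = x -> c ** e = c)].
Proof.
move=> ax /quadratic_root[c [cq cx hc]]; exists c; split=> //.
- apply: (hc [set c | adj c = c]) => /=; rewrite ?adj0 //.
    exact: closed_lips_eq lips_adj lips_id.
  by move=> y ay; rewrite adjZ adjD adjM ax ay fmorphV rmorph_nat.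
- move=> z xz; apply: (hc [set c | c ** z = z ** c]) => /=; rewrite ?amul0l ?amul0r //.
    exact: closed_lips_eq (lips_mulr z) (lips_mull z).
  move=> y yz; rewrite amulZl amulZr amulDl amulDr xz -amulA yz !amulA.
  by congr (_ *: (_ + _)); rewrite yz.
- move=> X [cX X0 Xl Xm Xa] Xx; apply: hc => // y Xy.
  rewrite -[_ *: _]addr0; apply: (Xl) => //; rewrite -[x]scale1r.
  by apply: Xl => //; exact: Xm.
- move=> e; split=> hx.
    apply: (hc [set c | e ** c = c]) => /=; rewrite ?amul0r //.
      exact: closed_lips_eq (lips_mull e) lips_id.
    by move=> y ey; rewrite amulZr amulDr hx amulA ey.
  apply: (hc [set c | c ** e = c]) => /=; rewrite ?amul0l //.
    exact: closed_lips_eq (lips_mulr e) lips_id.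
  by move=> y ey; rewrite amulZl amulDl hx -amulA ey.
Qed.

End SelfAdjointRoot.

(** * Contractive and isometric homomorphisms *)

Section StarHom.
Context {R : realType} {T T' : cstarAlgType R}.

(** Relative to a subset, because contractivity is also applied to maps that are meaningful only on
    a closed subalgebra: the inverse of a faithful representation, and formulas on matrices of a
    fixed size. *)
Definition star_hom_on (X : set T) (f : T -> T') : Prop :=
  [/\ forall (a : R[i]) x y, X x -> X y -> f (a *: x + y) = a *: f x + f y,
      forall x y, X x -> X y -> f (x ** y) = f x ** f y &
      forall x, X x -> f (adj x) = adj (f x)].

Lemma closed_star_subalgebraT : closed_star_subalgebra [set: T].
Proof. by split. Qed.

Lemma star_homT (f : T -> T') : star_hom f -> star_hom_on [set: T] f.
Proof. by case=> h1 h2 h3; split => [a x y _ _|x y _ _|x _]; [exact: h1|exact: h2|exact: h3]. Qed.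

Section OnSubalgebra.
Variables (X : set T) (f : T -> T').
Hypotheses (hX : closed_star_subalgebra X) (hf : star_hom_on X f).

Lemma star_hom_on0 : f 0 = 0.
Proof.
case: hX hf => _ X0 _ _ _ [h _ _]; have := h 1 0 0 X0 X0.
by rewrite !scale1r !addr0 => /eqP; rewrite addrC -subr_eq subrr => /eqP.
Qed.

Lemma star_hom_onD x y : X x -> X y -> f (x + y) = f x + f y.
Proof. by case: hf => h _ _ Xx Xy; have := h 1 x y Xx Xy; rewrite !scale1r. Qed.

Lemma star_hom_onZ a x : X x -> f (a *: x) = a *: f x.
Proof.
case: hX hf => _ X0 _ _ _ [h _ _] Xx; have := h a x 0 Xx X0.
by rewrite star_hom_on0 !addr0.
Qed.

(** After scaling to norm 1, put h = y^* y and solve 2 c = h^2 + c^2 inside X. The equation is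
    algebraic, so f h and f c satisfy it as well, and [selfadj_contraction] bounds f h. *)
Lemma star_hom_on_nrm x : X x -> nrm (f x) <= nrm x.
Proof.
move=> Xx; have [x0|x0] := eqVneq (nrm x) 0.
  by rewrite (nrm_eq0 x0) star_hom_on0 !nrm0.
have xp : 0 < nrm x by rewrite lt_neqAle eq_sym x0 nrm_ge0.
case: (hX) => cX X0 Xl Xm Xa.
have XZ a u : X u -> X (a *: u) by move=> Xu; rewrite -[_ *: _]addr0; exact: Xl.
pose y := ((nrm x)^-1)%:C *: x; pose h := adj y ** y.
have Xy : X y by exact: XZ.
have Xh : X h by apply: (Xm) => //; exact: Xa.
have y1 : nrm y = 1.
  by rewrite /y nrmZ cabsC ger0_norm ?invr_ge0 ?nrm_ge0 // mulVf.
have ah : adj h = h by rewrite /h adjM adjK.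
have ahh : adj (h ** h) = h ** h by rewrite adjM ah.
have h1 : nrm h = 1 by rewrite /h nrm_cstar y1 expr1n.
have hh1 : nrm (h ** h) <= 1 by rewrite (le_trans (nrmM _ _)) // h1 mulr1.
have [c [[cq _] ac cz cXX _]] := cstar_sqrt ahh hh1.
have Xc : X c by apply: cXX => //; exact: Xm.
case: hf => fl fm fa.
have fh : nrm (f h) <= 1.
  apply: (@selfadj_contraction _ _ (f h) (f c)).
  - by rewrite -fa // ah.
  - by rewrite -fa // ac.
  - by rewrite -!fm // (cz h) // amulA.
  - by rewrite -!fm // -!star_hom_onD ?cq //; apply: Xm.
have fy : nrm (f y) <= 1.
  have : nrm (f y) ^+ 2 <= 1 by rewrite -nrm_cstar -fa // -fm //; exact: Xa.
  by rewrite expr_le1 ?nrm_ge0.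
have xE : x = (nrm x)%:C *: y by rewrite /y scalerA -rmorphM /= mulfV // scale1r.
clearbody y; rewrite xE star_hom_onZ // !nrmZ y1 mulr1 -[leRHS]mulr1.
by rewrite ler_wpM2l ?cabs_ge0.
Qed.

End OnSubalgebra.

Section Hom.
Variable f : T -> T'.
Hypothesis hf : star_hom f.

Lemma star_hom_nrm x : nrm (f x) <= nrm x.
Proof. exact: (star_hom_on_nrm closed_star_subalgebraT (star_homT hf)). Qed.
Lemma star_hom0 : f 0 = 0.
Proof. exact: (star_hom_on0 closed_star_subalgebraT (star_homT hf)). Qed.
Lemma star_homD x y : f (x + y) = f x + f y.
Proof. exact: (star_hom_onD (star_homT hf)). Qed.
Lemma star_homZ a x : f (a *: x) = a *: f x.
Proof. exact: (star_hom_onZ closed_star_subalgebraT (star_homT hf)). Qed.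
Lemma star_homN x : f (- x) = - f x.
Proof. by rewrite -scaleN1r star_homZ scaleN1r. Qed.
Lemma star_homB x y : f (x - y) = f x - f y.
Proof. by rewrite star_homD star_homN. Qed.
Lemma star_homM x y : f (x ** y) = f x ** f y.
Proof. by case: hf. Qed.
Lemma star_homV x : f (adj x) = adj (f x).
Proof. by case: hf. Qed.
Lemma star_hom_sum (I : Type) (r : seq I) (P : pred I) (F : I -> T) :
  f (\sum_(i <- r | P i) F i) = \sum_(i <- r | P i) f (F i).
Proof. by elim/big_rec2: _ => [|i u v _ <-]; rewrite ?star_hom0 ?star_homD. Qed.
Lemma lips_star_hom : lips f.
Proof.
exists 1 => // x y; rewrite mul1r -star_homB; exact: star_hom_nrm.
Qed.

(** It suffices that a self-adjoint h is a contraction when f h is, that is, that e - h^2 has a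
    self-adjoint root. A root q of the absolute value of e - h^2 (up to scale) always exists; in the
    image, e - h^2 itself has a root because f h is a contraction, so there it equals its absolute
    value. Injectivity carries this equality back. *)
Lemma star_hom_isometric e : (forall x : T, e ** x = x /\ x ** e = x) ->
  injective f -> forall x, nrm x <= nrm (f x).
Proof.
move=> he finj.
have el x : e ** x = x by case: (he x).
have er x : x ** e = x by case: (he x).
have ae : adj e = e.
  by have h := el (adj e); have := congr1 (@adj R T) h; rewrite adjM !adjK h.
have key h : adj h = h -> nrm (f h) <= 1 -> nrm h <= 1.
  move=> ah fh1.
  pose y := e - h ** h; pose M := nrm y + 1.
  have M0 : 0 < M by rewrite ltr_wpDl ?nrm_ge0.
  have Mn0 : M != 0 by rewrite gt_eqF.
  pose y1 := (M^-1)%:C *: y.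
  have y1n : nrm y1 <= 1.
    rewrite nrmZ cabsC ger0_norm ?invr_ge0 ?(ltW M0) // mulrC ler_pdivrMr //.
    by rewrite mul1r lerDl.
  have ay1 : adj y1 = y1.
    by rewrite /y1 adjZ conjC_re /y adjB ae adjM ah.
  have hy1 : h ** y1 = y1 ** h.
    by rewrite /y1 /y amulZl amulZr amulBl amulBr el er amulA.
  have yE : y = M%:C *: y1 by rewrite /y1 scalerA -rmorphM /= mulfV // scale1r.
  have ayy : adj (y1 ** y1) = y1 ** y1 by rewrite adjM ay1.
  have nyy : nrm (y1 ** y1) <= 1 by rewrite (le_trans (nrmM _ _)) // mulr_ile1 ?nrm_ge0.
  (* Three extractions: [b] is a root of e - y1^2 and serves to bound that element by 1; then e - c1
     is a root of y1^2, playing the role of |y1|; finally q is a root of e - c1. *)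
  have [c [[cq cn] ac cz _ _]] := cstar_sqrt ayy nyy.
  pose b := e - c.
  have ab : adj b = b by rewrite /b adjB ae ac.
  have bb : b ** b = e - y1 ** y1.
    rewrite /b amulBl !amulBr el !er el.
    by rewrite -[y1 ** y1](addrK (c ** c)) -cq; lmod.
  have b1 : nrm b <= 1.
    apply: (@selfadj_contraction _ _ b (e - y1)) => //; first by rewrite adjB ae ay1.
      rewrite amulBr amulBl er el; congr (_ - _).
      by rewrite /b amulBl amulBr el er; congr (_ - _); apply: cz; rewrite !amulA.
    by rewrite bb amulBl !amulBr el er el; lmod.
  have abb : adj (b ** b) = b ** b by rewrite adjM ab.
  have nbb : nrm (b ** b) <= 1 by rewrite (le_trans (nrmM _ _)) // mulr_ile1 ?nrm_ge0.
  have [c1 [[c1q c1n] ac1 c1z _ _]] := cstar_sqrt abb nbb.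
  have c11 : nrm c1 <= 1 by exact: le_trans c1n nbb.
  have [c2 [[c2q _] ac2 c2z _ _]] := cstar_sqrt ac1 c11.
  pose q := e - c2.
  have aq : adj q = q by rewrite /q adjB ae ac2.
  have qq : q ** q = e - c1.
    rewrite /q amulBl !amulBr el !er el.
    by rewrite -[c1](addrK (c2 ** c2)) -c2q; lmod.
  have qqqq : (q ** q) ** (q ** q) = y1 ** y1.
    rewrite qq amulBl !amulBr el !er el.
    have -> : y1 ** y1 = e - b ** b by rewrite bb; lmod.
    by rewrite -[b ** b](addrK (c1 ** c1)) -c1q; lmod.
  have comq z : z ** y1 = y1 ** z -> q ** z = z ** q.
    move=> zy; rewrite /q amulBl amulBr el er; congr (_ - _).
    apply: c2z; apply: c1z; rewrite bb amulBl amulBr el er; congr (_ - _).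
    by rewrite -[LHS]amulA -zy amulA -zy amulA.
  have qh : q ** h = h ** q by exact: comq.
  have qy : q ** y1 = y1 ** q by exact: comq.
  (* Then e - h^2 = M q^2 is the square of [s *: q], so e - s q solves the equation required by
     [selfadj_contraction]. *)
  suff yq : y1 = q ** q.
    pose s := (Num.sqrt M)%:C : R[i].
    have ss : s * s = M%:C by rewrite -rmorphM /= -expr2 sqr_sqrtr // ltW.
    apply: (@selfadj_contraction _ _ h (e - s *: q)) => //.
    - by rewrite adjB ae adjZ conjC_re aq.
    - by rewrite amulBr amulBl er el amulZl amulZr qh.
    - rewrite amulBl !amulBr el er el amulZl amulZr scalerA ss -yq -yE /y.
      by lmod.
  apply: finj.
  have afh : adj (f h) = f h by rewrite -star_homV ah.
  have fhh1 : nrm (f h ** f h) <= 1 by rewrite (le_trans (nrmM _ _)) // mulr_ile1 ?nrm_ge0.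
  have afhh : adj (f h ** f h) = f h ** f h by rewrite adjM afh.
  have [d [[dq _] ad dz _ de]] := cstar_sqrt afhh fhh1.
  have fel x : f e ** f x = f x by rewrite -star_homM el.
  have fer x : f x ** f e = f x by rewrite -star_homM er.
  have dl : f e ** d = d by apply: (proj1 (de (f e))); rewrite -!star_homM el.
  have dr : d ** f e = d by apply: (proj2 (de (f e))); rewrite -!star_homM er.
  have comd z : z ** f h = f h ** z -> d ** z = z ** d.
    by move=> zh; apply: dz; rewrite -[LHS]amulA -zh amulA -zh amulA.
  pose s := (Num.sqrt M)^-1%:C : R[i].
  have ss : s * s = (M^-1)%:C.
    by rewrite -rmorphM /= -expr2 exprVn sqr_sqrtr // ltW.
  have cs : conjC s = s by rewrite /s conjC_re.
  pose g := s *: (f e - d).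
  have ag : adj g = g by rewrite /g adjZ cs adjB -star_homV ae ad.
  have gg : g ** g = f y1.
    rewrite /g amulZl amulZr scalerA ss amulBl !amulBr dl dr -star_homM el.
    rewrite /y1 star_homZ /y star_homB star_homM.
    rewrite -[f h ** f h](addrK (d ** d)) -dq; congr (_ *: _); lmod.
  have gz z : f e ** z = z -> z ** f e = z -> z ** f h = f h ** z -> g ** z = z ** g.
    by move=> z1 z2 z3; rewrite /g amulZl amulZr amulBl amulBr z1 z2 (comd z).
  pose p := f q.
  have ap : adj p = p by rewrite /p -star_homV aq.
  have gp : g ** p = p ** g.
    by apply: gz; rewrite /p ?fel ?fer // -!star_homM qh.
  (* g^2 = f y1 and p^2 = f (q^2) have the same square, so g^2 + p^2 annihilates their difference w.
     Applied to g w and p w, [sum_sq_eq0] shows that g^2 and p^2 annihilate w separately, hence w^2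
     = 0. *)
  pose w := g ** g - p ** p.
  have aw : adj w = w by rewrite /w adjB !adjM ag ap.
  have gw : g ** w = w ** g.
    by rewrite /w amulBl amulBr !amulA gp -(amulA p) gp amulA.
  have pw : p ** w = w ** p.
    by rewrite /w amulBl amulBr !amulA -gp -(amulA g) -gp amulA.
  have wsum : (g ** g + p ** p) ** w = 0.
    rewrite /w amulDl !amulBr.
    have -> : g ** g ** (g ** g) = p ** p ** (p ** p).
      by rewrite gg /p -!star_homM qqqq.
    have -> : g ** g ** (p ** p) = p ** p ** (g ** g).
      by apply: commM; apply/esym; apply: commM.
    by lmod.
  have gw0 : g ** w = 0.
    apply: (@sum_sq_eq0 _ _ (g ** w) (p ** w)).
    - by rewrite adjM aw ag gw.
    - by rewrite adjM aw ap pw.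
    - by apply: commM; apply/esym; apply: commM.
    - have -> : g ** w ** (g ** w) = (g ** g) ** w ** w by exact: commMM.
      have -> : p ** w ** (p ** w) = (p ** p) ** w ** w by exact: commMM.
      by rewrite -!amulDl wsum amul0l.
  have ggw : g ** g ** w = 0 by rewrite -amulA gw0 amul0r.
  have ppw : p ** p ** w = 0.
    by move: wsum; rewrite amulDl ggw add0r.
  have : w = 0.
    by apply: adjM_eq0; rewrite aw {1}/w amulBl ggw ppw subrr.
  by rewrite /w gg /p -star_homM => /eqP; rewrite subr_eq0 => /eqP.
move=> x; have [fx0|fx0] := eqVneq (nrm (f x)) 0.
  have -> : x = 0 by apply: finj; rewrite (nrm_eq0 fx0) star_hom0.
  by rewrite nrm0 nrm_ge0.
have fp : 0 < nrm (f x) by rewrite lt_neqAle eq_sym fx0 nrm_ge0.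
pose y := ((nrm (f x))^-1)%:C *: x.
have y1 : nrm (f y) = 1.
  by rewrite /y star_homZ nrmZ cabsC ger0_norm ?invr_ge0 ?nrm_ge0 // mulVf.
have : nrm (adj y ** y) <= 1.
  apply: key; first by rewrite adjM adjK.
  by rewrite star_homM star_homV nrm_cstar y1 expr1n.
rewrite nrm_cstar expr_le1 ?nrm_ge0 // /y nrmZ cabsC ger0_norm ?invr_ge0 ?nrm_ge0 //.
by rewrite mulrC ler_pdivrMr // mul1r.
Qed.

End Hom.
End StarHom.

(** * Projections whose sum is a projection *)

Section Projections.
Context {R : realType} {T : cstarAlgType R}.

Lemma nrm_projection (q : T) : projection q -> nrm q <= 1.
Proof.
case=> qq aq; have := nrm_cstar q; rewrite aq qq.
have := nrm_ge0 q; nra.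
Qed.

(** Positivity of z in the corner of q is expressed by |q - z| <= 1, the hypothesis of
    [corner_sqrt]; this is the case z = q r q. *)
Lemma nrm_corner (q r : T) : projection q -> projection r -> nrm (q - q ** r ** q) <= 1.
Proof.
move=> pq pr; have [qq aq] := pq; have [rr ar] := pr.
pose y := q - r ** q; pose x := q - q ** r ** q.
have xy : adj y ** y = x.
  by rewrite /y /x adjB adjM aq ar; amul_expand; rewrite qq -(amulA q r r) rr; lmod.
have qy : q ** y = x by rewrite /y /x amulBr qq amulA.
have h1 := nrm_projection pq; have h2 := nrmM q y.
have := nrm_cstar y; rewrite xy -/x.
have h3 : nrm x <= nrm y.
  by move: h2; rewrite qy; have := nrm_ge0 y; have := nrm_ge0 q; nra.
by move=> h4; have := sqr_ge0 (1 - nrm y); rewrite sqrrB -h4; lra.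
Qed.

Lemma corner_sqrt (q z : T) : projection q -> q ** z = z -> z ** q = z ->
  adj z = z -> nrm (q - z) <= 1 ->
  exists h : T, [/\ adj h = h, h ** h = z, q ** h = h, h ** q = h &
    forall w, q ** w = w -> w ** q = w -> z ** w = w ** z -> h ** w = w ** h].
Proof.
move=> [qq aq] qz zq az nz.
have ax : adj (q - z) = q - z by rewrite adjB aq az.
have [c [[cq _] ac cz _ ce]] := cstar_sqrt ax nz.
have qc : q ** c = c by apply: (proj1 (ce q)); rewrite amulBr qq qz.
have cq' : c ** q = c by apply: (proj2 (ce q)); rewrite amulBl qq zq.
exists (q - c); split.
- by rewrite adjB aq ac.
- rewrite amulBl !amulBr qq qc cq'.
  by rewrite -[c ** c](addKr (q - z)) -cq; lmod.
- by rewrite amulBr qq qc.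
- by rewrite amulBl qq cq'.
- move=> w qw wq zw; rewrite amulBl amulBr qw wq; congr (_ - _).
  by apply: cz; rewrite amulBl amulBr qw wq zw.
Qed.

(** The Cuntz-Krieger relations do not say that the projections S_e S_e^* are mutually orthogonal;
    it follows from their sum being a projection. Compressing the sum by q_e leaves the q_e q_i q_e
    with i distinct from e, together with q_e - q_e P q_e: positive elements of sum 0. Roots of one
    of them and of the mean of the others are then killed by [sum_sq_eq0]. *)
Lemma projection_sum_orth (I : finType) (A : pred I) (q : I -> T) (P : T) :
  (forall i, A i -> projection (q i)) -> projection P -> P = \sum_(i | A i) q i ->
  forall e f, A e -> A f -> f != e -> q f ** q e = 0.
Proof.
move=> pq pP PE e f Ae Af fe.
have [qq aq] := pq e Ae; have [ff af] := pq f Af.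
pose z i := q e ** q i ** q e.
have qz i : q e ** z i = z i by rewrite /z !amulA qq.
have zq i : z i ** q e = z i by rewrite /z -!amulA qq.
have az i : A i -> adj (z i) = z i.
  by move=> /pq[_ ai]; rewrite /z !adjM ai aq amulA.
have nz i : A i -> nrm (q e - z i) <= 1 by move=> /pq pi; apply: nrm_corner => //; exact: pq.
pose t := q e - q e ** P ** q e.
have qt : q e ** t = t by rewrite /t amulBr qq !amulA qq.
have tq : t ** q e = t by rewrite /t amulBl qq -!amulA qq.
have [_ aP] := pP.
have at_ : adj t = t by rewrite /t adjB !adjM aq aP amulA.
have nt : nrm (q e - t) <= 1.
  rewrite /t opprB addrC subrK; have h1 := nrm_projection (pq e Ae).
  have h2 := nrm_projection pP.
  rewrite (le_trans (nrmM _ _)) // mulr_ile1 ?nrm_ge0 //.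
  by rewrite (le_trans (nrmM _ _)) // mulr_ile1 ?nrm_ge0.
pose B := [pred i | [&& A i, i != e & i != f]].
(* [n] counts the terms of [Z], namely the z i for i in B, and t. Each is at distance at most 1 from
   q e, hence so is their mean [Y], as [corner_sqrt] requires. *)
pose n := (#|B|.+1)%N.
have n0 : n%:R != 0 :> R[i] by rewrite pnatr_eq0.
pose Z0 := \sum_(i | B i) z i.
pose Z := Z0 + t.
have zZ : z f + Z = 0.
  have E : q e ** P ** q e = z e + (z f + Z0).
    rewrite PE amul_sumr amul_suml (bigD1 e) //= (bigD1 f) /=; last by rewrite Af fe.
    by congr (_ + (_ + _)); apply: eq_bigl => i; rewrite /B /= andbA.
  have ze : z e = q e by rewrite /z !qq.
  by rewrite /Z /t E ze; lmod.
pose Y := (n%:R^-1 : R[i]) *: Z.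
have aZ : adj Z = Z.
  rewrite /Z adjD at_ /Z0 adj_sum; congr (_ + _); apply: eq_bigr => i.
  by move=> /andP[/az].
have aY : adj Y = Y by rewrite /Y adjZ aZ fmorphV rmorph_nat.
have qZ : q e ** Z = Z.
  by rewrite /Z /Z0 amulDr qt amul_sumr; congr (_ + _); apply: eq_bigr => i _; rewrite qz.
have Zq : Z ** q e = Z.
  by rewrite /Z /Z0 amulDl tq amul_suml; congr (_ + _); apply: eq_bigr => i _; rewrite zq.
have nY : nrm (q e - Y) <= 1.
  have -> : q e - Y = (n%:R^-1 : R[i]) *: (\sum_(i | B i) (q e - z i) + (q e - t)).
    have -> : q e - Y = (n%:R^-1 : R[i]) *: (n%:R *: q e - Z).
      by rewrite scalerBr scalerA mulVf // scale1r.
    have -> : \sum_(i | B i) (q e - z i) = q e *+ #|B| - Z0.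
      by rewrite sumrB sumr_const.
    congr (_ *: _); rewrite /Z /n -natr1 scalerDl scale1r scaler_nat.
    by lmod.
  rewrite nrmZ cabs_inv.
  have cn : cabs (n%:R : R[i]) = n%:R by rewrite -(rmorph_nat (real_complex R)) cabsC ger0_norm.
  rewrite cn mulrC ler_pdivrMr ?mul1r ?ltr0n //.
  rewrite (le_trans (nrmD _ _)) // /n -natr1 lerD // (le_trans (nrm_sum _ _ _)) //.
  rewrite -sum1_card natr_sum; apply: ler_sum => i /andP[/nz h _]; exact: h.
have [h [ah hh qh hq hw]] := corner_sqrt (pq e Ae) (qz f) (zq f) (az f Af) (nz f Af).
have qY : q e ** Y = Y by rewrite /Y amulZr qZ.
have Yq : Y ** q e = Y by rewrite /Y amulZl Zq.
have [k [ak kk qk kq kw]] := corner_sqrt (pq e Ae) qY Yq aY nY.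
have ZE : Z = - z f by apply/eqP; rewrite -addr_eq0 addrC zZ.
have kz : z f ** k = k ** z f.
  rewrite (kw (z f) (qz f) (zq f)) // /Y ZE amulZl amulZr amulNl amulNr //.
have kh : h ** k = k ** h by apply: hw.
pose s := (Num.sqrt (n%:R : R))%:C : R[i].
have ss : s * s = n%:R by rewrite -rmorphM /= -expr2 sqr_sqrtr // rmorph_nat.
have h0 : h = 0.
  apply: (@sum_sq_eq0 _ _ h (s *: k)) => //.
  - by rewrite adjZ conjC_re ak.
  - by rewrite amulZl amulZr kh.
  - by rewrite amulZl amulZr scalerA ss hh kk /Y scalerA mulfV // scale1r.
apply: adjM_eq0; rewrite adjM aq af -amulA (amulA (q f)) ff amulA.
by rewrite -/(z f) -hh h0 amul0l.
Qed.

End Projections.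

(** * Limits and extension by continuity *)

Section Tends.
Context {R : realType} {T : cstarAlgType R}.

Lemma tends_lips {T1 T2 : normedModType R[i]} (f : T1 -> T2) u l :
  lips f -> tends u l -> tends (f \o u) (f l).
Proof.
case=> k k0 hf hu e e0; have [|N hN] := hu (e / k); first by rewrite divr_gt0.
exists N => n /hN h; rewrite (le_lt_trans (hf _ _)) // mulrC -ltr_pdivlMr //.
Qed.

Lemma tendsD {T1 : normedModType R[i]} (u v : nat -> T1) l m :
  tends u l -> tends v m -> tends (fun n => u n + v n) (l + m).
Proof.
move=> hu hv e e0; have e2 : 0 < e / 2 by lra.
have [N hN] := hu _ e2; have [M hM] := hv _ e2.
exists (maxn N M) => n; rewrite geq_max => /andP[/hN h1 /hM h2].
rewrite opprD addrACA (le_lt_trans (nrmD _ _)) //; lra.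
Qed.

Lemma tendsZ {T1 : normedModType R[i]} (u : nat -> T1) l (a : R[i]) :
  tends u l -> tends (fun n => a *: u n) (a *: l).
Proof.
apply: tends_lips; exists (cabs a + 1) => [|x y]; first by rewrite ltr_wpDl ?cabs_ge0.
by rewrite -scalerBr nrmZ ler_wpM2r ?nrm_ge0 // lerDl.
Qed.

Lemma tendsM (u v : nat -> T) l m :
  tends u l -> tends v m -> tends (fun n => u n ** v n) (l ** m).
Proof.
move=> hu hv e e0.
pose k := nrm l + nrm m + 1.
have k0 : 0 < k by rewrite /k; have := nrm_ge0 l; have := nrm_ge0 m; lra.
have e2 : 0 < e / (2 * k) by rewrite divr_gt0 ?mulr_gt0.
have [N hN] := hu _ e2; have [M hM] := hv _ e2.
have [N1 hN1] := hu _ (ltr01).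
exists (maxn N1 (maxn N M)) => n; rewrite !geq_max => /andP[/hN1 h1 /andP[/hN h2 /hM h3]].
have -> : l ** m - u n ** v n = (l - u n) ** m + u n ** (m - v n) by amul_expand; lmod.
rewrite (le_lt_trans (nrmD _ _)) //.
have un : nrm (u n) <= k.
  have := nrm_sub_le (u n) l; rewrite nrmBC /k; have := nrm_ge0 m; lra.
have mk : nrm m <= k by rewrite /k; have := nrm_ge0 l; lra.
have a1 : nrm ((l - u n) ** m) <= nrm (l - u n) * k.
  by rewrite (le_trans (nrmM _ _)) // ler_wpM2l ?nrm_ge0.
have a2 : nrm (u n ** (m - v n)) <= nrm (m - v n) * k.
  by rewrite (le_trans (nrmM _ _)) // mulrC ler_wpM2l ?nrm_ge0.
have e3 : e = e / (2 * k) * k + e / (2 * k) * k by field; rewrite gt_eqF.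
have b1 : nrm (l - u n) * k < e / (2 * k) * k by rewrite ltr_pM2r.
have b2 : nrm (m - v n) * k < e / (2 * k) * k by rewrite ltr_pM2r.
by rewrite e3; lra.
Qed.

Lemma tends_nrm_le {T1 : normedModType R[i]} (u : nat -> T1) l (r : R) :
  tends u l -> (forall n, nrm (u n) <= r) -> nrm l <= r.
Proof.
move=> hu ur; apply/ler_addgt0Pl => e e0; have [N /(_ N (leqnn _)) h] := hu e e0.
have := nrm_sub_le l (u N); have := ur N; lra.
Qed.

End Tends.

Section Extension.
Context {R : realType} {T T' : cstarAlgType R}.

(** The densely defined map is a relation because it is known on representations of elements rather
    than on elements. The norm bound forces y = 0 when 0 is related to y in the closure [H], so [H]
    is the graph of a function. *)
Lemma star_hom_extension (G : T -> T' -> Prop) :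
  (forall (a : R[i]) x y x' y', G x y -> G x' y' -> G (a *: x + x') (a *: y + y')) ->
  (forall x y x' y', G x y -> G x' y' -> G (x ** x') (y ** y')) ->
  (forall x y, G x y -> G (adj x) (adj y)) ->
  (forall x y, G x y -> nrm y <= nrm x) ->
  (forall x, adh [set x | exists y, G x y] x) ->
  exists2 f : T -> T', star_hom f & forall x y, G x y -> f x = y.
Proof.
move=> Gl Gm Ga Gn Gd.
have G00 : G 0 0.
  have [x [y xy] _] := Gd 0 1 ltr01.
  by have := Gl (-1) x y x y xy xy; rewrite !scaleN1r !addNr.
have GB x y x' y' : G x y -> G x' y' -> G (x - x') (y - y').
  by move=> h h'; have := Gl (-1) _ _ _ _ h' h; rewrite !scaleN1r !(addrC (- _)).
pose H x y := exists u v, [/\ forall n, G (u n) (v n), tends u x & tends v y].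
have Htot x : exists y, H x y.
  have [u hu ux] := adh_tends (Gd x).
  have [v hv] := choice hu.
  have [y vy] : exists y, tends v y.
    apply: cauchy_tends => e e0; have e2 : 0 < e / 2 by lra.
    have [N hN] := ux _ e2; exists N => n m /hN h1 /hN h2.
    rewrite (le_lt_trans (Gn _ _ (GB _ _ _ _ (hv n) (hv m)))) //.
    by rewrite (le_lt_trans (nrm_tri x _ _)) // nrmBC; lra.
  by exists y, u, v.
have Hl a x y x' y' : H x y -> H x' y' -> H (a *: x + x') (a *: y + y').
  move=> [u [v [h1 h2 h3]]] [u' [v' [h1' h2' h3']]].
  exists (fun n => a *: u n + u' n), (fun n => a *: v n + v' n); split.
  - by move=> n; exact: Gl.
  - by apply: tendsD => //; exact: tendsZ.
  - by apply: tendsD => //; exact: tendsZ.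
have Hm x y x' y' : H x y -> H x' y' -> H (x ** x') (y ** y').
  move=> [u [v [h1 h2 h3]]] [u' [v' [h1' h2' h3']]].
  exists (fun n => u n ** u' n), (fun n => v n ** v' n).
  by split; [move=> n; exact: Gm|exact: tendsM|exact: tendsM].
have Ha x y : H x y -> H (adj x) (adj y).
  move=> [u [v [h1 h2 h3]]]; exists (fun n => adj (u n)), (fun n => adj (v n)).
  by split; [move=> n; exact: Ga|apply: tends_lips h2; exact: lips_adj|apply: tends_lips h3; exact: lips_adj].
have Hn y : H 0 y -> y = 0.
  move=> [u [v [h1 h2 h3]]]; apply: nrm_small => e e0.
  have [N hN] := h2 _ e0.
  apply: (tends_nrm_le (u := fun n => v (N + n)%N)).
    move=> d /h3[M hM]; exists M => n Mn; apply: hM.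
    exact: leq_trans Mn (leq_addl _ _).
  move=> n; rewrite (le_trans (Gn _ _ (h1 _))) // ltW //.
  by have := hN (N + n)%N (leq_addr _ _); rewrite sub0r nrmN.
have Hu x y y' : H x y -> H x y' -> y = y'.
  move=> h h'; apply/eqP; rewrite -subr_eq0; apply/eqP/Hn.
  by have := Hl (-1) _ _ _ _ h' h; rewrite !scaleN1r addNr addrC.
have [f hf] := choice Htot.
exists f; first split.
- by move=> a x y; apply: (Hu (a *: x + y)); [exact: hf|exact: Hl].
- by move=> x y; apply: (Hu (x ** y)); [exact: hf|exact: Hm].
- by move=> x; apply: (Hu (adj x)); [exact: hf|exact: Ha].
- move=> x y xy; apply: (Hu x) => //; exists (fun=> x), (fun=> y); split=> // e e0.
    by exists 0%N => n _; rewrite subrr nrm0.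
  by exists 0%N => n _; rewrite subrr nrm0.
Qed.

End Extension.

(** * Matrix units in the compact operators *)

Section Inner.
Context {R : realType} {K : compact_operators R}.
Notation H := (hilbert K).
Implicit Types x y z : H.

Definition ip x y : R[i] := inner K x y.

Lemma ipDl x y z : ip (x + y) z = ip x z + ip y z.
Proof. by rewrite /ip linearDl. Qed.
Lemma ipZl a x z : ip (a *: x) z = a * ip x z.
Proof. by rewrite /ip linearZl_LR. Qed.
Lemma ipC x y : ip x y = conjC (ip y x).
Proof. by rewrite /ip hermC expr0 mul1r. Qed.
Lemma ipDr x y z : ip z (x + y) = ip z x + ip z y.
Proof. by rewrite /ip linearDr. Qed.
Lemma ipZr a x z : ip z (a *: x) = conjC a * ip z x.
Proof. by rewrite /ip linearZr_LR. Qed.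
Lemma ip0l z : ip 0 z = 0.
Proof. by rewrite -(scale0r (0 : H)) ipZl mul0r. Qed.
Lemma ip0r z : ip z 0 = 0.
Proof. by rewrite ipC ip0l conjC0. Qed.
Lemma ipNl x z : ip (- x) z = - ip x z.
Proof. by rewrite -scaleN1r ipZl mulN1r. Qed.
Lemma ipNr x z : ip z (- x) = - ip z x.
Proof. by rewrite ipC ipNl rmorphN [ip z x]ipC. Qed.
Lemma ipBl x y z : ip (x - y) z = ip x z - ip y z.
Proof. by rewrite ipDl ipNl. Qed.
Lemma ipBr x y z : ip z (x - y) = ip z x - ip z y.
Proof. by rewrite ipDr ipNr. Qed.
Lemma ip_suml (I : Type) (r : seq I) (P : pred I) (F : I -> H) z :
  ip (\sum_(i <- r | P i) F i) z = \sum_(i <- r | P i) ip (F i) z.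
Proof. by elim/big_rec2: _ => [|i u v _ <-]; rewrite ?ip0l ?ipDl. Qed.
Lemma ip_sumr (I : Type) (r : seq I) (P : pred I) (F : I -> H) z :
  ip z (\sum_(i <- r | P i) F i) = \sum_(i <- r | P i) ip z (F i).
Proof. by elim/big_rec2: _ => [|i u v _ <-]; rewrite ?ip0r ?ipDr. Qed.

Lemma ipxx x : ip x x = (nrm x ^+ 2)%:C.
Proof. by rewrite /ip inner_norm nrmE rmorphXn. Qed.

Lemma ip_eq x y : (forall z, ip z x = ip z y) -> x = y.
Proof.
move=> h; apply/eqP; rewrite -subr_eq0; apply/eqP/nrm_eq0/eqP.
rewrite -sqrf_eq0; apply/eqP/complexI; rewrite -ipxx ipBr h subrr //.
Qed.

Lemma cauchy_schwarz x y : cabs (ip x y) <= nrm x * nrm y.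
Proof.
have [y0|y0] := eqVneq (nrm y) 0.
  by rewrite (nrm_eq0 y0) ip0r cabs0 nrm0 mulr0.
have yp : 0 < nrm y by rewrite lt_neqAle eq_sym y0 nrm_ge0.
pose a := ip x y; pose b := nrm y ^+ 2.
have bp : 0 < b by rewrite exprn_gt0.
have E : ip (b%:C *: x - a *: y) (b%:C *: x - a *: y) =
    (b * (b * nrm x ^+ 2 - cabs a ^+ 2))%:C.
  rewrite ipBl !ipBr !ipZl !ipZr !ipxx -/a -/b (ipC y x) -/a conjC_re.
  have -> : conjC a = (cabs a ^+ 2)%:C / a.
    have [->|an0] := eqVneq a 0; first by rewrite conjC0 invr0 mulr0.
    by apply: (mulfI an0); rewrite mulrCA mulfV // mulr1 -normCK cabsE rmorphXn.
  rewrite !(rmorphM, rmorphB) /=; clearbody a.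
  have [->|an0] := eqVneq a 0; first by rewrite cabs0 invr0 rmorph0; ring.
  by field.
have h : 0 <= b * (b * nrm x ^+ 2 - cabs a ^+ 2).
  by rewrite -lecR -E ipxx lecR sqr_ge0.
have h2 : cabs a ^+ 2 <= (nrm x * nrm y) ^+ 2.
  by rewrite exprMn mulrC -/b -subr_ge0 -(pmulr_rge0 _ bp).
by rewrite -ler_sqr ?nnegrE ?cabs_ge0 ?mulr_ge0 ?nrm_ge0.
Qed.

End Inner.

(** * A countable orthonormal basis *)

Section OrthonormalBasis.
Context {R : realType} {K : compact_operators R}.
Notation H := (hilbert K).
Implicit Types (x y z : H) (s : seq H).

Definition onproj s x : H := \sum_(v <- s) ip x v *: v.
Definition resid s x : H := x - onproj s x.
Definition orthonormal_seq s : Prop :=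
  forall i j, (i < size s)%N -> (j < size s)%N -> ip (s`_i) (s`_j) = (i == j)%:R.

Lemma onprojB s x y : onproj s (x - y) = onproj s x - onproj s y.
Proof.
by rewrite /onproj -sumrB; apply: eq_bigr => v _; rewrite ipBl scalerBl.
Qed.

Lemma residB s x y : resid s (x - y) = resid s x - resid s y.
Proof. by rewrite /resid onprojB !opprD !opprK addrACA. Qed.

Lemma ip_onproj s x k : orthonormal_seq s -> (k < size s)%N ->
  ip (onproj s x) s`_k = ip x s`_k.
Proof.
move=> os ks; rewrite /onproj ip_suml (big_nth 0) big_mkord (bigD1 (Ordinal ks)) //=.
rewrite ipZl os // eqxx mulr1 big1 ?addr0 // => i ik.
by rewrite ipZl os // -val_eqE /= in ik *; rewrite (negPf ik) mulr0.
Qed.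

Lemma ip_resid s x k : orthonormal_seq s -> (k < size s)%N -> ip (resid s x) s`_k = 0.
Proof. by move=> os ks; rewrite /resid ipBl ip_onproj // subrr. Qed.

Lemma nrm_resid s x : orthonormal_seq s -> nrm (resid s x) <= nrm x.
Proof.
move=> os.
have o1 : ip (resid s x) (onproj s x) = 0.
  rewrite /onproj ip_sumr (big_nth 0) big_mkord big1 // => i _.
  by rewrite ipZr ip_resid // mulr0.
have o2 : ip (onproj s x) (resid s x) = 0 by rewrite ipC o1 conjC0.
rewrite -ler_sqr ?nnegrE ?nrm_ge0 // -lecR -!ipxx.
have {3 4}-> : x = resid s x + onproj s x by rewrite subrK.
move: (resid s x) (onproj s x) o1 o2 => r p o1 o2.
by rewrite ipDl !ipDr o1 o2 addr0 add0r lerDl ipxx lecR sqr_ge0.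
Qed.

(** The coordinates of n + 1 independent vectors would form a matrix with n + 1 rows and n columns;
    a vector of its left kernel is a linear relation. *)
Lemma resid_span n s : orthonormal_seq s -> size s = n -> (forall x, resid s x = 0) -> False.
Proof.
move=> os sn h; have [y yl] := @hilbert_infinite _ K n.+1.
pose A : 'M[R[i]]_(n.+1, n) := \matrix_(j, i) ip (y j) s`_i.
have : ~~ row_free A by rewrite /row_free neq_ltn ltnS rank_leq_col.
rewrite -kermx_eq0 => /rowV0Pn[v /sub_kermxP vA v0].
have := yl (fun j => v 0 j); case/(_ _)/Wrap => [|vj]; last first.
  by case/eqP: v0; apply/rowP => j; rewrite mxE.
have E j : y j = \sum_(i < n) A j i *: s`_i.
  have /eqP := h (y j); rewrite subr_eq0 => /eqP {1}->.
  rewrite /onproj (big_nth 0) big_mkord sn; apply: eq_bigr => i _; by rewrite mxE.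
under eq_bigr => j _ do rewrite E scaler_sumr.
rewrite exchange_big big1 //= => i _.
under eq_bigr => j _ do rewrite scalerA.
rewrite -scaler_suml; have := congr1 (fun M : 'rV_n => M 0 i) vA.
by rewrite !mxE => ->; rewrite scale0r.
Qed.

Lemma dense_sequence : exists d : nat -> H, forall x (e : R), 0 < e -> exists n, nrm (x - d n) < e.
Proof.
have [D /countable_injP[f finj] /denseE_adh hD] := @hilbert_separable _ K.
have h n : exists x, (exists2 y, D y & f y = n) -> D x /\ f x = n.
  case: (pselect (exists2 y, D y & f y = n)) => [[y Dy fy]|no]; last by exists 0.
  by exists y.
have [d hd] := choice h; exists d => x e /(hD x)[y Dy xy]; exists (f y).
have [|D1 D2] := hd (f y); first by exists y.
by rewrite (_ : d (f y) = y) //; apply: finj; rewrite ?inE.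
Qed.

(** Gram-Schmidt along a dense sequence d, each step treating the least m for which d m is not yet
    in the span. After n steps all d m with m < n are in the span, and since residues do not
    increase norms, density gives the expansion of every vector. *)
Lemma orthonormal_basis : exists e : nat -> H,
  (forall i j, ip (e i) (e j) = (i == j)%:R) /\
  forall x, tends (fun n => \sum_(i < n) ip x (e i) *: e i) x.
Proof.
have [d hd] := dense_sequence.
(* The new vector depends on the finite sequence alone, so one choice function can be iterated; 0 is
   a default for sequences that are not orthonormal. *)
have step s : exists v : H, orthonormal_seq s -> orthonormal_seq (rcons s v) /\
    exists2 m, (forall k, (k < m)%N -> resid s (d k) = 0) /\ resid s (d m) != 0 &
      resid (rcons s v) (d m) = 0.
  case: (pselect (orthonormal_seq s)) => [os|no]; last by exists 0.
  have [m rm] : exists m, resid s (d m) != 0.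
    apply: contrapT => nm; apply: (resid_span os erefl) => x.
    apply: nrm_small => e e0; have [n hn] := hd x e e0.
    have rn : resid s (d n) = 0.
      by apply/eqP; apply: contrapT => /negP r; apply: nm; exists n.
    have := nrm_resid (x - d n) os; rewrite residB rn subr0 => /le_trans; apply.
    exact: ltW.
  have exm : exists m, resid s (d m) != 0 by exists m.
  pose m0 := ex_minn exm.
  have [rm0 m0P] : resid s (d m0) != 0 /\ forall k, resid s (d k) != 0 -> (m0 <= k)%N.
    by rewrite /m0; case: ex_minnP.
  pose r := resid s (d m0); pose c := (nrm r)^-1; pose v := c%:C *: r.
  have rp : 0 < nrm r.
    rewrite lt_neqAle nrm_ge0 andbT eq_sym; apply/eqP => /nrm_eq0 r0.
    by rewrite -/r r0 eqxx in rm0.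
  exists v => _.
  have vv : ip v v = 1.
    rewrite /v ipZl ipZr ipxx conjC_re -!rmorphM /= /c.
    by rewrite (_ : _ * _ = 1) ?rmorph1 //; field; rewrite gt_eqF.
  have vs k : (k < size s)%N -> ip v s`_k = 0 by move=> ks; rewrite /v ipZl ip_resid // mulr0.
  have sv k : (k < size s)%N -> ip s`_k v = 0 by move=> ks; rewrite ipC vs // conjC0.
  split.
    move=> i j; rewrite size_rcons !ltnS !nth_rcons => hi hj.
    case: ltnP => [i1|i1]; case: ltnP => [j1|j1]; first exact: os.
    - have -> : j = size s by apply/eqP; rewrite eqn_leq hj j1.
      by rewrite eqxx sv // ltn_eqF.
    - have -> : i = size s by apply/eqP; rewrite eqn_leq hi i1.
      by rewrite eqxx vs // gtn_eqF.
    - have -> : i = size s by apply/eqP; rewrite eqn_leq hi i1.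
      have -> : j = size s by apply/eqP; rewrite eqn_leq hj j1.
      by rewrite !eqxx vv.
  exists m0; first split=> // k km.
    by apply/eqP; apply: contrapT => /negP /m0P; rewrite leqNgt km.
  rewrite /resid /onproj -cats1 big_cat big_seq1 /= -/(onproj s (d m0)).
  have -> : ip (d m0) v = (nrm r)%:C.
    have -> : d m0 = r + onproj s (d m0) by rewrite subrK.
    rewrite ipDl; have -> : ip (onproj s (d m0)) v = 0.
      rewrite /onproj ip_suml (big_nth 0) big_mkord big1 // => i _.
      by rewrite ipZl sv // mulr0.
    rewrite addr0 /v ipZr conjC_re ipxx -rmorphM /c.
    by congr (_%:C); field; rewrite gt_eqF.
  rewrite /v scalerA -rmorphM /= mulfV ?gt_eqF // scale1r.
  by rewrite opprD addrA -/(resid s (d m0)) subrr.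
have [nxt hn] := choice step.
pose S n := iter n (fun s => rcons s (nxt s)) [::].
have SS n : S n.+1 = rcons (S n) (nxt (S n)) by [].
have So n : orthonormal_seq (S n).
  by elim: n => [//|n IH]; rewrite SS; have [] := hn _ IH.
have Ss n : size (S n) = n by elim: n => [//|n IH]; rewrite SS size_rcons IH.
pose e n := nxt (S n).
have Sn n i : (i < n)%N -> (S n)`_i = e i.
  elim: n i => [//|n IH] i; rewrite ltnS SS nth_rcons Ss => hi.
  have [/IH //|ni] := ltnP i n; have -> : i = n by apply/eqP; rewrite eqn_leq hi ni.
  by rewrite eqxx.
have oe i j : ip (e i) (e j) = (i == j)%:R.
  have hi : (i < (maxn i j).+1)%N by rewrite ltnS leq_maxl.
  have hj : (j < (maxn i j).+1)%N by rewrite ltnS leq_maxr.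
  by rewrite -(Sn _ _ hi) -(Sn _ _ hj) So ?Ss.
have pE n x : onproj (S n) x = \sum_(i < n) ip x (e i) *: e i.
  rewrite /onproj (big_nth 0) big_mkord Ss; apply: eq_bigr => i _.
  by rewrite Sn.
have rS n x : resid (S n) x = 0 -> resid (S n.+1) x = 0.
  rewrite /resid !pE big_ord_recr /= => /eqP; rewrite subr_eq0 => /eqP xE.
  suff -> : ip x (e n) = 0 by rewrite scale0r addr0 -xE subrr.
  rewrite xE ip_suml big1 // => i _.
  by rewrite ipZl oe (ltn_eqF (ltn_ord i)) mulr0.
have rd n m : (m < n)%N -> resid (S n) (d m) = 0.
  elim: n m => [//|n IH] m; rewrite ltnS => mn.
  have [_ [m0 [h1 h3] h2]] := hn _ (So n).
  have [mm0|m0m] := ltnP m m0; first by apply: rS; exact: h1.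
  have [mn'|nm] := ltnP m n; first by apply: rS; exact: IH.
  have [m0n|nm0] := ltnP m0 m.
    by move: h3; rewrite IH ?eqxx //; exact: leq_trans m0n mn.
  by have -> : m = m0 by apply/eqP; rewrite eqn_leq nm0 m0m.
exists e; split=> // x eps eps0.
have [m hm] := hd x eps eps0; exists m.+1 => n mn.
rewrite -pE -/(resid (S n) x) (le_lt_trans _ hm) //.
by have := nrm_resid (x - d m) (So n); rewrite residB rd ?subr0.
Qed.

End OrthonormalBasis.

(** * The C*-algebra of bounded operators *)

Section BoundedOperators.
Context {R : realType} (K : compact_operators R).
Notation H := (hilbert K).

Definition adjointable (f g : H -> H) : Prop := forall x y, ip (f x) y = ip x (g y).
Definition op_bound (f : H -> H) (c : R) : Prop := forall x, nrm (f x) <= c * nrm x.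

(** Requiring an adjoint makes linearity automatic and avoids the Riesz representation theorem. *)
Record bop := Bop { bfun :> H -> H;
  bfunP : exists2 g, adjointable bfun g & exists2 c : R, 0 <= c & op_bound bfun c }.

Lemma bop_eq (f g : bop) : (forall x, f x = g x) -> f = g.
Proof.
case: f g => [f hf] [g hg] /= /funext fg; subst g.
by rewrite (Prop_irrelevance hf hg).
Qed.

HB.instance Definition _ := gen_eqMixin bop.
HB.instance Definition _ := gen_choiceMixin bop.

Lemma adjointable_lin f g : adjointable f g -> forall (a : R[i]) x y, f (a *: x + y) = a *: f x + f y.
Proof.
move=> h a x y; apply: ip_eq => z.
by rewrite ipC h ipDl ipZl -!h -ipZl -ipDl -ipC.
Qed.

Lemma adjointable_sym f g : adjointable f g -> adjointable g f.
Proof. by move=> h x y; rewrite ipC -h -ipC. Qed.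

Lemma adjointable_unique f g g' : adjointable f g -> adjointable f g' -> g = g'.
Proof. by move=> h h'; apply: funext => y; apply: ip_eq => x; rewrite -h -h'. Qed.

Lemma op_bound_adj f g c : 0 <= c -> adjointable f g -> op_bound f c -> op_bound g c.
Proof.
move=> c0 h hf y; have [g0|g0] := eqVneq (nrm (g y)) 0.
  by rewrite g0 mulr_ge0 ?nrm_ge0.
have gp : 0 < nrm (g y) by rewrite lt_neqAle eq_sym g0 nrm_ge0.
rewrite -(ler_pM2r gp) -expr2.
have : cabs (ip (g y) (g y)) = nrm (g y) ^+ 2 by rewrite ipxx cabsC ger0_norm ?sqr_ge0.
rewrite -h => <-; rewrite (le_trans (cauchy_schwarz _ _)) //.
by rewrite mulrAC ler_wpM2r ?nrm_ge0.
Qed.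

Definition badj_fun (f : bop) : H -> H := s2val (cid2 (bfunP f)).
Lemma badj_funP (f : bop) : adjointable f (badj_fun f).
Proof. exact: s2valP (cid2 (bfunP f)). Qed.

Lemma badj_subproof (f : bop) : exists2 g, adjointable (badj_fun f) g & exists2 c : R, 0 <= c & op_bound (badj_fun f) c.
Proof.
exists f; first exact: adjointable_sym (badj_funP f).
have [_ _ [c c0 hc]] := bfunP f; exists c => //.
exact: op_bound_adj c0 (badj_funP f) hc.
Qed.
Definition badj (f : bop) : bop := Bop (badj_subproof f).

Lemma badjP (f : bop) x y : ip (f x) y = ip x (badj f y).
Proof. exact: badj_funP. Qed.
Lemma badjP' (f : bop) x y : ip (badj f x) y = ip x (f y).
Proof. exact: (adjointable_sym (badj_funP f)). Qed.

Lemma bop_lin (f : bop) (a : R[i]) x y : f (a *: x + y) = a *: f x + f y.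
Proof. exact: adjointable_lin (badj_funP f) _ _ _. Qed.
Lemma bopD (f : bop) x y : f (x + y) = f x + f y.
Proof. by have := bop_lin f 1 x y; rewrite !scale1r. Qed.
Lemma bop0 (f : bop) : f 0 = 0.
Proof. by apply: (@addrI _ (f 0)); rewrite -bopD !addr0. Qed.
Lemma bopZ (f : bop) a x : f (a *: x) = a *: f x.
Proof. by have := bop_lin f a x 0; rewrite bop0 !addr0. Qed.

Lemma bop_lincomb_subproof (a : R[i]) (f g : bop) :
  exists2 h, adjointable (fun x => a *: f x + g x) h &
  exists2 c : R, 0 <= c & op_bound (fun x => a *: f x + g x) c.
Proof.
exists (fun y => conjC a *: badj f y + badj g y).
  by move=> x y; rewrite ipDl ipZl ipDr ipZr conjCK !badjP.
have [_ _ [c c0 hc]] := bfunP f; have [_ _ [d d0 hd]] := bfunP g.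
exists (cabs a * c + d) => [|x]; first by rewrite addr_ge0 ?mulr_ge0 ?cabs_ge0.
rewrite mulrDl (le_trans (nrmD _ _)) // lerD // nrmZ -mulrA ler_wpM2l ?cabs_ge0 //.
Qed.
Definition blincomb a f g : bop := Bop (bop_lincomb_subproof a f g).

Lemma bzero_subproof : exists2 h : H -> H, adjointable (fun=> 0) h &
  exists2 c : R, 0 <= c & op_bound (fun=> 0) c.
Proof.
exists (fun=> 0); first by move=> x y; rewrite ip0l ip0r.
by exists 0 => // x; rewrite nrm0 mul0r.
Qed.
Definition bzero : bop := Bop bzero_subproof.
Definition badd f g := blincomb 1 f g.
Definition bscale a f := blincomb a f bzero.
Definition bopp f := bscale (-1) f.

Lemma baddE f g x : badd f g x = f x + g x. Proof. by rewrite /= scale1r. Qed.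
Lemma bscaleE a f x : bscale a f x = a *: f x. Proof. by rewrite /= addr0. Qed.
Lemma boppE f x : bopp f x = - f x. Proof. by rewrite /= addr0 scaleN1r. Qed.

Lemma baddA : associative badd.
Proof. by move=> f g h; apply: bop_eq => x; rewrite !baddE addrA. Qed.
Lemma baddC : commutative badd.
Proof. by move=> f g; apply: bop_eq => x; rewrite !baddE addrC. Qed.
Lemma badd0 : left_id bzero badd.
Proof. by move=> f; apply: bop_eq => x; rewrite !baddE add0r. Qed.
Lemma baddN : left_inverse bzero bopp badd.
Proof. by move=> f; apply: bop_eq => x; rewrite baddE boppE addNr. Qed.
HB.instance Definition _ := GRing.isZmodule.Build bop baddA baddC badd0 baddN.

Lemma bscaleA a b f : bscale a (bscale b f) = bscale (a * b) f.
Proof. by apply: bop_eq => x; rewrite !bscaleE scalerA. Qed.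
Lemma bscale1 : left_id 1 bscale.
Proof. by move=> f; apply: bop_eq => x; rewrite !bscaleE scale1r. Qed.
Lemma bscaleDr : right_distributive bscale badd.
Proof. by move=> a f g; apply: bop_eq => x; rewrite !(bscaleE, baddE) scalerDr. Qed.
Lemma bscaleDl f : {morph bscale^~ f : a b / a + b >-> badd a b}.
Proof. by move=> a b; apply: bop_eq => x; rewrite !(bscaleE, baddE) scalerDl. Qed.
HB.instance Definition _ := GRing.Zmodule_isLmodule.Build R[i] bop
  bscaleA bscale1 bscaleDr bscaleDl.

Lemma bopE_add (f g : bop) x : (f + g) x = f x + g x. Proof. exact: baddE. Qed.
Lemma bopE_scale a (f : bop) x : (a *: f) x = a *: f x. Proof. exact: bscaleE. Qed.
Lemma bopE_opp (f : bop) x : (- f) x = - f x. Proof. exact: boppE. Qed.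
Lemma bopE_sub (f g : bop) x : (f - g) x = f x - g x.
Proof. by rewrite bopE_add bopE_opp. Qed.
Lemma bopE_zero x : (0 : bop) x = 0. Proof. by []. Qed.

Definition opnorm (f : bop) : R := sup [set nrm (f x) | x in [set x | nrm x <= 1]].

Lemma opnorm_has_sup (f : bop) : has_sup [set nrm (f x) | x in [set x | nrm x <= 1]].
Proof.
split; first by exists (nrm (f 0)), 0 => //=; rewrite nrm0.
have [_ _ [c c0 hc]] := bfunP f; exists c => _ [x /= x1 <-].
by rewrite (le_trans (hc x)) // -[leRHS]mulr1 ler_wpM2l.
Qed.

Lemma opnorm_ge0 f : 0 <= opnorm f.
Proof.
apply: le_trans (_ : nrm (f 0) <= _); first exact: nrm_ge0.
apply: ub_le_sup; first by case: (opnorm_has_sup f).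
by exists 0 => //=; rewrite nrm0.
Qed.

Lemma opnormP (f : bop) x : nrm (f x) <= opnorm f * nrm x.
Proof.
have [x0|x0] := eqVneq (nrm x) 0.
  by rewrite (nrm_eq0 x0) bop0 nrm0 mulr0.
have xp : 0 < nrm x by rewrite lt_neqAle eq_sym x0 nrm_ge0.
rewrite -ler_pdivrMr //; apply: ub_le_sup; first by case: (opnorm_has_sup f).
exists ((nrm x)^-1%:C *: x) => /=.
  by rewrite nrmZ cabsC ger0_norm ?invr_ge0 ?nrm_ge0 // mulVf.
by rewrite bopZ nrmZ cabsC ger0_norm ?invr_ge0 ?nrm_ge0 // mulrC.
Qed.

Lemma opnorm_le (f : bop) c : 0 <= c -> op_bound f c -> opnorm f <= c.
Proof.
move=> c0 hc; apply: ge_sup; first by case: (opnorm_has_sup f).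
by move=> _ [x /= x1 <-]; rewrite (le_trans (hc x)) // -[leRHS]mulr1 ler_wpM2l.
Qed.

Definition bnorm (f : bop) : R[i] := (opnorm f)%:C.

Lemma bnormD (f g : bop) : bnorm (f + g) <= bnorm f + bnorm g.
Proof.
rewrite /bnorm -rmorphD lecR; apply: opnorm_le => [|x].
  by rewrite addr_ge0 ?opnorm_ge0.
by rewrite bopE_add mulrDl (le_trans (nrmD _ _)) // lerD ?opnormP.
Qed.

Lemma bnormZ a (f : bop) : bnorm (a *: f) = `|a| * bnorm f.
Proof.
have le b g : opnorm (b *: g) <= cabs b * opnorm g.
  apply: opnorm_le => [|x]; first by rewrite mulr_ge0 ?cabs_ge0 ?opnorm_ge0.
  by rewrite bopE_scale nrmZ -mulrA ler_wpM2l ?cabs_ge0 ?opnormP.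
rewrite /bnorm cabsE -rmorphM; congr (_%:C); apply/eqP; rewrite eq_le le /=.
have [->|a0] := eqVneq a 0; first by rewrite cabs0 mul0r opnorm_ge0.
have ap : 0 < cabs a.
  rewrite lt_neqAle cabs_ge0 andbT eq_sym; apply/eqP => /cabs_eq0 h.
  by rewrite h eqxx in a0.
have := le a^-1 (a *: f); rewrite scalerA mulVf // scale1r cabs_inv.
by rewrite mulrC ler_pdivlMr // mulrC.
Qed.

Lemma bnorm0_eq0 f : bnorm f = 0 -> f = 0.
Proof.
move=> /complexI f0; apply: bop_eq => x; apply: nrm_le0.
by rewrite (le_trans (opnormP f x)) // f0 mul0r.
Qed.

HB.instance Definition _ := Lmodule_isNormed.Build R[i] bop bnormD bnormZ bnorm0_eq0.

Lemma nrm_bop (f : bop) : nrm f = opnorm f. Proof. by []. Qed.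

Lemma opnorm_adj (f : bop) : opnorm (badj f) <= opnorm f.
Proof.
apply: opnorm_le; first exact: opnorm_ge0.
apply: op_bound_adj (opnorm_ge0 f) (badj_funP f) _; exact: opnormP.
Qed.

Lemma badjB (f g : bop) : badj (f - g) = badj f - badj g.
Proof.
apply: bop_eq => y; apply: ip_eq => x.
by rewrite -badjP !bopE_sub ipBl ipBr !badjP.
Qed.

(** The operators and their adjoints both converge pointwise, uniformly on the unit ball. The
    pairing passes to the limit, so the two limits are adjoint to each other and the limit is again
    a [bop]. *)
Lemma bop_seq_complete (u : nat -> bop) :
  (forall e : R, 0 < e -> exists N, forall n m, (N <= n)%N -> (N <= m)%N -> nrm (u n - u m) < e) ->
  exists l, tends u l.
Proof.
move=> uc.
have lim_of (v : nat -> bop) :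
    (forall e : R, 0 < e -> exists N, forall n m, (N <= n)%N -> (N <= m)%N -> nrm (v n - v m) < e) ->
    exists L : H -> H, (forall x, tends (fun n => v n x) (L x)) /\
      forall e : R, 0 < e -> exists N, forall n, (N <= n)%N -> forall x, nrm (L x - v n x) <= e * nrm x.
  move=> vc.
  have h x : exists y, tends (fun n => v n x) y.
    apply: cauchy_tends => e e0.
    have [|N hN] := vc (e / (nrm x + 1)); first by rewrite divr_gt0 // ltr_wpDl ?nrm_ge0.
    exists N => n m Nn Nm; rewrite -bopE_sub (le_lt_trans (opnormP _ _)) //.
    have x1 : 0 < nrm x + 1 by rewrite ltr_wpDl ?nrm_ge0.
    have := hN n m Nn Nm; rewrite nrm_bop ltr_pdivlMr //.
    apply: le_lt_trans; rewrite ler_wpM2l ?opnorm_ge0 // lerDl //.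
  have [L hL] := choice h; exists L; split=> // e e0.
  have [N hN] := vc e e0; exists N => n Nn x.
  apply/ler_addgt0Pl => d d0; have [M hM] := hL x d d0.
  have := hM (maxn M N) (leq_maxl _ _).
  have h1 := nrm_tri (v (maxn M N) x) (L x) (v n x).
  have h2 : nrm (v (maxn M N) x - v n x) <= e * nrm x.
    rewrite -bopE_sub (le_trans (opnormP _ _)) // ler_wpM2r ?nrm_ge0 // ltW //.
    by apply: hN => //; exact: leq_maxr.
  lra.
have [L [hL uL]] := lim_of u uc.
have ac (e : R) : 0 < e -> exists N, forall n m, (N <= n)%N -> (N <= m)%N ->
    nrm (badj (u n) - badj (u m)) < e.
  move=> /uc[N hN]; exists N => n m Nn Nm; rewrite -badjB.
  by rewrite (le_lt_trans (opnorm_adj _)) //; exact: hN.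
have [G [hG uG]] := lim_of (fun n => badj (u n)) ac.
have LG : adjointable L G.
  move=> x y; apply/eqP; rewrite -subr_eq0; apply/eqP/cabs_eq0.
  apply/eqP; rewrite eq_le cabs_ge0 andbT; apply/ler_addgt0Pl => e e0; rewrite addr0.
  pose k := nrm x + nrm y + 1.
  have k0 : 0 < k by rewrite /k; have := nrm_ge0 x; have := nrm_ge0 y; lra.
  have e2 : 0 < e / (2 * k) by rewrite divr_gt0 ?mulr_gt0.
  have [N hN] := hL x _ e2; have [M hM] := hG y _ e2.
  have := hN _ (leq_maxl N M); have := hM _ (leq_maxr N M); set n := maxn N M => a1 a2.
  have -> : ip (L x) y - ip x (G y) = ip (L x - u n x) y + ip x (badj (u n) y - G y).
    by rewrite ipBl ipBr badjP; ring.
  have t1 := cauchy_schwarz (L x - u n x) y.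
  have t2 := cauchy_schwarz x (badj (u n) y - G y).
  have t3 : cabs (ip (L x - u n x) y + ip x (badj (u n) y - G y)) <=
      cabs (ip (L x - u n x) y) + cabs (ip x (badj (u n) y - G y)).
    by rewrite -lecR rmorphD /= -!cabsE ler_normD.
  rewrite (le_trans t3) // (le_trans (lerD t1 t2)) // [nrm (badj _ _ - _)]nrmBC.
  have xk : nrm x <= k by rewrite /k; have := nrm_ge0 y; lra.
  have yk : nrm y <= k by rewrite /k; have := nrm_ge0 x; lra.
  have b1 : nrm (L x - u n x) * nrm y <= e / (2 * k) * k.
    by apply: ler_pM => //; rewrite ?nrm_ge0 // ltW.
  have b2 : nrm x * nrm (G y - badj (u n) y) <= k * (e / (2 * k)).
    by apply: ler_pM => //; rewrite ?nrm_ge0 // ltW.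
  have e3 : e = e / (2 * k) * k + k * (e / (2 * k)) by field; rewrite gt_eqF.
  by rewrite [leRHS]e3 lerD.
have Lb : exists2 c : R, 0 <= c & op_bound L c.
  have [N hN] := uL 1 ltr01; exists (1 + opnorm (u N)) => [|x].
    by rewrite addr_ge0 ?opnorm_ge0.
  have := nrm_sub_le (L x) (u N x); have := hN N (leqnn _) x; have := opnormP (u N) x.
  by rewrite mulrDl; lra.
exists (@Bop L (ex_intro2 _ _ G LG Lb)) => e e0.
have e2 : 0 < e / 2 by lra.
have [N hN] := uL _ e2; exists N => n Nn.
have hle : opnorm (@Bop L (ex_intro2 _ _ G LG Lb) - u n) <= e / 2.
  by apply: opnorm_le => [|x]; [exact: ltW|rewrite bopE_sub; exact: hN].
by rewrite nrm_bop (le_lt_trans hle) //; lra.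
Qed.

End BoundedOperators.

Section SequentialCompleteness.
Context {R : realType} {V : normedModType R[i]}.

(** A Cauchy filter contains a ball of radius 1/(n+1) for every n; the centres form a Cauchy
    sequence whose limit is that of the filter. *)
Lemma seq_complete_cvg :
  (forall u : nat -> V, (forall e : R, 0 < e -> exists N, forall n m,
     (N <= n)%N -> (N <= m)%N -> nrm (u n - u m) < e) -> exists l, tends u l) ->
  forall F : set_system V, ProperFilter F -> cauchy F -> cvg F.
Proof.
move=> sc F FF /cauchyP Fc.
have ballE (x : V) (e : R) : ball x e%:C = [set y | nrm (x - y) < e].
  by apply/seteqP; split=> y; rewrite -ball_normE /= nrmE ltcR.
have h n : exists x, F [set y : V | nrm (x - y) < n.+1%:R^-1].
  have [|x hx] := Fc (n.+1%:R^-1)%:C; first by rewrite ltcR invr_gt0 ltr0n.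
  by exists x; rewrite -ballE.
have [u hu] := choice h.
have small (e : R) : 0 < e -> exists N, forall n, (N <= n)%N -> n.+1%:R^-1 < e :> R.
  move=> e0; have := archi_boundP (ltW (_ : 0 < e^-1)); rewrite invr_gt0 => /(_ e0) hN.
  exists (archi_bound e^-1) => n Nn.
  rewrite invf_plt ?posrE ?ltr0n // (lt_le_trans hN) // ler_nat.
  exact: leq_trans Nn _.
have [l hl] : exists l, tends u l.
  apply: sc => e e0; have e2 : 0 < e / 2 by lra.
  have [N hN] := small _ e2; exists N => n m /hN h1 /hN h2.
  have [y [/= y1 y2]] := filter_ex (filterI (hu n) (hu m)).
  move: (lt_trans y1 h1) (lt_trans y2 h2); rewrite (nrmBC (u m)) => z1 z2.
  by rewrite (le_lt_trans (nrm_tri y _ _)) //; lra.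
apply/cvg_ex; exists l => A /nbhs_nrm[e e0 hA].
have e2 : 0 < e / 2 by lra.
have [N hN] := small _ e2; have [M hM] := hl _ e2.
apply: filterS (hu (maxn N M)) => y /= hy; apply: hA.
have h1 := lt_trans hy (hN _ (leq_maxl N M)); have h2 := hM _ (leq_maxr N M).
have := nrm_tri (u (maxn N M)) l y; lra.
Qed.

End SequentialCompleteness.

Section BoundedOperatorAlgebra.
Context {R : realType} (K : compact_operators R).
Notation bop := (bop K).

HB.instance Definition _ := Uniform_isComplete.Build bop
  (seq_complete_cvg (@bop_seq_complete R K)).

Lemma bmul_subproof (f g : bop) : exists2 h, adjointable (f \o g) h &
  exists2 c : R, 0 <= c & op_bound (f \o g) c.
Proof.
exists (badj g \o badj f); first by move=> x y /=; rewrite !badjP.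
exists (opnorm f * opnorm g) => [|x /=]; first by rewrite mulr_ge0 ?opnorm_ge0.
rewrite (le_trans (opnormP _ _)) // -mulrA ler_wpM2l ?opnorm_ge0 ?opnormP //.
Qed.
Definition bmul (f g : bop) : bop := Bop (bmul_subproof f g).

Lemma bmulE (f g : bop) x : bmul f g x = f (g x). Proof. by []. Qed.

Lemma bmulA : associative bmul.
Proof. by move=> f g h; exact: bop_eq. Qed.
Lemma bmul_linearl y : linear (bmul^~ y).
Proof. by move=> a f g; apply: bop_eq => x; rewrite !(bmulE, bopE_add, bopE_scale). Qed.
Lemma bmul_linearr x : linear (bmul x).
Proof.
move=> a f g; apply: bop_eq => y.
by rewrite !(bmulE, bopE_add, bopE_scale) bopD bopZ.
Qed.
Lemma badj_semilinear (a : R[i]) (f g : bop) :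
  badj (a *: f + g) = conjC a *: badj f + badj g.
Proof.
apply: bop_eq => y; apply: ip_eq => x.
by rewrite -badjP !(bopE_add, bopE_scale) ipDl ipDr ipZl ipZr conjCK !badjP.
Qed.
Lemma badjK : involutive (@badj R K).
Proof. by move=> f; apply: bop_eq => y; apply: ip_eq => x; rewrite -badjP badjP'. Qed.
Lemma badjM f g : badj (bmul f g) = bmul (badj g) (badj f).
Proof. by apply: bop_eq => y; apply: ip_eq => x; rewrite -badjP /= !badjP. Qed.
Lemma bnormM (f g : bop) : `|bmul f g| <= `|f| * `|g|.
Proof.
rewrite !nrmE -rmorphM lecR !nrm_bop; apply: opnorm_le => [|x /=].
  by rewrite mulr_ge0 ?opnorm_ge0.
by rewrite (le_trans (opnormP _ _)) // -mulrA ler_wpM2l ?opnorm_ge0 ?opnormP.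
Qed.
Lemma bnorm_cstar (f : bop) : `|bmul (badj f) f| = `|f| ^+ 2.
Proof.
rewrite !nrmE -rmorphXn !nrm_bop; congr (_%:C); apply/eqP; rewrite eq_le.
have h : opnorm (bmul (badj f) f) <= opnorm (badj f) * opnorm f.
  by have := bnormM (badj f) f; rewrite !nrmE -rmorphM lecR.
rewrite (le_trans h) /=; last by rewrite expr2 ler_wpM2r ?opnorm_ge0 ?opnorm_adj.
rewrite -[leLHS]ger0_norm ?sqr_ge0 // -sqrtr_sqr.
have s0 := opnorm_ge0 (bmul (badj f) f).
have : opnorm f <= Num.sqrt (opnorm (bmul (badj f) f)).
  apply: opnorm_le => [|x]; first exact: sqrtr_ge0.
  rewrite -ler_sqr ?nnegrE ?mulr_ge0 ?sqrtr_ge0 ?nrm_ge0 // exprMn sqr_sqrtr //.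
  have -> : nrm (f x) ^+ 2 = cabs (ip (bmul (badj f) f x) x).
    by rewrite /= badjP' ipxx cabsC ger0_norm ?sqr_ge0.
  rewrite (le_trans (cauchy_schwarz _ _)) // expr2 mulrA ler_wpM2r ?nrm_ge0 //.
  exact: opnormP.
rewrite sqrtr_sqr ger0_norm ?sqr_ge0 // => hf.
by rewrite -[leRHS](sqr_sqrtr s0) ler_sqr ?nnegrE ?opnorm_ge0 ?sqrtr_ge0.
Qed.

HB.instance Definition _ := isCStarAlgebra.Build R bop bmulA bmul_linearl
  bmul_linearr badj_semilinear badjK badjM bnormM bnorm_cstar.

End BoundedOperatorAlgebra.
Definition bopC (R : realType) (K : compact_operators R) : cstarAlgType R := bop K.

(** * Compact operators and their matrix units *)

Section CompactOperators.
Context {R : realType} (K : compact_operators R).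
Notation H := (hilbert K).

Lemma unit_ballE : [set x : H | `|x| <= 1] = [set x : H | nrm x <= 1].
Proof. by apply/seteqP; split=> x /=; rewrite nrmE -(lecR _ 1). Qed.

Lemma rep_compact_op (k : K) : compact_operator (rep k).
Proof. by apply/rep_compact; exists k. Qed.

Lemma rep_lin (k : K) : linear (rep k).
Proof. by case: (rep_compact_op k). Qed.

Lemma rep_precompact (k : K) : exists2 U : set H, compact U &
  forall x, nrm x <= 1 -> U (rep k x).
Proof.
have [_ [U hU [cU _]]] := rep_compact_op k; exists U => // x x1.
by apply: hU; rewrite unit_ballE; exists x.
Qed.

Lemma linear_bound (f : H -> H) (c : R) : linear f -> 0 <= c ->
  (forall x, nrm x <= 1 -> nrm (f x) <= c) -> op_bound f c.
Proof.
move=> lf c0 hc x.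
have f0 : f 0 = 0 by have := lf (-1) 0 0; rewrite scaler0 addr0 scaleN1r addNr.
have fZ a y : f (a *: y) = a *: f y.
  by have := lf a y 0; rewrite f0 !addr0.
have [x0|x0] := eqVneq (nrm x) 0.
  by rewrite (nrm_eq0 x0) f0 nrm0 mulr0.
have xp : 0 < nrm x by rewrite lt_neqAle eq_sym x0 nrm_ge0.
have := hc ((nrm x)^-1%:C *: x); rewrite fZ !nrmZ cabsC ger0_norm ?invr_ge0 ?nrm_ge0 //.
by rewrite mulVf // => /(_ (lexx _)); rewrite mulrC ler_pdivrMr.
Qed.

Lemma rep_bounded (k : K) : exists2 c : R, 0 <= c & op_bound (rep k) c.
Proof.
have [U cU hU] := rep_precompact k.
have [N hN] : exists N : nat, forall y, U y -> nrm y <= N%:R.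
  have := (iffLR (compact_near_coveringP _) cU) nat \oo (fun n y => nrm y <= n%:R) _.
  case.
    move=> y Uy; pose N := archi_bound (nrm y + 1).
    have hN : nrm y + 1 < N%:R by apply: archi_boundP; rewrite addr_ge0 ?nrm_ge0.
    exists ([set z | nrm (y - z) < 1], [set n | (N <= n)%N]).
      split; first by apply/nbhs_nrm; exists 1.
      by exists N.
    case=> z n [/= yz Nn]; have : (N%:R : R) <= n%:R by rewrite ler_nat.
    by have := nrm_sub_le z y; rewrite nrmBC; lra.
  by move=> N _ hN; exists N => y Uy; apply: (hN N (leqnn N)).
exists N%:R => //; apply: linear_bound => //; first exact: rep_lin.
by move=> x /hU /hN.
Qed.

Lemma rep_bop_subproof (k : K) : exists2 g : H -> H, adjointable (rep k) g &
  exists2 c : R, 0 <= c & op_bound (rep k) c.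
Proof.
exists (rep (adj k)); last exact: rep_bounded.
by move=> x y; exact: rep_adj.
Qed.
Definition repb (k : K) : bopC K := Bop (rep_bop_subproof k).

Lemma repbE k x : bfun (repb k) x = rep k x. Proof. by []. Qed.

Lemma repb_hom : star_hom repb.
Proof.
split.
- move=> a k l; apply: bop_eq => x.
  by rewrite [RHS]bopE_add bopE_scale !repbE rep_linear.
- by move=> k l; apply: bop_eq => x; rewrite repbE rep_mul.
- move=> k; apply: bop_eq => y; apply: ip_eq => x; rewrite repbE.
  by rewrite -[RHS](@badjP _ _ (repb k)) repbE; apply/esym/rep_adj.
Qed.

Lemma repb_inj : injective repb.
Proof. by move=> k l h; apply: rep_inj; have := congr1 (@bfun R K) h. Qed.

(** This makes the range of [repb] closed. An ultrafilter on the closure of the image of the ball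
    under T is Cauchy, because for each precision its sets can be transported to the image under a
    compact k close to T, where a cluster point exists. *)
Lemma compact_limit (T : bopC K) :
  (forall e : R, 0 < e -> exists k, nrm (T - repb k) < e) -> exists k, repb k = T.
Proof.
move=> hT; suff [k hk] : exists k, rep k = T by exists k; apply: bop_eq => x; rewrite repbE hk.
apply/rep_compact; split; first by move=> a x y; exact: bop_lin.
rewrite precompactE unit_ballE.
rewrite compact_ultra => F FF FA.
have Fex : cauchy F.
  apply: cauchy_exP => eps eps0.
  have -> : eps = (complex.Re eps)%:C by rewrite RRe_real // gtr0_real.
  have e0 : 0 < complex.Re eps by move: eps0; rewrite ltcE /= => /andP[].
  move: (complex.Re eps) e0 => e e0.
  have e3 : 0 < e / 3 by lra.
  have [k hk] := hT _ e3; have [U cU hU] := rep_precompact k.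
  have close x : nrm x <= 1 -> nrm (bfun T x - rep k x) < e / 3.
    move=> x1; rewrite -repbE -bopE_sub (le_lt_trans (opnormP _ _)) //.
    rewrite (le_lt_trans _ hk) // -[leRHS]mulr1 ler_wpM2l //; exact: opnorm_ge0.
  (* [B S] consists of the k x for which T x is close to S. The three errors, from s to T x, from T
     x to k x and from k x to the cluster point, are each below e / 3. *)
  pose B (S : set H) := [set y | exists2 x, nrm x <= 1 & y = rep k x /\ exists2 s, S s & nrm (bfun T x - s) < e / 3].
  have GF : ProperFilter (filter_from F B).
    apply: filter_from_proper; last first.
      move=> S FS; have [s [Ss cs]] := filter_ex (filterI FS FA).
      have /closureE_adh/(_ _ e3)[_ [x /= x1 <-] hx] := cs.
      exists (rep k x), x => //; split => //; exists s => //; by rewrite nrmBC.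
    apply: filter_from_filter; first by exists setT; exact: filterT.
    move=> S S' FS FS'; exists (S `&` S'); first exact: filterI.
    by move=> _ [x x1 [-> [s [Ss S's] hs]]]; split; exists x => //; split => //; exists s.
  have [] := cU _ GF.
    exists setT; first exact: filterT.
    by move=> _ [x x1 [-> _]]; exact: hU.
  move=> y [Uy cy]; exists y.
  rewrite (_ : ball y e%:C = [set z | nrm (y - z) < e]); last first.
    by apply/seteqP; split=> z; rewrite -ball_normE /= nrmE ltcR.
  have [//|FC] := in_ultra_setVsetC [set z | nrm (y - z) < e] FF.
  have GB : filter_from F B (B (~` [set z | nrm (y - z) < e])) by exists (~` [set z | nrm (y - z) < e]).
  have nb : nbhs y [set z | nrm (y - z) < e / 3] by apply/nbhs_nrm; exists (e / 3).
  have [z [[x x1 [zx [s /= Ss hs]]] /= hz]] := cy _ _ GB nb.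
  exfalso; apply: Ss; subst z.
  have h1 := nrm_tri (rep k x) y s; have h2 := nrm_tri (bfun T x) (rep k x) s.
  have := close x x1; rewrite nrmBC => h3; lra.
have /cauchy_cvg/cvg_ex[y hy] := Fex.
exists y; split=> //; apply: closed_closure => B /hy FB.
by have [z [Az Bz]] := filter_ex (filterI FA FB); exists z.
Qed.

(** The norm of K is tied to operators only by algebra: the inverse of [repb] is a homomorphism on
    its closed range, hence contractive. *)
Lemma nrm_rep_le (k : K) (c : R) : 0 <= c -> op_bound (rep k) c -> nrm k <= c.
Proof.
move=> c0 hc.
have hX : closed_star_subalgebra (range repb).
  have [hl hm ha] := repb_hom; split.
  - apply/closedE_adh => T hT; have [|k' <-] := @compact_limit T; last by exists k'.
    by move=> e /hT[_ [k' _ <-] h]; exists k'.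
  - by exists 0 => //; exact: star_hom0 repb_hom.
  - by move=> a _ _ [x _ <-] [y _ <-]; exists (a *: x + y); rewrite ?hl.
  - by move=> _ _ [x _ <-] [y _ <-]; exists (x ** y); rewrite ?hm.
  - by move=> _ [x _ <-]; exists (adj x); rewrite ?ha.
have [g hg] : exists g : bopC K -> K, forall k, g (repb k) = k.
  have h T : exists k, (exists k', repb k' = T) -> repb k = T.
    case: (pselect (exists k', repb k' = T)) => [[k' h]|no]; last by exists 0.
    by exists k'.
  have [g hg] := choice h; exists g => k'; apply: repb_inj; apply: hg; by exists k'.
have hG : star_hom_on (range repb) g.
  have [hl hm ha] := repb_hom; split.
  - by move=> a _ _ [x _ <-] [y _ <-]; rewrite -hl !hg.
  - by move=> _ _ [x _ <-] [y _ <-]; rewrite -hm !hg.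
  - by move=> _ [x _ <-]; rewrite -ha !hg.
have := star_hom_on_nrm hX hG (ex_intro2 _ _ k I erefl); rewrite hg => /le_trans; apply.
by rewrite nrm_bop; exact: opnorm_le.
Qed.

Lemma complexReIm (a : R[i]) : a = (complex.Re a)%:C + 'i * (complex.Im a)%:C.
Proof. by rewrite [LHS]complexE complexiE. Qed.

Lemma abs_Re_le (a : R[i]) : `|complex.Re a| <= cabs a.
Proof. by rewrite -lecR -cabsE normc_ge_Re. Qed.
Lemma abs_Im_le (a : R[i]) : `|complex.Im a| <= cabs a.
Proof.
have -> : complex.Im a = - complex.Re (a * 'i%C) by rewrite ReiNIm opprK.
rewrite normrN (le_trans (abs_Re_le _)) // cabsM.
have -> : cabs 'i%C = 1 :> R by rewrite complexiE /cabs normCi.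
by rewrite mulr1.
Qed.

Lemma rank_one (x y : H) : exists k : K, forall z, rep k z = ip z y *: x.
Proof.
suff /rep_compact[k hk] : compact_operator (fun z => ip z y *: x).
  by exists k => z; rewrite hk.
split; first by move=> a z w; rewrite ipDl ipZl scalerDl scalerA.
pose M := nrm y; pose f (p : R * R) : H := (p.1%:C + 'i * p.2%:C) *: x.
have cf : continuous f.
  move=> p A /nbhs_nrm[e e0 hA].
  pose d := e / (2 * (nrm x + 1)).
  have x1 : 0 < nrm x + 1 by rewrite ltr_wpDl ?nrm_ge0.
  have d0 : 0 < d by rewrite divr_gt0 ?mulr_gt0.
  apply/nbhs_ballP; exists d => //= q [/= h1 h2]; apply: hA.
  move: h1 h2; rewrite -!ball_normE /= => h1 h2.
  rewrite /f -scalerBl nrmZ.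
  have -> : p.1%:C + 'i * p.2%:C - (q.1%:C + 'i * q.2%:C) =
      (p.1 - q.1)%:C + 'i * (p.2 - q.2)%:C :> R[i].
    by rewrite !rmorphB /=; ring.
  have h3 : cabs ((p.1 - q.1)%:C + 'i * (p.2 - q.2)%:C) <= `|p.1 - q.1| + `|p.2 - q.2|.
    by rewrite (le_trans (cabsD _ _)) // cabsM cabs_i mul1r !cabsC.
  have h4 : cabs ((p.1 - q.1)%:C + 'i * (p.2 - q.2)%:C) * nrm x <= (`|p.1 - q.1| + `|p.2 - q.2|) * (nrm x + 1).
    by apply: ler_pM; rewrite ?cabs_ge0 ?nrm_ge0 // lerDl.
  rewrite (le_lt_trans h4) // -ltr_pdivlMr //.
  have -> : e / (nrm x + 1) = d + d by rewrite /d; field; rewrite gt_eqF.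
  exact: ltrD.
exists (f @` (`[- M, M] `*` `[- M, M])).
  rewrite unit_ballE => _ [z /= z1 <-].
  exists (complex.Re (ip z y), complex.Im (ip z y)); last by rewrite /f /= -complexReIm.
  have zy : cabs (ip z y) <= M.
    by rewrite (le_trans (cauchy_schwarz _ _)) // -[leRHS]mul1r ler_wpM2r ?nrm_ge0.
  split=> /=; rewrite in_itv /= -ler_norml (le_trans _ zy) //;
    [exact: abs_Re_le|exact: abs_Im_le].
have cU : compact (f @` (`[- M, M] `*` `[- M, M])).
  apply: continuous_compact; first exact: continuous_subspaceT.
  by apply: compact_setX; exact: segment_compact.
by split=> //; apply: compact_closed => //; exact: norm_hausdorff.
Qed.

(** [eps i j] is the rank one operator sending e_j to e_i. With p_N the projection on the first N
    vectors, p_N y tends to y uniformly on the compact closure of the image of the ball, so p_N k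
    tends to k in norm. The same for k^* bounds k - p_N k p_N, and p_N k p_N is a finite combination
    of matrix units. *)
Lemma matrix_units : exists eps : nat -> nat -> K,
  [/\ forall i j k l, eps i j ** eps k l = if j == k then eps i l else 0,
      forall i j, adj (eps i j) = eps j i,
      forall i j, eps i j != 0 &
      forall (k : K) (e : R), 0 < e -> exists N, exists c : nat -> nat -> R[i],
        nrm (k - \sum_(i < N) \sum_(j < N) c i j *: eps i j) < e].
Proof.
have [e [oe te]] := @orthonormal_basis R K.
have h (p : nat * nat) : exists k : K, forall z, rep k z = ip z (e p.2) *: e p.1 by exact: rank_one.
have [f hf] := choice h; pose eps i j := f (i, j).
have epsE i j z : rep (eps i j) z = ip z (e j) *: e i by rewrite /eps hf.
have rep0 z : rep (0 : K) z = 0 by rewrite -repbE (star_hom0 repb_hom).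
have repD (k l : K) z : rep (k + l) z = rep k z + rep l z.
  by have := rep_linear 1 k l z; rewrite !scale1r.
have repZ a (k : K) z : rep (a *: k) z = a *: rep k z.
  by have := rep_linear a k 0 z; rewrite rep0 !addr0.
have repS (I : Type) (r : seq I) (F : I -> K) z : rep (\sum_(i <- r) F i) z = \sum_(i <- r) rep (F i) z.
  by elim/big_rec2: _ => [|i u v _ <-]; rewrite ?rep0 ?repD.
have epsM i j k l : eps i j ** eps k l = if j == k then eps i l else 0.
  apply: rep_inj; apply: funext => z; rewrite rep_mul !epsE ipZl oe.
  rewrite (eq_sym j); case: (k == j); first by rewrite mulr1 epsE.
  by rewrite mulr0 scale0r rep0.
have epsA i j : adj (eps i j) = eps j i.
  apply: rep_inj; apply: funext => y; apply: ip_eq => x.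
  rewrite /ip -rep_adj -!/(ip _ _) !epsE ipZl ipZr.
  by rewrite [ip y _]ipC conjCK mulrC.
have epsN i j : eps i j != 0.
  apply/eqP => h0; have := congr1 (fun k => rep k (e j)) h0.
  rewrite rep0 epsE oe eqxx scale1r => ei.
  by have := oe i i; rewrite ei ip0l eqxx => /eqP; rewrite eq_sym oner_eq0.
exists eps; split=> // k d d0.
pose P N x := \sum_(i < N) ip x (e i) *: e i.
pose p N := \sum_(i < N) eps i i.
have pE N z : rep (p N) z = P N z by rewrite repS; apply: eq_bigr => i _; rewrite epsE.
have oS N : orthonormal_seq [seq e i | i <- iota 0 N].
  move=> i j; rewrite size_map size_iota => hi hj.
  by rewrite !(nth_map 0%N) ?size_iota // !nth_iota // oe.
have PN N x : nrm (x - P N x) <= nrm x.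
  have := nrm_resid x (oS N); rewrite /resid /onproj big_map.
  by rewrite -{1}(subn0 N) -/(index_iota 0 N) big_mkord.
have PB N x y : P N (x - y) = P N x - P N y.
  by rewrite -sumrB; apply: eq_bigr => i _; rewrite ipBl scalerBl.
have appr (l : K) (c : R) : 0 < c -> exists N, forall n, (N <= n)%N -> nrm (l - p n ** l) <= c.
  move=> c0; have [U cU hU] := rep_precompact l; have c2 : 0 < c / 2 by lra.
  have := (iffLR (compact_near_coveringP _) cU) nat \oo (fun n y => nrm (y - P n y) <= c) _.
  case.
    move=> y Uy; have [N hN] := te y _ c2.
    exists ([set z | nrm (y - z) < c / 2], [set n | (N <= n)%N]).
      split; first by apply/nbhs_nrm; exists (c / 2).
      by exists N.
    case=> z n [/= yz Nn]; have h1 := hN n Nn; have h2 := PN n (z - y).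
    have -> : z - P n z = (z - y - P n (z - y)) + (y - P n y).
      by rewrite PB; lmod.
    have h3 : nrm (z - y) < c / 2 by rewrite nrmBC.
    have := nrmD (z - y - P n (z - y)) (y - P n y); rewrite -/(P n y) in h1; lra.
  move=> N _ hN; exists N => n Nn; apply: nrm_rep_le; first exact: ltW.
  apply: linear_bound; [exact: rep_lin|exact: ltW|].
  move=> x x1; rewrite -scaleN1r addrC rep_linear rep_mul pE addrC scaleN1r.
  by apply: (hN n Nn); exact: hU.
have p1 N : nrm (p N) <= 1.
  apply: nrm_projection; split; last by rewrite adj_sum; apply: eq_bigr => i _; rewrite epsA.
  rewrite amul_suml; apply: eq_bigr => i _; rewrite amul_sumr (bigD1 i) //= epsM eqxx.
  rewrite big1 ?addr0 // => j; rewrite -val_eqE /= eq_sym epsM => /negPf ->.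
  by [].
have d2 : 0 < d / 3 by lra.
have [N1 h1] := appr k _ d2; have [N2 h2] := appr (adj k) _ d2.
pose N := maxn N1 N2; exists N, (fun i j => ip (rep k (e j)) (e i)).
have -> : \sum_(i < N) \sum_(j < N) ip (rep k (e j)) (e i) *: eps i j = p N ** k ** p N.
  rewrite !amul_suml; apply: eq_bigr => i _; rewrite amul_sumr; apply: eq_bigr => j _.
  apply: rep_inj; apply: funext => z; rewrite repZ !rep_mul !epsE.
  have -> : rep k (ip z (e j) *: e j) = ip z (e j) *: rep k (e j).
    have := rep_lin k (ip z (e j)) (e j) 0.
    have k0 : rep k 0 = 0 by have := bop0 (repb k).
    by rewrite k0 !addr0.
  by rewrite ipZl scalerA mulrC.
have -> : k - p N ** k ** p N = (k - p N ** k) + p N ** adj (adj k - p N ** adj k).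
  rewrite adjB adjM !adjK amulBr amulA.
  have -> : adj (p N) = p N by rewrite adj_sum; apply: eq_bigr => i _; rewrite epsA.
  by lmod.
rewrite (le_lt_trans (nrmD _ _)) //.
have := h1 N (leq_maxl _ _); have h3 := h2 N (leq_maxr _ _).
have : nrm (p N ** adj (adj k - p N ** adj k)) <= d / 3.
  rewrite (le_trans (nrmM _ _)) // nrm_adj -[leRHS]mul1r; apply: ler_pM => //; exact: nrm_ge0.
lra.
Qed.

End CompactOperators.

(** * Cuntz-Krieger families *)

Section CuntzKrieger.
Context {R : realType} {V : finType} {A : V -> V -> nat} {T : cstarAlgType R}.
Variables (P : V -> T) (S : edge A -> T).
Hypothesis PS : cuntz_krieger_family P S.

Lemma ckP v : P v ** P v = P v. Proof. by case: PS => h _ _ _ _; case: (h v). Qed.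
Lemma ckPa v : adj (P v) = P v. Proof. by case: PS => h _ _ _ _; case: (h v). Qed.
Lemma ckPP v w : P v ** P w = if v == w then P v else 0.
Proof.
case: eqP => [<-|/eqP vw]; first exact: ckP.
by case: PS => _ h _ _ _; exact: h.
Qed.
Lemma ckSS e : adj (S e) ** S e = P (edge_range e). Proof. by case: PS. Qed.
Lemma ckPsum v : P v = \sum_(e : edge A | edge_source e == v) S e ** adj (S e).
Proof. by case: PS. Qed.

Lemma ckSP e : S e ** P (edge_range e) = S e.
Proof. by rewrite -ckSS amulA; case: PS => _ _ h _ _; exact: h. Qed.
Lemma ckPSa e : P (edge_range e) ** adj (S e) = adj (S e).
Proof. by rewrite -[RHS](congr1 (@adj R T) (ckSP e)) adjM ckPa. Qed.

Let q e := S e ** adj (S e).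
Let qproj e : projection (q e).
Proof.
split; last by rewrite /q adjM adjK.
by rewrite /q amulA -(amulA (S e)) ckSS ckSP.
Qed.

Let qorth e f : edge_source e = edge_source f -> e != f -> q e ** q f = 0.
Proof.
move=> ef nef; have PE := ckPsum (edge_source f).
apply: (projection_sum_orth (A := fun e => edge_source e == edge_source f) (q := q) _ _ PE) => //.
- by split; [exact: ckP|exact: ckPa].
- exact/eqP.
Qed.

Lemma ckPS v e : P v ** S e = if edge_source e == v then S e else 0.
Proof.
have h : P (edge_source e) ** S e = S e.
  rewrite ckPsum (bigD1 e) //= amulDl -amulA ckSS ckSP amul_suml big1 ?addr0 // => f /andP[/eqP fe nfe].
  have : q f ** q e = 0 by exact: qorth.
  move=> /(congr1 (fun x => x ** S e)); rewrite amul0l /q -amulA -(amulA (S e)) ckSS ckSP.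
  by [].
by rewrite -{1}h amulA ckPP (eq_sym v); case: eqP => [<-|_]; rewrite ?amul0l ?h.
Qed.

Lemma ckSaP v e : adj (S e) ** P v = if edge_source e == v then adj (S e) else 0.
Proof.
by rewrite -[LHS]adjK adjM adjK ckPa ckPS; case: eqP => _ //; rewrite adj0.
Qed.

Lemma ckSaS e f : adj (S e) ** S f = if e == f then P (edge_range e) else 0.
Proof.
have [<-|nef] := eqVneq e f; first exact: ckSS.
have [ef|nsef] := eqVneq (edge_source e) (edge_source f).
  have -> : adj (S e) ** S f = adj (S e) ** (q e ** q f) ** S f.
    rewrite /q !amulA ckSS ckPSa.
    by rewrite -(amulA _ (adj (S f))) ckSS -amulA ckSP.
  by rewrite qorth // amul0r amul0l.
have := ckPS (edge_source e) f; rewrite (eq_sym (edge_source f)) (negPf nsef) => h.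
by have := ckSaP (edge_source e) e; rewrite eqxx => <-; rewrite -amulA h amul0r.
Qed.

Lemma ckSPif w e : S e ** P w = if edge_range e == w then S e else 0.
Proof. by rewrite -{1}ckSP -amulA ckPP; case: eqP => _; rewrite ?ckSP ?amul0r. Qed.

End CuntzKrieger.

Section GraphAlgebraUnit.
Context {R : realType} {V : finType} {A : V -> V -> nat} (OA : graph_algebra R A).

Definition gunit : OA := \sum_v vertex_proj OA v.

Lemma gunitP (x : OA) : gunit ** x = x /\ x ** gunit = x.
Proof.
have PS := graph_family OA.
pose X := [set x : OA | gunit ** x = x] `&` [set x : OA | x ** gunit = x].
have ua : adj gunit = gunit.
  by rewrite adj_sum; apply: eq_bigr => v _; exact: (ckPa PS).
suff : X x by [].
apply: graph_generated.
- split.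
  + by apply: closedI; apply: closed_lips_eq => //; [exact: lips_mull|exact: lips_id|exact: lips_mulr|exact: lips_id].
  + by split; rewrite /= ?amul0l ?amul0r.
  + by move=> a y z [/= y1 y2] [/= z1 z2]; split; rewrite /= ?amulDr ?amulDl ?amulZr ?amulZl ?y1 ?y2 ?z1 ?z2.
  + by move=> y z [/= y1 y2] [/= z1 z2]; split; rewrite /= ?amulA ?y1 // -amulA z2.
  + by move=> y [/= y1 y2]; split; rewrite /= -{1}ua -adjM ?y1 ?y2.
- move=> v; split; rewrite /= /gunit ?amul_suml ?amul_sumr (bigD1 v) //= (ckPP PS) eqxx big1 ?addr0 //.
    by move=> w /negPf wv; rewrite (ckPP PS) wv.
  by move=> w wv; rewrite (ckPP PS) eq_sym (negPf wv).
- move=> e; split; rewrite /= /gunit ?amul_suml ?amul_sumr.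
    rewrite (bigD1 (edge_source e)) //= (ckPS PS) eqxx big1 ?addr0 // => w wv.
    by rewrite (ckPS PS) eq_sym (negPf wv).
  rewrite (bigD1 (edge_range e)) //= (ckSP PS) big1 ?addr0 // => w wv.
  by rewrite (ckSPif PS) eq_sym (negPf wv).
Qed.

Lemma gunit_adj : adj gunit = gunit.
Proof. by rewrite adj_sum; apply: eq_bigr => v _; exact: (ckPa (graph_family OA)). Qed.

End GraphAlgebraUnit.

(** * Operators given by partial injections of a basis *)

Section BasisOperators.
Context {R : realType} (K : compact_operators R).
Notation H := (hilbert K).
Variable (b : nat -> H).
Hypothesis ob : forall i j, ip (b i) (b j) = (i == j)%:R.
Hypothesis tb : forall x, tends (fun n => \sum_(i < n) ip x (b i) *: b i) x.

Definition partial_inverse (I : Type) (f g : I -> option I) :=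
  forall i j, f i = Some j <-> g j = Some i.

Lemma partial_inverseC (I : Type) (f g : I -> option I) :
  partial_inverse f g -> partial_inverse g f.
Proof. by move=> fg i j; split=> /fg. Qed.

Definition basis_image (f : nat -> option nat) (n : nat) : H :=
  if f n is Some j then b j else 0.
Notation u := basis_image.

Lemma ip_basis_image f m n : ip (u f m) (b n) = (f m == Some n)%:R.
Proof. by rewrite /u; case: (f m) => [j|]; rewrite ?ip0l ?ob. Qed.

Lemma ip_basis_image2 f g m n : partial_inverse f g ->
  ip (u f m) (u f n) = if f m is Some _ then (m == n)%:R else 0.
Proof.
move=> fg; rewrite {1}/u; case fm : (f m) => [j|]; last by rewrite ip0l.
rewrite ipC ip_basis_image conjC_nat; congr (_%:R); congr (nat_of_bool _).
apply/eqP/eqP => [/fg gj|<-] //; by move/fg: fm; rewrite gj => -[].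
Qed.

Lemma ip_tends (v w : nat -> H) y y' z z' : tends v y -> tends w y' ->
  (forall n, ip (v n) z = ip (w n) z') -> ip y z = ip y' z'.
Proof.
move=> hv hw h; apply/eqP; rewrite -subr_eq0; apply/eqP/cabs_eq0/eqP.
rewrite eq_le cabs_ge0 andbT; apply/ler_addgt0Pl => e e0; rewrite addr0.
pose k := nrm z + nrm z' + 1.
have k0 : 0 < k by rewrite /k; have := nrm_ge0 z; have := nrm_ge0 z'; lra.
have e2 : 0 < e / (2 * k) by rewrite divr_gt0 ?mulr_gt0.
have [N hN] := hv _ e2; have [M hM] := hw _ e2.
have := hN _ (leq_maxl N M); have := hM _ (leq_maxr N M); set n := maxn N M => a1 a2.
have -> : ip y z - ip y' z' = ip (y - v n) z + ip (w n - y') z'.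
  by rewrite !ipBl h; ring.
rewrite (le_trans (cabsD _ _)) // (le_trans (lerD (cauchy_schwarz _ _) (cauchy_schwarz _ _))) //.
have b1 : nrm (y - v n) * nrm z <= e / (2 * k) * k.
  apply: ler_pM; rewrite ?nrm_ge0 //; [exact: ltW|].
  by rewrite /k; have := nrm_ge0 z'; lra.
have b2 : nrm (w n - y') * nrm z' <= e / (2 * k) * k.
  apply: ler_pM; rewrite ?nrm_ge0 //; first by rewrite nrmBC ltW.
  by rewrite /k; have := nrm_ge0 z; lra.
have e3 : e = e / (2 * k) * k + e / (2 * k) * k by field; rewrite gt_eqF.
by rewrite [leRHS]e3 lerD.
Qed.

Let psum f x n := \sum_(i < n) ip x (b i) *: u f i.

Lemma nrm_basis_image_sum f g (c : nat -> R[i]) m n : partial_inverse f g ->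
  nrm (\sum_(m <= i < n) c i *: u f i) <= nrm (\sum_(m <= i < n) c i *: b i).
Proof.
move=> fg; rewrite -ler_sqr ?nnegrE ?nrm_ge0 // -lecR -!ipxx.
have E (v : nat -> H) (p : nat -> bool) : (forall i j, ip (v i) (v j) = if p i then (i == j)%:R else 0) ->
    ip (\sum_(m <= i < n) c i *: v i) (\sum_(m <= i < n) c i *: v i) =
    \sum_(m <= i < n) (if p i then `|c i| ^+ 2 else 0).
  move=> hv; rewrite ip_suml big_seq [RHS]big_seq; apply: eq_bigr => i hi.
  rewrite ip_sumr (bigD1_seq i) ?iota_uniq //= ipZl ipZr hv eqxx big1 ?addr0.
    by case: (p i); rewrite ?mulr0 // mulr1 normCK.
  by move=> j ji; rewrite ipZl ipZr hv eq_sym (negPf ji); case: (p i); rewrite !mulr0.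
rewrite (E (u f) (fun i => isSome (f i))); last first.
  by move=> i j; rewrite (ip_basis_image2 _ _ fg); case: (f i).
rewrite (E b (fun=> true)); last by move=> i j; rewrite ob.
by apply: ler_sum => i _; case: isSome; rewrite // exprn_ge0.
Qed.

Lemma basis_image_cvg f g x : partial_inverse f g -> exists y, tends (psum f x) y.
Proof.
move=> fg; apply: cauchy_tends => e e0; have e2 : 0 < e / 2 by lra.
have [N hN] := tb x e2; exists N.
have aux m n : (N <= m)%N -> (m <= n)%N -> nrm (psum f x n - psum f x m) < e.
  move=> Nm mn; rewrite /psum -!(big_mkord xpredT (fun i => ip x (b i) *: u f i)).
  rewrite (big_cat_nat (leq0n m) mn) //= addrAC subrr add0r.
  rewrite (le_lt_trans (nrm_basis_image_sum _ _ _ fg)) //.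
  have -> : \sum_(m <= i < n) ip x (b i) *: b i =
     \sum_(i < n) ip x (b i) *: b i - \sum_(i < m) ip x (b i) *: b i.
    rewrite -!(big_mkord xpredT (fun i => ip x (b i) *: b i)) (big_cat_nat (leq0n m) mn) //=.
    by rewrite addrAC subrr add0r.
  have h1 := hN m Nm; have h2 := hN n (leq_trans Nm mn).
  rewrite (le_lt_trans (nrm_tri x _ _)) // nrmBC; lra.
move=> n m Nn Nm; have [nm|mn] := leqP n m; first by rewrite nrmBC; exact: aux.
by apply: aux => //; exact: ltnW.
Qed.

(** T sends b_i to b_(f i), or to 0 where f is undefined, and its adjoint does the same with g. In
    coordinates, relations between such operators become statements about partial maps. *)
Lemma basis_operator f g : partial_inverse f g -> exists T : bopC K,
  (forall x n, ip (bfun T x) (b n) = if g n is Some i then ip x (b i) else 0) /\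
  (forall x n, ip (bfun (adj T) x) (b n) = if f n is Some i then ip x (b i) else 0).
Proof.
move=> fg; have gf := partial_inverseC fg.
have [F hF] := choice (fun x => basis_image_cvg x fg).
have [G hG] := choice (fun x => basis_image_cvg x gf).
have coef f' g' F' : partial_inverse f' g' -> (forall x, tends (psum f' x) (F' x)) ->
    forall x n, ip (F' x) (b n) = ip x (u g' n).
  move=> fg' hF' x n; apply: (ip_tends (hF' x) (tb x)) => m.
  rewrite /psum !ip_suml; apply: eq_bigr => i _; rewrite !ipZl; congr (_ * _).
  rewrite ip_basis_image ipC ip_basis_image conjC_nat; congr (_%:R).
  by congr (nat_of_bool _); apply/eqP/eqP => /fg'.
have FG : adjointable F G.
  move=> x y; rewrite ipC [RHS]ipC; congr (conjC _).
  apply: (ip_tends (tb y) (hG y)) => m; rewrite /psum !ip_suml.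
  apply: eq_bigr => i _; rewrite !ipZl; congr (_ * _).
  by rewrite ipC (coef _ _ _ fg hF) -ipC.
have Fb : op_bound F 1.
  move=> x; rewrite mul1r; apply: (tends_nrm_le (hF x)) => n.
  have := nrm_basis_image_sum (fun i => ip x (b i)) 0 n fg; rewrite !big_mkord.
  move/le_trans; apply.
  have oS : orthonormal_seq [seq b i | i <- iota 0 n].
    move=> i j; rewrite size_map size_iota => hi hj.
    by rewrite !(nth_map 0%N) ?size_iota // !nth_iota // ob.
  rewrite -ler_sqr ?nnegrE ?nrm_ge0 // -lecR -!ipxx.
  have E : \sum_(i < n) ip x (b i) *: b i = onproj [seq b i | i <- iota 0 n] x.
    by rewrite /onproj big_map -(big_mkord xpredT (fun i => ip x (b i) *: b i)) /index_iota subn0.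
  have o1 : ip (resid [seq b i | i <- iota 0 n] x) (\sum_(i < n) ip x (b i) *: b i) = 0.
    rewrite ip_sumr big1 // => i _; rewrite ipZr.
    have := ip_resid x oS (k := i); rewrite size_map size_iota => /(_ (ltn_ord i)).
    by rewrite (nth_map 0%N) ?size_iota // nth_iota // => ->; rewrite mulr0.
  have xE : x = resid [seq b i | i <- iota 0 n] x + \sum_(i < n) ip x (b i) *: b i.
    by rewrite E subrK.
  rewrite [in leRHS]xE; move: (resid _ _) (\sum_(i < n) _) o1 => r p o1.
  by rewrite ipDl !ipDr o1 (ipC p r) o1 conjC0 addr0 add0r lerDr ipxx lecR sqr_ge0.
pose T : bopC K := @Bop R K F (ex_intro2 _ _ G FG (ex_intro2 _ _ 1 ler01 Fb)).
have TG : bfun (adj T) = G by exact: (@adjointable_unique _ _ _ _ _ (badj_funP T) FG).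
exists T; split=> x n.
  by rewrite (coef _ _ _ fg hF) /u; case: (g n) => [i|]; rewrite ?ip0r.
by rewrite TG (coef _ _ _ gf hG) /u; case: (f n) => [i|]; rewrite ?ip0r.
Qed.

Lemma basis_ext x y : (forall n, ip x (b n) = ip y (b n)) -> x = y.
Proof.
move=> h; apply: tends_unique (tb x) _.
by rewrite (_ : (fun n => _) = (fun n => \sum_(i < n) ip y (b i) *: b i)) //; apply: funext => n; apply: eq_bigr => i _; rewrite h.
Qed.

End BasisOperators.

Section NonzeroFamily.
Context {R : realType} (K : compact_operators R) {V : finType} (A : V -> V -> nat).
Hypothesis rows : forall v, exists w, A v w != 0%N.

(* The graph acts on a Hilbert space with orthonormal vectors indexed by [V * nat]: [S_e] maps the
   vectors over the range of [e] onto those over its source whose second index has the residue of [e]. *)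
Lemma nonzero_family : exists (P : V -> bopC K) (S : edge A -> bopC K),
  cuntz_krieger_family P S /\ forall v, P v <> 0.
Proof.
have [b [ob tb]] := @orthonormal_basis R K.
pose out v := enum [pred e : edge A | edge_source e == v].
have mem_out v e : (e \in out v) = (edge_source e == v) by rewrite mem_enum.
have out0 v : (0 < size (out v))%N.
  have [w vw] := rows v; rewrite -has_predT; apply/hasP.
  rewrite -lt0n in vw; exists (Tagged (fun vw : V * V => 'I_(A vw.1 vw.2)) (Ordinal vw : 'I_(A (v, w).1 (v, w).2))) => //.
  by rewrite mem_out /edge_source /=.
pose deg (e : edge A) := size (out (edge_source e)).
pose idx (e : edge A) := index e (out (edge_source e)).
have idx_lt e : (idx e < deg e)%N by rewrite index_mem mem_out.
pose code (p : V * nat) : nat := pickle p.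
pose dec (n : nat) : option (V * nat) := pickle_inv n.
have codeK p : dec (code p) = Some p by exact: pickleK_inv.
have decK n p : dec n = Some p -> code p = n.
  by move=> h; have := @pickle_invK (V * nat)%type n; rewrite /dec in h; rewrite h.
(* Basis vectors whose index encodes no pair are sent to 0 by all the operators. *)
pose lift_ (f : V * nat -> option (V * nat)) n := obind (fun p => omap code (f p)) (dec n).
have lift_pi f g : partial_inverse f g -> partial_inverse (lift_ f) (lift_ g).
  have aux f' g' : partial_inverse f' g' -> forall i j, lift_ f' i = Some j -> lift_ g' j = Some i.
    move=> fg i j; rewrite /lift_; case di : (dec i) => [p|] //=.
    case fp : (f' p) => [q|] //= [<-]; rewrite codeK /=.
    by move/fg: fp => ->; rewrite /= (decK _ _ di).
  move=> fg i j; split; [exact: aux|apply: aux; exact: partial_inverseC].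
pose pv v (p : V * nat) := if p.1 == v then Some p else None.
pose se (e : edge A) (p : V * nat) := if p.1 == edge_range e then
  Some (edge_source e, (p.2 * deg e + idx e)%N) else None.
pose sf (e : edge A) (p : V * nat) := if (p.1 == edge_source e) && (p.2 %% deg e == idx e)%N then
  Some (edge_range e, (p.2 %/ deg e)%N) else None.
have pv_pi v : partial_inverse (pv v) (pv v).
  by move=> p p'; rewrite /pv; split; case: eqP => // h [<-]; rewrite h eqxx.
have deg0 e : (0 < deg e)%N by exact: out0.
have s_pi e : partial_inverse (se e) (sf e).
  move=> [w m] [w' m']; rewrite /se /sf /=; split.
    case: eqP => // -> [<- <-]; rewrite eqxx /= modnMDl modn_small // eqxx.
    by rewrite divnMDl // divn_small // addn0.
  case: eqP => //= ->; case: eqP => // hm [<- <-]; rewrite eqxx.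
  by congr (Some (_, _)); rewrite -hm -divn_eq.
have [P hP] := choice (fun v => basis_operator ob tb (lift_pi _ _ (pv_pi v))).
have [S hS] := choice (fun e => basis_operator ob tb (lift_pi _ _ (s_pi e))).
have hP1 v x n : ip (bfun (P v) x) (b n) = if lift_ (pv v) n is Some i then ip x (b i) else 0.
  by case: (hP v) => h _; exact: h.
have hPa v x n : ip (bfun (adj (P v)) x) (b n) = if lift_ (pv v) n is Some i then ip x (b i) else 0.
  by case: (hP v) => _ h; exact: h.
have hS1 e x n : ip (bfun (S e) x) (b n) = if lift_ (sf e) n is Some i then ip x (b i) else 0.
  by case: (hS e) => h _; exact: h.
have hSa e x n : ip (bfun (adj (S e)) x) (b n) = if lift_ (se e) n is Some i then ip x (b i) else 0.
  by case: (hS e) => _ h; exact: h.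
have hSb e x n : ip (badj_fun (S e) x) (b n) = if lift_ (se e) n is Some i then ip x (b i) else 0 := hSa e x n.
have ext (X Y : bopC K) : (forall x n, ip (bfun X x) (b n) = ip (bfun Y x) (b n)) -> X = Y.
  by move=> h; apply: bop_eq => x; apply: (basis_ext tb) => n; exact: h.
have mulE (X Y : bopC K) x : bfun (X ** Y) x = bfun X (bfun Y x) by [].
have PP v : P v ** P v = P v.
  apply: ext => x n; rewrite mulE !hP1 /lift_; case: (dec n) => [[w m]|] //=.
  rewrite /pv /=; case: eqP => //= wv; by rewrite hP1 /lift_ codeK /= /pv /= wv eqxx.
have SS e : adj (S e) ** S e = P (edge_range e).
  apply: ext => x n; rewrite mulE hSa hP1 /lift_; case: (dec n) => [[w m]|] //=.
  rewrite /se /pv /=; case: eqP => //= wr; rewrite hS1 /lift_ codeK /= /sf /= eqxx /=.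
  by rewrite modnMDl modn_small // eqxx /= divnMDl // divn_small // addn0 wr.
exists P, S; split; first split.
- move=> v; split=> //; apply: ext => x n; by rewrite hPa hP1.
- move=> v w vw; apply: ext => x n; rewrite mulE hP1 /lift_.
  case: (dec n) => [[w' m]|] /=; last by rewrite ip0l.
  rewrite /pv /=; case: eqP => /= [->|_]; last by rewrite ip0l.
  by rewrite hP1 /lift_ codeK /= /pv /= (negPf vw) ip0l.
- move=> e; rewrite /partial_isometry -amulA SS; apply: ext => x n; rewrite mulE !hS1 /lift_.
  case: (dec n) => [[w m]|] //=; rewrite /sf /=; case: ifP => //= h.
  by rewrite hP1 /lift_ codeK /= /pv /= eqxx.
- exact: SS.
- move=> v; apply: ext => x n.
  have sumE (s : seq (edge A)) : ip (bfun (\sum_(e <- s | edge_source e == v) (S e ** adj (S e) : bopC K)) x) (b n) =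
      \sum_(e <- s | edge_source e == v) ip (bfun (S e ** adj (S e)) x) (b n).
    elim/big_rec2: _ => [|e u w _ <-]; first by rewrite ip0l.
    by rewrite -ipDl -bopE_add.
  rewrite sumE hP1 /lift_.
  case dn : (dec n) => [[w m]|]; last first.
    by rewrite [RHS]big1 // => e _; rewrite mulE hS1 /lift_ dn.
  have E e : edge_source e == v -> ip (bfun (S e ** adj (S e)) x) (b n) =
      if (w == v) && (m %% size (out v) == index e (out v))%N then ip x (b n) else 0.
    move=> /eqP ev; rewrite mulE hS1 /lift_ dn /= /sf /= /deg /idx ev.
    case: eqP => //= wv; case: eqP => //= hm.
    rewrite hSb /lift_ codeK /= /se /= eqxx /= /deg /idx ev -hm -divn_eq.
    by rewrite -(decK _ _ dn) wv.
  rewrite (eq_bigr _ E) /pv /=; case: eqP => /= [wv|_]; last by rewrite big1.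
  have mlt : (m %% size (out v) < size (out v))%N by rewrite ltn_mod.
  have [e0 _] : exists e0 : edge A, true.
    by have := out0 v; case: (out v) => [//|e0 ?]; exists e0.
  pose e1 := nth e0 (out v) (m %% size (out v)).
  have e1o : e1 \in out v by rewrite mem_nth.
  have e1v : edge_source e1 == v by rewrite -mem_out.
  rewrite (bigD1 e1) //= index_uniq ?enum_uniq // eqxx big1 ?addr0.
    by rewrite (decK _ _ dn).
  move=> e /andP[ev ne]; case: eqP => // hm; case/negP: ne; apply/eqP.
  by rewrite /e1 hm nth_index // mem_out.
- move=> v Pv0; have := hP1 v (b (code (v, 0%N))) (code (v, 0%N)).
  rewrite Pv0 bopE_zero ip0l /lift_ codeK /= /pv /= eqxx /= ob eqxx => /eqP.
  by rewrite eq_sym oner_eq0.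
Qed.

(** A zero row would make P_v an empty sum. Otherwise the universal property maps P_v to the nonzero
    projection of a concrete family. *)
Lemma vertex_proj_neq0 (OA : graph_algebra R A) v : vertex_proj OA v != 0.
Proof.
have [P [S [PS P0]]] := nonzero_family.
have [f [hf fP _]] := @graph_universal R V A OA _ P S PS.
by apply/eqP => h; apply: (P0 v); rewrite -fP h (star_hom0 hf).
Qed.

End NonzeroFamily.

(** * Stabilized graph algebras *)

Section ClosedRange.
Context {R : realType} {T T' : cstarAlgType R}.

Lemma closed_range_isometric (f : T -> T') : star_hom f ->
  (forall x, nrm x <= nrm (f x)) -> closed (range f).
Proof.
move=> hf fn; apply/closedE_adh => y /adh_tends[u uf uy].
have [v hv] : exists v : nat -> T, forall n, f (v n) = u n.
  have h n : exists x, f x = u n by have [x _ <-] := uf n; exists x.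
  by have [v hv] := choice h; exists v.
have [x hx] : exists x, tends v x.
  apply: cauchy_tends => e e0; have e2 : 0 < e / 2 by lra.
  have [N hN] := uy _ e2; exists N => n m /hN h1 /hN h2.
  rewrite (le_lt_trans (fn _)) // (star_homB hf) !hv.
  rewrite (le_lt_trans (nrm_tri y _ _)) // nrmBC; lra.
exists x => //; apply: (@tends_unique _ _ u) => //.
have := tends_lips (lips_star_hom hf) hx.
by rewrite (_ : f \o v = u) //; apply: funext => n /=.
Qed.

End ClosedRange.

Section GraphAlgebraHoms.
Context {R : realType} {V : finType} {A : V -> V -> nat} {OA : graph_algebra R A}.

Lemma graph_hom_ext (T : cstarAlgType R) (f g : OA -> T) : star_hom f -> star_hom g ->
  (forall v, f (vertex_proj OA v) = g (vertex_proj OA v)) ->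
  (forall e, f (edge_isom OA e) = g (edge_isom OA e)) -> forall x, f x = g x.
Proof.
move=> hf hg hP hS x.
suff : [set x | f x = g x] x by [].
apply: graph_generated => //; split.
- exact: closed_lips_eq (lips_star_hom hf) (lips_star_hom hg).
- by rewrite /= (star_hom0 hf) (star_hom0 hg).
- by move=> a y z /= hy hz; rewrite (star_homD hf) (star_homD hg) (star_homZ hf) (star_homZ hg) hy hz.
- by move=> y z /= hy hz; rewrite (star_homM hf) (star_homM hg) hy hz.
- by move=> y /= hy; rewrite (star_homV hf) (star_homV hg) hy.
Qed.

Lemma star_hom_comp (T1 T2 T3 : cstarAlgType R) (f : T1 -> T2) (g : T2 -> T3) :
  star_hom f -> star_hom g -> star_hom (g \o f).
Proof.
move=> hf hg; split => [a x y|x y|x] /=.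
- by rewrite (star_homD hf) (star_homZ hf) (star_homD hg) (star_homZ hg).
- by rewrite (star_homM hf) (star_homM hg).
- by rewrite (star_homV hf) (star_homV hg).
Qed.

End GraphAlgebraHoms.

Section Stabilization.
Context {R : realType} {V : finType} {A : V -> V -> nat} {OA : graph_algebra R A}
  {K : compact_operators R} (OAK : stabilization OA K).
Variable eps : nat -> nat -> K.
Hypothesis epsM : forall i j k l, eps i j ** eps k l = if j == k then eps i l else 0.
Hypothesis epsA : forall i j, adj (eps i j) = eps j i.
Hypothesis epsN : forall i j, eps i j != 0.
Hypothesis epsD : forall (k : K) (e : R), 0 < e -> exists N, exists c : nat -> nat -> R[i],
  nrm (k - \sum_(i < N) \sum_(j < N) c i j *: eps i j) < e.

Notation t := (tensor OAK).
Notation u1 := (gunit OA).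

Definition mu (i j : nat) (a : OA) : OAK := t a (eps i j).

Lemma tensorDl a b k : t (a + b) k = t a k + t b k.
Proof. by have [[h _] _ _ _ _] := tensorP OAK; have := h k 1 a b; rewrite !scale1r. Qed.
Lemma tensor0l k : t 0 k = 0.
Proof. by apply: (@addrI _ (t 0 k)); rewrite -tensorDl !addr0. Qed.
Lemma tensorZl c a k : t (c *: a) k = c *: t a k.
Proof. by have [[h _] _ _ _ _] := tensorP OAK; have := h k c a 0; rewrite tensor0l !addr0. Qed.
Lemma tensorDr a k l : t a (k + l) = t a k + t a l.
Proof. by have [[_ h] _ _ _ _] := tensorP OAK; have := h a 1 k l; rewrite !scale1r. Qed.
Lemma tensor0r a : t a 0 = 0.
Proof. by apply: (@addrI _ (t a 0)); rewrite -tensorDr !addr0. Qed.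
Lemma tensorZr c a k : t a (c *: k) = c *: t a k.
Proof. by have [[_ h] _ _ _ _] := tensorP OAK; have := h a c k 0; rewrite tensor0r !addr0. Qed.
Lemma tensorM a k b l : t a k ** t b l = t (a ** b) (k ** l).
Proof. by have [_ h _ _ _] := tensorP OAK; exact: h. Qed.
Lemma tensorA a k : adj (t a k) = t (adj a) (adj k).
Proof. by have [_ _ h _ _] := tensorP OAK; exact: h. Qed.
Lemma tensorNl a k : t (- a) k = - t a k.
Proof. by rewrite -scaleN1r tensorZl scaleN1r. Qed.
Lemma tensorBr a k l : t a (k - l) = t a k - t a l.
Proof. by rewrite tensorDr -scaleN1r tensorZr scaleN1r. Qed.

Lemma u1l x : u1 ** x = x. Proof. by case: (gunitP x). Qed.
Lemma u1r x : x ** u1 = x. Proof. by case: (gunitP x). Qed.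

Lemma muM i j k l a b : mu i j a ** mu k l b = if j == k then mu i l (a ** b) else 0.
Proof. by rewrite /mu tensorM epsM; case: eqP => // _; rewrite tensor0r. Qed.
Lemma muA i j a : adj (mu i j a) = mu j i (adj a).
Proof. by rewrite /mu tensorA epsA. Qed.
Lemma muD i j a b : mu i j (a + b) = mu i j a + mu i j b. Proof. exact: tensorDl. Qed.
Lemma mu0 i j : mu i j 0 = 0. Proof. exact: tensor0l. Qed.
Lemma muZ i j c a : mu i j (c *: a) = c *: mu i j a. Proof. exact: tensorZl. Qed.
Lemma mu_sum i j (I : Type) (r : seq I) (P : pred I) (F : I -> OA) :
  mu i j (\sum_(x <- r | P x) F x) = \sum_(x <- r | P x) mu i j (F x).
Proof. by elim/big_rec2: _ => [|x u v _ <-]; rewrite ?mu0 ?muD. Qed.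

Lemma mu_hom i : star_hom (mu i i).
Proof.
split => [a x y|x y|x]; first by rewrite muD muZ.
  by rewrite muM eqxx.
by rewrite muA.
Qed.

Lemma mu_inj i : injective (mu i i).
Proof.
move=> a b ab; have [_ _ _ h _] := tensorP OAK.
have li : linearly_independent (fun _ : 'I_1 => eps i i).
  move=> c; rewrite big_ord1 => /eqP; rewrite scaler_eq0 (negPf (epsN i i)) orbF.
  by move=> /eqP c0 j; rewrite ord1.
have := h 1%N (fun _ => a - b) (fun _ => eps i i) li.
rewrite big_ord1 tensorDl tensorNl -/(mu i i a) -/(mu i i b) ab subrr => /(_ erefl ord0) /eqP.
by rewrite subr_eq0 => /eqP.
Qed.

(** Norms of elementary tensors are not given, but [mu i i] is injective by the algebraic condition
    on the tensor product, and O_A has a unit. *)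
Lemma mu_isometric i a : nrm a <= nrm (mu i i a).
Proof. exact: (star_hom_isometric (mu_hom i) (@gunitP _ _ _ OA) (@mu_inj i)). Qed.

Lemma nrm_tensor1 k : nrm (t u1 k) <= nrm k.
Proof.
apply: (@star_hom_nrm R K OAK (t u1)); split => [a x y|x y|x].
- by rewrite tensorDr tensorZr.
- by rewrite tensorM u1l.
- by rewrite tensorA gunit_adj.
Qed.

(** A self-adjoint contraction h is the mean of the unitaries h + i w and h - i w, where w is a root
    of 1 - h^2. For a unitary u, the square of u (x) k in the sense of the C*-identity is 1 (x) k^*
    k, and k |-> 1 (x) k is a homomorphism, hence contractive. *)
Lemma nrm_tensor_bound a : exists2 C : R, 0 < C & forall k, nrm (t a k) <= C * nrm k.
Proof.
have sa h : adj h = h -> nrm h <= 1 -> forall k, nrm (t h k) <= nrm k.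
  move=> ah h1 k.
  have ahh : adj (h ** h) = h ** h by rewrite adjM ah.
  have hh1 : nrm (h ** h) <= 1 by rewrite (le_trans (nrmM _ _)) // mulr_ile1 ?nrm_ge0.
  have [c [[cq _] ac cz _ _]] := cstar_sqrt ahh hh1.
  pose w := u1 - c.
  have aw : adj w = w by rewrite /w adjB gunit_adj ac.
  have hw : h ** w = w ** h.
    by rewrite /w amulBl amulBr u1l u1r; congr (_ - _); apply/esym/cz; rewrite amulA.
  have sum : h ** h + w ** w = u1.
    rewrite /w amulBl !amulBr u1l u1r u1l.
    by rewrite -[h ** h](addrK (c ** c)) -cq; lmod.
  clearbody w.
  have key (s : R[i]) : s * conjC s = 1 -> conjC s = - s -> nrm (t (h + s *: w) k) <= nrm k.
    move=> s1 sc.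
    have uu : adj (h + s *: w) ** (h + s *: w) = u1.
      rewrite adjD adjZ ah aw amulDl !amulDr !amulZl !amulZr -hw scalerA.
      rewrite -sum mulrC s1 sc scale1r scaleNr; lmod.
    rewrite -ler_sqr ?nnegrE ?nrm_ge0 // -nrm_cstar tensorA tensorM uu.
    by rewrite (le_trans (nrm_tensor1 _)) // nrm_cstar.
  have i1 : 'i * conjC 'i = 1 :> R[i] by rewrite conjCi mulrN sqi opprK.
  have -> : h = (2^-1 : R[i]) *: ((h + 'i *: w) + (h + (- 'i) *: w)) by lmod.
  rewrite tensorZl tensorDl nrmZ cabs_half.
  have h2 := key 'i i1 (conjCi _).
  have h3 : nrm (t (h + - 'i *: w) k) <= nrm k.
    by apply: key; rewrite rmorphN ?mulrNN //; congr (- _); exact: conjCi.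
  have := nrmD (t (h + 'i *: w) k) (t (h + - 'i *: w) k); lra.
have scaled h : adj h = h -> exists2 C : R, 0 < C & forall k, nrm (t h k) <= C * nrm k.
  move=> ah; pose C := nrm h + 1; have C0 : 0 < C by rewrite ltr_wpDl ?nrm_ge0.
  exists C => // k.
  have -> : h = C%:C *: ((C^-1)%:C *: h) by rewrite scalerA -rmorphM mulfV ?gt_eqF // scale1r.
  rewrite tensorZl nrmZ cabsC gtr0_norm // ler_wpM2l ?(ltW C0) // sa //.
    by rewrite adjZ conjC_re ah.
  rewrite nrmZ cabsC gtr0_norm ?invr_gt0 // mulrC ler_pdivrMr // mul1r /C lerDl //.
have [C1 C10 h1] := scaled (a + adj a) (ltac:(by rewrite adjD adjK addrC)).
have [C2 C20 h2] := scaled ('i *: (a - adj a)) (ltac:(by rewrite adjZ conjCi adjB adjK scaleNr -scalerN opprB)).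
exists (C1 + C2) => [|k]; first exact: addr_gt0.
have -> : a = (2^-1 : R[i]) *: ((a + adj a) - 'i *: ('i *: (a - adj a))).
  by rewrite scalerA sqi; lmod.
have -> : (2^-1 : R[i]) *: ((a + adj a) - 'i *: ('i *: (a - adj a))) =
   (2^-1 : R[i]) *: ((a + adj a) + (- 'i) *: ('i *: (a - adj a))) by rewrite scaleNr.
rewrite tensorZl tensorDl tensorZl nrmZ cabs_half.
have h3 := nrmD (t (a + adj a) k) (- 'i *: t ('i *: (a - adj a)) k).
have h4 : nrm (- 'i *: t ('i *: (a - adj a)) k) = nrm (t ('i *: (a - adj a)) k).
  by rewrite nrmZ cabsN cabs_i mul1r.
have := h1 k; have := h2 k; have := nrm_ge0 (t (a + adj a) k); have := nrm_ge0 (t ('i *: (a - adj a)) k).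
rewrite h4 in h3; rewrite mulrDl; lra.
Qed.

Definition mel (N : nat) (a : nat -> nat -> OA) : OAK := \sum_(i < N) \sum_(j < N) mu i j (a i j).

Lemma mel_widen N M a : (N <= M)%N ->
  mel N a = mel M (fun i j => if (i < N)%N && (j < N)%N then a i j else 0).
Proof.
move=> NM; rewrite /mel (big_ord_widen _ (fun i => \sum_(j < N) mu i j (a i j)) NM) big_mkcond /=.
apply: eq_bigr => i _; case: ifP => iN; last by rewrite big1 // => j _; rewrite mu0.
rewrite (big_ord_widen _ (fun j => mu i j (a i j)) NM) big_mkcond /=.
by apply: eq_bigr => j _; case: ifP => // _; rewrite mu0.
Qed.

Lemma mel_lin N c a b : c *: mel N a + mel N b = mel N (fun i j => c *: a i j + b i j).
Proof.
rewrite /mel scaler_sumr -big_split; apply: eq_bigr => i _.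
by rewrite scaler_sumr -big_split; apply: eq_bigr => j _; rewrite muD muZ.
Qed.

Lemma mel_dense (x : OAK) : adh [set x | exists N a, x = mel N a] x.
Proof.
have adhD (y z : OAK) : adh [set x | exists N a, x = mel N a] y ->
    adh [set x | exists N a, x = mel N a] z -> adh [set x | exists N a, x = mel N a] (y + z).
  move=> hy hz e e0; have e2 : 0 < e / 2 by lra.
  have [_ [N [a ->]] h1] := hy _ e2; have [_ [M [b ->]] h2] := hz _ e2.
  rewrite (mel_widen a (leq_maxl N M)) in h1; rewrite (mel_widen b (leq_maxr N M)) in h2.
  exists (1 *: mel (maxn N M) (fun i j => if (i < N)%N && (j < N)%N then a i j else 0) +
      mel (maxn N M) (fun i j => if (i < M)%N && (j < M)%N then b i j else 0)).
    by rewrite mel_lin; eexists; eexists.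
  rewrite scale1r opprD addrACA (le_lt_trans (nrmD _ _)) //; lra.
have adh0 : adh [set x | exists N a, x = mel N a] (0 : OAK).
  move=> e e0; exists 0; last by rewrite subrr nrm0.
  by exists 0%N, (fun _ _ => 0); rewrite /mel big_ord0.
have adht a k : adh [set x | exists N a, x = mel N a] (t a k).
  move=> e e0; have [C C0 hC] := nrm_tensor_bound a.
  have [|N [c hc]] := @epsD k (e / C); first by rewrite divr_gt0.
  exists (mel N (fun i j => c i j *: a)); first by exists N, (fun i j => c i j *: a).
  have -> : mel N (fun i j => c i j *: a) = t a (\sum_(i < N) \sum_(j < N) c i j *: eps i j).
    have tS (I : Type) (r : seq I) (F : I -> K) : t a (\sum_(i <- r) F i) = \sum_(i <- r) t a (F i).
      by elim/big_rec2: _ => [|i u v _ <-]; rewrite ?tensor0r ?tensorDr.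
    rewrite tS; apply: eq_bigr => i _; rewrite tS; apply: eq_bigr => j _.
    by rewrite /mu tensorZl tensorZr.
  by rewrite -tensorBr (le_lt_trans (hC _)) // mulrC -ltr_pdivlMr.
have [_ _ _ _ /denseE_adh hd] := tensorP OAK.
move=> e e0; have e2 : 0 < e / 2 by lra.
have [_ [n [a [k ->]]] h1] := hd x _ e2.
have : adh [set x | exists N a, x = mel N a] (\sum_(i < n) t (a i) (k i)).
  by elim/big_ind: _ => // i _; exact: adht.
move=> /(_ _ e2)[y hy h2]; exists y => //.
have := nrm_tri (\sum_(i < n) t (a i) (k i)) x y; lra.
Qed.

Lemma stab_hom_ext (T : cstarAlgType R) (f g : OAK -> T) : star_hom f -> star_hom g ->
  (forall i j a, f (mu i j a) = g (mu i j a)) -> forall x, f x = g x.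
Proof.
move=> hf hg h x.
have cl := closed_lips_eq (lips_star_hom hf) (lips_star_hom hg).
move: cl => /closedE_adh; apply => e /(mel_dense x)[_ [N [a ->]] hxy].
exists (mel N a) => //=; rewrite /mel (star_hom_sum hf) (star_hom_sum hg); apply: eq_bigr => i _.
by rewrite (star_hom_sum hf) (star_hom_sum hg); apply: eq_bigr => j _.
Qed.

Lemma corner_mel N a i j : (i < N)%N -> (j < N)%N -> mu 0 i u1 ** mel N a ** mu j 0 u1 = mu 0 0 (a i j).
Proof.
move=> iN jN; rewrite /mel amul_sumr amul_suml (bigD1 (Ordinal iN)) //= [X in _ + X]big1 ?addr0.
  rewrite amul_sumr amul_suml (bigD1 (Ordinal jN)) //= [X in _ + X]big1 ?addr0.
    by rewrite muM eqxx muM eqxx u1l u1r.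
  by move=> k; rewrite -val_eqE /= => /negPf kj; rewrite muM eqxx muM kj.
move=> k; rewrite -val_eqE /= eq_sym => /negPf ki.
by rewrite amul_sumr amul_suml big1 // => l _; rewrite muM ki amul0l.
Qed.

Lemma melM N a b : mel N a ** mel N b = mel N (fun i j => \sum_(k < N) a i k ** b k j).
Proof.
rewrite /mel amul_suml; apply: eq_bigr => i _; rewrite amul_suml.
under eq_bigr => k _ do rewrite amul_sumr.
under [RHS]eq_bigr => j _ do rewrite mu_sum.
rewrite [RHS]exchange_big; apply: eq_bigr => k _ /=.
rewrite (bigD1 k) //= [X in _ + X]big1 ?addr0.
  by rewrite amul_sumr; apply: eq_bigr => j _; rewrite muM eqxx.
move=> l; rewrite -val_eqE /= eq_sym => /negPf kl.
by rewrite amul_sumr big1 // => j _; rewrite muM kl.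
Qed.

Lemma mel_adj N a : adj (mel N a) = mel N (fun i j => adj (a j i)).
Proof.
rewrite /mel adj_sum; under eq_bigr => i _ do rewrite adj_sum.
by rewrite exchange_big; apply: eq_bigr => i _; apply: eq_bigr => j _; rewrite muA.
Qed.

Lemma mel_eq N a b : mel N a = mel N b -> forall i j, (i < N)%N -> (j < N)%N -> a i j = b i j.
Proof. by move=> ab i j iN jN; apply: (@mu_inj 0%N); rewrite -!(@corner_mel N) // ab. Qed.

(** A limit x of matrices of size N satisfies p x p = x for the unit p of these matrices, and each
    of its entries, moved to the corner, lies in the range of the isometric map [mu 0 0], which is
    closed. *)
Lemma closed_mel N : closed [set x | exists a, x = mel N a].
Proof.
pose p := mel N (fun i j => if i == j then u1 else 0).
have pl a : p ** mel N a = mel N a.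
  rewrite melM; apply: eq_bigr => i _; apply: eq_bigr => j _; congr (mu _ _ _).
  rewrite (bigD1 i) //= eqxx u1l big1 ?addr0 // => k.
  by rewrite -val_eqE /= eq_sym => /negPf ->; rewrite amul0l.
have pr a : mel N a ** p = mel N a.
  rewrite melM; apply: eq_bigr => i _; apply: eq_bigr => j _; congr (mu _ _ _).
  rewrite (bigD1 j) //= eqxx u1r big1 ?addr0 // => k.
  by rewrite -val_eqE /= => /negPf ->; rewrite amul0r.
have pE : p = \sum_(i < N) mu i 0 u1 ** mu 0 i u1.
  apply: eq_bigr => i _; rewrite muM eqxx u1l (bigD1 i) //= eqxx big1 ?addr0 // => k.
  by rewrite -val_eqE /= eq_sym => /negPf ->; rewrite mu0.
apply/closedE_adh => x hx.
have ent i j : (i < N)%N -> (j < N)%N -> exists a, mu 0 0 a = mu 0 i u1 ** x ** mu j 0 u1.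
  move=> iN jN.
  have cr := closed_range_isometric (mu_hom 0) (mu_isometric 0).
  have lf : lips (fun y : OAK => mu 0 i u1 ** y ** mu j 0 u1).
    exact: lips_comp (lips_mull _) (lips_mulr _).
  have /closedE_adh/(_ x) := closed_preim_lips lf cr.
  case=> [e /hx[_ [a ->] h]|a _ <-]; last by exists a.
  by exists (mel N a) => //=; rewrite corner_mel //; exists (a i j).
have xp : p ** x ** p = x.
  have lf : lips (fun y : OAK => p ** y ** p) by exact: lips_comp (lips_mull _) (lips_mulr _).
  have /closedE_adh := closed_lips_eq lf lips_id; apply => e /hx[_ [a ->] h].
  by exists (mel N a) => //=; rewrite pl pr.
have h i : exists r, forall j, (i < N)%N -> (j < N)%N -> mu 0 0 (r j) = mu 0 i u1 ** x ** mu j 0 u1.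
  have h' j : exists b, (i < N)%N -> (j < N)%N -> mu 0 0 b = mu 0 i u1 ** x ** mu j 0 u1.
    case iN : (i < N)%N; last by exists 0.
    case jN : (j < N)%N; last by exists 0.
    by have [b hb] := ent i j iN jN; exists b.
  by have [r hr] := choice h'; exists r.
have [a ha] := choice h; exists a.
rewrite -xp pE amul_suml amul_suml; apply: eq_bigr => i _.
rewrite amul_sumr; apply: eq_bigr => j _.
have <- : mu i 0 u1 ** mu 0 0 (a i j) ** mu 0 j u1 = mu i j (a i j).
  by rewrite muM eqxx muM eqxx u1l u1r.
by rewrite ha // !amulA.
Qed.

Lemma closed_star_subalgebra_mel N : closed_star_subalgebra [set x | exists a, x = mel N a].
Proof.
split; first exact: closed_mel.
- exists (fun _ _ => 0); rewrite /mel big1 // => i _; rewrite big1 // => j _.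
  by rewrite mu0.
- by move=> c _ _ [a ->] [b ->]; rewrite mel_lin; eexists.
- by move=> _ _ [a ->] [b ->]; rewrite melM; eexists.
- by move=> _ [a ->]; rewrite mel_adj; eexists.
Qed.

Section Extend.
Variables (T : cstarAlgType R) (phi : OA -> T) (X : nat -> T).
Hypothesis hphi : star_hom phi.
Hypothesis hX : forall i j a, adj (X i) ** X j ** phi a = if i == j then phi a else 0.

Let img N (a : nat -> nat -> OA) : T := \sum_(i < N) \sum_(j < N) X i ** phi (a i j) ** adj (X j).

Let hX' i j a : phi a ** adj (X i) ** X j = if i == j then phi a else 0.
Proof.
have := congr1 (@adj R T) (hX j i (adj a)); rewrite !adjM adjK -(star_homV hphi) adjK amulA => ->.
by rewrite eq_sym; case: eqP => // _; rewrite ?adj0 // -(star_homV hphi) adjK.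
Qed.

Let img_widen N M a : (N <= M)%N ->
  img N a = img M (fun i j => if (i < N)%N && (j < N)%N then a i j else 0).
Proof.
move=> NM; rewrite /img (big_ord_widen _ (fun i => \sum_(j < N) X i ** phi (a i j) ** adj (X j)) NM) big_mkcond /=.
apply: eq_bigr => i _; case: ifP => iN; last first.
  by rewrite big1 // => j _; rewrite (star_hom0 hphi) amul0r amul0l.
rewrite (big_ord_widen _ (fun j => X i ** phi (a i j) ** adj (X j)) NM) big_mkcond /=.
by apply: eq_bigr => j _; case: ifP => // _; rewrite (star_hom0 hphi) amul0r amul0l.
Qed.

Let img_lin N c a b : c *: img N a + img N b = img N (fun i j => c *: a i j + b i j).
Proof.
rewrite /img scaler_sumr -big_split; apply: eq_bigr => i _.
rewrite scaler_sumr -big_split; apply: eq_bigr => j _.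
by rewrite (star_homD hphi) (star_homZ hphi) amulDr amulDl amulZr amulZl.
Qed.

Let imgM N a b : img N a ** img N b = img N (fun i j => \sum_(k < N) a i k ** b k j).
Proof.
rewrite /img amul_suml; apply: eq_bigr => i _; rewrite amul_suml.
under eq_bigr => k _ do rewrite amul_sumr.
under [RHS]eq_bigr => j _ do rewrite (star_hom_sum hphi) amul_sumr amul_suml.
rewrite [RHS]exchange_big; apply: eq_bigr => k _ /=.
have E (l j : 'I_N) : X i ** phi (a i k) ** adj (X k) ** (X l ** phi (b l j) ** adj (X j)) =
    if k == l then X i ** phi (a i k ** b l j) ** adj (X j) else 0.
  rewrite !amulA -(amulA (X i)) -(amulA (X i)) hX' val_eqE.
  by case: eqP => _; rewrite ?amul0r ?amul0l // (star_homM hphi) !amulA.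
rewrite (bigD1 k) //= [X in _ + X]big1 ?addr0.
  by rewrite amul_sumr; apply: eq_bigr => j _; rewrite E eqxx.
move=> l lk; rewrite amul_sumr big1 // => j _.
by rewrite E eq_sym (negPf lk).
Qed.

Let img_adj N a : adj (img N a) = img N (fun i j => adj (a j i)).
Proof.
rewrite /img adj_sum; under eq_bigr => i _ do rewrite adj_sum.
rewrite exchange_big; apply: eq_bigr => i _; apply: eq_bigr => j _.
by rewrite !adjM adjK (star_homV hphi) amulA.
Qed.

Let img_mel N a b : mel N a = mel N b -> img N a = img N b.
Proof.
move=> ab; apply: eq_bigr => i _; apply: eq_bigr => j _.
by rewrite (mel_eq ab).
Qed.

(** The assignment from matrices of size N to their images is a homomorphism on a closed subalgebra,
    so the bound comes for free. It is the point for which closedness of the finite matrices is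
    needed. *)
Let img_nrm N a : nrm (img N a) <= nrm (mel N a).
Proof.
have h x : exists y, forall a, x = mel N a -> y = img N a.
  case: (pselect (exists a, x = mel N a)) => [[b ->]|no].
    by exists (img N b) => c /img_mel.
  by exists 0 => c hc; case: no; exists c.
have [f hf] := choice h.
have fE b : f (mel N b) = img N b by exact: hf.
rewrite -fE; apply: (star_hom_on_nrm (closed_star_subalgebra_mel N)); last by exists a.
split.
- by move=> c _ _ [b ->] [d ->]; rewrite mel_lin !fE img_lin.
- by move=> _ _ [b ->] [d ->]; rewrite melM !fE imgM.
- by move=> _ [b ->]; rewrite mel_adj !fE img_adj.
Qed.

(** F is phi on the corner, spread over all matrices by the columns X i, which act as isometries on
    the range of phi. *)
Lemma stab_extension : exists2 F : OAK -> T, star_hom F &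
  forall i j a, F (mu i j a) = X i ** phi a ** adj (X j).
Proof.
pose G (x : OAK) (y : T) := exists N a, x = mel N a /\ y = img N a.
have [||||| F hF hG] := @star_hom_extension R OAK T G.
- move=> c _ _ _ _ [N [a [-> ->]]] [M [b [-> ->]]].
  rewrite (mel_widen a (leq_maxl N M)) (mel_widen b (leq_maxr N M)).
  rewrite (img_widen a (leq_maxl N M)) (img_widen b (leq_maxr N M)).
  by rewrite mel_lin img_lin; eexists; eexists.
- move=> _ _ _ _ [N [a [-> ->]]] [M [b [-> ->]]].
  rewrite (mel_widen a (leq_maxl N M)) (mel_widen b (leq_maxr N M)).
  rewrite (img_widen a (leq_maxl N M)) (img_widen b (leq_maxr N M)).
  by rewrite melM imgM; eexists; eexists.
- by move=> _ _ [N [a [-> ->]]]; rewrite mel_adj img_adj; eexists; eexists.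
- by move=> _ _ [N [a [-> ->]]]; exact: img_nrm.
- move=> x e /(mel_dense x)[_ [N [a ->]] h]; exists (mel N a) => //.
  by exists (img N a), N, a.
exists F => // i j a.
pose N := (maxn i j).+1; pose b k l := if (k == i) && (l == j) then a else 0.
have iN : (i < N)%N by rewrite ltnS leq_maxl.
have jN : (j < N)%N by rewrite ltnS leq_maxr.
have sE (U : zmodType) (f : nat -> nat -> OA -> U) : (forall k l, f k l 0 = 0) ->
    \sum_(k < N) \sum_(l < N) f k l (b k l) = f i j a.
  move=> f0; rewrite (bigD1 (Ordinal iN)) //= [X in _ + X]big1 ?addr0.
    rewrite (bigD1 (Ordinal jN)) //= [X in _ + X]big1 ?addr0 /b ?eqxx // => l.
    by rewrite -val_eqE /= => /negPf ->; rewrite ?andbF f0.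
  by move=> k; rewrite -val_eqE /= => /negPf ki; rewrite big1 // => l _; rewrite /b ki f0.
rewrite -(sE _ mu) ?(hG _ (img N b)).
- by rewrite -(sE _ (fun k l x => X k ** phi x ** adj (X l))) // => k l; rewrite (star_hom0 hphi) amul0r amul0l.
- by exists N, b.
- exact: mu0.
Qed.

End Extend.

End Stabilization.

(** * Homotopies *)

Section Paths.
Context {R : realType}.

Definition contR {T : normedModType R[i]} (u : R -> T) : Prop :=
  forall (s e : R), 0 < e -> exists2 d : R, 0 < d & forall s', `|s - s'| < d -> nrm (u s - u s') < e.

Definition contC (c : R -> R[i]) : Prop :=
  forall (s e : R), 0 < e -> exists2 d : R, 0 < d & forall s', `|s - s'| < d -> cabs (c s - c s') < e.

Definition contRR (c : R -> R) : Prop :=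
  forall (s e : R), 0 < e -> exists2 d : R, 0 < d & forall s', `|s - s'| < d -> `|c s - c s'| < e.

Section NormedModule.
Context {T : normedModType R[i]}.
Implicit Types u v : R -> T.

Lemma contR_cst (x : T) : contR (fun=> x).
Proof. by move=> s e e0; exists 1 => // s' _; rewrite subrr nrm0. Qed.

Lemma contRD u v : contR u -> contR v -> contR (fun s => u s + v s).
Proof.
move=> hu hv s e e0; have e2 : 0 < e / 2 by lra.
have [d d0 hd] := hu s _ e2; have [d' d0' hd'] := hv s _ e2.
exists (Num.min d d') => [|s']; first by rewrite lt_min d0.
rewrite lt_min => /andP[/hd h1 /hd' h2].
rewrite opprD addrACA (le_lt_trans (nrmD _ _)) //; lra.
Qed.

Lemma contR_sum (I : Type) (r : seq I) (P : pred I) (F : I -> R -> T) :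
  (forall i, contR (F i)) -> contR (fun s => \sum_(i <- r | P i) F i s).
Proof.
move=> h; elim: r => [|i r IH].
  by under eq_fun do rewrite big_nil; exact: contR_cst.
under eq_fun do rewrite big_cons.
by case: (P i) => //; exact: contRD.
Qed.

Lemma contRZ (c : R -> R[i]) u : contC c -> contR u -> contR (fun s => c s *: u s).
Proof.
move=> hc hu s e e0.
pose k := cabs (c s) + nrm (u s) + 1.
have k0 : 0 < k by rewrite /k; have := cabs_ge0 (c s); have := nrm_ge0 (u s); lra.
have e2 : 0 < e / (2 * k) by rewrite divr_gt0 ?mulr_gt0.
have [d d0 hd] := hu s _ e2; have [d' d0' hd'] := hc s _ e2.
have [d1 d10 hd1] := hu s _ ltr01.
exists (Num.min d1 (Num.min d d')) => [|s']; first by rewrite !lt_min d10 d0.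
rewrite !lt_min => /andP[/hd1 h1 /andP[/hd h2 /hd' h3]].
have -> : c s *: u s - c s' *: u s' = (c s - c s') *: u s' + c s *: (u s - u s').
  by rewrite scalerBl scalerBr [RHS]addrC subrKA.
have uk : nrm (u s') <= k.
  by have := nrm_sub_le (u s') (u s); rewrite nrmBC /k; have := cabs_ge0 (c s); lra.
have ck : cabs (c s) <= k by rewrite /k; have := nrm_ge0 (u s); lra.
rewrite (le_lt_trans (nrmD _ _)) // !nrmZ.
have b1 : cabs (c s - c s') * nrm (u s') <= cabs (c s - c s') * k.
  by rewrite ler_wpM2l ?cabs_ge0.
have b2 : cabs (c s) * nrm (u s - u s') <= k * nrm (u s - u s').
  by rewrite ler_wpM2r ?nrm_ge0.
have b3 : cabs (c s - c s') * k < e / (2 * k) * k by rewrite ltr_pM2r.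
have b4 : k * nrm (u s - u s') < k * (e / (2 * k)) by rewrite ltr_pM2l.
have e3 : e = e / (2 * k) * k + k * (e / (2 * k)) by field; rewrite gt_eqF.
rewrite e3; lra.
Qed.

Lemma contR_repar (c : R -> R) u : contRR c -> contR u -> contR (fun s => u (c s)).
Proof.
move=> hc hu s e e0; have [d d0 hd] := hu (c s) e e0; have [d' d0' hd'] := hc s d d0.
by exists d' => // s' /hd' /hd.
Qed.

Lemma contR_lips {T' : normedModType R[i]} (f : T -> T') u : lips f -> contR u -> contR (fun s => f (u s)).
Proof.
case=> k k0 hf hu s e e0; have [|d d0 hd] := hu s (e / k); first by rewrite divr_gt0.
exists d => // s' /hd h; rewrite (le_lt_trans (hf _ _)) // mulrC -ltr_pdivlMr //.
Qed.

End NormedModule.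

Lemma contRM {T : cstarAlgType R} (u v : R -> T) : contR u -> contR v -> contR (fun s => u s ** v s).
Proof.
move=> hu hv s e e0.
pose k := nrm (v s) + nrm (u s) + 1.
have k0 : 0 < k by rewrite /k; have := nrm_ge0 (v s); have := nrm_ge0 (u s); lra.
have e2 : 0 < e / (2 * k) by rewrite divr_gt0 ?mulr_gt0.
have [d d0 hd] := hu s _ e2; have [d' d0' hd'] := hv s _ e2.
have [d1 d10 hd1] := hu s _ ltr01.
exists (Num.min d1 (Num.min d d')) => [|s']; first by rewrite !lt_min d10 d0.
rewrite !lt_min => /andP[/hd1 h1 /andP[/hd h2 /hd' h3]].
have -> : u s ** v s - u s' ** v s' = (u s - u s') ** v s + u s' ** (v s - v s').
  by amul_expand; lmod.
have uk : nrm (u s') <= k.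
  by have := nrm_sub_le (u s') (u s); rewrite nrmBC /k; have := nrm_ge0 (v s); lra.
have vk : nrm (v s) <= k by rewrite /k; have := nrm_ge0 (u s); lra.
rewrite (le_lt_trans (nrmD _ _)) //.
have a1 := nrmM (u s - u s') (v s); have a2 := nrmM (u s') (v s - v s').
have b1 : nrm (u s - u s') * nrm (v s) <= nrm (u s - u s') * k.
  by rewrite ler_wpM2l ?nrm_ge0.
have b2 : nrm (u s') * nrm (v s - v s') <= k * nrm (v s - v s').
  by rewrite ler_wpM2r ?nrm_ge0.
have b3 : nrm (u s - u s') * k < e / (2 * k) * k by rewrite ltr_pM2r.
have b4 : k * nrm (v s - v s') < k * (e / (2 * k)) by rewrite ltr_pM2l.
have e3 : e = e / (2 * k) * k + k * (e / (2 * k)) by field; rewrite gt_eqF.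
rewrite e3; lra.
Qed.

Definition clamp (x : R) : R := if x <= 0 then 0 else if 1 <= x then 1 else x.

Lemma clamp01 x : 0 <= clamp x <= 1.
Proof. by rewrite /clamp; case: (leP x 0) => h; case: (leP 1 x) => h'; lra. Qed.
Lemma clamp_le0 x : x <= 0 -> clamp x = 0. Proof. by rewrite /clamp => ->. Qed.
Lemma clamp_ge1 x : 1 <= x -> clamp x = 1.
Proof. by rewrite /clamp => h; rewrite h; case: leP => // h'; lra. Qed.
Lemma clamp_lip x y : `|clamp x - clamp y| <= `|x - y|.
Proof.
have aux a b : a <= b -> `|clamp a - clamp b| <= `|a - b|.
  move=> ab; have : 0 <= clamp b - clamp a <= b - a.
    rewrite /clamp; case: (leP a 0) => a0; first by case: (leP b 0) => b0; last case: (leP 1 b) => b1; lra.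
    by case: (leP 1 a) => a1; case: (leP b 0) => b0; try lra; case: (leP 1 b) => b1; lra.
  by move=> /andP[h1 h2]; rewrite distrC [`|a - b|]distrC !ger0_norm // subr_ge0.
by have [/aux|/ltW/aux] := leP x y; rewrite // distrC => /le_trans; apply; rewrite distrC.
Qed.

(* Algebraic substitutes for the cosine and the sine on a quarter circle, constant outside [0, 1]. *)
Definition rotc (x : R) : R := Num.sqrt (1 - clamp x).
Definition rots (x : R) : R := Num.sqrt (clamp x).

Lemma rot_sq x : rotc x * rotc x + rots x * rots x = 1.
Proof.
by rewrite -!expr2 !sqr_sqrtr; have := clamp01 x; lra.
Qed.
Lemma rotc_le0 x : x <= 0 -> rotc x = 1.
Proof. by move=> h; rewrite /rotc clamp_le0 // subr0 sqrtr1. Qed.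
Lemma rots_le0 x : x <= 0 -> rots x = 0.
Proof. by move=> h; rewrite /rots clamp_le0 // sqrtr0. Qed.
Lemma rotc_ge1 x : 1 <= x -> rotc x = 0.
Proof. by move=> h; rewrite /rotc clamp_ge1 // subrr sqrtr0. Qed.
Lemma rots_ge1 x : 1 <= x -> rots x = 1.
Proof. by move=> h; rewrite /rots clamp_ge1 // sqrtr1. Qed.

Lemma sqrt_dist (x y : R) : 0 <= x -> 0 <= y -> `|Num.sqrt x - Num.sqrt y| ^+ 2 <= `|x - y|.
Proof.
move=> x0 y0.
have -> : x - y = (Num.sqrt x - Num.sqrt y) * (Num.sqrt x + Num.sqrt y).
  by rewrite -subr_sqr !sqr_sqrtr.
rewrite normrM expr2 ler_wpM2l // [leRHS]ger0_norm ?addr_ge0 ?sqrtr_ge0 //.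
rewrite (le_trans (ler_normB _ _)) // !ger0_norm ?sqrtr_ge0 //.
Qed.

Lemma cont_sqrt (f : R -> R) : (forall x, 0 <= f x) -> (forall x y, `|f x - f y| <= `|x - y|) ->
  contRR (fun x => Num.sqrt (f x)).
Proof.
move=> f0 fl s e e0; exists (e ^+ 2) => [|s' h]; first exact: exprn_gt0.
rewrite -ltr_sqr ?nnegrE ?(ltW e0) //.
exact: le_lt_trans (sqrt_dist (f0 _) (f0 _)) (le_lt_trans (fl _ _) h).
Qed.

Lemma cont_rots : contRR rots.
Proof. by apply: cont_sqrt; [move=> x; case/andP: (clamp01 x)|exact: clamp_lip]. Qed.
Lemma cont_rotc : contRR rotc.
Proof.
apply: cont_sqrt => [x|x y]; first by have := clamp01 x; lra.
have -> : 1 - clamp x - (1 - clamp y) = clamp y - clamp x by ring.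
by rewrite distrC clamp_lip.
Qed.
Lemma cont_clamp : contRR clamp.
Proof. by move=> s e e0; exists e => // s' h; exact: le_lt_trans (clamp_lip _ _) h. Qed.

Lemma cont_affine (a b : R) : contRR (fun x => a * x + b).
Proof.
move=> s e e0; exists (e / (`|a| + 1)) => [|s' h]; first by rewrite divr_gt0 // ltr_wpDl.
have -> : a * s + b - (a * s' + b) = a * (s - s') by ring.
rewrite normrM; move: h; rewrite ltr_pdivlMr ?ltr_wpDl //.
apply: le_lt_trans; rewrite mulrC ler_wpM2l // lerDl //.
Qed.

Lemma contRR_comp (f g : R -> R) : contRR f -> contRR g -> contRR (fun x => g (f x)).
Proof.
move=> hf hg s e e0; have [d d0 hd] := hg (f s) e e0; have [d' d0' hd'] := hf s d d0.
by exists d' => // s' /hd' /hd.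
Qed.

Lemma contC_real (f : R -> R) : contRR f -> contC (fun x => (f x)%:C).
Proof.
move=> hf s e e0; have [d d0 hd] := hf s e e0; exists d => // s' /hd.
by rewrite -rmorphB cabsC.
Qed.

Lemma contCD (f g : R -> R[i]) : contC f -> contC g -> contC (fun x => f x + g x).
Proof.
move=> hu hv s e e0; have e2 : 0 < e / 2 by lra.
have [d d0 hd] := hu s _ e2; have [d' d0' hd'] := hv s _ e2.
exists (Num.min d d') => [|s']; first by rewrite lt_min d0.
rewrite lt_min => /andP[/hd h1 /hd' h2].
rewrite opprD addrACA (le_lt_trans (cabsD _ _)) //; lra.
Qed.

Lemma contCZ (a : R[i]) (f : R -> R[i]) : contC f -> contC (fun x => a * f x).
Proof.
move=> hf s e e0; have a1 : 0 < cabs a + 1 by rewrite ltr_wpDl ?cabs_ge0.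
have [|d d0 hd] := hf s (e / (cabs a + 1)); first by rewrite divr_gt0.
exists d => // s' /hd; rewrite -mulrBr cabsM ltr_pdivlMr // => h.
by rewrite (le_lt_trans _ h) // mulrC ler_wpM2l ?cabs_ge0 // lerDl.
Qed.

End Paths.

Section Homotopy.
Context {R : realType}.

(** The path is parametrized by all of R, so that it can be reparametrized and concatenated without
    subspace topologies; [htpy_equiv] returns to [0, 1]. *)
Definition htpy {T T' : cstarAlgType R} (act : R[i] -> T -> T) (act' : R[i] -> T' -> T') (f g : T -> T') : Prop :=
  exists h : R -> T -> T', [/\ forall s, equivariant_star_hom act act' (h s),
    forall x, contR (fun s => h s x), h 0 =1 f & h 1 =1 g].

Section Basic.
Context {T T' : cstarAlgType R}.
Variables (act : R[i] -> T -> T) (act' : R[i] -> T' -> T').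

Lemma htpy_refl f : equivariant_star_hom act act' f -> htpy act act' f f.
Proof. by move=> hf; exists (fun=> f); split=> // x; exact: contR_cst. Qed.

Lemma htpy_sym f g : htpy act act' f g -> htpy act act' g f.
Proof.
case=> h [h1 h2 h3 h4]; exists (fun s => h (1 - s)); split=> //.
- move=> x; have -> : (fun s => h (1 - s) x) = (fun s => h (-1 * s + 1) x).
    by apply: funext => s; congr (h _ _); ring.
  exact: (contR_repar (u := h^~ x) (cont_affine (-1) 1) (h2 x)).
- by move=> x; rewrite subr0.
- by move=> x; rewrite subrr.
Qed.

(** At each time one of the two clamped paths is at g, so adding both and subtracting g is their
    concatenation; written this way it is visibly continuous. *)
Lemma htpy_trans g f k : htpy act act' f g -> htpy act act' g k -> htpy act act' f k.
Proof.
case=> h [h1 h2 h3 h4] [h' [h1' h2' h3' h4']].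
exists (fun s x => h (clamp (2 * s)) x + h' (clamp (2 * s - 1)) x - g x); split.
- move=> s; have [s2|s2] := leP (2 * s) 1.
    have -> : (fun x => h (clamp (2 * s)) x + h' (clamp (2 * s - 1)) x - g x) = h (clamp (2 * s)).
      by apply: funext => x; rewrite (clamp_le0 (x := 2 * s - 1)) ?subr_le0 // h3' addrK.
    exact: h1.
  have -> : (fun x => h (clamp (2 * s)) x + h' (clamp (2 * s - 1)) x - g x) = h' (clamp (2 * s - 1)).
    by apply: funext => x; rewrite clamp_ge1 ?(ltW s2) // h4 addrAC subrr add0r.
  exact: h1'.
- move=> x; apply: contRD; last exact: contR_cst.
  apply: contRD.
    apply: (contR_repar (u := h^~ x) (c := fun s => clamp (2 * s))) => //.
    apply: contRR_comp cont_clamp => s e e0.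
    by have [d d0 hd] := cont_affine 2 0 s e0; exists d => // s' /hd; rewrite !addr0.
  apply: (contR_repar (u := h'^~ x) (c := fun s => clamp (2 * s - 1))) => //.
  exact: contRR_comp (cont_affine 2 (-1)) cont_clamp.
- by move=> x; rewrite mulr0 clamp_le0 // clamp_le0 ?h3 ?h3' ?addrK //; lra.
- move=> x; have e1 : clamp (2 * 1) = 1 :> R by rewrite clamp_ge1 //; lra.
  have e2 : clamp (2 * 1 - 1) = 1 :> R by rewrite clamp_ge1 //; lra.
  by rewrite e1 e2 h4 h4' addrAC subrr add0r.
Qed.

Lemma htpy_equiv f g : htpy act act' f g -> equivariantly_homotopic act act' f g.
Proof.
case=> h [h1 h2 h3 h4]; exists h; split=> // x.
apply: continuous_subspaceT => s A /nbhs_nrm[e e0 hA].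
have [d d0 hd] := h2 x s e e0.
by apply/nbhs_ballP; exists d => //= s' hs; apply/hA/hd.
Qed.

Lemma htpy_eq f f' g g' : f =1 f' -> g =1 g' -> htpy act act' f g -> htpy act act' f' g'.
Proof. by move=> /funext -> /funext ->. Qed.

End Basic.

Lemma equivariant_comp {T1 T2 T3 : cstarAlgType R} (act1 : R[i] -> T1 -> T1) (act2 : R[i] -> T2 -> T2)
    (act3 : R[i] -> T3 -> T3) (f : T1 -> T2) (g : T2 -> T3) :
  equivariant_star_hom act1 act2 f -> equivariant_star_hom act2 act3 g ->
  equivariant_star_hom act1 act3 (g \o f).
Proof.
case=> hf ef [hg eg]; split; first exact: star_hom_comp.
by move=> z z1 x; rewrite /= ef // eg.
Qed.

Lemma htpy_postcomp {T1 T2 T3 : cstarAlgType R} (act1 : R[i] -> T1 -> T1) (act2 : R[i] -> T2 -> T2)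
    (act3 : R[i] -> T3 -> T3) (f f' : T1 -> T2) (g : T2 -> T3) :
  equivariant_star_hom act2 act3 g -> htpy act1 act2 f f' -> htpy act1 act3 (g \o f) (g \o f').
Proof.
move=> hg [h [h1 h2 h3 h4]]; exists (fun s => g \o h s); split=> /=.
- by move=> s; exact: equivariant_comp.
- by move=> x; apply: contR_lips (h2 x); case: hg => hg _; exact: lips_star_hom.
- by move=> x /=; rewrite h3.
- by move=> x /=; rewrite h4.
Qed.

Lemma htpy_precomp {T1 T2 T3 : cstarAlgType R} (act1 : R[i] -> T1 -> T1) (act2 : R[i] -> T2 -> T2)
    (act3 : R[i] -> T3 -> T3) (f : T1 -> T2) (g g' : T2 -> T3) :
  equivariant_star_hom act1 act2 f -> htpy act2 act3 g g' -> htpy act1 act3 (g \o f) (g' \o f).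
Proof.
move=> hf [h [h1 h2 h3 h4]]; exists (fun s => h s \o f); split=> /=.
- by move=> s; apply: equivariant_comp hf _.
- by move=> x; exact: h2.
- by move=> x /=; rewrite h3.
- by move=> x /=; rewrite h4.
Qed.

End Homotopy.

Section FiberBijection.

(** Elements with the same label are matched by their rank in the enumeration of their fibre. *)
Lemma fiber_bijection (I J : finType) (Z : eqType) (c : I -> Z) (d : J -> Z) :
  (forall z, #|[pred x | c x == z]| = #|[pred x | d x == z]|) ->
  exists (b : I -> J) (b' : J -> I), [/\ cancel b b', cancel b' b & forall x, d (b x) = c x].
Proof.
have half (X Y : finType) (f : X -> Z) (g : Y -> Z) :
    (forall z, #|[pred x | f x == z]| = #|[pred x | g x == z]|) ->
    exists b : X -> Y, forall x, g (b x) = f x /\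
      index (b x) (enum [pred y | g y == f x]) = index x (enum [pred x' | f x' == f x]).
  move=> h; suff : forall x, exists y, g y = f x /\
      index y (enum [pred y | g y == f x]) = index x (enum [pred x' | f x' == f x]).
    by move=> H; have [b hb] := choice H; exists b.
  move=> x; set k := index x _.
  have kl : (k < size (enum [pred x' | f x' == f x]))%N by rewrite index_mem mem_enum inE.
  have kl' : (k < size (enum [pred y | g y == f x]))%N by move: kl; rewrite -!cardE h.
  have [y0 _] : exists y0 : Y, true by case: (enum _) kl' => [//|y0 ?]; exists y0.
  exists (nth y0 (enum [pred y | g y == f x]) k); split; last by rewrite index_uniq ?enum_uniq.
  by apply/eqP; have := mem_nth y0 kl'; rewrite mem_enum inE.
have canc (X Y : finType) (f : X -> Z) (g : Y -> Z) (b : X -> Y) (b' : Y -> X) :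
    (forall x, g (b x) = f x /\ index (b x) (enum [pred y | g y == f x]) = index x (enum [pred x' | f x' == f x])) ->
    (forall y, f (b' y) = g y /\ index (b' y) (enum [pred x | f x == g y]) = index y (enum [pred y' | g y' == g y])) ->
    cancel b b'.
  move=> hb hb' x; have [b1 b2] := hb x; have [b1' b2'] := hb' (b x).
  move: b2'; rewrite b1 b2 => e.
  have xin : x \in enum [pred x0 | f x0 == f x] by rewrite mem_enum inE.
  have bin : b' (b x) \in enum [pred x0 | f x0 == f x] by rewrite mem_enum inE b1' b1.
  by rewrite -[LHS](nth_index x bin) e nth_index.
move=> h; have [b hb] := half _ _ c d h.
have [b' hb'] := half _ _ d c (fun z => esym (h z)).
exists b, b'; split; [exact: canc hb hb'|exact: canc hb' hb|].
by move=> x; case: (hb x).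
Qed.

End FiberBijection.

Section MatrixUnits.
Context {R : realType} {K : compact_operators R}.

Definition munits (eps : nat -> nat -> K) : Prop :=
  [/\ forall i j k l, eps i j ** eps k l = if j == k then eps i l else 0,
      forall i j, adj (eps i j) = eps j i,
      forall i j, eps i j != 0 &
      forall (k : K) (e : R), 0 < e -> exists N, exists c : nat -> nat -> R[i],
        nrm (k - \sum_(i < N) \sum_(j < N) c i j *: eps i j) < e].

Variable eps : nat -> nat -> K.
Hypothesis E : munits eps.
Lemma munitsM i j k l : eps i j ** eps k l = if j == k then eps i l else 0.
Proof. by case: E. Qed.
Lemma munitsA i j : adj (eps i j) = eps j i. Proof. by case: E. Qed.
Lemma munitsN i j : eps i j != 0. Proof. by case: E. Qed.
Lemma munitsD (k : K) (e : R) : 0 < e -> exists N, exists c : nat -> nat -> R[i],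
  nrm (k - \sum_(i < N) \sum_(j < N) c i j *: eps i j) < e.
Proof. by case: E => _ _ _; apply. Qed.

End MatrixUnits.

(** * Homomorphisms and homotopies given on generators *)

Section Generators.
Context {R : realType} {K : compact_operators R}.
Variable eps : nat -> nat -> K.
Hypothesis E : munits eps.
Let epsM := munitsM E.
Let epsA := munitsA E.
Let epsN := munitsN E.
Let epsD := munitsD E.
Context {V : finType} {A : V -> V -> nat} {OA : graph_algebra R A} {OAK : stabilization OA K}.
Notation mA := (mu OAK eps).
Notation PA := (vertex_proj OA).
Notation SA := (edge_isom OA).
Notation actA := (@stab_gauge _ _ _ _ _ OAK).

Lemma mu_unit i j a : mA i j a = mA i 0 (gunit OA) ** mA 0 0 a ** mA 0 j (gunit OA).
Proof. by rewrite !(muM OAK epsM) !eqxx u1l u1r. Qed.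

Lemma star_hom_mu_unit (T : cstarAlgType R) (f : OAK -> T) i j : star_hom f ->
  f (mA i j (gunit OA)) = \sum_v f (mA i j (PA v)).
Proof. by move=> hf; rewrite mu_sum (star_hom_sum hf). Qed.

Lemma stab_gen_ext (T : cstarAlgType R) (f g : OAK -> T) : star_hom f -> star_hom g ->
  (forall i j v, f (mA i j (PA v)) = g (mA i j (PA v))) ->
  (forall i j e, f (mA i j (SA e)) = g (mA i j (SA e))) -> forall x, f x = g x.
Proof.
move=> hf hg hP hS; apply: (stab_hom_ext epsD) => // i j a.
have h0 := mu_hom OAK epsM epsA 0%N.
have fg b : f (mA 0 0 b) = g (mA 0 0 b).
  exact: (graph_hom_ext (star_hom_comp h0 hf) (star_hom_comp h0 hg) (hP 0%N 0%N) (hS 0%N 0%N)).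
have U k l : f (mA k l (gunit OA)) = g (mA k l (gunit OA)).
  by rewrite !star_hom_mu_unit //; apply: eq_bigr => v _.
by rewrite mu_unit !(star_homM hf) !(star_homM hg) fg !U.
Qed.

Lemma stab_gauge_hom z : `|z| = 1 -> star_hom (actA z).
Proof. by move=> z1; have [] := @stab_gaugeP _ _ _ _ _ OAK z z1. Qed.

Lemma stab_gauge_mu z i j a : `|z| = 1 -> actA z (mA i j a) = mA i j (gauge z a).
Proof. by move=> z1; have [_] := @stab_gaugeP _ _ _ _ _ OAK z z1; exact. Qed.

Lemma stab_gauge_P z i j v : `|z| = 1 -> actA z (mA i j (PA v)) = mA i j (PA v).
Proof. by move=> z1; rewrite stab_gauge_mu //; have [_ -> _] := @gaugeP _ _ _ OA z z1. Qed.

Lemma stab_gauge_S z i j e : `|z| = 1 -> actA z (mA i j (SA e)) = z *: mA i j (SA e).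
Proof. by move=> z1; rewrite stab_gauge_mu //; have [_ _ ->] := @gaugeP _ _ _ OA z z1; rewrite muZ. Qed.

Lemma stab_gauge_unit z i j : `|z| = 1 -> actA z (mA i j (gunit OA)) = mA i j (gunit OA).
Proof.
move=> z1; rewrite star_hom_mu_unit ?mu_sum; last exact: stab_gauge_hom.
by apply: eq_bigr => v _; exact: stab_gauge_P.
Qed.

Lemma equivariant_gen (T : cstarAlgType R) (act : R[i] -> T -> T) (F : OAK -> T) : star_hom F ->
  (forall z, `|z| = 1 -> star_hom (act z)) ->
  (forall z i j v, `|z| = 1 -> act z (F (mA i j (PA v))) = F (mA i j (PA v))) ->
  (forall z i j e, `|z| = 1 -> act z (F (mA i j (SA e))) = z *: F (mA i j (SA e))) ->
  equivariant_star_hom (@stab_gauge _ _ _ _ _ OAK) act F.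
Proof.
move=> hF hact hP hS; split=> // z z1.
apply: (@stab_gen_ext T (F \o actA z) (act z \o F)).
- by apply: star_hom_comp hF; exact: stab_gauge_hom.
- exact: star_hom_comp hF (hact z z1).
- by move=> i j v /=; rewrite stab_gauge_P // hP.
- by move=> i j e /=; rewrite stab_gauge_S // hS // (star_homZ hF).
Qed.

(** The family gives a homomorphism of O_A that sends the unit to the sum of the P v; columns with
    this initial projection spread it over the stabilization. *)
Lemma ck_extension (T : cstarAlgType R) (P : V -> T) (S : edge A -> T) (X : nat -> T) :
  cuntz_krieger_family P S ->
  (forall i j, adj (X i) ** X j = if i == j then \sum_v P v else 0) ->
  exists2 F : OAK -> T, star_hom F &
    (forall i j v, F (mA i j (PA v)) = X i ** P v ** adj (X j)) /\
    (forall i j e, F (mA i j (SA e)) = X i ** S e ** adj (X j)).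
Proof.
move=> PS hX; have [phi [hphi phiP phiS]] := graph_universal OA PS.
have [|F hF FE] := @stab_extension _ _ _ OA _ OAK eps epsM epsA epsN epsD T phi X hphi.
  move=> i j a; rewrite hX; case: eqP => _; last by rewrite amul0l.
  have <- : phi (gunit OA) = \sum_v P v.
    by rewrite (star_hom_sum hphi); apply: eq_bigr => v _.
  by rewrite -(star_homM hphi) u1l.
by exists F => //; split=> i j a; rewrite FE ?phiP ?phiS.
Qed.

(** The elements with a continuous path form a closed set, because the h s are contractive uniformly
    in s. Generation settles the corner, the units of the corners then all matrix entries, and
    density the rest. *)
Lemma contR_gen (T : cstarAlgType R) (h : R -> OAK -> T) : (forall s, star_hom (h s)) ->
  (forall i j v, contR (fun s => h s (mA i j (PA v)))) ->
  (forall i j e, contR (fun s => h s (mA i j (SA e)))) -> forall x, contR (fun s => h s x).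
Proof.
move=> hh hP hS.
have cl (T1 : cstarAlgType R) (k : R -> T1 -> T) : (forall s, star_hom (k s)) ->
    closed [set x | contR (fun s => k s x)].
  move=> hk; apply/closedE_adh => x hx s e e0; have e3 : 0 < e / 3 by lra.
  have [y hy xy] := hx _ e3; have [d d0 hd] := hy s _ e3; exists d => // s' /hd h1.
  have b s1 : nrm (k s1 x - k s1 y) < e / 3.
    by rewrite -(star_homB (hk s1)) (le_lt_trans (star_hom_nrm (hk s1) _)).
  have := nrm_tri (k s y) (k s x) (k s' x); have := nrm_tri (k s' y) (k s y) (k s' x).
  have := b s; have := b s'; rewrite (nrmBC (k s' y)); lra.
have h0 s : star_hom (h s \o mA 0 0) := star_hom_comp (mu_hom OAK epsM epsA 0%N) (hh s).
have c0 a : contR (fun s => h s (mA 0 0 a)).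
  suff : [set a | contR (fun s => h s (mA 0 0 a))] a by [].
  refine (@graph_generated _ _ _ OA [set a | contR (fun s => h s (mA 0 0 a))] _ (hP 0%N 0%N) (hS 0%N 0%N) a); split.
  - exact: (cl _ _ h0).
  - rewrite /= (_ : (fun s => _) = fun=> 0); first exact: contR_cst.
    by apply: funext => s; rewrite mu0 (star_hom0 (hh s)).
  - move=> c y z /= hy hz.
    rewrite (_ : (fun s => _) = fun s => c *: h s (mA 0 0 y) + h s (mA 0 0 z)).
      apply: contRD => //; apply: contRZ => //; move=> s e e0; exists 1 => // s' _.
      by rewrite subrr cabs0.
    by apply: funext => s; rewrite muD muZ (star_homD (hh s)) (star_homZ (hh s)).
  - move=> y z /= hy hz.
    rewrite (_ : (fun s => _) = fun s => h s (mA 0 0 y) ** h s (mA 0 0 z)); first exact: contRM.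
    by apply: funext => s; rewrite -(star_homM (hh s)) (muM OAK epsM) eqxx.
  - move=> y /= hy; rewrite (_ : (fun s => _) = fun s => adj (h s (mA 0 0 y))).
      exact: contR_lips lips_adj hy.
    by apply: funext => s; rewrite -(star_homV (hh s)) (muA OAK epsA).
have cu i j : contR (fun s => h s (mA i j (gunit OA))).
  rewrite (_ : (fun s => _) = fun s => \sum_v h s (mA i j (PA v))); first exact: contR_sum.
  by apply: funext => s; rewrite star_hom_mu_unit.
have cm i j a : contR (fun s => h s (mA i j a)).
  rewrite (_ : (fun s => _) = fun s => h s (mA i 0 (gunit OA)) ** h s (mA 0 0 a) ** h s (mA 0 j (gunit OA))).
    by apply: contRM => //; exact: contRM.
  by apply: funext => s; rewrite mu_unit !(star_homM (hh s)).
move=> x; have /closedE_adh := cl _ _ hh; apply => e /(mel_dense epsD x)[_ [N [a ->]] hx].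
exists (mel OAK eps N a) => //=.
rewrite (_ : (fun s => _) = fun s => \sum_(i < N) \sum_(j < N) h s (mA i j (a i j))).
  by apply: contR_sum => i; exact: contR_sum.
apply: funext => s; rewrite /mel (star_hom_sum (hh s)); apply: eq_bigr => i _.
by rewrite (star_hom_sum (hh s)).
Qed.

Lemma htpy_gen (T : cstarAlgType R) (act : R[i] -> T -> T) (h : R -> OAK -> T) (F G : OAK -> T) :
  (forall z, `|z| = 1 -> star_hom (act z)) ->
  (forall s, star_hom (h s)) ->
  (forall s z i j v, `|z| = 1 -> act z (h s (mA i j (PA v))) = h s (mA i j (PA v))) ->
  (forall s z i j e, `|z| = 1 -> act z (h s (mA i j (SA e))) = z *: h s (mA i j (SA e))) ->
  (forall i j v, contR (fun s => h s (mA i j (PA v)))) ->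
  (forall i j e, contR (fun s => h s (mA i j (SA e)))) ->
  h 0 =1 F -> h 1 =1 G -> htpy (@stab_gauge _ _ _ _ _ OAK) act F G.
Proof.
move=> hact hh hP hS cP cS h0 h1; exists h; split=> //; last exact: contR_gen.
by move=> s; apply: equivariant_gen => //; [exact: hP|exact: hS].
Qed.

End Generators.

(** * Homomorphisms implemented by bijections of paths *)

Section BimoduleIso.
Context {V W : finType} {A : V -> V -> nat} {B : W -> W -> nat} {I : finType}.

(* I with s and r is a bipartite graph from V to W, and theta a bijection from
   the pairs (edge of A, edge of I) to the pairs (edge of I, edge of B) that
   compose to paths, with inverse theta'; both are arbitrary on other pairs. *)
Definition path_bijection (s : I -> V) (r : I -> W)
    (theta : edge A * I -> I * edge B) (theta' : I * edge B -> edge A * I) : Prop :=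
  (forall e f, edge_range e = s f ->
    [/\ r (theta (e, f)).1 = edge_source (theta (e, f)).2,
        s (theta (e, f)).1 = edge_source e,
        edge_range (theta (e, f)).2 = r f & theta' (theta (e, f)) = (e, f)]) /\
  (forall g e', r g = edge_source e' ->
    edge_range (theta' (g, e')).1 = s (theta' (g, e')).2 /\
    theta (theta' (g, e')) = (g, e')).

End BimoduleIso.

Section Frames.
Context {R : realType} {K : compact_operators R}.
Variable eps : nat -> nat -> K.
Hypothesis E : munits eps.
Context {W : finType} {B : W -> W -> nat} {OB : graph_algebra R B} {OBK : stabilization OB K}.
Notation mB := (mu OBK eps).
Notation QB := (vertex_proj OB).
Notation TB := (edge_isom OB).
Notation uB := (gunit OB).
Let mBM := muM OBK (munitsM E).
Let mBA := muA OBK (munitsA E).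
Let CKB := graph_family OB.
Context {I : finType}.
Variable r : I -> W.

(** [y f i] is a partial isometry with initial projection p_(r f); its range is where row i of the
    source is placed in the copy belonging to f. *)
Definition frame (y : I -> nat -> OBK) : Prop := forall f i g j,
  adj (y f i) ** y g j = if (f == g) && (i == j) then mB 0 0 (QB (r f)) else 0.

Definition path_elt (y : I -> nat -> OBK) (q : I * edge B) i := y q.1 i ** mB 0 0 (TB q.2).

Variable y : I -> nat -> OBK.
Hypothesis yF : frame y.
Notation b := (path_elt y).

Lemma frame_proj f i : y f i ** mB 0 0 (QB (r f)) = y f i.
Proof.
apply/esym/eqP; rewrite -subr_eq0; apply/eqP; apply: adjM_eq0.
rewrite adjB adjM mBA (ckPa CKB) amulBl !amulBr -!amulA !(amulA _ (y f i)) yF !eqxx /=.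
by rewrite !mBM !eqxx !(ckP CKB) subrr.
Qed.

Lemma frame_unit f i : y f i ** mB 0 0 uB = y f i.
Proof. by rewrite -[in LHS](frame_proj f i) -amulA mBM eqxx u1r frame_proj. Qed.

Lemma path_elt_orth q i q' j : adj (b q i) ** b q' j =
  if [&& q == q', i == j & r q.1 == edge_source q.2] then mB 0 0 (QB (edge_range q.2)) else 0.
Proof.
rewrite /path_elt adjM mBA -!amulA (amulA _ (y q'.1 j)) yF.
case: q q' => [f e] [f' e'] /=; rewrite xpair_eqE.
case: (f =P f') => [_|_] /=; last by rewrite amul0l amul0r.
case: (i == j) => /=; last by rewrite amul0l amul0r !andbF.
rewrite !mBM !eqxx (ckPS CKB) [r f == _]eq_sym.
case: (e =P e') => [<-|ne] /=.
  by case: eqP => _; rewrite ?(ckSS CKB) ?amul0r ?mu0.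
by case: eqP => _; rewrite ?amul0r ?mu0 // (ckSaS CKB); case: eqP => // _; rewrite mu0.
Qed.

Lemma path_elt_proj q i : b q i ** mB 0 0 (QB (edge_range q.2)) = b q i.
Proof. by rewrite /path_elt -amulA mBM eqxx (ckSP CKB). Qed.

Lemma frame_expand f i j : y f i ** adj (y f j) =
  \sum_(e | edge_source e == r f) b (f, e) i ** adj (b (f, e) j).
Proof.
rewrite -[in LHS](frame_proj f i) (ckPsum CKB) mu_sum amul_sumr amul_suml.
apply: eq_bigr => e _; rewrite /path_elt adjM mBA !amulA; congr (_ ** _).
by rewrite -!amulA mBM eqxx.
Qed.

End Frames.

Section Implements.
Context {R : realType} {K : compact_operators R}.
Variable eps : nat -> nat -> K.
Hypothesis E : munits eps.
Context {V : finType} {A : V -> V -> nat} {OA : graph_algebra R A} {OAK : stabilization OA K}.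
Context {W : finType} {B : W -> W -> nat} {OB : graph_algebra R B} {OBK : stabilization OB K}.
Notation mA := (mu OAK eps).
Notation PA := (vertex_proj OA).
Notation SA := (edge_isom OA).
Notation actA := (@stab_gauge _ _ _ _ _ OAK).
Notation mB := (mu OBK eps).
Notation QB := (vertex_proj OB).
Notation actB := (@stab_gauge _ _ _ _ _ OBK).

(** A relation rather than a construction: the two formulas determine F ([implements_ext]), so any
    homomorphism can be recognized as coming from such data. *)
Definition implements (I : finType) (s : I -> V) (theta : edge A * I -> I * edge B)
    (y : I -> nat -> OBK) (F : OAK -> OBK) : Prop :=
  [/\ star_hom F,
      forall i j v, F (mA i j (PA v)) = \sum_(f | s f == v) y f i ** adj (y f j) &
      forall i j e, F (mA i j (SA e)) =
        \sum_(f | s f == edge_range e) path_elt eps y (theta (e, f)) i ** adj (y f j)].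

Definition degree0 (I : finType) (y : I -> nat -> OBK) : Prop :=
  forall z f i, `|z| = 1 -> actB z (y f i) = y f i.

Lemma degree0_path_elt (I : finType) (y : I -> nat -> OBK) z q i : degree0 y -> `|z| = 1 ->
  actB z (path_elt eps y q i) = z *: path_elt eps y q i.
Proof.
move=> y0 z1; rewrite /path_elt (star_homM (stab_gauge_hom z1)) y0 //.
by rewrite stab_gauge_S // amulZr.
Qed.

Section Data.
Context {I : finType} {s : I -> V} {r : I -> W} {theta : edge A * I -> I * edge B}
  {theta' : I * edge B -> edge A * I}.
Hypothesis th : path_bijection s r theta theta'.
Variable y : I -> nat -> OBK.
Hypothesis yF : frame eps r y.
Notation b := (path_elt eps y).

Lemma path_bijection_inj e f e' f' : edge_range e = s f -> edge_range e' = s f' ->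
  (theta (e, f) == theta (e', f')) = ((e == e') && (f == f')).
Proof.
move=> h h'; rewrite -xpair_eqE; apply/eqP/eqP => [ef|[-> ->]//].
by have [_ _ _ <-] := th.1 _ _ h; have [_ _ _ <-] := th.1 _ _ h'; rewrite ef.
Qed.

Lemma frame_sum_adj (P : pred I) (G : I -> OBK) g i : 
  (\sum_(f | P f) G f ** adj (y f i)) ** y g i = if P g then G g ** mB 0 0 (QB (r g)) else 0.
Proof.
rewrite amul_suml; case: ifP => Pg.
  rewrite (bigD1 g) //= big1 ?addr0 => [|f /andP[Pf fg]]; rewrite -amulA yF ?eqxx //.
  by rewrite (negPf fg) amul0r.
rewrite big1 // => f Pf; rewrite -amulA yF; case: eqP => [fg|_] /=; last by rewrite amul0r.
by rewrite -fg Pf in Pg.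
Qed.

(** S_e carries y_f to the path element of theta (e, f). Hence S_e^* S_e is a projection because
    theta is injective, and the sum relation for P_v holds because theta is onto the paths (g, e')
    of which g starts at v. *)
Lemma implements_ck : cuntz_krieger_family
  (fun v => \sum_(f | s f == v) y f 0 ** adj (y f 0))
  (fun e => \sum_(f | s f == edge_range e) b (theta (e, f)) 0 ** adj (y f 0)).
Proof.
pose P v := \sum_(f | s f == v) y f 0 ** adj (y f 0).
pose S e := \sum_(f | s f == edge_range e) b (theta (e, f)) 0 ** adj (y f 0).
have Pa v : adj (P v) = P v.
  by rewrite /P adj_sum; apply: eq_bigr => f _; rewrite adjM adjK.
have Py v g : P v ** y g 0 = if s g == v then y g 0 else 0.
  by rewrite /P frame_sum_adj; case: ifP => // _; exact: frame_proj.
have PP v w : P v ** P w = if v == w then P w else 0.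
  rewrite {2}/P amul_sumr.
  under eq_bigr => f fw do rewrite amulA Py (eqP fw) eq_sym.
  by case: eqP => // _; rewrite big1 // => f _; rewrite amul0l.
have Sy e g : S e ** y g 0 = if s g == edge_range e then b (theta (e, g)) 0 else 0.
  rewrite /S frame_sum_adj; case: ifP => // /eqP sg.
  have [_ _ <- _] := th.1 e g (esym sg); exact: path_elt_proj.
have SP e : S e ** P (edge_range e) = S e.
  rewrite {1}/P amul_sumr; apply: eq_bigr => f fe.
  by rewrite amulA Sy fe.
have SS e : adj (S e) ** S e = P (edge_range e).
  rewrite {2}/S amul_sumr; apply: eq_bigr => f /eqP fe.
  rewrite amulA; congr (_ ** _); rewrite /S adj_sum.
  under eq_bigr => g _ do rewrite adjM adjK.
  have [h1 _ h2 _] := th.1 e f (esym fe).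
  rewrite amul_suml (bigD1 f) /=; last by rewrite fe.
  rewrite -amulA (path_elt_orth E yF) !eqxx h1 eqxx /= h2 (frame_proj E yF) big1 ?addr0 //.
  move=> g /andP[/eqP ge gf]; rewrite -amulA (path_elt_orth E yF).
  by rewrite path_bijection_inj // (negPf gf) andbF amul0r.
have SSs e : S e ** adj (S e) = \sum_(f | s f == edge_range e) b (theta (e, f)) 0 ** adj (b (theta (e, f)) 0).
  rewrite {2}/S adj_sum amul_sumr; apply: eq_bigr => f fe.
  by rewrite adjM adjK amulA Sy fe.
split=> //.
- by move=> v; split; [rewrite -/(P v) PP eqxx|exact: Pa].
- by move=> v w /negPf vw; rewrite -/(P v) -/(P w) PP vw.
- by move=> e; rewrite /partial_isometry -/(S e) -amulA SS SP.
- move=> v; rewrite -/(P v); under [RHS]eq_bigr => e _ do rewrite -/(S e) SSs.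
  rewrite pair_big_dep /= /P.
  under [LHS]eq_bigr => f _ do rewrite (frame_expand E yF) //.
  rewrite pair_big_dep /=.
  (* Both sides are now sums of path elements times their adjoints: on the left over the paths (g,
     e') starting at v, on the right over the pairs (e, f) with e starting at v. *)
  rewrite (reindex_onto theta theta') /=; last first.
    by move=> [g e] /andP[_ /eqP/esym] /th.2[].
  apply: eq_big => [[e f]|[e f] _] /=; last by case: (theta _).
  apply/idP/idP => [/andP[/andP[sv eg] /eqP te]|/andP[/eqP sv /eqP/esym fe]].
    have [] := th.2 (theta (e, f)).1 (theta (e, f)).2 (esym (eqP eg)).
    rewrite -surjective_pairing te /= => /[dup] fe <- _.
    by have [_ <- _ _] := th.1 e f fe; rewrite sv eqxx.
  have [h1 h2 _ h4] := th.1 e f fe.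
  by rewrite h1 h2 h4 sv !eqxx.
Qed.

Let P v := \sum_(f | s f == v) y f 0 ** adj (y f 0).
(** The partial isometry moving row 0 of the frame to row i. *)
Let X i := \sum_f y f i ** adj (y f 0).

Lemma frame_shift i j : adj (X i) ** X j = if i == j then \sum_v P v else 0.
Proof.
have -> : \sum_v P v = \sum_f y f 0 ** adj (y f 0) by rewrite [RHS](partition_big s xpredT).
rewrite {2}/X amul_sumr.
under eq_bigr => f _.
  rewrite amulA (_ : adj (X i) ** y f j = if i == j then y f 0 else 0).
    over.
  rewrite /X adj_sum amul_suml (bigD1 f) //= big1 ?addr0.
    by rewrite adjM adjK -amulA yF eqxx /=; case: eqP; rewrite ?amul0r // (frame_proj E yF).
  by move=> g /negPf gf; rewrite adjM adjK -amulA yF gf amul0r.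
by case: eqP => // _; rewrite big1 // => f _; rewrite amul0l.
Qed.

Lemma implements_exists : exists F : OAK -> OBK, implements s theta y F.
Proof.
have [F hF [FP FS]] := ck_extension (OAK := OAK) E implements_ck frame_shift.
have Xy i f : X i ** y f 0 = y f i.
  by rewrite /X frame_sum_adj (frame_proj E yF).
have yX j f : adj (y f 0) ** adj (X j) = adj (y f j) by rewrite -adjM Xy.
exists F; split=> // i j x.
  rewrite FP amul_sumr amul_suml; apply: eq_bigr => f _.
  by rewrite amulA Xy -amulA yX.
rewrite FS amul_sumr amul_suml; apply: eq_bigr => f _.
by rewrite /path_elt !amulA Xy -!amulA yX.
Qed.

Lemma implements_equivariant F : degree0 y -> implements s theta y F ->
  equivariant_star_hom actA actB F.
Proof.
move=> y0 [hF FP FS]; apply: (equivariant_gen E) => //.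
- by move=> z z1; exact: stab_gauge_hom.
- move=> z i j v z1; rewrite FP (star_hom_sum (stab_gauge_hom z1)); apply: eq_bigr => f _.
  by rewrite (star_homM (stab_gauge_hom z1)) (star_homV (stab_gauge_hom z1)) !y0.
- move=> z i j e z1; rewrite FS (star_hom_sum (stab_gauge_hom z1)) scaler_sumr; apply: eq_bigr => f _.
  rewrite (star_homM (stab_gauge_hom z1)) (star_homV (stab_gauge_hom z1)) !y0 //.
  by rewrite degree0_path_elt // amulZl.
Qed.

Lemma implements_ext F G : implements s theta y F -> implements s theta y G -> F =1 G.
Proof.
move=> [hF FP FS] [hG GP GS].
apply: (stab_gen_ext E) => // i j x; first by rewrite FP GP.
by rewrite FS GS.
Qed.

End Data.

(** For a fixed theta the formulas on generators depend continuously on the frame. *)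
Lemma frame_path_htpy (I : finType) (s : I -> V) (r : I -> W) theta theta'
    (y : R -> I -> nat -> OBK) F G :
  path_bijection s r theta theta' -> (forall x, frame eps r (y x)) -> (forall x, degree0 (y x)) ->
  (forall f i, contR (fun x => y x f i)) ->
  implements s theta (y 0) F -> implements s theta (y 1) G -> htpy actA actB F G.
Proof.
move=> th yF y0 yc hF hG.
have [h hh] := choice (fun x => implements_exists th (yF x)).
have heq x : equivariant_star_hom actA actB (h x) by exact: (implements_equivariant (y0 x) (hh x)).
apply: (htpy_gen E _ (h := h)).
- by move=> z z1; exact: stab_gauge_hom.
- by move=> x; case: (hh x).
- by move=> x z i j v z1; rewrite -(heq x).2 // stab_gauge_P.
- by move=> x z i j v z1; rewrite -(heq x).2 // stab_gauge_S // (star_homZ (heq x).1).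
- move=> i j v; rewrite (_ : (fun x => _) = fun x => \sum_(f | s f == v) y x f i ** adj (y x f j)).
    apply: contR_sum => f; apply: contRM => //.
    exact: (contR_lips lips_adj).
  by apply: funext => x; case: (hh x) => _ -> _.
- move=> i j e; rewrite (_ : (fun x => _) = fun x =>
      \sum_(f | s f == edge_range e) path_elt eps (y x) (theta (e, f)) i ** adj (y x f j)).
    apply: contR_sum => f; apply: contRM; last exact: (contR_lips lips_adj).
    by apply: contRM => //; exact: contR_cst.
  by apply: funext => x; case: (hh x) => _ _ ->.
- exact: implements_ext (hh 0) hF.
- exact: implements_ext (hh 1) hG.
Qed.

End Implements.

(** * Changing the bijection of paths *)

Section Twist.
Context {R : realType} {K : compact_operators R}.
Variable eps : nat -> nat -> K.
Hypothesis E : munits eps.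
Context {V : finType} {A : V -> V -> nat} {OA : graph_algebra R A} {OAK : stabilization OA K}.
Notation mA := (mu OAK eps).
Notation PA := (vertex_proj OA).
Notation SA := (edge_isom OA).
Notation uA := (gunit OA).
Notation actA := (@stab_gauge _ _ _ _ _ OAK).
Let mAM := muM OAK (munitsM E).
Let mAA := muA OAK (munitsA E).
Let CKA := graph_family OA.

Definition circ (x : R) : R[i] := (rotc x)%:C + 'i * (rots x)%:C.

Lemma circ_conj x : circ x * conjC (circ x) = 1.
Proof.
have -> : conjC (circ x) = (rotc x)%:C - 'i * (rots x)%:C.
  rewrite /circ rmorphD; congr (_ + _); first exact: conjC_re.
  transitivity (conjC 'i * conjC (rots x)%:C : R[i]); first exact: rmorphM.
  by rewrite conjC_re -mulNr; congr (_ * _); exact: conjCi.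
have -> : 1 = (rotc x * rotc x + rots x * rots x)%:C :> R[i] by rewrite rot_sq.
rewrite rmorphD !rmorphM /= /circ.
have <- : (rotc x)%:C * (rotc x)%:C - ('i * 'i) * ((rots x)%:C * (rots x)%:C) = (rotc x)%:C * (rotc x)%:C + (rots x)%:C * (rots x)%:C :> R[i].
  by rewrite sqi mulN1r opprK.
ring.
Qed.

Lemma contC_circ : contC circ.
Proof.
apply: contCD; first exact: contC_real cont_rotc.
by apply: contCZ; exact: contC_real cont_rots.
Qed.

Lemma circ_le0 x : x <= 0 -> circ x = 1.
Proof. by move=> x0; rewrite /circ rotc_le0 // rots_le0 // mulr0 addr0. Qed.
Lemma circ_ge1 x : 1 <= x -> circ x = 'i.
Proof. by move=> x0; rewrite /circ rotc_ge1 // rots_ge1 // mulr1 add0r. Qed.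

(** Multiplying all S_e on the left by a unitary that commutes with the P_v preserves the relations.
    The unitary moves from 1 to the reflection 1 - 2 p. *)
Lemma twist_htpy (T : cstarAlgType R) (act : R[i] -> T -> T) (F G : OAK -> T) (p : T) :
  (forall z, `|z| = 1 -> star_hom (act z)) ->
  equivariant_star_hom actA act F -> star_hom G -> projection p ->
  (forall z, `|z| = 1 -> act z p = p) ->
  (forall v, p ** F (mA 0 0 (PA v)) = F (mA 0 0 (PA v)) ** p) ->
  (forall i j v, G (mA i j (PA v)) = F (mA i j (PA v))) ->
  (forall i j e, G (mA i j (SA e)) = F (mA i 0 uA) **
     (F (mA 0 0 (SA e)) - 2%:R *: (p ** F (mA 0 0 (SA e)))) ** F (mA 0 j uA)) ->
  htpy actA act F G.
Proof.
move=> hact [hF eF] hG [pp pa] pact pP GP GS.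
pose P v := F (mA 0 0 (PA v)); pose S e := F (mA 0 0 (SA e)); pose X i := F (mA i 0 uA).
have XaE i : adj (X i) = F (mA 0 i uA) by rewrite /X -(star_homV hF) mAA gunit_adj.
have PS : cuntz_krieger_family P S.
  split.
  - move=> v; split; first by rewrite /P -(star_homM hF) mAM eqxx (ckP CKA).
    by rewrite /P -(star_homV hF) mAA (ckPa CKA).
  - by move=> v w /negPf vw; rewrite /P -(star_homM hF) mAM eqxx (ckPP CKA) vw mu0 (star_hom0 hF).
  - move=> e; rewrite /partial_isometry /S -(star_homV hF) -!(star_homM hF) mAA !mAM !eqxx.
    by case: CKA => _ _ -> _ _.
  - by move=> e; rewrite /S -(star_homV hF) -(star_homM hF) mAA mAM eqxx (ckSS CKA).
  - move=> v; rewrite /P (ckPsum CKA) mu_sum (star_hom_sum hF); apply: eq_bigr => e _.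
    by rewrite /S -(star_homV hF) -(star_homM hF) mAA mAM eqxx.
have XX i j : adj (X i) ** X j = if i == j then \sum_v P v else 0.
  rewrite XaE -(star_homM hF) mAM; case: eqP => _; last exact: star_hom0 hF.
  by rewrite u1l mu_sum (star_hom_sum hF).
(* The unitary is 1 + (z^2 - 1) p: with z = [circ x] on the quarter circle from 1 to i, the factor
   z^2 reaches -1. As T need not have a unit, only its action on elements is written. *)
pose w z (x : T) := x + (z * z - 1) *: (p ** x).
have wM z x y : w z x ** y = w z (x ** y) by rewrite /w amulDl amulZl amulA.
have ww z x : z * conjC z = 1 -> w (conjC z) (w z x) = x.
  move=> z1; have h : conjC z * conjC z * (z * z) = 1 by rewrite -[RHS](mul1r 1) -{1}z1 -z1; ring.
  rewrite /w amulDr amulZr amulA pp; move: (conjC z * conjC z) (z * z) (p ** x) h => a b y h.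
  by rewrite scalerDr scalerA mulrBl mulrBr h mulr1 mul1r; by lmod.
have wa z x y : adj (w z x) ** y = adj x ** w (conjC z) y.
  rewrite /w adjD adjZ adjM pa rmorphB rmorphM rmorph1 amulDl amulDr amulZl amulZr.
  by rewrite -!amulA.
have CK z : z * conjC z = 1 -> cuntz_krieger_family P (fun e => w z (S e)).
  move=> z1.
  have SS e : adj (w z (S e)) ** w z (S e) = P (edge_range e) by rewrite wa ww // (ckSS PS).
  split; [by case: PS|by case: PS| |exact: SS|].
    by move=> e; rewrite /partial_isometry -amulA SS wM (ckSP PS).
  move=> v; have wsum : w (conjC z) (P v) =
      \sum_(e | edge_source e == v) S e ** adj (w z (S e)).
    rewrite /w /P pP -/(P v) (ckPsum PS v) amul_suml scaler_sumr -big_split /=.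
    apply: eq_bigr => e _; rewrite adjD adjZ adjM pa rmorphB rmorphM rmorph1 amulDr amulZr.
    by rewrite amulA.
  have -> : P v = w z (w (conjC z) (P v)).
    by rewrite -{1}[z]conjCK ww // conjCK mulrC.
  rewrite wsum {1}/w amul_sumr scaler_sumr -big_split /=; apply: eq_bigr => e _.
  by rewrite wM.
have ex x : exists h : OAK -> T, star_hom h /\
    (forall i j v, h (mA i j (PA v)) = X i ** P v ** adj (X j)) /\
    (forall i j e, h (mA i j (SA e)) = X i ** w (circ x) (S e) ** adj (X j)).
  by have [h h1 h2] := ck_extension (OAK := OAK) E (CK _ (circ_conj x)) XX; exists h.
have [h hh] := choice ex.
have hC x : star_hom (h x) by case: (hh x).
have hP x i j v : h x (mA i j (PA v)) = F (mA i j (PA v)).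
  case: (hh x) => _ [-> _]; rewrite XaE /P /X -!(star_homM hF) !mAM !eqxx.
  by rewrite u1l u1r.
have hS x i j e : h x (mA i j (SA e)) = X i ** w (circ x) (S e) ** adj (X j).
  by case: (hh x) => _ [_ ->].
have S0 i j e : X i ** S e ** adj (X j) = F (mA i j (SA e)).
  by rewrite XaE /S /X -!(star_homM hF) !mAM !eqxx u1l u1r.
have actP z i j v : `|z| = 1 -> act z (F (mA i j (PA v))) = F (mA i j (PA v)).
  by move=> z1; rewrite -eF // stab_gauge_P.
have actX z i : `|z| = 1 -> act z (X i) = X i.
  by move=> z1; rewrite /X -eF // stab_gauge_unit.
have actS z e : `|z| = 1 -> act z (S e) = z *: S e.
  by move=> z1; rewrite /S -eF // stab_gauge_S // (star_homZ hF).
apply: (htpy_gen E hact (h := h)) => //.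
- by move=> x z i j v z1; rewrite hP actP.
- move=> x z i j e z1; have az := hact z z1.
  rewrite hS !(star_homM az) (star_homV az) !actX // (star_homD az) (star_homZ az) (star_homM az) actS // pact //.
  by rewrite amulZr scalerA mulrC -scalerA -scalerDr amulZr amulZl.
- by move=> i j v; rewrite (funext (fun x => hP x i j v)); exact: contR_cst.
- move=> i j e; rewrite (funext (fun x => hS x i j e)).
  apply: contRM; last exact: contR_cst.
  apply: contRM; first exact: contR_cst.
  rewrite (_ : (fun x => _) = fun x => (S e - p ** S e) + circ x *: (circ x *: (p ** S e))).
    apply: contRD; first exact: contR_cst.
    by do 2![apply: contRZ; first exact: contC_circ]; exact: contR_cst.
  by apply: funext => x; rewrite /w scalerA; lmod.
- apply: (stab_gen_ext E (hC 0) hF) => // i j e.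
  by rewrite hS circ_le0 // /w mulr1 subrr scale0r addr0.
- apply: (stab_gen_ext E (hC 1) hG) => i j x; first by rewrite hP GP.
  by rewrite hS GS XaE; congr (_ ** _ ** _); rewrite circ_ge1 // /w sqi -/(S x); lmod.
Qed.

End Twist.

Section ChangeBijection.
Context {R : realType} {K : compact_operators R}.
Variable eps : nat -> nat -> K.
Hypothesis E : munits eps.
Context {V : finType} {A : V -> V -> nat} {OA : graph_algebra R A} {OAK : stabilization OA K}.
Context {W : finType} {B : W -> W -> nat} {OB : graph_algebra R B} {OBK : stabilization OB K}.
Notation mA := (mu OAK eps).
Notation PA := (vertex_proj OA).
Notation uA := (gunit OA).
Notation actA := (@stab_gauge _ _ _ _ _ OAK).
Notation mB := (mu OBK eps).
Notation QB := (vertex_proj OB).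
Notation actB := (@stab_gauge _ _ _ _ _ OBK).
Context {I : finType} {s : I -> V} {r : I -> W}.

Definition composable (q : I * edge B) : bool := r q.1 == edge_source q.2.

Definition preserves_ends (sigma : I * edge B -> I * edge B) : Prop := forall q,
  if composable q then
    [/\ composable (sigma q), s (sigma q).1 = s q.1 & edge_range (sigma q).2 = edge_range q.2]
  else sigma q = q.

Lemma path_bijection_perm (theta : edge A * I -> I * edge B) theta' (sigma : {perm I * edge B}) :
  path_bijection s r theta theta' -> preserves_ends sigma ->
  path_bijection s r (sigma \o theta) (theta' \o perm_inv sigma).
Proof.
move=> [th1 th2] hs; split=> [e f ef|g e' ge].
  have [h1 h2 h3 h4] := th1 e f ef; have := hs (theta (e, f)).
  by rewrite /composable h1 eqxx => -[/eqP c -> ->] /=; rewrite h2 h3 permK.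
have c : composable (perm_inv sigma (g, e')).
  apply/negPn/negP => nc; have := hs (perm_inv sigma (g, e')).
  by rewrite (negPf nc) permKV => gE; move: nc; rewrite -gE /composable /= ge eqxx.
have := th2 (perm_inv sigma (g, e')).1 (perm_inv sigma (g, e')).2 (eqP c).
by rewrite -surjective_pairing /= => -[-> ->]; rewrite permKV.
Qed.

Variable y : I -> nat -> OBK.
Hypothesis yF : frame eps r y.
Hypothesis y0 : degree0 y.
Notation b := (path_elt eps y).

(** With D the difference of the two path elements, p = D D^* / 2 is a projection and the reflection
    1 - 2 p exchanges them. It has degree 0 because D is homogeneous, and it commutes with the
    images of the p_v because both paths start at the same vertex. *)
Lemma transposition_htpy (theta : edge A * I -> I * edge B) theta' (x1 x2 : I * edge B) F G :
  path_bijection s r theta theta' -> x1 != x2 -> composable x1 -> composable x2 ->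
  s x1.1 = s x2.1 -> edge_range x1.2 = edge_range x2.2 ->
  implements eps s theta y F -> implements eps s (tperm x1 x2 \o theta) y G ->
  htpy actA actB F G.
Proof.
move=> th x12 c1 c2 sx rx iF iG.
have Fe := implements_equivariant E y0 iF.
case: iF iG => [hF FP FS] [hG GP GS].
pose D := b x1 0 - b x2 0; pose Q := mB 0 0 (QB (edge_range x1.2)).
have DQ : D ** Q = D.
  by rewrite /D amulBl /Q (path_elt_proj E) rx (path_elt_proj E).
have orth q q' : composable q -> adj (b q 0) ** b q' 0 = if q == q' then mB 0 0 (QB (edge_range q.2)) else 0.
  by move=> c; rewrite (path_elt_orth E yF) -/(composable q) c /= andbT.
have DD : adj D ** D = Q + Q.
  by rewrite /D adjB amulBl !amulBr !orth // !eqxx [x2 == x1]eq_sym (negPf x12) -rx -/Q; lmod.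
have Db q : composable q -> adj D ** b q 0 = if x1 == q then Q else if x2 == q then - Q else 0.
  move=> c; rewrite /D adjB amulBl !orth // -rx -/Q.
  case: (x1 =P q) => [<-|_]; first by rewrite eq_sym (negPf x12) subr0.
  by rewrite sub0r; case: (x2 == q); rewrite ?oppr0.
pose p := (2^-1 : R[i]) *: (D ** adj D).
have half : conjC (2^-1 : R[i]) = 2^-1 by rewrite fmorphV rmorph_nat.
have pp : p ** p = p.
  by rewrite /p amulZl amulZr amulA -(amulA D) DD amulDr DQ amulDl; lmod.
have pa : adj p = p by rewrite /p adjZ adjM adjK half.
have pb q : composable q -> b q 0 - 2%:R *: (p ** b q 0) = b (tperm x1 x2 q) 0.
  move=> c; rewrite /p amulZl scalerA mulfV ?pnatr_eq0 // scale1r -amulA Db //.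
  case: (x1 =P q) => [<-|n1]; first by rewrite tpermL DQ /D; by lmod.
  case: (x2 =P q) => [<-|n2]; first by rewrite tpermR amulNr DQ /D; by lmod.
  by rewrite amul0r subr0 tpermD //; exact/eqP.
have PD v : F (mA 0 0 (PA v)) ** D = if s x1.1 == v then D else 0.
  rewrite FP /D amulBr /path_elt !amulA !(frame_sum_adj yF) -sx.
  by case: eqP => _; rewrite ?amul0l ?subr0 // !(frame_proj E yF).
have X i : F (mA i 0 uA) = \sum_f y f i ** adj (y f 0).
  rewrite star_hom_mu_unit //.
  by rewrite [RHS](partition_big s xpredT) //; apply: eq_bigr => v _; exact: FP.
have Xy i f : F (mA i 0 uA) ** y f 0 = y f i by rewrite X (frame_sum_adj yF) (frame_proj E yF).
have yX j f : adj (y f 0) ** F (mA 0 j uA) = adj (y f j).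
  by rewrite -(Xy j) adjM -(star_homV hF) (muA OAK (munitsA E)) gunit_adj.
apply: (twist_htpy E (p := p)) => //.
- by move=> z z1; exact: stab_gauge_hom.
- move=> z z1; have az := stab_gauge_hom (OAK := OBK) z1.
  have aD : actB z D = z *: D.
    by rewrite /D (star_homB az) !degree0_path_elt // scalerBr.
  rewrite /p (star_homZ az) (star_homM az) (star_homV az) aD adjZ amulZl amulZr.
  by rewrite [z *: (_ *: _)]scalerA -normCK z1 expr1n scale1r.
- move=> v; have Pp : F (mA 0 0 (PA v)) ** p = if s x1.1 == v then p else 0.
    by rewrite /p amulZr amulA PD; case: eqP; rewrite ?amul0l ?scaler0.
  rewrite Pp -[LHS]adjK adjM pa -(star_homV hF) (muA OAK (munitsA E)).
  by rewrite (ckPa (graph_family OA)) Pp; case: eqP; rewrite ?adj0 ?pa.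
- by move=> i j v; rewrite FP GP.
- move=> i j e; rewrite GS FS amul_sumr scaler_sumr -sumrB amul_sumr amul_suml.
  apply: eq_bigr => f /eqP/esym fe; have [h1 _ _ _] := th.1 e f fe.
  rewrite [p ** _]amulA -amulZl -amulBl pb; last by rewrite /composable h1.
  by rewrite /path_elt !amulA Xy -!amulA yX.
Qed.

(** The two bijections differ by a permutation of the composable pairs that preserves both ends;
    transpositions are removed one at a time, by induction on the number of moved pairs. *)
Lemma change_bijection (theta : edge A * I -> I * edge B) theta' theta1 theta1' F G :
  path_bijection s r theta theta' -> path_bijection s r theta1 theta1' ->
  implements eps s theta y F -> implements eps s theta1 y G -> htpy actA actB F G.
Proof.
move=> th th1 iF iG.
suff key n (sigma : {perm I * edge B}) F' : preserves_ends sigma ->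
    (#|[pred q | sigma q != q]| < n)%N -> implements eps s (sigma \o theta) y F' ->
    htpy actA actB F F'.
  pose sg q := if composable q then theta1 (theta' q) else q.
  have cod q : composable q -> theta (theta' q) = q /\ edge_range (theta' q).1 = s (theta' q).2.
    by case: q => g e /eqP /th.2[h1 h2].
  have cod1 q : composable q -> composable (theta1 (theta' q)) /\ theta1' (theta1 (theta' q)) = theta' q.
    move=> /cod[_]; case: (theta' q) => e f /= /th1.1[h1 _ _ h4].
    by rewrite /composable h1.
  have sgI : injective sg.
    move=> q q'; rewrite /sg; case: ifP => c; case: ifP => c'.
    - move=> /(congr1 theta1'); rewrite (cod1 q c).2 (cod1 q' c').2 => /(congr1 theta).
      by rewrite (cod q c).1 (cod q' c').1.
    - by move=> qq'; move: c'; rewrite -qq' (cod1 q c).1.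
    - by move=> qq'; move: c; rewrite qq' (cod1 q' c').1.
    - by [].
  apply: (key _ (perm sgI) G _ (ltnSn _)).
    move=> q; case: ifP => c; rewrite permE /sg c //; have [h1 h2] := cod q c.
    have [c' _] := cod1 q c; split=> //.
      move: h1 h2 c'; case: (theta' q) => e f /= <- /[dup] ef /th1.1[_ -> _ _] _.
      by have [_ -> _ _] := th.1 e f ef.
    move: h1 h2 c'; case: (theta' q) => e f /= <- /[dup] ef /th1.1[_ _ -> _] _.
    by have [_ _ -> _] := th.1 e f ef.
  case: iG => hG GP GS; split=> // i j e; rewrite GS; apply: eq_bigr => f /eqP/esym ef /=.
  have [h1 _ _ h4] := th.1 e f ef.
  by rewrite permE /sg /composable h1 eqxx h4.
elim: n sigma F' => // n IH sigma F' hs.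
case: (pickP (fun q => sigma q != q)) => [x sx|fixs] hn iF'; last first.
  apply: (htpy_eq (f := F) (g := F)) => //; last first.
    by apply: htpy_refl; exact: (implements_equivariant E y0 iF).
  apply: (implements_ext E iF); case: iF' => h1 h2 h3; split=> // i j e.
  rewrite h3; apply: eq_bigr => f _ /=.
  by have /negPn/eqP -> := negbT (fixs (theta (e, f))).
have cx : composable x.
  by move: sx (hs x); case: ifP => // _ /eqP h /h.
have := hs x; rewrite cx => -[csx ssx rsx].
(* The product applies sigma first, so sigma' fixes x in addition to all fixed points of sigma. *)
pose sigma' : {perm I * edge B} := (sigma * tperm x (sigma x))%g.
have hs' : preserves_ends sigma'.
  move=> q; rewrite permM; have := hs q; case: ifP => [c [c' s' r']|c ->].
    case: tpermP => [e|e|_ _] //.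
      by split; rewrite ?ssx ?rsx // -e.
    move/perm_inj: e => e; subst q; by split.
  by rewrite tpermD //; apply: contraFneq c => <-.
have [F1 iF1] := implements_exists E (path_bijection_perm th hs') yF (OAK := OAK).
apply: (htpy_trans (g := F1)).
  rewrite ltnS in hn; apply: (IH sigma') => //; apply: leq_trans hn; apply: proper_card; apply/properP; split.
    apply/fintype.subsetP => q; rewrite !inE; apply: contraNneq => sq.
    rewrite permM sq tpermD //.
      by apply: contraNneq sx => ->; rewrite sq.
    apply: contraNneq sx => e; have /perm_inj qx : sigma q = sigma x by rewrite e sq.
    by rewrite e qx.
  by exists x; rewrite !inE // permM tpermR eqxx.
apply: (transposition_htpy (path_bijection_perm th hs') _ cx csx _ _ iF1 (x2 := sigma x)) => //.
- by rewrite eq_sym.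
case: iF' => h1 h2 h3; split=> // i j e; rewrite h3; apply: eq_bigr => f _ /=.
by rewrite permM tpermK.
Qed.

End ChangeBijection.

(** * Conjugation by isometries *)

Section Conjugation.
Context {R : realType} {K : compact_operators R}.
Variable eps : nat -> nat -> K.
Hypothesis E : munits eps.
Context {V : finType} {A : V -> V -> nat} {OA : graph_algebra R A} {OAK : stabilization OA K}.
Notation mA := (mu OAK eps).
Notation PA := (vertex_proj OA).
Notation SA := (edge_isom OA).
Notation uA := (gunit OA).
Notation actA := (@stab_gauge _ _ _ _ _ OAK).
Let mAM := muM OAK (munitsM E).
Let mAA := muA OAK (munitsA E).
Let CKA := graph_family OA.

Definition isometries (Z : nat -> OAK) : Prop :=
  forall i j, adj (Z i) ** Z j = if i == j then mA 0 0 uA else 0.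

(** Formally, F is conjugation by the isometry whose columns are the Z i, an element of the
    multiplier algebra. *)
Definition conj_hom (Z : nat -> OAK) (F : OAK -> OAK) : Prop :=
  star_hom F /\ forall i j a, F (mA i j a) = Z i ** mA 0 0 a ** adj (Z j).

Lemma conj_exists Z : isometries Z -> exists F, conj_hom Z F.
Proof.
move=> ZZ; have [||F hF FE] := stab_extension OAK (munitsM E) (munitsA E) (munitsN E) (munitsD E)
  (phi := mA 0 0) (X := Z); last by exists F.
  exact: mu_hom (munitsM E) (munitsA E) _.
move=> i j a; rewrite ZZ; case: eqP => _; last exact: amul0l.
by rewrite mAM eqxx u1l.
Qed.

Lemma isometry_unit Z i : isometries Z -> Z i ** mA 0 0 uA = Z i.
Proof.
move=> ZZ; apply/esym/eqP; rewrite -subr_eq0; apply/eqP; apply: adjM_eq0.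
rewrite adjB adjM mAA gunit_adj amulBl !amulBr -!amulA !(amulA _ (Z i)) ZZ eqxx.
by rewrite !mAM !eqxx !u1l subrr.
Qed.

Lemma isometry_unit_adj Z i : isometries Z -> mA 0 0 uA ** adj (Z i) = adj (Z i).
Proof. by move=> /(isometry_unit i) h; rewrite -[in RHS]h adjM mAA gunit_adj. Qed.

(** The bipartite graph of the identity matrix has one edge per vertex; an edge e moves past it
    unchanged. *)
Definition id_theta (p : edge A * V) : V * edge A := (edge_source p.1, p.1).
Definition id_theta' (q : V * edge A) : edge A * V := (q.2, edge_range q.2).

Lemma id_path_bijection : path_bijection id id id_theta id_theta'.
Proof. by split=> [e f|g e]; rewrite /id_theta /id_theta' /= => ->. Qed.

Definition conj_frame (Z : nat -> OAK) (v : V) (i : nat) : OAK := Z i ** mA 0 0 (PA v).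

Lemma conj_frameP Z : isometries Z -> frame eps id (conj_frame Z).
Proof.
move=> ZZ v i w j; rewrite /conj_frame adjM mAA (ckPa CKA) -amulA (amulA (adj (Z i))) ZZ.
case: (i == j); last by rewrite amul0l amul0r andbF.
by rewrite andbT !mAM !eqxx u1l (ckPP CKA); case: eqP; rewrite ?mu0.
Qed.

Lemma conj_implements Z F : isometries Z -> conj_hom Z F ->
  implements eps id id_theta (conj_frame Z) F.
Proof.
move=> ZZ [hF FE]; split=> // i j x.
  rewrite FE big_pred1_eq /conj_frame adjM mAA (ckPa CKA) -!amulA (amulA (mA _ _ _) (mA _ _ _)).
  by rewrite mAM eqxx (ckP CKA).
rewrite FE big_pred1_eq /path_elt /conj_frame adjM mAA (ckPa CKA) /id_theta /=.
have e1 : mA 0 0 (SA x) = mA 0 0 (PA (edge_source x)) ** mA 0 0 (SA x) ** mA 0 0 (PA (edge_range x)).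
  by rewrite !mAM !eqxx (ckPS CKA) eqxx (ckSP CKA).
by rewrite [in LHS]e1 !amulA.
Qed.

Definition degree0_seq (Z : nat -> OAK) : Prop := forall z i, `|z| = 1 -> actA z (Z i) = Z i.

Lemma conj_frame_degree0 Z : degree0_seq Z -> degree0 (conj_frame Z).
Proof.
move=> Z0 z v i z1; rewrite /conj_frame (star_homM (stab_gauge_hom z1)) Z0 //.
by rewrite stab_gauge_P.
Qed.

Lemma conj_path_htpy (Z : R -> nat -> OAK) F G :
  (forall x, isometries (Z x)) -> (forall x, degree0_seq (Z x)) ->
  (forall i, contR (fun x => Z x i)) -> conj_hom (Z 0) F -> conj_hom (Z 1) G -> htpy actA actA F G.
Proof.
move=> ZZ Z0 Zc hF hG; apply: (frame_path_htpy E id_path_bijection (y := fun x => conj_frame (Z x))).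
- by move=> x; exact: conj_frameP.
- by move=> x; exact: conj_frame_degree0.
- by move=> v i; apply: contRM => //; exact: contR_cst.
- exact: conj_implements.
- exact: conj_implements.
Qed.

Definition oddZ i : OAK := mA i.*2.+1 0 uA.
Definition evenZ i : OAK := mA i.*2 0 uA.

Lemma oddZ_isom : isometries oddZ.
Proof.
move=> i j; rewrite /oddZ mAA mAM gunit_adj u1l eqSS.
by rewrite (inj_eq double_inj).
Qed.

Lemma evenZ_isom : isometries evenZ.
Proof. by move=> i j; rewrite /evenZ mAA mAM gunit_adj u1l (inj_eq double_inj). Qed.

Lemma oddZ_evenZ i j : adj (oddZ i) ** evenZ j = 0.
Proof.
rewrite /oddZ /evenZ mAA mAM; case: eqP => // h.
by have := congr1 odd h; rewrite /= !odd_double.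
Qed.

Lemma degree0_unit z i j : `|z| = 1 -> actA z (mA i j uA) = mA i j uA.
Proof. exact: stab_gauge_unit. Qed.

(* The index i is moved to 2i+1 during the time interval [1/(i+2), 1/(i+1)]:
   once 0 < x only finitely many indices are unmoved, and 2i+1 has already left
   its place when i arrives there. *)
Definition progress (i : nat) (x : R) : R := (i.+1 * i.+2)%:R * x - i.+1%:R.

Definition idoddZ (x : R) (i : nat) : OAK :=
  (rotc (progress i x))%:C *: mA i 0 uA + (rots (progress i x))%:C *: mA i.*2.+1 0 uA.

Lemma progress_order i j x : (i < j)%N -> 0 < progress i x -> 1 <= progress j x.
Proof.
move=> ij; rewrite /progress !natrM.
have i0 : 0 <= i%:R :> R by exact: ler0n.
have ij' : (i%:R + 1 <= j%:R :> R) by rewrite natr1 ler_nat.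
rewrite -![_.+2%:R]natr1 -![_.+1%:R]natr1 => h.
have h1 : 1 < (i%:R + 1 + 1) * x by nra.
have h2 : 1 <= (j%:R + 1) * x by nra.
nra.
Qed.

Lemma idoddZ_isom x : isometries (idoddZ x).
Proof.
have key i j : (i < j)%N -> adj (idoddZ x i) ** idoddZ x j = 0.
  move=> ij; rewrite /idoddZ adjD !adjZ !conjC_re !mAA gunit_adj amulDl !amulDr !amulZl !amulZr !mAM.
  rewrite (ltn_eqF ij) eqSS (inj_eq double_inj) (ltn_eqF ij).
  rewrite (_ : (i == j.*2.+1) = false); last by apply/eqP; lia.
  have [p0|p0] := leP (progress i x) 0; first by rewrite (rots_le0 p0) !scale0r !scaler0 !addr0.
  by rewrite (rotc_ge1 (progress_order ij p0)) !scale0r !scaler0 !addr0.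
move=> i j; case: ltngtP => [ij|ij|<-]; first exact: key.
  by rewrite -[LHS]adjK adjM adjK key ?adj0.
rewrite /idoddZ adjD !adjZ !conjC_re !mAA gunit_adj amulDl !amulDr !amulZl !amulZr !mAM !eqxx u1l.
rewrite (_ : (i == i.*2.+1) = false); last by apply/eqP; lia.
rewrite (_ : (i.*2.+1 == i) = false); last by apply/eqP; lia.
rewrite !scaler0 addr0 add0r !scalerA -scalerDl -!rmorphM -rmorphD /=.
by rewrite rot_sq scale1r.
Qed.

Lemma id_conj : conj_hom (fun i => mA i 0 uA) id.
Proof. by split=> // i j a; rewrite mAA !mAM !eqxx gunit_adj u1l u1r. Qed.

(** Continuity is needed column by column only, so infinitely many rotations fit into the unit
    interval. [progress i] is -(i+1) at time 0 and (i+1)^2 at time 1. *)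
Lemma id_odd_htpy F : conj_hom oddZ F -> htpy actA actA id F.
Proof.
move=> hF; apply: (conj_path_htpy (Z := idoddZ)) => //.
- exact: idoddZ_isom.
- move=> x z i z1; have az := stab_gauge_hom (OAK := OAK) z1.
  by rewrite /idoddZ (star_homD az) !(star_homZ az) !degree0_unit.
- move=> i; have cp : contRR (progress i) by exact: cont_affine.
  apply: contRD; apply: contRZ; try exact: contR_cst.
    exact: (contC_real (contRR_comp cp cont_rotc)).
  exact: (contC_real (contRR_comp cp cont_rots)).
- rewrite (_ : idoddZ 0 = fun i => mA i 0 uA); first exact: id_conj.
  apply: funext => i; rewrite /idoddZ /progress mulr0 sub0r rotc_le0 ?rots_le0 ?oppr_le0 ?ler0n //.
  by rewrite scale1r scale0r addr0.
- rewrite (_ : idoddZ 1 = oddZ) //; apply: funext => i.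
  have p1 : 1 <= progress i 1.
    by rewrite /progress mulr1 -natrB ?leq_pmulr // ler1n subn_gt0; nia.
  by rewrite /idoddZ rotc_ge1 ?rots_ge1 // scale1r scale0r add0r.
Qed.

Lemma rotation_isom (Z Z' : nat -> OAK) x : isometries Z -> isometries Z' ->
  (forall i j, adj (Z i) ** Z' j = 0) ->
  isometries (fun i => (rotc x)%:C *: Z i + (rots x)%:C *: Z' i).
Proof.
move=> ZZ ZZ' o i j; have o' : adj (Z' i) ** Z j = 0 by rewrite -[LHS]adjK adjM adjK o adj0.
rewrite adjD !adjZ !conjC_re amulDl !amulDr !amulZl !amulZr ZZ ZZ' o o' !scaler0 addr0 add0r.
rewrite !scalerA -scalerDl -!rmorphM -rmorphD /= rot_sq scale1r.
by [].
Qed.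

Lemma contR_rotation (T : cstarAlgType R) (y y' : T) :
  contR (fun x => (rotc x)%:C *: y + (rots x)%:C *: y').
Proof.
apply: contRD; apply: contRZ; try exact: contR_cst.
  exact: (contC_real cont_rotc).
exact: (contC_real cont_rots).
Qed.

Lemma rotation0 (T : cstarAlgType R) (y y' : T) : (rotc 0)%:C *: y + (rots 0)%:C *: y' = y.
Proof. by rewrite rotc_le0 ?rots_le0 // scale1r scale0r addr0. Qed.

Lemma rotation1 (T : cstarAlgType R) (y y' : T) : (rotc 1)%:C *: y + (rots 1)%:C *: y' = y'.
Proof. by rewrite rotc_ge1 ?rots_ge1 // scale1r scale0r add0r. Qed.

Lemma odd_even_htpy F G : conj_hom oddZ F -> conj_hom evenZ G -> htpy actA actA F G.
Proof.
move=> hF hG; apply: (conj_path_htpy (Z := fun x i => (rotc x)%:C *: oddZ i + (rots x)%:C *: evenZ i)).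
- by move=> x; apply: rotation_isom; [exact: oddZ_isom|exact: evenZ_isom|exact: oddZ_evenZ].
- move=> x z i z1; have az := stab_gauge_hom (OAK := OAK) z1.
  by rewrite (star_homD az) !(star_homZ az) !degree0_unit.
- by move=> i; exact: contR_rotation.
- by rewrite (_ : (fun i => _) = oddZ) //; apply: funext => i; exact: rotation0.
- by rewrite (_ : (fun i => _) = evenZ) //; apply: funext => i; exact: rotation1.
Qed.

Lemma stab_closed_ind (X : set OAK) : closed X -> X 0 -> (forall x y, X x -> X y -> X (x + y)) ->
  (forall i j a, X (mA i j a)) -> forall x, X x.
Proof.
move=> /closedE_adh cX X0 XD Xm x; apply: cX => e /(mel_dense (munitsD E) x)[_ [N [a ->]] h].
exists (mel OAK eps N a) => //; rewrite /mel.
by elim/big_ind: _ => // i _; elim/big_ind: _ => // j _; exact: Xm.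
Qed.

Lemma conj_orthogonal Z Z' F F' x x' : conj_hom Z F -> conj_hom Z' F' ->
  (forall i j, adj (Z i) ** Z' j = 0) -> F x ** F' x' = 0.
Proof.
move=> [hF FE] [hF' FE'] o.
have step (T : cstarAlgType R) (f : OAK -> T) : lips f -> (forall x y, f (x + y) = f x + f y) ->
    (forall i j a, f (mA i j a) = 0) -> forall x, f x = 0.
  move=> lf fD f0 x0; have f00 : f 0 = 0 by apply: (@addrI _ (f 0)); rewrite -fD !addr0.
  suff : [set x | f x = 0] x0 by [].
  apply: stab_closed_ind => //=; last by move=> a b /= a0 b0; rewrite fD a0 b0 addr0.
  by apply: (closed_lips_eq lf (g := fun=> 0)); exists 1 => // a b; rewrite subrr nrm0 mul1r nrm_ge0.
pose f x0 := F x0 ** F' x'.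
apply: (step _ (fun x0 => F x0 ** F' x')).
- by apply: lips_comp (lips_mulr _); exact: lips_star_hom.
- by move=> a b; rewrite (star_homD hF) amulDl.
move=> i j a; apply: (step _ (fun x0 => F (mA i j a) ** F' x0)).
- by apply: lips_comp (lips_mull _); exact: lips_star_hom.
- by move=> b c; rewrite (star_homD hF') amulDr.
by move=> k l b; rewrite FE FE' -!amulA (amulA (adj (Z j))) o amul0l !amul0r.
Qed.

End Conjugation.

(** * Uniqueness up to homotopy *)

Section Uniqueness.
Context {R : realType} {K : compact_operators R}.
Variable eps : nat -> nat -> K.
Hypothesis E : munits eps.
Context {V : finType} {A : V -> V -> nat} {OA : graph_algebra R A} {OAK : stabilization OA K}.
Context {W : finType} {B : W -> W -> nat} {OB : graph_algebra R B} {OBK : stabilization OB K}.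
Notation actA := (@stab_gauge _ _ _ _ _ OAK).
Notation mB := (mu OBK eps).
Notation uB := (gunit OB).
Notation actB := (@stab_gauge _ _ _ _ _ OBK).
Let mBM := muM OBK (munitsM E).
Let mBA := muA OBK (munitsA E).

Section ConjComp.
Context {I : finType}.
Variables (s : I -> V) (r : I -> W).
Variables (theta : edge A * I -> I * edge B) (y : I -> nat -> OBK).
Hypothesis yF : frame eps r y.
Variables (Z : nat -> OBK) (G : OBK -> OBK).
Hypothesis ZZ : isometries eps Z.
Hypothesis hG : conj_hom eps Z G.
Notation Gy := (fun f i => G (y f i) ** Z 0).

Let Zmid (a : OB) : adj (Z 0) ** (Z 0 ** mB 0 0 a ** adj (Z 0)) ** Z 0 = mB 0 0 a.
Proof. by rewrite -!amulA ZZ eqxx !amulA ZZ eqxx !mBM eqxx u1l u1r. Qed.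

(** G moves the projections p_w of the corner under [Z 0]; the factor [Z 0] brings the initial
    projections back to the p_w themselves. *)
Lemma conj_frame_comp : frame eps r Gy.
Proof.
case: hG => sG GE f i g j /=.
rewrite adjM -(star_homV sG) -!amulA (amulA (G _)) -(star_homM sG) yF.
case: ifP => _; last by rewrite (star_hom0 sG) amul0l amul0r.
by rewrite GE amulA Zmid.
Qed.

Let Gout (x x' : OBK) (a : OB) : x ** mB 0 0 uB = x -> mB 0 0 uB ** x' = x' ->
  G x ** Z 0 ** mB 0 0 a ** (adj (Z 0) ** G x') = G (x ** mB 0 0 a ** x').
Proof.
case: hG => sG GE hx hx'; rewrite -{1}hx -{1}hx' !(star_homM sG) !GE.
rewrite !amulA -!(amulA _ (adj (Z 0)) (Z 0)) ZZ eqxx.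
do 2!rewrite -(amulA (G x) (Z 0)) (isometry_unit E 0 ZZ).
by do 2!rewrite -(amulA _ (mB 0 0 uB) (adj (Z 0))) (isometry_unit_adj E 0 ZZ).
Qed.

Lemma conj_comp_implements (F : OAK -> OBK) : implements eps s theta y F -> implements eps s theta Gy (G \o F).
Proof.
case: hG => sG GE [hF FP FS].
have hy f i : mB 0 0 uB ** adj (y f i) = adj (y f i).
  by rewrite -[in RHS](frame_unit E yF) adjM mBA gunit_adj.
split; first exact: star_hom_comp hF sG.
  move=> i j v; rewrite /= FP (star_hom_sum sG); apply: eq_bigr => f _.
  have := Gout uB (frame_unit E yF f i) (hy f j).
  rewrite (frame_unit E yF) => <-; rewrite adjM (star_homV sG) -!amulA; congr (_ ** _).
  by rewrite amulA (isometry_unit E 0 ZZ).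
move=> i j e; rewrite /= FS (star_hom_sum sG); apply: eq_bigr => f _.
by rewrite /path_elt -(Gout _ (frame_unit E yF _ i) (hy f j)) adjM (star_homV sG).
Qed.

Lemma conj_degree0 : degree0_seq Z -> degree0 y -> degree0 Gy.
Proof.
move=> Z0 y0 z f i z1.
have [_ eG] := implements_equivariant E (conj_frame_degree0 eps Z0) (conj_implements E ZZ hG).
by rewrite (star_homM (stab_gauge_hom z1)) Z0 // -eG // y0.
Qed.

End ConjComp.

(** Conjugations into the odd and into the even rows are both homotopic to the identity. Composing F
    with one and G with the other makes their frames orthogonal, and orthogonal frames are joined by
    a rotation. *)
Lemma same_bijection_htpy (I : finType) (s : I -> V) (r : I -> W) (theta : edge A * I -> I * edge B)
    theta' (y y' : I -> nat -> OBK) F G :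
  path_bijection s r theta theta' -> frame eps r y -> frame eps r y' -> degree0 y -> degree0 y' ->
  implements eps s theta y F -> implements eps s theta y' G -> htpy actA actB F G.
Proof.
move=> th yF yF' y0 y0' iF iG.
have [Go hGo] := conj_exists E (oddZ_isom E (OAK := OBK)).
have [Ge hGe] := conj_exists E (evenZ_isom E (OAK := OBK)).
have io := id_odd_htpy E hGo; have ie := htpy_trans io (odd_even_htpy E hGo hGe).
have eF := implements_equivariant E y0 iF; have eG := implements_equivariant E y0' iG.
have h1 : htpy actA actB F (Go \o F) by apply: htpy_eq (htpy_precomp eF io).
have h2 : htpy actA actB G (Ge \o G) by apply: htpy_eq (htpy_precomp eG ie).
apply: htpy_trans h1 _; apply: htpy_trans (htpy_sym h2).
have fo := conj_frame_comp yF (oddZ_isom E) hGo.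
have fe := conj_frame_comp yF' (evenZ_isom E) hGe.
have d0o : degree0_seq (oddZ (OAK := OBK) eps) by move=> z i z1; exact: degree0_unit.
have d0e : degree0_seq (evenZ (OAK := OBK) eps) by move=> z i z1; exact: degree0_unit.
have do' := conj_degree0 (oddZ_isom E) hGo d0o y0.
have de' := conj_degree0 (evenZ_isom E) hGe d0e y0'.
have imo := conj_comp_implements yF (oddZ_isom E) hGo iF.
have ime := conj_comp_implements yF' (evenZ_isom E) hGe iG.
pose Y f i := Go (y f i) ** oddZ (OAK := OBK) eps 0; pose Y' f i := Ge (y' f i) ** evenZ (OAK := OBK) eps 0.
have orth f i g j : adj (Y f i) ** Y' g j = 0.
  rewrite /Y /Y' adjM -(star_homV hGo.1) -amulA (amulA (Go _)) (conj_orthogonal E _ _ hGo hGe) ?amul0l ?amul0r //.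
  exact: oddZ_evenZ.
move: fo fe do' de' imo ime orth; rewrite -/Y -/Y'; move: Y Y' => Y Y' fo fe do' de' imo ime orth.
have orth' f i g j : adj (Y' f i) ** Y g j = 0 by rewrite -[LHS]adjK adjM adjK orth adj0.
apply: (frame_path_htpy E th (y := fun x f i => (rotc x)%:C *: Y f i + (rots x)%:C *: Y' f i)).
- move=> x f i g j; rewrite adjD !adjZ !conjC_re amulDl !amulDr !amulZl !amulZr fo fe orth orth'.
  by rewrite !scaler0 addr0 add0r !scalerA -scalerDl -!rmorphM -rmorphD /= rot_sq scale1r.
- by move=> x z f i z1; have az := stab_gauge_hom (OAK := OBK) z1; rewrite (star_homD az) !(star_homZ az) do' // de'.
- by move=> f i; exact: contR_rotation.
- by rewrite (_ : (fun f i => _) = Y) //; apply: funext => f; apply: funext => i; exact: rotation0.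
- by rewrite (_ : (fun f i => _) = Y') //; apply: funext => f; apply: funext => i; exact: rotation1.
Qed.

Definition mhom (M : V -> W -> nat) (F : OAK -> OBK) : Prop :=
  exists (I : finType) (s : I -> V) (r : I -> W) (theta : edge A * I -> I * edge B)
    (theta' : I * edge B -> edge A * I) (y : I -> nat -> OBK),
  [/\ forall v w, #|[pred f | (s f == v) && (r f == w)]| = M v w,
      path_bijection s r theta theta', frame eps r y, degree0 y & implements eps s theta y F].

Lemma mhom_equivariant M F : mhom M F -> equivariant_star_hom actA actB F.
Proof. by case=> I [s [r [th [th' [y [_ _ _ y0 iF]]]]]]; exact: (implements_equivariant E y0 iF). Qed.

(** The data of G are transported along a bijection of edges that respects both ends. Then the frame
    is changed with theta fixed, and theta with the frame fixed. *)
Lemma mhom_htpy M M' F G : M =2 M' -> mhom M F -> mhom M' G -> htpy actA actB F G.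
Proof.
move=> MM' [I [s [r [th [th' [y [cM pb yF y0 iF]]]]]]] [J [s' [r' [ph [ph' [y' [cM' pb' yF' y0' iG]]]]]]].
have [b [b' [bK bK' bE]]] : exists (b : I -> J) (b' : J -> I),
    [/\ cancel b b', cancel b' b & forall x, (s' (b x), r' (b x)) = (s x, r x)].
  apply: (@fiber_bijection I J _ (fun f => (s f, r f)) (fun f => (s' f, r' f))) => -[v w].
  transitivity (M v w); [rewrite -cM|rewrite MM' -cM']; apply: eq_card => f; rewrite !inE.
    by rewrite ?xpair_eqE.
  by rewrite ?xpair_eqE.
have sb f : s' (b f) = s f by case: (bE f).
have rb f : r' (b f) = r f by case: (bE f).
have sb' f : s (b' f) = s' f by rewrite -sb bK'.
have rb' f : r (b' f) = r' f by rewrite -rb bK'.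
pose ps (p : edge A * I) : I * edge B := (b' (ph (p.1, b p.2)).1, (ph (p.1, b p.2)).2).
pose ps' (q : I * edge B) : edge A * I := ((ph' (b q.1, q.2)).1, b' (ph' (b q.1, q.2)).2).
have pbs : path_bijection s r ps ps'.
  split=> [e f|g e'] /=.
    rewrite -sb => /pb'.1[h1 h2 h3 h4]; rewrite /ps /ps' /= rb' sb' h2 h3 rb bK'.
    by rewrite -surjective_pairing h4 /= bK h1.
  rewrite -rb => /pb'.2[h1 h2]; rewrite /ps /ps' /= sb' bK' h1.
  by rewrite -surjective_pairing h2 /= bK.
have byF : frame eps r (fun f => y' (b f)).
  by move=> f i g j; rewrite yF' rb (inj_eq (can_inj bK)).
have by0 : degree0 (fun f => y' (b f)) by move=> z f i; exact: y0'.
have iG' : implements eps s ps (fun f => y' (b f)) G.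
  case: iG => hG GP GS; split=> // i j x.
    rewrite GP (reindex b) /=; last by apply: onW_bij; exists b'.
    by apply: eq_bigl => f; rewrite sb.
  rewrite GS (reindex b) /=; last by apply: onW_bij; exists b'.
  by apply: eq_big => f; rewrite ?sb // /path_elt /ps /= bK'.
have [F1 iF1] := implements_exists E pb byF (OAK := OAK).
apply: htpy_trans (same_bijection_htpy pb yF byF y0 by0 iF iF1) _.
exact: (change_bijection E byF by0 pb pbs iF1 iG').
Qed.

End Uniqueness.

(** * Composition and products of matrices *)

Section Counting.
Context {V W U : finType}.

Lemma card_tagged (M : V -> W -> nat) v w :
  #|[pred f : {vw : V * W & 'I_(M vw.1 vw.2)} | ((tag f).1 == v) && ((tag f).2 == w)]| = M v w.
Proof.
rewrite -sum1_card.
transitivity (\sum_(vw : V * W | (vw.1 == v) && (vw.2 == w)) \sum_(j : 'I_(M vw.1 vw.2)) 1)%N.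
  by rewrite sig_big_dep /=; apply: eq_bigl => f; rewrite !inE andbT.
rewrite (big_pred1 (v, w)) => [|[v' w']]; last by rewrite ?xpair_eqE.
by rewrite sum1_card card_ord.
Qed.

Lemma card_paths (I J : finType) (s : I -> V) (r : I -> W) (s' : J -> W) (r' : J -> U)
    (M : V -> W -> nat) (N : W -> U -> nat) v w :
  (forall v w, #|[pred f | (s f == v) && (r f == w)]| = M v w) ->
  (forall v w, #|[pred f | (s' f == v) && (r' f == w)]| = N v w) ->
  #|[pred p : {p : I * J | p \in [pred p | r p.1 == s' p.2]} |
     (s (val p).1 == v) && (r' (val p).2 == w)]| = matmul M N v w.
Proof.
move=> cM cN; pose D := [pred p : I * J | r p.1 == s' p.2].
rewrite -sum1_card /matmul.
transitivity (\sum_(p in D | [pred p | (s p.1 == v) && (r' p.2 == w)] p) 1)%N.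
  by rewrite [RHS]big_sub_cond; apply: eq_bigl.
rewrite (partition_big (fun p : I * J => r p.1) xpredT) //=; apply: eq_bigr => u _.
rewrite -cM -cN -!sum1_card big_distrlr /= pair_big /= muln1; apply: eq_bigl => -[f g].
rewrite !inE /=; case: (r f =P u) => [->|]; rewrite ?andbF // !andbT.
by rewrite [u == _]eq_sym andbC -!andbA; congr (_ && _); rewrite andbC.
Qed.

End Counting.

Section Composition.
Context {R : realType} {K : compact_operators R}.
Variable eps : nat -> nat -> K.
Hypothesis E : munits eps.
Context {V : finType} {A : V -> V -> nat} {OA : graph_algebra R A} {OAK : stabilization OA K}.
Context {W : finType} {B : W -> W -> nat} {OB : graph_algebra R B} {OBK : stabilization OB K}.
Context {U : finType} {C : U -> U -> nat} {OC : graph_algebra R C} {OCK : stabilization OC K}.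
Notation mB := (mu OBK eps).
Notation mC := (mu OCK eps).

(** The edges of the product are the composable pairs (f, g), with frame F' (y_f) y'_g; an edge of A
    is moved past f by the first bijection, then past g by the second. *)
Lemma mhom_comp (M : V -> W -> nat) (N : W -> U -> nat) (F : OAK -> OBK) (F' : OBK -> OCK) :
  mhom eps M F -> mhom eps N F' -> mhom eps (matmul M N) (F' \o F).
Proof.
move=> [I [s [r [th [th' [y [cM pb yF y0 [hF FP FS]]]]]]]] mF'.
have [_ eF'] := mhom_equivariant E mF'.
case: mF' => [J [s' [r' [ph [ph' [y' [cN pb' yF' y0' [hF' FP' FS']]]]]]]].
pose D := [pred p : I * J | r p.1 == s' p.2].
pose Kc : finType := {p : I * J | p \in D}.
pose S (p : Kc) := s (val p).1; pose T (p : Kc) := r' (val p).2.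
(* The default of [insubd] is the pair at hand, as [Kc] might be empty; by [ThP] it is not taken on
   composable arguments. *)
pose Th (q : edge A * Kc) : Kc * edge C :=
  let q1 := th (q.1, (val q.2).1) in let q2 := ph (q1.2, (val q.2).2) in
  (insubd q.2 (q1.1, q2.1), q2.2).
pose Th' (q : Kc * edge C) : edge A * Kc :=
  let q2 := ph' ((val q.1).2, q.2) in let q1 := th' ((val q.1).1, q2.1) in
  (q1.1, insubd q.1 (q1.2, q2.2)).
have ThP e (p : Kc) : edge_range e = S p -> val (Th (e, p)).1 =
    ((th (e, (val p).1)).1, (ph ((th (e, (val p).1)).2, (val p).2)).1).
  case: p => -[f g] fg; rewrite /S /Th /= => ef; apply: insubdK; rewrite /D inE /=.
  have [h1 _ h3 _] := pb.1 e f ef.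
  have [_ h2' _ _] := pb'.1 _ g (etrans h3 (eqP fg)).
  by rewrite h1 h2'.
have PB : path_bijection S T Th Th'.
  split=> [e [[f g] fg]|[[f g] fg] e'].
    move=> ef; have vT := ThP e _ ef; move: ef vT; rewrite /S /T /Th' => /= ef vT; rewrite vT /=.
    have [h1 h2 h3 h4] := pb.1 e f ef.
    have [h1' h2' h3' h4'] := pb'.1 _ g (etrans h3 (eqP fg)).
    rewrite -surjective_pairing h4' /= -surjective_pairing h4; split=> //.
    by congr (_, _); apply: val_inj; rewrite insubdK.
  rewrite /T /S /= => ge.
  have [h1 h2] := pb'.2 _ _ ge.
  have := pb'.1 _ _ h1; rewrite -surjective_pairing h2 /= => -[_ h3 h4 _].
  have [k1 k2] := pb.2 f (ph' (g, e')).1 (etrans (eqP fg) h3).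
  have := pb.1 _ _ k1; rewrite -surjective_pairing k2 /= => -[_ _ k3 _].
  rewrite /Th' /=.
  have vi : val (insubd (exist _ (f, g) fg : Kc) ((th' (f, (ph' (g, e')).1)).2, (ph' (g, e')).2)) =
     ((th' (f, (ph' (g, e')).1)).2, (ph' (g, e')).2).
    by apply: insubdK; rewrite /D inE /= -k3 h1.
  rewrite vi /=; split=> //; rewrite /Th /= vi /= -surjective_pairing k2 /= -surjective_pairing h2.
  by congr (_, _); apply: val_inj; rewrite insubdK.
pose Y (p : Kc) i := F' (y (val p).1 i) ** y' (val p).2 0.
have YF : frame eps T Y.
  move=> [[f g] fg] i [[f' g'] fg'] j; rewrite /Y /T /= -val_eqE /= xpair_eqE.
  rewrite adjM -(star_homV hF') -!amulA (amulA (F' _)) -(star_homM hF') yF.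
  case: (f =P f') => [ff|_] /=; last by rewrite (star_hom0 hF') amul0l amul0r.
  case: (i == j); last by rewrite (star_hom0 hF') amul0l amul0r andbF.
  rewrite FP' (frame_sum_adj yF') -(eqP fg') -ff /= eqxx (frame_proj E yF') yF' eqxx.
  by rewrite !andbT.
exists Kc, S, T, Th, Th', Y; split=> //.
- by move=> v w; exact: card_paths.
- move=> z p i z1; have az := stab_gauge_hom (OAK := OCK) z1.
  by rewrite /Y (star_homM az) y0' // -eF' // y0.
- have mid f i f' j a : F' (y f i ** mB 0 0 a ** adj (y f' j)) = F' (y f i) ** F' (mB 0 0 a) ** adj (F' (y f' j)).
    by rewrite !(star_homM hF') (star_homV hF').
  split; first exact: star_hom_comp hF hF'.
    move=> i j v; rewrite /= FP (star_hom_sum hF').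
    rewrite -[RHS](@big_sub_cond _ _ _ _ D [pred p | s p.1 == v] (fun p => F' (y p.1 i) ** y' p.2 0 ** adj (F' (y p.1 j) ** y' p.2 0))) /=.
    transitivity (\sum_(f | s f == v) \sum_(g | s' g == r f) F' (y f i) ** y' g 0 ** adj (F' (y f j) ** y' g 0)).
      apply: eq_bigr => f _; rewrite -[y f i](frame_proj E yF) mid FP' amul_sumr amul_suml.
      rewrite (frame_proj E yF); apply: eq_bigr => g _; by rewrite adjM !amulA.
    rewrite pair_big_dep /=; apply: eq_bigl => -[f g]; rewrite !inE /= andbC; congr (_ && _).
    by rewrite eq_sym.
  move=> i j e; rewrite /= FS (star_hom_sum hF').
  transitivity (\sum_(f | s f == edge_range e) \sum_(g | s' g == r f)
     F' (y (th (e, f)).1 i) ** path_elt eps y' (ph ((th (e, f)).2, g)) 0 ** adj (F' (y f j) ** y' g 0)).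
    apply: eq_bigr => f /eqP/esym fe; have [_ _ h3 _] := pb.1 e f fe.
    rewrite /path_elt mid FS' h3 amul_sumr amul_suml.
    by apply: eq_bigr => g _; rewrite adjM !amulA.
  rewrite pair_big_dep /=.
  under [RHS]eq_bigr => p pe do rewrite /path_elt /Y (ThP e p (esym (eqP pe))) /=.
  rewrite -[RHS](@big_sub_cond _ _ _ _ D [pred p | s p.1 == edge_range e] (fun p => F' (y (th (e, p.1)).1 i) **
     y' (ph ((th (e, p.1)).2, p.2)).1 0 ** mC 0 0 (edge_isom OC (ph ((th (e, p.1)).2, p.2)).2) **
     adj (F' (y p.1 j) ** y' p.2 0))) /=.
  apply: eq_big => [[f g]|[f g] _]; first by rewrite !inE /= andbC; congr (_ && _); rewrite eq_sym.
  by rewrite /path_elt !amulA.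
Qed.

End Composition.

(** * Existence, and invertibility for powers of the matrix itself *)

Section Existence.
Context {R : realType} {K : compact_operators R}.
Variable eps : nat -> nat -> K.
Hypothesis E : munits eps.
Context {W : finType} {B : W -> W -> nat} {OB : graph_algebra R B} {OBK : stabilization OB K}.
Notation mB := (mu OBK eps).
Notation QB := (vertex_proj OB).
Notation TB := (edge_isom OB).
Notation uB := (gunit OB).
Notation actB := (@stab_gauge _ _ _ _ _ OBK).
Let mBM := muM OBK (munitsM E).
Let mBA := muA OBK (munitsA E).
Let CKB := graph_family OB.

(** The rows are cut into consecutive blocks of size #|I|, the block i having one row for each f. *)
Definition slot (I : finType) (f : I) (i : nat) : nat := (i * #|I| + enum_rank f)%N.

Lemma slot_eq (I : finType) (f g : I) i j : (slot f i == slot g j) = (f == g) && (i == j).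
Proof.
apply/eqP/andP => [h|[/eqP -> /eqP ->]//]; have I0 : (0 < #|I|)%N by apply/card_gt0P; exists f.
have m k (x : I) : (slot x k %% #|I|)%N = enum_rank x by rewrite /slot modnMDl modn_small.
have d k (x : I) : (slot x k %/ #|I|)%N = k by rewrite /slot divnMDl // divn_small ?addn0.
split; last by rewrite -(d i f) h d.
by apply/eqP/enum_rank_inj/val_inj; rewrite /= -(m i) h m.
Qed.

Definition slot_frame (I : finType) (r : I -> W) (f : I) (i : nat) : OBK :=
  mB (slot f i) 0 (QB (r f)).

Lemma slot_frameP (I : finType) (r : I -> W) : frame eps r (slot_frame r).
Proof.
move=> f i g j; rewrite /slot_frame mBA mBM slot_eq (ckPa CKB).
by case: ifP => // /andP[/eqP -> _]; rewrite (ckP CKB).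
Qed.

Lemma slot_frame_degree0 (I : finType) (r : I -> W) : degree0 (slot_frame r).
Proof. by move=> z f i z1; exact: stab_gauge_P. Qed.

Lemma path_bijection_exists (V : finType) (A : V -> V -> nat) (M : V -> W -> nat)
    (I : finType) (s : I -> V) (r : I -> W) :
  (forall w, exists w', B w w' != 0%N) -> (forall v, exists v', A v' v != 0%N) ->
  matmul A M =2 matmul M B -> (forall v w, #|[pred f | (s f == v) && (r f == w)]| = M v w) ->
  exists (theta : edge A * I -> I * edge B) theta', path_bijection s r theta theta'.
Proof.
move=> rows cols AM cM.
have cA v w : #|[pred e : edge A | (edge_source e == v) && (edge_range e == w)]| = A v w.
  exact: card_tagged.
have cB v w : #|[pred e : edge B | (edge_source e == v) && (edge_range e == w)]| = B v w.
  exact: card_tagged.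
(* [eb] and [ea] supply the arbitrary values of theta and theta' on pairs that do not compose. *)
have [eb _] : exists eb : W -> edge B, True.
  suff : forall w : W, exists e : edge B, True by move=> /choice[eb _]; exists eb.
  move=> w; have [w' ww'] := rows w; have k : (0 < B w w')%N by rewrite lt0n.
  by exists (Tagged (fun vw => 'I_(B vw.1 vw.2)) (i := (w, w')) (Ordinal k)).
have [ea _] : exists ea : V -> edge A, True.
  suff : forall v : V, exists e : edge A, True by move=> /choice[ea _]; exists ea.
  move=> v; have [v' vv'] := cols v; have k : (0 < A v' v)%N by rewrite lt0n.
  by exists (Tagged (fun vw => 'I_(A vw.1 vw.2)) (i := (v', v)) (Ordinal k)).
pose X : finType := {p : edge A * I | p \in [pred p | edge_range p.1 == s p.2]}.
pose Y : finType := {q : I * edge B | q \in [pred q | r q.1 == edge_source q.2]}.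
have [b [b' [bK b'K bE]]] : exists (b : X -> Y) (b' : Y -> X), [/\ cancel b b', cancel b' b &
    forall x, (s (val (b x)).1, edge_range (val (b x)).2) = (edge_source (val x).1, r (val x).2)].
  apply: (@fiber_bijection X Y _ (fun x => (edge_source (val x).1, r (val x).2))
    (fun y => (s (val y).1, edge_range (val y).2))) => -[v w].
  transitivity (matmul A M v w).
    by rewrite -(card_paths v w cA cM); apply: eq_card => x; rewrite !inE xpair_eqE.
  by rewrite AM -(card_paths v w cM cB); apply: eq_card => x; rewrite !inE ?xpair_eqE.
pose th (p : edge A * I) := if insub p is Some x then val (b x) else (p.2, eb (r p.2)).
pose th' (q : I * edge B) := if insub q is Some y then val (b' y) else (ea (s q.1), q.1).
exists th, th'; split=> [e f|g e'] h.
  have xin : (e, f) \in [pred p : edge A * I | edge_range p.1 == s p.2] by rewrite inE /= h.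
  rewrite /th insubT; set x := Sub _ _.
  have := valP (b x); rewrite inE => /eqP h1.
  have [h2 h3] := bE x; split=> //.
  by rewrite /th' valK bK.
have yin : (g, e') \in [pred q : I * edge B | r q.1 == edge_source q.2] by rewrite inE /= h.
rewrite /th' insubT; set y := Sub _ _.
have := valP (b' y); rewrite inE => /eqP h1; split=> //.
by rewrite /th valK b'K.
Qed.

Lemma mhom_exists (V : finType) (A : V -> V -> nat) (OA : graph_algebra R A) (OAK : stabilization OA K)
    (M : V -> W -> nat) :
  (forall w, exists w', B w w' != 0%N) -> (forall v, exists v', A v' v != 0%N) ->
  matmul A M =2 matmul M B -> exists F : OAK -> OBK, mhom eps M F.
Proof.
move=> rows cols AM.
pose I : finType := {vw : V * W & 'I_(M vw.1 vw.2)}.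
pose s (f : I) := (tag f).1; pose r (f : I) := (tag f).2.
have cM v w : #|[pred f | (s f == v) && (r f == w)]| = M v w by exact: card_tagged.
have [th [th' pb]] := path_bijection_exists rows cols AM cM.
have [F iF] := implements_exists E pb (slot_frameP r) (OAK := OAK).
by exists F, I, s, r, th, th', (slot_frame r); split=> //; [exact: slot_frameP|exact: slot_frame_degree0].
Qed.

Notation delta := (fun v w : W => (v == w) : nat).

Lemma conj_mhom Z (F : OBK -> OBK) : isometries eps Z -> degree0_seq Z -> conj_hom eps Z F -> mhom eps delta F.
Proof.
move=> ZZ Z0 hF; exists W, id, id, (@id_theta _ B), (@id_theta' _ B), (conj_frame eps Z); split.
- move=> v w; rewrite -sum1_card; case: (v =P w) => [<-|vw].
    by rewrite (big_pred1 v) // => f; rewrite !inE andbb.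
  by rewrite big_pred0 // => f; rewrite !inE; apply/negP => /andP[/eqP fv /eqP fw]; case: vw; rewrite -fv -fw.
- exact: id_path_bijection.
- exact: conj_frameP.
- exact: conj_frame_degree0.
- exact: conj_implements.
Qed.

Lemma id_mhom : mhom eps delta (@id OBK).
Proof.
apply: (conj_mhom (Z := fun i => mB i 0 uB)) => //; last exact: id_conj.
  by move=> i j; rewrite mBA mBM gunit_adj u1l.
by move=> z i z1; exact: degree0_unit.
Qed.

Lemma conj_htpy_id Z (F : OBK -> OBK) : isometries eps Z -> degree0_seq Z -> conj_hom eps Z F -> htpy actB actB F id.
Proof. by move=> ZZ Z0 hF; exact: (mhom_htpy E _ (conj_mhom ZZ Z0 hF) id_mhom). Qed.

Lemma conj_equivariant Z F (c : R[i] -> R[i]) : conj_hom eps Z F ->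
  (forall z, `|z| = 1 -> c z * conjC (c z) = 1) ->
  (forall z i, `|z| = 1 -> actB z (Z i) = c z *: Z i) -> equivariant_star_hom actB actB F.
Proof.
move=> [hF FE] c1 cZ; split=> // z z1 x; have az := stab_gauge_hom (OAK := OBK) z1.
apply: (stab_hom_ext (munitsD E) (star_hom_comp az hF) (star_hom_comp hF az)) => i j a /=.
rewrite stab_gauge_mu // !FE !(star_homM az) (star_homV az) !cZ // stab_gauge_mu //.
by rewrite adjZ !amulZl amulZr scalerA c1 // scale1r.
Qed.

Lemma conj_comp (Z Z' : nat -> OBK) (F F' : OBK -> OBK) : isometries eps Z -> isometries eps Z' ->
  conj_hom eps Z F -> conj_hom eps Z' F' ->
  isometries eps (fun i => F' (Z i) ** Z' 0) /\ conj_hom eps (fun i => F' (Z i) ** Z' 0) (F' \o F).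
Proof.
move=> ZZ ZZ' [hF FE] [hF' FE']; split.
  move=> i j; rewrite adjM -(star_homV hF') -amulA (amulA (F' _)) -(star_homM hF') ZZ.
  case: eqP => _; last by rewrite (star_hom0 hF') amul0l amul0r.
  by rewrite FE' -!amulA ZZ' eqxx !amulA ZZ' eqxx !mBM eqxx !u1l.
split; first exact: star_hom_comp.
move=> i j a; rewrite /= FE !(star_homM hF') FE' adjM (star_homV hF').
by rewrite -!amulA.
Qed.

(** Z T_g = y_g, so conjugation by Z turns p_v, the sum of the T_f T_f^*, into the sum of the y_f
    y_f^*: it is the homomorphism of B, with the edges of B as index set and the identity as
    bijection of paths. The adjoints T_f^* give degree -1. *)
Lemma shift_down : exists Z, [/\ isometries eps Z,
  forall z i, `|z| = 1 -> actB z (Z i) = conjC z *: Z i &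
  forall F, conj_hom eps Z F -> mhom eps B F].
Proof.
pose r : edge B -> W := @edge_range _ B.
pose y := slot_frame r.
have yF : frame eps r y by exact: slot_frameP.
pose Z i := \sum_f y f i ** mB 0 0 (adj (TB f)).
have yZ f i j : adj (y f i) ** Z j = if i == j then mB 0 0 (adj (TB f)) else 0.
  rewrite /Z amul_sumr (bigD1 f) //= big1 ?addr0 => [|g /negPf gf]; rewrite amulA yF ?eqxx.
    by case: eqP => _; rewrite ?amul0l // mBM eqxx (ckPSa CKB).
  by rewrite eq_sym gf amul0l.
have ZZ : isometries eps Z.
  move=> i j; rewrite {1}/Z adj_sum amul_suml.
  under eq_bigr => f _ do rewrite adjM mBA adjK -amulA yZ.
  case: eqP => _; last by rewrite big1 // => f _; rewrite amul0r.
  rewrite /gunit mu_sum (partition_big (@edge_source _ B) xpredT) //=.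
  apply: eq_bigr => v _; rewrite (ckPsum CKB) mu_sum; apply: eq_bigr => f _.
  by rewrite mBM eqxx.
exists Z; split=> //.
  move=> z i z1; have az := stab_gauge_hom (OAK := OBK) z1.
  rewrite (star_hom_sum az) scaler_sumr; apply: eq_bigr => f _.
  rewrite (star_homM az) (slot_frame_degree0 _ _ _ z1) -mBA (star_homV az) stab_gauge_S //.
  by rewrite adjZ amulZr.
move=> F [hF FE]; exists (edge B), (@edge_source _ B), r, id, id, y; split=> //.
- by move=> v w; exact: card_tagged.
- exact: slot_frame_degree0.
have Zy j g : Z j ** mB 0 0 (TB g) = y g j.
  rewrite /Z amul_suml (bigD1 g) //= big1 ?addr0 => [|f /negPf fg]; rewrite -amulA mBM eqxx (ckSaS CKB).
    by rewrite eqxx (frame_proj E yF).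
  by rewrite fg mu0 amul0r.
have yZa j g : mB 0 0 (adj (TB g)) ** adj (Z j) = adj (y g j) by rewrite -mBA -adjM Zy.
split=> // i j x.
  rewrite FE (ckPsum CKB) mu_sum amul_sumr amul_suml; apply: eq_bigr => f _.
  have -> : mB 0 0 (TB f ** adj (TB f)) = mB 0 0 (TB f) ** mB 0 0 (adj (TB f)) by rewrite mBM eqxx.
  by rewrite amulA Zy -amulA yZa.
rewrite FE -(ckSP CKB x) (ckPsum CKB) amul_sumr mu_sum amul_sumr amul_suml; apply: eq_bigr => f _.
have -> : mB 0 0 (TB x ** (TB f ** adj (TB f))) = mB 0 0 (TB x) ** mB 0 0 (TB f) ** mB 0 0 (adj (TB f)).
  by rewrite !mBM !eqxx amulA.
by rewrite !amulA Zy -!amulA yZa.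
Qed.

(** One edge ending at each vertex suffices: the initial projections add up to the unit, and the
    slots keep the ranges apart. *)
Lemma shift_up : (forall v, exists v', B v' v != 0%N) -> exists Z, isometries eps Z /\
  forall z i, `|z| = 1 -> actB z (Z i) = z *: Z i.
Proof.
move=> cols; have [ev evP] : exists ev : W -> edge B, forall v, edge_range (ev v) = v.
  suff H : forall v : W, exists e : edge B, edge_range e = v by have [ev h] := choice H; exists ev.
  move=> v.
  have [v' vv'] := cols v; have k : (0 < B v' v)%N by rewrite lt0n.
  by exists (Tagged (fun vw => 'I_(B vw.1 vw.2)) (i := (v', v)) (Ordinal k)).
pose Z i := \sum_v mB (slot v i) 0 (TB (ev v)); exists Z; split.
  move=> i j; rewrite /Z adj_sum amul_suml /gunit mu_sum.
  transitivity (\sum_v (if i == j then mB 0 0 (QB v) else 0)); last first.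
    by case: eqP => // _; rewrite big1.
  apply: eq_bigr => v _; rewrite mBA amul_sumr (bigD1 v) //= big1 ?addr0 => [|w /negPf wv].
    by rewrite mBM slot_eq eqxx (ckSS CKB) evP.
  by rewrite mBM slot_eq eq_sym wv.
move=> z i z1; rewrite (star_hom_sum (stab_gauge_hom z1)) scaler_sumr; apply: eq_bigr => v _.
exact: stab_gauge_S.
Qed.

Definition hinvertible (F : OBK -> OBK) : Prop := equivariant_star_hom actB actB F /\
  exists G, [/\ equivariant_star_hom actB actB G, htpy actB actB (G \o F) id &
    htpy actB actB (F \o G) id].

Lemma hinvertible_id : hinvertible id.
Proof.
have h : equivariant_star_hom actB actB (@id OBK) by [].
by split=> //; exists id; split=> //; apply: htpy_refl.
Qed.

Lemma hinvertible_comp F F' : hinvertible F -> hinvertible F' -> hinvertible (F' \o F).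
Proof.
move=> [eF [G [eG h1 h2]]] [eF' [G' [eG' h1' h2']]]; split; first exact: equivariant_comp eF eF'.
exists (G \o G'); split; first exact: equivariant_comp eG' eG.
  apply: htpy_trans h1; apply: (htpy_precomp (g := (G \o (G' \o F'))) (g' := G) eF).
  exact: (htpy_postcomp eG h1').
apply: htpy_trans h2'; apply: (htpy_precomp (g := (F' \o (F \o G))) (g' := F') eG').
exact: (htpy_postcomp eF' h2).
Qed.

(** Conjugation by homogeneous isometries is equivariant since the factors z and its conjugate
    cancel. The composites of the two conjugations, of degrees -1 and 1, are conjugations of degree
    0, hence homotopic to the identity. *)
Lemma hinvertible_adjacency : (forall v, exists v', B v' v != 0%N) ->
  exists2 F, mhom eps B F & hinvertible F.
Proof.
move=> cols; have [Z [ZZ Zd ZF]] := shift_down; have [Z' [ZZ' Zd']] := shift_up cols.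
have [F hF] := conj_exists E ZZ; have [F' hF'] := conj_exists E ZZ'.
have nz z : `|z| = 1 -> z * conjC z = 1 :> R[i] by move=> z1; rewrite -normCK z1 expr1n.
have eF' : equivariant_star_hom actB actB F' by apply: (conj_equivariant hF' (c := id)).
have eF : equivariant_star_hom actB actB F.
  by apply: (conj_equivariant hF (c := conjC)) => // z z1; rewrite conjCK mulrC nz.
exists F; first exact: ZF.
split=> //; exists F'; split=> //.
  have [i1 i2] := conj_comp ZZ ZZ' hF hF'; apply: conj_htpy_id i1 _ i2.
  move=> z i z1; have az := stab_gauge_hom (OAK := OBK) z1.
  rewrite (star_homM az) -eF'.2 // Zd // Zd' // (star_homZ eF'.1) amulZl amulZr scalerA mulrC.
  by rewrite nz // scale1r.
have [i1 i2] := conj_comp ZZ' ZZ hF' hF; apply: conj_htpy_id i1 _ i2.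
move=> z i z1; have az := stab_gauge_hom (OAK := OBK) z1.
rewrite (star_homM az) -eF.2 // Zd // Zd' // (star_homZ eF.1) amulZl amulZr scalerA.
by rewrite nz // scale1r.
Qed.

Lemma hinvertible_matpow m : (forall v, exists v', B v' v != 0%N) ->
  exists2 F, mhom eps (matpow B m) F & hinvertible F.
Proof.
move=> cols; have [F mF iF] := hinvertible_adjacency cols.
elim: m => [|m [G mG iG]]; first by exists id; [exact: id_mhom|exact: hinvertible_id].
by exists (G \o F); [exact: (mhom_comp E mF mG)|exact: hinvertible_comp].
Qed.

End Existence.

Lemma shift_equivalent_homotopy {R : realType} {V W : finType}
    {A : V -> V -> nat} {B : W -> W -> nat} {OA : graph_algebra R A} {OB : graph_algebra R B}
    {K : compact_operators R} {OAK : stabilization OA K} {OBK : stabilization OB K} :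
  essential A -> essential B -> shift_equivalent A B ->
  stably_equivariantly_homotopy_equivalent OAK OBK.
Proof.
move=> [rowA colA] [rowB colB] [m _ [M [N [AM BM BN AMB]]]].
have [eps E0] := matrix_units K; have {E0}E : munits eps by case: E0.
have [tau mt] := mhom_exists E OAK (OBK := OBK) rowB colA AMB.
have BN' : matmul B N =2 matmul N A by [].
have [rho mr] := mhom_exists E OBK (OBK := OAK) rowA colB BN'.
have et := mhom_equivariant E mt; have er := mhom_equivariant E mr.
have [FA mA [eFA [GA [eGA gA1 gA2]]]] := hinvertible_matpow E (OBK := OAK) m colA.
have [FB mB [eFB [GB [eGB gB1 gB2]]]] := hinvertible_matpow E (OBK := OBK) m colB.
have rt := mhom_htpy E (fun v w => esym (AM v w)) (mhom_comp E mt mr) mA.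
have tr := mhom_htpy E (fun v w => esym (BM v w)) (mhom_comp E mr mt) mB.
(* Up to homotopy [L] is a left inverse of tau and [Rr] a right inverse, so they are homotopic, both
   being homotopic to L tau Rr. *)
pose L := GA \o rho; pose Rr := rho \o GB.
have eL : equivariant_star_hom (@stab_gauge _ _ _ _ _ OBK) (@stab_gauge _ _ _ _ _ OAK) L.
  exact: equivariant_comp er eGA.
have hL := htpy_trans (htpy_postcomp eGA rt) gA1.
have hR := htpy_trans (htpy_precomp eGB tr) gB2.
have LR := htpy_trans (htpy_sym (htpy_postcomp eL hR)) (htpy_precomp (equivariant_comp eGB er) hL).
exists tau, L; split=> //; apply: htpy_equiv; last exact: hL.
exact: htpy_trans (htpy_postcomp et LR) hR.
Qed.

(** * Equivalence of families of projections *)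

Section Relation.
Context {R : realType}.

Section OneAlgebra.
Context {T : cstarAlgType R}.
Variable act : R[i] -> T -> T.
Hypothesis act_hom : forall z, `|z| = 1 -> star_hom (act z).

(* Murray-von Neumann equivalence, by elements of degree d, of the direct sums
   of two families of idempotents. *)
Definition rel (d : int) (I J : finType) (p : I -> T) (q : J -> T) : Prop :=
  exists (u : I -> J -> T) (u' : J -> I -> T),
  [/\ forall z i j, `|z| = 1 -> act z (u i j) = (z ^ d) *: u i j,
      forall z i j, `|z| = 1 -> act z (u' j i) = (z ^ (- d)) *: u' j i,
      forall i k, \sum_j u i j ** u' j k = if i == k then p i else 0 &
      forall j l, \sum_i u' j i ** u i l = if j == l then q j else 0].

Definition idem (I : finType) (p : I -> T) : Prop := forall i, p i ** p i = p i.

Lemma rel_sym d (I J : finType) (p : I -> T) (q : J -> T) : rel d p q -> rel (- d) q p.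
Proof.
case=> u [u' [h1 h2 h3 h4]]; exists u', u; split=> // z i j z1; first exact: h2.
by rewrite opprK; exact: h1.
Qed.

(** The entries of u and u' are not assumed to be cut down by p and q. Inserting q = u' u gives (u
    u')^2 = p^2 = p, which is what transitivity needs. *)
Lemma rel_mid (I J : finType) (p : I -> T) (q : J -> T) (u : I -> J -> T) (u' : J -> I -> T) : idem p ->
  (forall i k, \sum_j u i j ** u' j k = if i == k then p i else 0) ->
  (forall j l, \sum_i u' j i ** u i l = if j == l then q j else 0) ->
  forall i k, \sum_j u i j ** q j ** u' j k = if i == k then p i else 0.
Proof.
move=> pp h3 h4 i k.
transitivity (\sum_j \sum_l (u i j ** (\sum_m u' j m ** u m l) ** u' l k)).
  apply: eq_bigr => j _; rewrite (bigD1 j) //= h4 eqxx big1 ?addr0 // => l lj.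
  by rewrite h4 eq_sym (negPf lj) amul0r amul0l.
transitivity (\sum_m (\sum_j u i j ** u' j m) ** (\sum_l u m l ** u' l k)).
  under eq_bigr => j _ do under eq_bigr => l _ do rewrite amul_sumr amul_suml.
  under [RHS]eq_bigr => m _ do rewrite amul_suml.
  under [RHS]eq_bigr => m _ do under eq_bigr => j _ do rewrite amul_sumr.
  under eq_bigr => j _ do rewrite exchange_big /=.
  rewrite exchange_big; apply: eq_bigr => m _; apply: eq_bigr => j _; apply: eq_bigr => l _.
  by rewrite !amulA.
under eq_bigr => m _ do rewrite !h3.
rewrite (bigD1 i) //= big1 ?addr0 => [|m mi]; last by rewrite eq_sym (negPf mi) amul0l.
by rewrite eqxx; case: (i == k); rewrite ?pp ?amul0r.
Qed.

Lemma rel_trans_half (I J L : finType) (p : I -> T) (q : J -> T) (r : L -> T) u u' v v' :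
  (forall i k, \sum_j u i j ** q j ** u' j k = if i == k then p i else 0) ->
  (forall j l, \sum_k v j k ** v' k l = if j == l then q j else 0) ->
  forall (i l : I), \sum_(k : L) (\sum_(j : J) u i j ** v j k) ** (\sum_j v' k j ** u' j l) =
    if i == l then p i else 0.
Proof.
move=> h3 h4 i l; rewrite -h3.
transitivity (\sum_j \sum_j' u i j ** (\sum_k v j k ** v' k j') ** u' j' l).
  under eq_bigr => k _ do rewrite amul_suml.
  rewrite exchange_big; apply: eq_bigr => j _ /=.
  under eq_bigr => k _ do rewrite amul_sumr.
  rewrite exchange_big; apply: eq_bigr => j' _ /=.
  by rewrite amul_sumr amul_suml; apply: eq_bigr => k _; rewrite !amulA.
apply: eq_bigr => j _; rewrite (bigD1 j) //= h4 eqxx big1 ?addr0 // => j' jj.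
by rewrite h4 eq_sym (negPf jj) amul0r amul0l.
Qed.

Lemma rel_trans d d' (I J L : finType) (p : I -> T) (q : J -> T) (r : L -> T) :
  idem p -> idem r -> rel d p q -> rel d' q r -> rel (d + d') p r.
Proof.
move=> pp rr [u [u' [h1 h2 h3 h4]]] [v [v' [k1 k2 k3 k4]]].
have z0 (z : R[i]) : `|z| = 1 -> z != 0 by move=> z1; rewrite -normr_eq0 z1 oner_eq0.
exists (fun i k => \sum_j u i j ** v j k), (fun k i => \sum_j v' k j ** u' j i); split.
- move=> z i k z1; have az := act_hom z1; rewrite (star_hom_sum az) scaler_sumr; apply: eq_bigr => j _.
  by rewrite (star_homM az) h1 // k1 // amulZl amulZr scalerA expfzDr ?z0.
- move=> z i k z1; have az := act_hom z1; rewrite (star_hom_sum az) scaler_sumr; apply: eq_bigr => j _.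
  by rewrite (star_homM az) h2 // k2 // amulZl amulZr scalerA opprD [- d - d']addrC expfzDr ?z0.
- exact: (rel_trans_half r (rel_mid pp h3 h4) k3).
- exact: (rel_trans_half p (rel_mid rr k4 k3) h4).
Qed.

Lemma rel_bij (I J : finType) (p : I -> T) (q : J -> T) (b : I -> J) (b' : J -> I) :
  idem p -> (forall z i, `|z| = 1 -> act z (p i) = p i) -> cancel b b' -> cancel b' b ->
  (forall i, q (b i) = p i) -> rel 0 p q.
Proof.
move=> pp p0 bK b'K qb.
exists (fun i j => if b i == j then p i else 0), (fun j i => if b i == j then p i else 0); split.
- move=> z i j z1; rewrite expr0z scale1r; case: eqP => _; first exact: p0.
  exact: (star_hom0 (act_hom z1)).
- move=> z i j z1; rewrite oppr0 expr0z scale1r; case: eqP => _; first exact: p0.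
  exact: (star_hom0 (act_hom z1)).
- move=> i k; rewrite (bigD1 (b i)) //= eqxx big1 ?addr0.
    by rewrite (can_eq bK) eq_sym; case: eqP => [->|_]; rewrite ?pp ?amul0r.
  by move=> j ji; rewrite eq_sym (negPf ji) amul0l.
- move=> j l; rewrite (bigD1 (b' j)) //= b'K eqxx big1 ?addr0.
    by case: (j == l); rewrite ?amul0r // pp -qb b'K.
  by move=> i ij; rewrite (can2_eq bK b'K) (negPf ij) amul0l.
Qed.

Lemma rel_refl (I : finType) (p : I -> T) : idem p -> (forall z i, `|z| = 1 -> act z (p i) = p i) -> rel 0 p p.
Proof. by move=> pp p0; apply: (rel_bij (b := id) (b' := id)). Qed.

Lemma rel_sum d (I : finType) (p : I -> T) (J : I -> finType) (q : forall i, J i -> T) :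
  (forall i, rel d (fun _ : unit => p i) (q i)) ->
  rel d p (fun x : {i : I & J i} => q (tag x) (tagged x)).
Proof.
move=> h.
have h' i : exists uu : (J i -> T) * (J i -> T),
    [/\ forall z j, `|z| = 1 -> act z (uu.1 j) = (z ^ d) *: uu.1 j,
      forall z j, `|z| = 1 -> act z (uu.2 j) = (z ^ (- d)) *: uu.2 j,
      \sum_j uu.1 j ** uu.2 j = p i &
      forall j l, uu.2 j ** uu.1 l = if j == l then q i j else 0].
  have [u [u' [h1 h2 h3 h4]]] := h i; exists (u tt, u'^~ tt); split=> /=.
  - by move=> z j; exact: h1.
  - by move=> z j; exact: h2.
  - exact: (h3 tt tt).
  - by move=> j l; rewrite -h4 (big_pred1 tt) // => -[].
have [w hw] : exists w : forall i, (J i -> T) * (J i -> T), forall i,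
    [/\ forall z j, `|z| = 1 -> act z ((w i).1 j) = (z ^ d) *: (w i).1 j,
      forall z j, `|z| = 1 -> act z ((w i).2 j) = (z ^ (- d)) *: (w i).2 j,
      \sum_j (w i).1 j ** (w i).2 j = p i &
      forall j l, (w i).2 j ** (w i).1 l = if j == l then q i j else 0].
  by exists (fun i => projT1 (cid (h' i))) => i; exact: (projT2 (cid (h' i))).
exists (fun i x => if i == tag x then (w (tag x)).1 (tagged x) else 0).
exists (fun x i => if i == tag x then (w (tag x)).2 (tagged x) else 0); split.
- move=> z i x z1; case: eqP => _; first by case: (hw (tag x)) => ->.
  by rewrite scaler0 (star_hom0 (act_hom z1)).
- move=> z i x z1; case: eqP => _; first by case: (hw (tag x)) => _ ->.
  by rewrite scaler0 (star_hom0 (act_hom z1)).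
- move=> i k.
  transitivity (\sum_i' \sum_(j : J i') (if i == i' then (w i').1 j else 0) ** (if k == i' then (w i').2 j else 0)).
    by rewrite sig_big_dep.
  rewrite (bigD1 i) //= [X in _ + X]big1 ?addr0.
    case: (hw i) => _ _ <- _; rewrite eqxx eq_sym; case: (i == k) => //.
    by rewrite big1 // => j _; rewrite amul0r.
  by move=> i' ii; rewrite big1 // => j _; rewrite eq_sym (negPf ii) amul0l.
- move=> [i j] [i' j'] /=; rewrite (bigD1 i) //= eqxx big1 ?addr0; last first.
    by move=> k /negPf ->; rewrite amul0l.
  case: (i =P i') => [ii|ii]; last first.
    rewrite amul0r; case: eqP => // /(congr1 (@tag _ _)) /=.
    by [].
  by subst i'; case: (hw i) => _ _ _ ->; rewrite eq_Tagged.
Qed.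

End OneAlgebra.

Lemma rel_hom {T T' : cstarAlgType R} (act : R[i] -> T -> T) (act' : R[i] -> T' -> T') (F : T -> T')
    d (I J : finType) (p : I -> T) (q : J -> T) :
  equivariant_star_hom act act' F -> rel act d p q -> rel act' d (F \o p) (F \o q).
Proof.
move=> [hF eF] [u [u' [h1 h2 h3 h4]]]; exists (fun i j => F (u i j)), (fun j i => F (u' j i)); split=> /=.
- by move=> z i j z1; rewrite -eF // h1 // (star_homZ hF).
- by move=> z i j z1; rewrite -eF // h2 // (star_homZ hF).
- move=> i k; under eq_bigr => j _ do rewrite -(star_homM hF).
  by rewrite -(star_hom_sum hF) h3; case: eqP => // _; rewrite (star_hom0 hF).
- move=> j l; under eq_bigr => i _ do rewrite -(star_homM hF).
  by rewrite -(star_hom_sum hF) h4; case: eqP => // _; rewrite (star_hom0 hF).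
Qed.

End Relation.

(** * Elements of degree zero *)

Section Span.
Context {R : realType} {T : normedModType R[i]}.

Definition lspan (P : set T) : set T := [set a | exists n (c : 'I_n -> R[i]) (m : 'I_n -> T),
  (forall i, P (m i)) /\ a = \sum_i c i *: m i].

Lemma lspan0 P : lspan P 0.
Proof. by exists 0%N, (fun=> 0), (fun=> 0); split=> [[]//|]; rewrite big_ord0. Qed.

Lemma lspanD P a b : lspan P a -> lspan P b -> lspan P (a + b).
Proof.
move=> [n [c [m [hm ->]]]] [k [c' [m' [hm' ->]]]].
exists (n + k)%N, (fun i : 'I_(n + k) => match fintype.split i with inl x => c x | inr x => c' x end),
  (fun i : 'I_(n + k) => match fintype.split i with inl x => m x | inr x => m' x end); split.
  by move=> i; case: (fintype.split i).
rewrite big_split_ord /=; congr (_ + _); apply: eq_bigr => i _.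
  by rewrite (unsplitK (inl i)).
by rewrite (unsplitK (inr i)).
Qed.

Lemma lspanZ P (c : R[i]) a : lspan P a -> lspan P (c *: a).
Proof.
move=> [n [d [m [hm ->]]]]; exists n, (fun i => c * d i), m; split=> //.
by rewrite scaler_sumr; apply: eq_bigr => i _; rewrite scalerA.
Qed.

Lemma lspan_gen P a : P a -> lspan P a.
Proof. by move=> Pa; exists 1%N, (fun=> 1), (fun=> a); split=> //; rewrite big_ord1 scale1r. Qed.

Lemma lspan_sum P (I : Type) (r : seq I) (Q : pred I) (F : I -> T) :
  (forall i, Q i -> lspan P (F i)) -> lspan P (\sum_(i <- r | Q i) F i).
Proof. by move=> h; elim/big_ind: _ => //; [exact: lspan0|exact: lspanD]. Qed.

Lemma closed_adh (P : set T) : closed [set a | adh P a].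
Proof.
apply/closedE_adh => x hx e e0; have e2 : 0 < e / 2 by lra.
have [y hy h1] := hx _ e2; have [z Pz h2] := hy _ e2; exists z => //.
have := nrm_tri y x z; lra.
Qed.

Lemma adh_sub (P : set T) x : P x -> adh P x.
Proof. by move=> Px e e0; exists x => //; rewrite subrr nrm0. Qed.

Lemma adh_lspanD P a b : adh (lspan P) a -> adh (lspan P) b -> adh (lspan P) (a + b).
Proof.
move=> ha hb e e0; have e2 : 0 < e / 2 by lra.
have [x hx h1] := ha _ e2; have [y hy h2] := hb _ e2.
exists (x + y); first exact: lspanD.
by rewrite opprD addrACA (le_lt_trans (nrmD _ _)) //; lra.
Qed.

End Span.

Lemma lspan_map {R : realType} {T T' : normedModType R[i]} (f : T -> T') (P : set T) (P' : set T') a :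
  (forall a b, f (a + b) = f a + f b) -> (forall (c : R[i]) a, f (c *: a) = c *: f a) ->
  (forall a, P a -> lspan P' (f a)) -> lspan P a -> lspan P' (f a).
Proof.
move=> fD fZ h [n [c [m [hm ->]]]].
have f0 : f 0 = 0 by apply: (@addrI _ (f 0)); rewrite -fD !addr0.
have -> : f (\sum_i c i *: m i) = \sum_i c i *: f (m i).
  by elim/big_rec2: _ => // i x y _ <-; rewrite fD fZ.
by apply: lspan_sum => i _; apply: lspanZ; exact: h.
Qed.

Lemma adh_lspan_map {R : realType} {T T' : normedModType R[i]} (f : T -> T') (P : set T) (P' : set T') a :
  lips f ->
  (forall a b, f (a + b) = f a + f b) -> (forall (c : R[i]) a, f (c *: a) = c *: f a) ->
  (forall a, P a -> lspan P' (f a)) -> adh (lspan P) a -> adh (lspan P') (f a).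
Proof.
move=> lf fD fZ h /(lips_adh lf) ha e /ha[_ [x hx <-] hn]; exists (f x) => //.
exact: lspan_map hx.
Qed.

Section Levels.
Context {R : realType} {V : finType} {A : V -> V -> nat} {OA : graph_algebra R A}.
Notation PA := (vertex_proj OA).
Notation SA := (edge_isom OA).
Notation uA := (gunit OA).
Let CKA := graph_family OA.

Record path_system := { psX :> finType; src : psX -> V; rng : psX -> V; el : psX -> OA }.

Definition extend (L : path_system) : path_system :=
  {| psX := {p : edge A * L | p \in [pred p | edge_range p.1 == src p.2]};
     src := fun p => edge_source (val p).1;
     rng := fun p => rng (val p).2;
     el := fun p => SA (val p).1 ** el (val p).2 |}.

(* The paths of length n, with the corresponding products of edge isometries. *)
Fixpoint lev (n : nat) : path_system :=
  if n is m.+1 then extend (lev m) else {| psX := V; src := id; rng := id; el := PA |}.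

Lemma lev_src n v (x : lev n) : PA v ** el x = if src x == v then el x else 0.
Proof.
case: n x => [|n] x /=; first by rewrite (ckPP CKA) eq_sym; case: eqP => // ->.
by rewrite amulA (ckPS CKA); case: eqP => // _; rewrite amul0l.
Qed.

Lemma lev_rng n (x : lev n) : el x ** PA (rng x) = el x.
Proof. by elim: n x => [|n IH] x /=; [exact: (ckP CKA)|rewrite -amulA IH]. Qed.

Lemma lev_orth n (x y : lev n) : adj (el x) ** el y = if x == y then PA (rng x) else 0.
Proof.
elim: n x y => [|n IH] x y /=; first by rewrite (ckPa CKA) (ckPP CKA).
rewrite adjM -amulA (amulA _ _ (el _)) (ckSaS CKA) -val_eqE; case: x y => -[e x] h [[f y] h'] /=.
rewrite xpair_eqE; case: (e =P f) => [ef|] /=; last by rewrite amul0l amul0r.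
move: h'; rewrite inE /= -ef => /eqP ->; rewrite lev_src eqxx; exact: IH.
Qed.

Lemma lev_sum n v : PA v = \sum_(x : lev n | src x == v) el x ** adj (el x).
Proof.
elim: n v => [|n IH] v /=; first by rewrite big_pred1_eq (ckPa CKA) (ckP CKA).
pose D := [pred p : edge A * lev n | edge_range p.1 == src p.2].
rewrite -(@big_sub_cond _ _ _ _ D [pred p | edge_source p.1 == v]
   (fun p => SA p.1 ** el p.2 ** adj (SA p.1 ** el p.2))) /=.
rewrite (ckPsum CKA).
transitivity (\sum_(e | edge_source e == v) \sum_(x : lev n | src x == edge_range e)
   SA e ** el x ** adj (SA e ** el x)).
  apply: eq_bigr => e _; rewrite -{1}(ckSP CKA) (IH (edge_range e)) amul_sumr amul_suml.
  by apply: eq_bigr => x _; rewrite adjM !amulA.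
rewrite pair_big_dep /=; apply: eq_bigl => -[e x]; rewrite !inE /= andbC; congr (_ && _).
by rewrite eq_sym.
Qed.

Lemma lev_gauge n z (x : lev n) : `|z| = 1 -> gauge z (el x) = z ^+ n *: el x.
Proof.
move=> z1; have [hg hP hS] := @gaugeP _ _ _ OA z z1.
elim: n x => [|n IH] x /=; first by rewrite expr0 scale1r hP.
by rewrite (star_homM hg) hS IH amulZl amulZr scalerA exprS.
Qed.

Lemma lev_count n v w : #|[pred x : lev n | (src x == v) && (rng x == w)]| = matpow A n v w.
Proof.
elim: n v w => [|n IH] v w.
  rewrite -sum1_card /=; case: (v =P w) => [<-|vw].
    by rewrite (big_pred1 v) // => f; rewrite !inE andbb.
  by rewrite big_pred0 // => f; rewrite !inE; apply/negP => /andP[/eqP fv /eqP fw]; case: vw; rewrite -fv -fw.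
apply: (card_paths (s := @edge_source _ A) (r := @edge_range _ A) (s' := @src (lev n)) (r' := @rng (lev n))).
  by move=> a b; exact: card_tagged.
exact: IH.
Qed.

Lemma lev_mulS n e (x : lev n) : (exists x' : lev n.+1, SA e ** el x = el x') \/ SA e ** el x = 0.
Proof.
case: (edge_range e =P src x) => [h|h].
  have hin : (e, x) \in [pred p : edge A * lev n | edge_range p.1 == src p.2] by rewrite inE /= h.
  by left; exists (exist _ (e, x) hin).
right; rewrite -(ckSP CKA) -amulA lev_src.
by case: eqP => [h'|]; rewrite ?amul0r //; case: h; rewrite h'.
Qed.

Lemma lev_mulSr n e (x : lev n) : (exists x' : lev n.+1, el x ** SA e = el x') \/ el x ** SA e = 0.
Proof.
elim: n x => [|n IH] x.
  rewrite /= (ckPS CKA); case: eqP => [_|_]; last by right.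
  case: (lev_mulS e (edge_range e : lev 0)) => /= [[x' h]|h]; rewrite (ckSP CKA) in h; last by right.
  by left; exists x'.
rewrite /= -amulA; case: (IH (val x).2) => [[x' ->]|->]; last by right; rewrite amul0r.
exact: (lev_mulS (val x).1 x').
Qed.

Definition mono (k l : nat) : set OA := [set a | exists (x : lev k) (y : lev l), a = el x ** adj (el y)].

Definition monos : set OA := [set a | exists k l, mono k l a].

(** Products of two general monomials need not be computed. Left multiplication by a generator or
    its adjoint preserves the closed span L; the elements that preserve L together with their
    adjoints form a closed subalgebra, hence everything, and they are applied to the unit, which
    lies in L. *)
Lemma monos_dense (a : OA) : adh (lspan monos) a.
Proof.
pose L : set OA := [set a | adh (lspan monos) a].
have gen g : (forall x, monos x -> lspan monos (g ** x)) -> forall x, L x -> L (g ** x).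
  move=> h x; apply: adh_lspan_map => //; first exact: lips_mull.
    by move=> b c; exact: amulDr.
  by move=> c b; exact: amulZr.
have S1 e x : L x -> L (SA e ** x).
  move: x; apply: gen => _ [k [l [x [y ->]]]]; rewrite amulA.
  case: (lev_mulS e x) => [[x' ->]|->]; last by rewrite amul0l; exact: lspan0.
  by apply: lspan_gen; exists k.+1, l, x', y.
have S2 e x : L x -> L (adj (SA e) ** x).
  move: x; apply: gen => _ [k [l [x [y ->]]]]; case: k x => [|k] x /=.
    rewrite amulA (ckSaP CKA); case: eqP => [_|_]; last by rewrite amul0l; exact: lspan0.
    rewrite -adjM; case: (lev_mulSr e y) => [[y' ->]|->]; last by rewrite adj0; exact: lspan0.
    apply: lspan_gen; exists 0%N, l.+1, (rng y'), y'.
    have h := congr1 (@adj _ _) (lev_rng y'); rewrite adjM (ckPa CKA) in h; exact: esym h.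
  rewrite !amulA (ckSaS CKA); case: eqP => [h|_]; last by rewrite !amul0l; exact: lspan0.
  case: x h => -[f x] fx /= ->; move: fx; rewrite inE /= => /eqP ->.
  rewrite lev_src eqxx; apply: lspan_gen; by exists k, l, x, y.
have P1 v x : L x -> L (PA v ** x).
  move: x; apply: gen => _ [k [l [x [y ->]]]]; rewrite amulA lev_src; case: eqP => _.
    by apply: lspan_gen; exists k, l, x, y.
  by rewrite amul0l; exact: lspan0.
have cL : closed L by exact: closed_adh.
pose B : set OA := [set b | forall x, L x -> L (b ** x) /\ L (adj b ** x)].
suff : B a.
  move=> /(_ uA)[|]; last by rewrite u1r.
  apply: adh_sub; rewrite /gunit; apply: lspan_sum => v _; apply: lspan_gen.
  by exists 0%N, 0%N, v, v; rewrite /= (ckPa CKA) (ckP CKA).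
apply: (@graph_generated _ _ _ OA B).
- split.
  + apply/closedE_adh => b hb x Lx; split.
      have /closedE_adh := closed_preim_lips (lips_mulr x) cL; apply => e /hb[c Bc h].
      by exists c => //; case: (Bc x Lx).
    have lf : lips (fun c => adj c ** x) by exact: lips_comp lips_adj (lips_mulr x).
    have /closedE_adh := closed_preim_lips lf cL; apply => e /hb[c Bc h].
    by exists c => //; case: (Bc x Lx).
  + move=> x _; rewrite adj0 amul0l; split; apply: adh_sub; exact: lspan0.
  + move=> c x y Bx By w Lw; have [x1 x2] := Bx w Lw; have [y1 y2] := By w Lw.
    have LZ (d : R[i]) w' : L w' -> L (d *: w').
      move=> Lw'; have -> : d *: w' = (d *: uA) ** w' by rewrite amulZl u1l.
      apply: gen Lw' => m hm; rewrite amulZl u1l; apply: lspanZ; exact: lspan_gen.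
    by rewrite adjD adjZ !amulDl !amulZl; split; apply: adh_lspanD => //; exact: LZ.
  + move=> x y Bx By w Lw; rewrite adjM -!amulA; split.
      by case: (By w Lw) => /Bx[].
    by case: (Bx w Lw) => _ /By[].
  + by move=> x Bx w Lw; rewrite adjK; case: (Bx w Lw).
- by move=> v x Lx; rewrite (ckPa CKA); split; exact: P1.
- by move=> e x Lx; split; [exact: S1|exact: S2].
Qed.

Definition diag (n : nat) : set OA := lspan (mono n n).

(** The Cuntz-Krieger relation inserts the sum of the S_e S_e^* between s_x and s_y^*. Peeling off
    first edges reduces this to the case of P_v. *)
Lemma diag_succ n a : diag n a -> diag n.+1 a.
Proof.
have sand m e f b : diag m b -> diag m.+1 (SA e ** b ** adj (SA f)).
  apply: (lspan_map (f := fun b => SA e ** b ** adj (SA f))).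
  - by move=> c d; rewrite amulDr amulDl.
  - by move=> c d; rewrite amulZr amulZl.
  move=> _ [x [y ->]]; rewrite amulA -amulA -adjM.
  case: (lev_mulS e x) => [[x' ->]|->]; last by rewrite amul0l; exact: lspan0.
  case: (lev_mulS f y) => [[y' ->]|->]; last by rewrite adj0 amul0r; exact: lspan0.
  by apply: lspan_gen; exists x', y'.
apply: (lspan_map (f := id)) => // {}a; elim: n a => [|n IH] _ [x [y ->]].
  rewrite /= (ckPa CKA) (ckPP CKA); case: eqP => _; last exact: lspan0.
  rewrite (ckPsum CKA); apply: lspan_sum => e _; rewrite -{1}(ckSP CKA).
  apply: sand; apply: lspan_gen; exists (edge_range e), (edge_range e).
  by rewrite /= (ckPa CKA) (ckP CKA).
rewrite /= adjM amulA -(amulA (SA _)); apply: sand; apply: IH.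
by eexists; eexists.
Qed.

Lemma diag_le n m a : (n <= m)%N -> diag n a -> diag m a.
Proof.
by move=> /subnK <-; elim: (m - n)%N => // k IH /IH; exact: diag_succ.
Qed.

End Levels.

Section Approximation.
Context {R : realType} {K : compact_operators R}.
Variable eps : nat -> nat -> K.
Hypothesis E : munits eps.
Context {V : finType} {A : V -> V -> nat} {OA : graph_algebra R A} {OAK : stabilization OA K}.
Notation mA := (mu OAK eps).
Notation uA := (gunit OA).
Notation actA := (@stab_gauge _ _ _ _ _ OAK).

Definition stab_monos (k l : nat) : set OAK := [set x | exists i j a, mono (OA := OA) k l a /\ x = mA i j a].

Definition stab_diag (n : nat) : set OAK := lspan (stab_monos n n).

Lemma stab_diag_le n m x : (n <= m)%N -> stab_diag n x -> stab_diag m x.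
Proof.
move=> nm; apply: (lspan_map (f := id)) => // _ [i [j [a [ha ->]]]].
apply: (lspan_map (f := mA i j) (P := mono (OA := OA) m m)).
- by move=> b c; rewrite muD.
- by move=> c b; rewrite muZ.
- by move=> b hb; apply: lspan_gen; exists i, j, b.
by apply: (diag_le nm); exact: lspan_gen.
Qed.

Lemma stab_monos_dense (x : OAK) : adh (lspan [set y | exists k l, stab_monos k l y]) x.
Proof.
apply: (stab_closed_ind E (X := [set x | adh (lspan [set y | exists k l, stab_monos k l y]) x])).
- exact: closed_adh.
- by apply: adh_sub; exact: lspan0.
- by move=> a b; exact: adh_lspanD.
move=> i j a /=; apply: (adh_lspan_map (f := mA i j) (P := @monos _ _ _ OA)).
- rewrite (_ : mA i j = fun a => mA i 0 uA ** mA 0 0 a ** mA 0 j uA); last first.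
    by apply: funext => b; exact: mu_unit.
  apply: lips_comp (lips_mulr _); apply: lips_comp (lips_mull _).
  exact: lips_star_hom (mu_hom OAK (munitsM E) (munitsA E) 0%N).
- by move=> b c; rewrite muD.
- by move=> c b; rewrite muZ.
- by move=> b [k [l hb]]; apply: lspan_gen; exists k, l, i, j, b.
exact: monos_dense.
Qed.

Lemma minus_one_root (d : nat) : (0 < d)%N -> exists2 z : R[i], `|z| = 1 & z ^+ d = -1.
Proof.
move=> d0; exists (d.-root (-1)); last exact: rootCK.
apply/eqP; rewrite -(@pexpr_eq1 _ _ d) // -normrX rootCK // normrN1.
by [].
Qed.

Lemma stab_monos_gauge z k l x : `|z| = 1 -> stab_monos k l x ->
  actA z x = (z ^+ k * conjC z ^+ l) *: x.
Proof.
move=> z1 [i [j [a [[p [q ->]] ->]]]]; rewrite stab_gauge_mu //.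
have [hg _ _] := @gaugeP _ _ _ OA z z1.
by rewrite (star_homM hg) (star_homV hg) !lev_gauge // adjZ rmorphXn amulZl amulZr scalerA muZ.
Qed.

(* Averaging over 1 and a root of order d of -1 is a contraction that kills the
   homogeneous elements of degree d and -d. *)
Lemma degree0_approx (x : OAK) (e : R) : (forall z, `|z| = 1 -> actA z x = x) -> 0 < e ->
  exists n, exists2 y, stab_diag n y & nrm (x - y) < e.
Proof.
move=> x0 e0; have [_ [n [c [m [hm ->]]]] hx] := stab_monos_dense x e0.
have [k [l hkl]] : exists k l : 'I_n -> nat, forall t, stab_monos (k t) (l t) (m t).
  have h t : exists kl : nat * nat, stab_monos kl.1 kl.2 (m t).
    by have [k [l h]] := hm t; exists (k, l).
  by have [kl h'] := choice h; exists (fun t => (kl t).1), (fun t => (kl t).2).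
(* After j averagings the weights are 1 in degree 0 and vanish in the degrees of absolute value from
   1 to j. The distance to x stays below e because x is fixed by the action. *)
have avg j : exists w : 'I_n -> R[i],
    [/\ forall t, k t = l t -> w t = 1,
        forall t, k t != l t -> (k t <= l t + j)%N -> (l t <= k t + j)%N -> w t = 0 &
        nrm (x - \sum_t w t *: (c t *: m t)) < e].
  elim: j => [|j [w [w1 w0 hw]]].
    exists (fun=> 1); split=> // [t kl|]; first by rewrite !addn0 => h h'; case/eqP: kl; lia.
    by under eq_bigr do rewrite scale1r.
  have [z z1 zj] := @minus_one_root j.+1 isT.
  have zz : z * conjC z = 1 by rewrite -normCK z1 expr1n.
  exists (fun t => 2^-1 * (1 + z ^+ k t * conjC z ^+ l t) * w t); split.
  - move=> t kl; rewrite w1 // kl -exprMn zz expr1n mulr1 -[1 + 1]/(2%:R) mulVf //.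
  - move=> t kl h h'.
    have [h1|h1] := leqP (k t) (l t + j); last first.
      have -> : k t = (l t + j.+1)%N by lia.
      have -> : z ^+ (l t + j.+1) * conjC z ^+ l t = -1 by rewrite exprD mulrAC -exprMn zz expr1n mul1r zj.
      by rewrite subrr mulr0 mul0r.
    have [h2|h2] := leqP (l t) (k t + j); first by rewrite w0 // mulr0.
    have -> : l t = (k t + j.+1)%N by lia.
    have -> : z ^+ k t * conjC z ^+ (k t + j.+1) = -1.
      rewrite exprD mulrA -exprMn zz expr1n mul1r; transitivity (conjC (z ^+ j.+1)); first by rewrite rmorphXn.
      by rewrite zj rmorphN1.
    by rewrite subrr mulr0 mul0r.
  - have hz := stab_gauge_hom (OAK := OAK) z1.
    have -> : x - \sum_t (2^-1 * (1 + z ^+ k t * conjC z ^+ l t) * w t) *: (c t *: m t) =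
        (2^-1 : R[i]) *: ((x - \sum_t w t *: (c t *: m t)) + actA z (x - \sum_t w t *: (c t *: m t))).
      rewrite (star_homB hz) x0 // (star_hom_sum hz).
      have -> : \sum_t (2^-1 * (1 + z ^+ k t * conjC z ^+ l t) * w t) *: (c t *: m t) =
         (2^-1 : R[i]) *: (\sum_t w t *: (c t *: m t) + \sum_t actA z (w t *: (c t *: m t))).
        rewrite -big_split scaler_sumr; apply: eq_bigr => t _ /=.
        rewrite !(star_homZ hz) (stab_monos_gauge z1 (hkl t)) !scalerA -scalerDl scalerA; congr (_ *: _).
        by ring.
      by lmod.
    rewrite nrmZ cabs_half; have h1 := nrmD (x - \sum_t w t *: (c t *: m t)) (actA z (x - \sum_t w t *: (c t *: m t))).
    have h2 := star_hom_nrm hz (x - \sum_t w t *: (c t *: m t)).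
    lra.
(* [M] bounds all lengths: it is enough averagings to kill every nonzero degree, and a common level
   for the remaining terms. *)
pose M := \sum_t (k t + l t)%N.
have kM t : (k t <= M)%N /\ (l t <= M)%N by rewrite /M (bigD1 t) //=; lia.
have [w [w1 w0 hw]] := avg M.
exists M, (\sum_t w t *: (c t *: m t)) => //; apply: lspan_sum => t _.
have [kl|kl] := eqVneq (k t) (l t); last first.
  have [kt lt] := kM t; rewrite w0 ?scale0r; [exact: lspan0| |lia|lia].
  exact: kl.
do 2!apply: lspanZ; apply: (@stab_diag_le (k t)); first by case: (kM t).
by apply: lspan_gen; have := hkl t; rewrite -kl.
Qed.

End Approximation.

(** * Close projections are equivalent *)

Section CloseProjections.
Context {R : realType} {T : cstarAlgType R}.

Lemma geometric_small (k e : R) : 0 <= k -> k < 1 -> 0 < e -> exists N, forall n, (N <= n)%N -> k ^+ n < e.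
Proof.
move=> k0 k1 e0; have := @cvg_expr R k; rewrite ger0_norm // => /(_ k1) /cvgrPdist_lt /(_ e e0).
case=> N _ hN; exists N => n /hN /=; rewrite sub0r normrN ger0_norm //.
exact: exprn_ge0.
Qed.

(** The sum of the x^n p, obtained as the fixed point of a contraction because 1 - x needs a
    unit. *)
Lemma neumann (x p : T) : nrm x < 1 -> exists a, a = p + x ** a.
Proof.
move=> x1; set k := nrm x in x1; have k0 : 0 <= k by exact: nrm_ge0.
pose u n := iter n (fun a => p + x ** a) 0.
pose C := nrm p / (1 - k); have k10 : 0 < 1 - k by lra.
have C0 : 0 <= C by rewrite divr_ge0 ?nrm_ge0 // ltW.
have du n : nrm (u n.+1 - u n) <= nrm p * k ^+ n.
  elim: n => [|n IH]; first by rewrite /u /= amul0r addr0 subr0 expr0 mulr1.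
  have -> : u n.+2 - u n.+1 = x ** (u n.+1 - u n).
    by rewrite amulBr /u /= opprD addrACA subrr add0r.
  rewrite (le_trans (nrmM _ _)) // exprS mulrCA ler_wpM2l //.
have duk n j : nrm (u (n + j)%N - u n) <= C * (k ^+ n - k ^+ (n + j)).
  elim: j => [|j IH]; first by rewrite addn0 !subrr nrm0 mulr0.
  rewrite addnS (le_trans (nrm_tri (u (n + j)%N) _ _)) //.
  have h := du (n + j)%N.
  have pC : nrm p = C * (1 - k) by rewrite /C divfK // gt_eqF.
  have -> : C * (k ^+ n - k ^+ (n + j).+1) = C * (k ^+ n - k ^+ (n + j)) + nrm p * k ^+ (n + j).
    by rewrite pC exprS; ring.
  lra.
have [a ua] : exists a, tends u a.
  apply: cauchy_tends => e e0; have [|N hN] := @geometric_small k (e / (2%:R * (C + 1))) k0 x1.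
    by rewrite divr_gt0 // mulr_gt0 //; lra.
  have far n : (N <= n)%N -> nrm (u n - u N) < e / 2%:R.
    move=> /subnKC <-; rewrite (le_lt_trans (duk _ _)) //.
    have h1 := hN N (leqnn _); have h2 : 0 <= k ^+ (N + (n - N)) by exact: exprn_ge0.
    move: h1; rewrite ltr_pdivlMr; last by apply: mulr_gt0 => //; lra.
    have h3 : 0 <= k ^+ N by exact: exprn_ge0.
    by move=> h1; nra.
  exists N => n m /far h1 /far h2; have := nrm_tri (u N) (u n) (u m).
  by rewrite (nrmBC (u N)); lra.
exists a; apply: (@tends_unique _ _ (fun n => u n.+1)).
  by move=> e /ua[N hN]; exists N => n Nn; apply: hN; rewrite (leq_trans Nn).
have := tends_lips (f := fun a => p + x ** a) _ ua; apply.
have [c c0 hc] := lips_mull x; exists c => // y z.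
by rewrite opprD addrACA subrr add0r.
Qed.

(** a is the inverse of p q p in the corner of p; it is self-adjoint because its adjoint is an
    inverse on the other side. *)
Lemma corner_inverse (p q : T) : projection p -> projection q -> nrm (p - q) < 1 ->
  exists a, [/\ a = p + (p - p ** q ** p) ** a, nrm (p - p ** q ** p) < 1, p ** a = a, adj a = a & p ** q ** p ** a = p].
Proof.
move=> pp pq pq1; have [ppp pa] := pp; have [qqq qa] := pq.
have n1 : nrm (p - p ** q ** p) < 1.
  have -> : p - p ** q ** p = p ** (p - q) ** p by rewrite amulBr amulBl !ppp.
  have h1 := nrmM (p ** (p - q)) p; have h2 := nrmM p (p - q).
  have := nrm_projection pp; have := nrm_ge0 p; have := nrm_ge0 (p - q); have := nrm_ge0 (p ** (p - q)).
  nra.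
have [a aE] := neumann p n1; exists a.
have pa' : p ** a = a by rewrite [in LHS]aE amulDr amulA amulBr !amulA !ppp -aE.
have inv : p ** q ** p ** a = p.
  move: aE; rewrite amulBl pa' => aE; apply: (@addIr _ (a - p ** q ** p ** a)).
  by rewrite -aE addrC subrK.
have inv' : adj a ** (p ** q ** p) = p by rewrite -[RHS]pa -{3}inv !adjM pa qa !amulA.
have aE' : adj a = a.
  rewrite -[RHS]pa' -inv' -amulA inv -[LHS](congr1 (@adj _ _) pa').
  by rewrite adjM pa.
by split.
Qed.

Variable act : R[i] -> T -> T.
Hypothesis act_hom : forall z, `|z| = 1 -> star_hom (act z).
Definition fixed (p : T) : Prop := forall z, `|z| = 1 -> act z p = p.

(** The equivalence is p q with inverse q a, where a inverts p q p. That q a q = q uses that q p q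
    is invertible in the corner of q. The element a is fixed by the action, since its image solves
    the same contractive equation. *)
Lemma close_projections_rel (p q : T) : projection p -> projection q -> fixed p -> fixed q ->
  nrm (p - q) < 1 -> rel act 0 (fun _ : unit => p) (fun _ : unit => q).
Proof.
move=> pp pq p0 q0 pq1; have [ppp pa] := pp; have [qqq qa] := pq.
have [a [aE n1 pa' aa inv]] := corner_inverse pp pq pq1.
have [b [_ _ _ bb invq]] := corner_inverse pq pp (ltac:(by rewrite nrmBC)).
have a0 : fixed a.
  move=> z z1; have hz := act_hom z1; apply/eqP; rewrite -subr_eq0; apply/eqP/nrm_eq0.
  have aE' : act z a = p + (p - p ** q ** p) ** act z a.
    by rewrite {1}aE (star_homD hz) (star_homM hz) (star_homB hz) !(star_homM hz) p0 // q0.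
  have e1 : (p - p ** q ** p) ** (act z a - a) = act z a - a.
    by rewrite amulBr [in RHS]aE' [X in _ = _ - X]aE opprD addrACA subrr add0r.
  have h := nrmM (p - p ** q ** p) (act z a - a); have := nrm_ge0 (act z a - a).
  by rewrite e1 in h *; move=> h0; nra.
have ap : a ** p = a by rewrite -{1}aa -[in LHS]pa -adjM pa' aa.
have e : q ** a ** q = q.
  have h : p ** q ** (q - q ** a ** q) = 0.
    have h1 : p ** q ** (q ** a ** q) = p ** q ** p ** a ** q by rewrite -{1}pa' !amulA -(amulA p) qqq.
    by rewrite amulBr h1 inv -amulA qqq subrr.
  have h2 : b ** (q ** p ** q) = q by rewrite -{1}bb -[RHS]qa -{3}invq !adjM qa pa !amulA.
  have h3 : q ** (q - q ** a ** q) = 0.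
    by move: (q - _) h => x h; rewrite -{1}h2 -!amulA (amulA p) h !amul0r.
  move: h3; rewrite amulBr qqq !amulA qqq => /eqP; rewrite subr_eq0 => /eqP <-.
  by [].
exists (fun _ _ => p ** q), (fun _ _ => q ** a); split.
- by move=> z i j z1; rewrite expr0z scale1r (star_homM (act_hom z1)) p0 // q0.
- by move=> z i j z1; rewrite oppr0 expr0z scale1r (star_homM (act_hom z1)) q0 // a0.
- move=> [] []; rewrite (big_pred1 tt) => [|[]//] /=.
  by rewrite !amulA -(amulA p) qqq -{1}pa' !amulA inv.
- move=> [] []; rewrite (big_pred1 tt) => [|[]//] /=.
  by rewrite !amulA -(amulA q) ap e.
Qed.

(** Let c be the supremum of the s with g s equivalent to g 0. Local equivalence around c reaches c
    from below, and a point beyond c if c < 1. *)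
Lemma path_rel (g : R -> T) : (forall s, 0 <= s <= 1 -> projection (g s) /\ fixed (g s)) ->
  {within `[0, 1], continuous g} -> rel act 0 (fun _ : unit => g 0) (fun _ : unit => g 1).
Proof.
move=> pg /subspace_continuousP cg.
have near s : 0 <= s <= 1 -> exists2 d : R, 0 < d & forall s', 0 <= s' <= 1 -> `|s - s'| < d ->
    rel act 0 (fun _ : unit => g s) (fun _ : unit => g s').
  move=> s01; have sin : `[0, 1]%classic s by rewrite /= in_itv.
  have h : nbhs (g s) [set y | nrm (g s - y) < 1] by apply/nbhs_nrm; exists 1.
  have /nbhs_ballP[d d0 hd] := cg s sin _ h; exists d => // s' s01' ss'.
  have [p1 p2] := pg s s01; have [p1' p2'] := pg s' s01'.
  by apply: close_projections_rel => //; apply: hd => //=.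
have pid s : 0 <= s <= 1 -> idem (fun _ : unit => g s) by move=> /pg[[h _] _] _.
pose S : set R := [set s | 0 <= s <= 1 /\ rel act 0 (fun _ : unit => g 0) (fun _ : unit => g s)].
have l01 : (0 <= 0 :> R) && (0 <= 1 :> R) by rewrite lexx ler01.
have S0 : S 0.
  by split=> //; apply: rel_refl => //; [exact: pid|move=> z i; exact: (pg 0 l01).2].
have supS : has_sup S by split; [exists 0|exists 1 => s [/andP[]]].
pose c := sup S.
have c0 : 0 <= c by apply: sup_ubound => //; case: supS.
have c1 : c <= 1 by apply: ge_sup; [exists 0|move=> s [/andP[]]].
have c01 : 0 <= c <= 1 by rewrite c0.
have [d d0 hd] := near c c01.
have [t [t01 gt] tc] : exists2 t, S t & c - d < t by apply: sup_adherent.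
have tle : t <= c by apply: sup_ubound => //; case: supS.
have relc : rel act 0 (fun _ : unit => g 0) (fun _ : unit => g c).
  rewrite -[0 : int](addr0 0); apply: (rel_trans act_hom (pid _ l01) (pid _ c01) gt).
  rewrite -oppr0; apply: rel_sym; apply: hd => //; rewrite ger0_norm ?subr_ge0 //; lra.
pose t' := Num.min 1 (c + d / 2%:R).
have t'c : c <= t' by rewrite /t' le_min c1 /=; lra.
have t'01 : 0 <= t' <= 1 by rewrite (le_trans c0 t'c) ge_min lexx.
have St' : S t'.
  split=> //; rewrite -[0 : int](addr0 0); apply: (rel_trans act_hom (pid _ l01) (pid _ t'01) relc).
  apply: hd => //; rewrite distrC ger0_norm ?subr_ge0 // /t'.
  have : Num.min 1 (c + d / 2%:R) <= c + d / 2%:R by rewrite ge_min lexx orbT.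
  by move: d0; lra.
have : t' <= c by apply: sup_ubound => //; case: supS.
rewrite /t' ge_min => /orP[h1|]; last by move: d0; lra.
by have <- : c = 1 by apply/eqP; rewrite eq_le c1.
Qed.

End CloseProjections.

Section Kernel.

Lemma kernel_vector (F : fieldType) (X Y : finType) (c : X -> Y -> F) : (#|Y| < #|X|)%N ->
  exists2 xi : X -> F, (exists x, xi x != 0) & forall y, \sum_x xi x * c x y = 0.
Proof.
move=> YX; pose M : 'M[F]_(#|X|, #|Y|) := \matrix_(i, j) c (enum_val i) (enum_val j).
have : kermx M != 0.
  rewrite -mxrank_eq0 mxrank_ker subn_eq0 -ltnNge.
  by rewrite (leq_ltn_trans (rank_leq_col M)).
case/rowV0Pn => v /sub_kermxP vM v0; exists (fun x => v 0 (enum_rank x)).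
  have [i vi] : exists i, v 0 i != 0 by apply/rV0Pn.
  by exists (enum_val i); rewrite enum_valK.
move=> y; have h : \sum_j v 0 j * M j (enum_rank y) = 0.
  by have := congr1 (fun m : 'rV_(_) => m 0 (enum_rank y)) vM; rewrite !mxE.
rewrite -[RHS]h [RHS](reindex (@enum_rank X)) /=; last first.
  by apply: onW_bij; exists enum_val; [exact: enum_rankK|exact: enum_valK].
by apply: eq_bigr => x _; rewrite !mxE !enum_rankK.
Qed.

End Kernel.

(** * Direct sums of vertex projections and their multiplicities *)

Section Standard.
Context {R : realType} {K : compact_operators R}.
Variable eps : nat -> nat -> K.
Hypothesis E : munits eps.
Context {V : finType} {A : V -> V -> nat} {OA : graph_algebra R A} {OAK : stabilization OA K}.
Notation mA := (mu OAK eps).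
Notation PA := (vertex_proj OA).
Notation actA := (@stab_gauge _ _ _ _ _ OAK).
Let mAM := muM OAK (munitsM E).
Let mAA := muA OAK (munitsA E).
Let CKA := graph_family OA.
Let acth := fun z => @stab_gauge_hom _ _ _ _ _ OAK z.

Definition std (J : finType) (rho : J -> V) (j : J) : OAK := mA 0 0 (PA (rho j)).

Lemma std_idem (J : finType) (rho : J -> V) : idem (std rho).
Proof. by move=> j; rewrite /std mAM eqxx (ckP CKA). Qed.

Lemma std_fixed (J : finType) (rho : J -> V) z j : `|z| = 1 -> actA z (std rho j) = std rho j.
Proof. exact: stab_gauge_P. Qed.

Lemma unit_exprz_conj (z : R[i]) n : `|z| = 1 -> conjC z ^+ n = z ^ (- n%:Z).
Proof.
move=> z1; have zz : z * conjC z = 1 by rewrite -normCK z1 expr1n.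
have -> : conjC z = z^-1.
  by rewrite -[RHS]mulr1 -zz mulKf // -normr_eq0 z1 oner_eq0.
by rewrite -exprnN exprVn.
Qed.

Definition lev_from n (v : V) : finType := {x : @lev _ _ _ OA n | x \in [pred x | src x == v]}.

Lemma lev_from_count n v w : #|[pred x : lev_from n v | rng (val x) == w]| = matpow A n v w.
Proof.
rewrite -(lev_count (OA := OA)) -!sum1_card.
rewrite -(@big_sub_cond _ _ _ _ [pred x : @lev _ _ _ OA n | src x == v] [pred x | rng x == w] (fun=> 1%N)).
by apply: eq_bigl => x; rewrite !inE.
Qed.

Lemma vertex_rel n v : rel actA n%:Z (fun _ : unit => mA 0 0 (PA v))
  (std (fun x : lev_from n v => rng (val x))).
Proof.
exists (fun _ x => mA 0 0 (el (val x))), (fun x _ => mA 0 0 (adj (el (val x)))); split.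
- by move=> z _ x z1; rewrite stab_gauge_mu // lev_gauge // muZ.
- move=> z _ x z1; rewrite stab_gauge_mu //; have [hg _ _] := @gaugeP _ _ _ OA z z1.
  by rewrite (star_homV hg) lev_gauge // adjZ rmorphXn /= unit_exprz_conj // muZ.
- move=> [] [] /=; rewrite [in RHS](lev_sum n) mu_sum.
  transitivity (\sum_(x in [pred x : @lev _ _ _ OA n | src x == v]) mA 0 0 (el x ** adj (el x))); last by apply: eq_bigl.
  by rewrite [RHS]big_sub; apply: eq_bigr => x _; rewrite mAM eqxx.
- move=> x y; rewrite (big_pred1 tt) => [|[]//]; rewrite mAM eqxx lev_orth -val_eqE /std.
  by case: eqP; rewrite ?mu0.
Qed.

(** Every vertex is replaced by the ends of the paths of length n starting there, which multiplies
    the vector of multiplicities by A^n. *)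
Definition bump_idx n (J : finType) (rho : J -> V) : finType := {j : J & lev_from n (rho j)}.
Definition bump n (J : finType) (rho : J -> V) (x : bump_idx n rho) : V := rng (val (tagged x)).

Lemma bump_rel n (J : finType) (rho : J -> V) : rel actA n%:Z (std rho) (std (@bump n J rho)).
Proof.
exact: (rel_sum acth (q := fun j => std (fun x : lev_from n (rho j) => rng (val x))) (fun j => vertex_rel n (rho j))).
Qed.

Lemma bump_count n (J : finType) (rho : J -> V) w :
  #|[pred x | @bump n J rho x == w]| = (\sum_j matpow A n (rho j) w)%N.
Proof.
rewrite -sum1_card.
transitivity (\sum_(j : J) \sum_(x : lev_from n (rho j) | rng (val x) == w) 1)%N.
  by rewrite sig_big_dep.
by apply: eq_bigr => j _; rewrite -lev_from_count -sum1_card.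
Qed.

(** By orthogonality of the s_x for paths of length n, an element of level n acts on these columns
    by scalar coefficients and preserves the end of the path. *)
Lemma stab_diag_col n (d : OAK) v (y : @lev _ _ _ OA n) : stab_diag eps n d ->
  exists c : @lev _ _ _ OA n -> R[i], mA 0 0 (PA v) ** d ** mA 0 0 (el y) =
    \sum_(x | (src x == v) && (rng x == rng y)) c x *: mA 0 0 (el x).
Proof.
case=> m [a [g [hg ->]]].
have h t : exists c : @lev _ _ _ OA n -> R[i], mA 0 0 (PA v) ** g t ** mA 0 0 (el y) =
    \sum_(x | (src x == v) && (rng x == rng y)) c x *: mA 0 0 (el x).
  have zero : exists c : @lev _ _ _ OA n -> R[i], 0 =
      \sum_(x | (src x == v) && (rng x == rng y)) c x *: mA 0 0 (el x).
    by exists (fun=> 0); rewrite big1 // => x _; rewrite scale0r.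
  have [i [j [_ [[p [q ->]] ->]]]] := hg t.
  rewrite mAM; case: (0%N =P i) => [_|_]; last by rewrite amul0l.
  rewrite mAM; case: (j =P 0%N) => // _.
  rewrite !amulA lev_src; case: (src p =P v) => [pv|_]; last by rewrite !amul0l mu0.
  rewrite -amulA lev_orth; case: (q =P y) => [->|_]; last by rewrite amul0r mu0.
  rewrite -{1}(lev_rng p) -amulA (ckPP CKA).
  case: (rng p =P rng y) => [py|_]; last by rewrite amul0r mu0.
  exists (fun x => if x == p then 1 else 0); rewrite lev_rng (bigD1 p) /=; last by rewrite pv py !eqxx.
  by rewrite eqxx scale1r big1 ?addr0 // => x /andP[_ /negPf ->]; rewrite scale0r.
have [c hc] := choice h; exists (fun x => \sum_t a t * c t x).
rewrite amul_sumr amul_suml.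
under eq_bigr => t _ do rewrite amulZr amulZl hc scaler_sumr.
rewrite exchange_big; apply: eq_bigr => x _; rewrite scaler_suml.
by apply: eq_bigr => t _; rewrite scalerA.
Qed.

(** The inverse of the equivalence is approximated by a matrix z of level n. On the paths of length
    n ending at w it is a scalar matrix, with as many columns and rows as the two sides of the
    inequality. If it had more columns than rows, a nonzero eta would satisfy z eta = 0 and hence
    eta = u (v' - z) eta, which is too small. Symmetry of the relation will give the equality. *)
Lemma std_rel_le (J L : finType) (rho : J -> V) (rho' : L -> V) : (forall v, PA v != 0) ->
  rel actA 0 (std rho) (std rho') ->
  exists N, forall n w, (N <= n)%N ->
    (\sum_j matpow A n (rho j) w <= \sum_j matpow A n (rho' j) w)%N.
Proof.
move=> P0 [u [u' [_ u'0 h3 h4]]].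
(* Cutting u' down keeps u v' = p and confines the approximating paths to the prescribed sources. *)
pose v' j k := std rho' j ** u' j k ** std rho k.
have v'fix j k : forall z, `|z| = 1 -> actA z (v' j k) = v' j k.
  move=> z z1; have az := acth z1; rewrite /v' !(star_homM az) !std_fixed // u'0 //.
  by rewrite oppr0 expr0z scale1r.
have uv i k : \sum_j u i j ** v' j k = if i == k then std rho i else 0.
  under eq_bigr => j _ do rewrite /v' !amulA.
  rewrite -amul_suml (rel_mid (@std_idem _ rho) h3 h4).
  by case: eqP => [->|_]; rewrite ?std_idem ?amul0l.
pose C : R := \sum_i \sum_j nrm (u i j).
have C0 : 0 <= C by apply: sumr_ge0 => i _; apply: sumr_ge0 => j _; exact: nrm_ge0.
(* Chosen so that C #|J| e <= 1/2; the added 1's keep the denominator positive. *)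
pose e : R := ((C + 1) * (#|J|%:R + 1))^-1 / 2%:R.
have J0 : 0 <= #|J|%:R :> R by exact: ler0n.
have D0 : 0 < (C + 1) * (#|J|%:R + 1) :> R by apply: mulr_gt0; lra.
have e0 : 0 < e by rewrite /e divr_gt0 // invr_gt0.
have [Nf hN] : exists Nf : L * J -> nat, forall p, exists2 y, stab_diag eps (Nf p) y & nrm (v' p.1 p.2 - y) < e.
  have h p : exists n, exists2 y, stab_diag eps n y & nrm (v' p.1 p.2 - y) < e.
    exact: (degree0_approx E (v'fix p.1 p.2) e0).
  by have [Nf h'] := choice h; exists Nf.
pose N := \sum_p Nf p; exists N => n w Nn.
rewrite leqNgt; apply/negP => lt.
have [Y hY] : exists Y : L * J -> OAK, forall p, stab_diag eps n (Y p) /\ nrm (v' p.1 p.2 - Y p) < e.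
  have h p : exists y, stab_diag eps n y /\ nrm (v' p.1 p.2 - y) < e.
    have [y hy1 hy2] := hN p; exists y; split=> //; apply: stab_diag_le hy1.
    by apply: leq_trans Nn; rewrite /N (bigD1 p) //= leq_addr.
  by have [Y h'] := choice h; exists Y.
pose z j k := std rho' j ** Y (j, k) ** std rho k.
have vz j k : nrm (v' j k - z j k) <= e.
  have -> : v' j k - z j k = std rho' j ** (v' j k - Y (j, k)) ** std rho k.
    by rewrite amulBr amulBl /v' !amulA std_idem -!(amulA _ (std rho k)) std_idem.
  have pj (I : finType) (f : I -> V) i : nrm (std f i) <= 1.
    apply: nrm_projection; split; first exact: std_idem.
    by rewrite /std mAA (ckPa CKA).
  have h1 := nrmM (std rho' j ** (v' j k - Y (j, k))) (std rho k).
  have h2 := nrmM (std rho' j) (v' j k - Y (j, k)).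
  have [_ /= h5] := hY (j, k); have := pj _ rho' j; have := pj _ rho k.
  have := nrm_ge0 (std rho k); have := nrm_ge0 (std rho' j); have := nrm_ge0 (v' j k - Y (j, k)).
  have := nrm_ge0 (std rho' j ** (v' j k - Y (j, k))); nra.
pose DX := [pred p : J * @lev _ _ _ OA n | (src p.2 == rho p.1) && (rng p.2 == w)].
pose DY := [pred p : L * @lev _ _ _ OA n | (src p.2 == rho' p.1) && (rng p.2 == w)].
have card (I : finType) (f : I -> V) :
    #|{: {p : I * @lev _ _ _ OA n | p \in [pred p | (src p.2 == f p.1) && (rng p.2 == w)]}}| = (\sum_j matpow A n (f j) w)%N.
  rewrite card_sub -sum1_card.
  transitivity (\sum_(j : I) \sum_(x : @lev _ _ _ OA n | (src x == f j) && (rng x == w)) 1)%N.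
    by rewrite pair_big_dep /=; apply: eq_bigl => p; rewrite inE.
  by apply: eq_bigr => j _; rewrite -(lev_count (OA := OA)) -sum1_card.
pose X : finType := {p | p \in DX}; pose Y' : finType := {p | p \in DY}.
have [c hc] : exists c : L * X -> @lev _ _ _ OA n -> R[i], forall p,
    z p.1 (val p.2).1 ** mA 0 0 (el (val p.2).2) =
    \sum_(x | (src x == rho' p.1) && (rng x == w)) c p x *: mA 0 0 (el x).
  have h (p : L * X) : exists cc : @lev _ _ _ OA n -> R[i], z p.1 (val p.2).1 ** mA 0 0 (el (val p.2).2) =
      \sum_(x | (src x == rho' p.1) && (rng x == w)) cc x *: mA 0 0 (el x).
    case: p => j [[k y] hy] /=; have := hy; rewrite inE /= => /andP[/eqP sy /eqP <-].
    have [cc hcc] := stab_diag_col (rho' j) y (hY (j, k)).1; exists cc; rewrite -hcc.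
    by rewrite /z -amulA /std mAM eqxx lev_src sy eqxx.
  by have [c h'] := choice h; exists c.
(* X indexes the unknowns and Y' the equations of z eta = 0; by contradiction Y' is the smaller
   set. *)
have [|xi [p0 xp0] xiK] := @kernel_vector R[i] X Y' (fun p q => c ((val q).1, p) (val q).2).
  by rewrite !card.
pose eta k : OAK := \sum_(p : X | (val p).1 == k) xi p *: mA 0 0 (el (val p).2).
have zeta j : \sum_k z j k ** eta k = 0.
  transitivity (\sum_(p : X) xi p *: (z j (val p).1 ** mA 0 0 (el (val p).2))).
    rewrite [RHS](partition_big (fun p : X => (val p).1) xpredT) //=; apply: eq_bigr => k _.
    by rewrite amul_sumr; apply: eq_bigr => p /eqP <-; rewrite amulZr.
  under eq_bigr => p _ do rewrite (hc (j, p)) /= scaler_sumr.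
  rewrite exchange_big big1 //= => x xin.
  have hin : (j, x) \in DY by rewrite inE.
  under eq_bigr do rewrite scalerA; rewrite -scaler_suml.
  by have /= -> := xiK (exist _ (j, x) hin); rewrite scale0r.
have eta_fix k : std rho k ** eta k = eta k.
  rewrite amul_sumr; apply: eq_bigr => -[[k' y] hy] /= /eqP kk; rewrite amulZr /std mAM eqxx lev_src.
  have /andP[/eqP sy _] : (src y == rho k') && (rng y == w) := hy.
  by rewrite sy -kk eqxx.
have etaE i : eta i = \sum_j u i j ** (\sum_k (v' j k - z j k) ** eta k).
  transitivity (\sum_j u i j ** (\sum_k v' j k ** eta k)).
    under eq_bigr => j _ do rewrite amul_sumr.
    rewrite exchange_big (bigD1 i) //= [X in _ + X]big1 ?addr0.
      under eq_bigr => j _ do rewrite amulA.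
      by rewrite -amul_suml uv eqxx eta_fix.
    move=> k ki; under eq_bigr => j _ do rewrite amulA.
    by rewrite -amul_suml uv eq_sym (negPf ki) amul0l.
  apply: eq_bigr => j _; congr (_ ** _).
  under [RHS]eq_bigr => k _ do rewrite amulBl.
  by rewrite sumrB zeta subr0.
(* The largest component of eta is at most half of itself, hence all components vanish, and
   multiplication by the adjoint of a column recovers the coefficient xi p0. *)
have [i0 _ imax] : exists2 i0, true & forall k, nrm (eta k) <= nrm (eta i0).
  pose k0 := (val p0).1.
  by case: (arg_maxP (fun k => nrm (eta k)) (isT : xpredT k0)) => i0 _ h; exists i0 => // k; exact: h.
have small : nrm (eta i0) <= C * (#|J|%:R * (e * nrm (eta i0))).
  rewrite {1}etaE (le_trans (nrm_sum _ _ _)) //.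
  have inner j : nrm (\sum_k (v' j k - z j k) ** eta k) <= #|J|%:R * (e * nrm (eta i0)).
    rewrite (le_trans (nrm_sum _ _ _)) // mulr_natl -sumr_const ler_sum // => k _.
    by rewrite (le_trans (nrmM _ _)) // ler_pM ?nrm_ge0.
  apply: (@le_trans _ _ (\sum_j nrm (u i0 j) * (#|J|%:R * (e * nrm (eta i0))))).
    apply: ler_sum => j _; rewrite (le_trans (nrmM _ _)) // ler_wpM2l ?nrm_ge0 //.
  rewrite -mulr_suml; apply: ler_wpM2r.
    by apply: mulr_ge0; [exact: J0|apply: mulr_ge0; [exact: ltW|exact: nrm_ge0]].
  rewrite /C (bigD1 i0) //= lerDl; apply: sumr_ge0 => i _; apply: sumr_ge0 => j _; exact: nrm_ge0.
have CJ : C * (#|J|%:R * e) <= 2%:R^-1.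
  rewrite /e mulrA mulrA -[leRHS]mul1r ler_pM2r ?invr_gt0 // ler_pdivrMr // mul1r.
  by apply: ler_pM => //; rewrite lerDl ler01.
have eta0 k : eta k = 0.
  apply: nrm_eq0; apply/eqP; rewrite eq_le nrm_ge0 andbT (le_trans (imax k)) //.
  have s' : nrm (eta i0) <= (C * (#|J|%:R * e)) * nrm (eta i0) by rewrite -(mulrA C) -(mulrA #|J|%:R).
  have n0 := nrm_ge0 (eta i0); move: CJ s' n0; clear; move: (C * _) (nrm _) => x y.
  by nra.
have := congr1 (fun x => adj (mA 0 0 (el (val p0).2)) ** x) (eta0 (val p0).1).
rewrite /eta amul_sumr amul0r (bigD1 p0) //= big1 ?addr0.
  rewrite amulZr mAA mAM eqxx lev_orth eqxx => /eqP; rewrite scaler_eq0 (negPf xp0) /=.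
  move=> /eqP m0; have /eqP := P0 (rng (val p0).2); apply.
  by apply: (mu_inj (munitsN E) (OAK := OAK) (i := 0%N)); rewrite mu0.
move=> p /andP[/eqP pk pp]; rewrite amulZr mAA mAM eqxx lev_orth.
case: eqP => [h|_]; last by rewrite mu0 scaler0.
by case/negP: pp; apply/eqP/val_inj; rewrite [LHS]surjective_pairing [RHS]surjective_pairing pk h.
Qed.

End Standard.

(** * Diagonalization of hermitian matrices over orthogonal columns *)

Section Spectral.
Context {R : realType}.
Local Open Scope sesquilinear_scope.

Lemma hermitian_spectral (X : finType) (c : X -> X -> R[i]) : (forall s t, c t s = conjC (c s t)) ->
  exists (U : X -> X -> R[i]) (d : X -> R),
    (forall k l, \sum_s U k s * conjC (U l s) = (k == l)%:R) /\
    (forall s t, c s t = \sum_k conjC (U k s) * (d k)%:C * U k t).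
Proof.
move=> ch; pose M : 'M[R[i]]_#|X| := \matrix_(i, j) c (enum_val i) (enum_val j).
have Mh : M \is hermsymmx.
  rewrite qualifE /= expr0 scale1r; apply/eqP/matrixP => i j; rewrite !mxE ch.
  by [].
have /orthomx_spectralP ME := hermitian_normalmx Mh.
have Pu := spectral_unitarymx M; rewrite invmx_unitary // in ME.
have dr := hermitian_spectral_diag_real Mh.
move: (spectralmx M) (spectral_diag M) ME Pu dr => P sp ME /unitarymxP PP dr.
have sumE (F : 'I_#|X| -> R[i]) : \sum_(x : X) F (enum_rank x) = \sum_i F i.
  rewrite [RHS](reindex (@enum_rank X)) //=.
  by apply: onW_bij; exists enum_val; [exact: enum_rankK|exact: enum_valK].
exists (fun k s => P (enum_rank k) (enum_rank s)), (fun k => complex.Re (sp 0 (enum_rank k))); split.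
  move=> k l; have := congr1 (fun m : 'M[R[i]]_#|X| => m (enum_rank k) (enum_rank l)) PP.
  rewrite !mxE (inj_eq enum_rank_inj) => <-.
  rewrite (sumE (fun j => P (enum_rank k) j * conjC (P (enum_rank l) j))).
  by apply: eq_bigr => j _; rewrite !mxE.
move=> s t; have := congr1 (fun m : 'M[R[i]]_#|X| => m (enum_rank s) (enum_rank t)) ME.
rewrite [LHS]mxE !enum_rankK => ->.
rewrite (sumE (fun k => conjC (P k (enum_rank s)) * (complex.Re (sp 0 k))%:C * P k (enum_rank t))).
rewrite mxE; apply: eq_bigr => k _; congr (_ * _).
rewrite mul_mx_diag !mxE; congr (_ * _).
by apply/esym/RRe_real; have /mxOverP := dr; apply.
Qed.

Context {T : cstarAlgType R}.

(** A unitary scalar change of columns preserves the relations of the g s, because they share the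
    initial projection P. *)
Lemma diagonalization (X : finType) (g : X -> T) (P : T) (c : X -> X -> R[i]) :
  (forall s t, adj (g s) ** g t = if s == t then P else 0) -> (forall s t, c t s = conjC (c s t)) ->
  exists (h : X -> T) (d : X -> R) (U : X -> X -> R[i]),
    [/\ forall k, h k = \sum_s U k s *: g s,
        forall k l, adj (h k) ** h l = if k == l then P else 0 &
        \sum_s \sum_t c s t *: (g s ** adj (g t)) = \sum_k (d k)%:C *: (h k ** adj (h k))].
Proof.
move=> gg ch; have [U [d [UU cE]]] := hermitian_spectral ch.
exists (fun k => \sum_s conjC (U k s) *: g s), d, (fun k s => conjC (U k s)); split=> //.
  move=> k l; rewrite adj_sum amul_suml.
  transitivity ((\sum_s U k s * conjC (U l s)) *: P); last first.
    by rewrite UU; case: (k == l); rewrite ?scale1r ?scale0r.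
  rewrite scaler_suml; apply: eq_bigr => s _; rewrite adjZ conjCK amulZl amul_sumr (bigD1 s) //=.
  rewrite [X in _ *: (_ + X)]big1 ?addr0 => [|t ts]; last first.
    by rewrite amulZr gg eq_sym (negPf ts) scaler0.
  by rewrite amulZr gg eqxx scalerA.
transitivity (\sum_s \sum_t \sum_k (d k)%:C *: ((conjC (U k s) *: g s) ** adj (conjC (U k t) *: g t))).
  apply: eq_bigr => s _; apply: eq_bigr => t _; rewrite cE scaler_suml; apply: eq_bigr => k _.
  rewrite adjZ conjCK amulZl amulZr !scalerA; congr (_ *: _); ring.
under eq_bigr => s _ do rewrite exchange_big /=.
rewrite exchange_big; apply: eq_bigr => k _ /=; rewrite amul_suml scaler_sumr; apply: eq_bigr => s _.
by rewrite adj_sum amul_sumr scaler_sumr.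
Qed.

Section OrthogonalProjections.
Context {Z : finType}.
Variable e : Z -> T.
Hypothesis ea : forall z, adj (e z) = e z.
Hypothesis ee : forall y z, e y ** e z = if y == z then e y else 0.

Lemma diag_mul (a b : Z -> R) : (\sum_z (a z)%:C *: e z) ** (\sum_z (b z)%:C *: e z) =
  \sum_z (a z * b z)%:C *: e z.
Proof.
rewrite amul_suml; apply: eq_bigr => z _; rewrite amul_sumr (bigD1 z) //= big1 ?addr0 => [|y yz].
  by rewrite amulZl amulZr ee eqxx scalerA rmorphM.
by rewrite amulZl amulZr ee eq_sym (negPf yz) !scaler0.
Qed.

Lemma diag_adj (a : Z -> R) : adj (\sum_z (a z)%:C *: e z) = \sum_z (a z)%:C *: e z.
Proof. by rewrite adj_sum; apply: eq_bigr => z _; rewrite adjZ conjC_re ea. Qed.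

Lemma diag_add (a b : Z -> R) : (\sum_z (a z)%:C *: e z) + (\sum_z (b z)%:C *: e z) =
  \sum_z (a z + b z)%:C *: e z.
Proof. by rewrite -big_split; apply: eq_bigr => z _; rewrite rmorphD scalerDl. Qed.

(* With r = sqrt (1 - m^2), the self-adjoint elements with eigenvalues m and
   1 - r satisfy 2 (1 - r) = m^2 + (1 - r)^2. *)
Lemma diag_norm_le (m : Z -> R) (M : R) : 0 < M -> (forall z, `|m z| <= M) ->
  nrm (\sum_z (m z)%:C *: e z) <= M.
Proof.
move=> M0 mM.
have unit (a : Z -> R) : (forall z, `|a z| <= 1) -> nrm (\sum_z (a z)%:C *: e z) <= 1.
  move=> a1; apply: (selfadj_contraction (c := \sum_z (1 - Num.sqrt (1 - a z ^+ 2))%:C *: e z)).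
  - exact: diag_adj.
  - exact: diag_adj.
  - by rewrite !diag_mul; apply: eq_bigr => z _; rewrite mulrC.
  rewrite !diag_mul !diag_add; apply: eq_bigr => z _; congr (_%:C *: _).
  have h : Num.sqrt (1 - a z ^+ 2) ^+ 2 = 1 - a z ^+ 2.
    rewrite sqr_sqrtr // subr_ge0 -[leRHS](expr1n _ 2) -real_normK ?num_real //.
    by rewrite lerXn2r ?nnegrE.
  by move: h; rewrite !expr2 => h; ring: h.
have -> : \sum_z (m z)%:C *: e z = M%:C *: \sum_z (m z / M)%:C *: e z.
  rewrite scaler_sumr; apply: eq_bigr => z _; rewrite scalerA -rmorphM mulrC divfK ?gt_eqF //.
rewrite nrmZ cabsC gtr0_norm // ler_piMr ?(ltW M0) //; apply: unit => z.
by rewrite normrM normfV (gtr0_norm M0) ler_pdivrMr // mul1r.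
Qed.

Lemma nrm_projection1 z : e z != 0 -> nrm (e z) = 1.
Proof.
move=> e0; have := nrm_cstar (e z); rewrite ea ee eqxx => h.
have n0 : nrm (e z) != 0 by apply: contraNneq e0 => /nrm_eq0 ->.
by apply: (mulfI n0); rewrite mulr1 -expr2 -h.
Qed.

End OrthogonalProjections.
End Spectral.

(** * Projections of degree 0 are sums of vertex projections *)

Section ProjectionsAreStandard.
Context {R : realType} {K : compact_operators R}.
Variable eps : nat -> nat -> K.
Hypothesis E : munits eps.
Context {V : finType} {A : V -> V -> nat} {OA : graph_algebra R A} {OAK : stabilization OA K}.
Notation mA := (mu OAK eps).
Notation PA := (vertex_proj OA).
Notation actA := (@stab_gauge _ _ _ _ _ OAK).
Notation std := (std (OA := OA) (OAK := OAK) eps).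
Let mAM := muM OAK (munitsM E).
Let mAA := muA OAK (munitsA E).
Let CKA := graph_family OA.
Let acth := fun z => @stab_gauge_hom _ _ _ _ _ OAK z.

Definition path_col n N (s : 'I_N * @lev _ _ _ OA n) : OAK := mA s.1 0 (el s.2).

Lemma path_col_orth n N (s t : 'I_N * @lev _ _ _ OA n) :
  adj (path_col s) ** path_col t = if s == t then mA 0 0 (PA (rng s.2)) else 0.
Proof.
rewrite /path_col mAA mAM lev_orth; case: s t => [i x] [j y] /=; rewrite xpair_eqE -val_eqE /=.
by case: eqP => // _; case: eqP => //= _; rewrite ?mu0.
Qed.

Lemma path_col_gauge n N (s : 'I_N * @lev _ _ _ OA n) z : `|z| = 1 ->
  actA z (path_col s) = z ^+ n *: path_col s.
Proof. by move=> z1; rewrite stab_gauge_mu // lev_gauge // muZ. Qed.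

Lemma path_col_cross n N (s t : 'I_N * @lev _ _ _ OA n) : rng s.2 != rng t.2 ->
  path_col s ** adj (path_col t) = 0.
Proof.
move=> /negPf st; rewrite /path_col mAA mAM eqxx -(lev_rng s.2) -(lev_rng t.2) adjM (ckPa CKA).
by rewrite -amulA (amulA (PA _)) (ckPP CKA) st amul0l amul0r mu0.
Qed.

Lemma stab_diag_coords n (a : OAK) : stab_diag eps n a ->
  exists N (c : 'I_N * @lev _ _ _ OA n -> 'I_N * @lev _ _ _ OA n -> R[i]),
    a = \sum_s \sum_t c s t *: (path_col s ** adj (path_col t)).
Proof.
case=> m [w [g [hg ->]]].
have [f hf] : exists f : 'I_m -> (nat * @lev _ _ _ OA n) * (nat * @lev _ _ _ OA n), forall i,
    g i = mA (f i).1.1 (f i).2.1 (el (f i).1.2 ** adj (el (f i).2.2)).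
  have h i : exists f : (nat * @lev _ _ _ OA n) * (nat * @lev _ _ _ OA n),
      g i = mA f.1.1 f.2.1 (el f.1.2 ** adj (el f.2.2)).
    by have [k [l [_ [[p [q ->]] ->]]]] := hg i; exists ((k, p), (l, q)).
  by have [f h'] := choice h; exists f.
pose N := \sum_i ((f i).1.1 + (f i).2.1).+1%N.
have b1 i : ((f i).1.1 < N)%N by rewrite /N (bigD1 i) //=; lia.
have b2 i : ((f i).2.1 < N)%N by rewrite /N (bigD1 i) //=; lia.
pose S i : 'I_N * @lev _ _ _ OA n := (Ordinal (b1 i), (f i).1.2).
pose T i : 'I_N * @lev _ _ _ OA n := (Ordinal (b2 i), (f i).2.2).
exists N, (fun s t => \sum_i if (S i == s) && (T i == t) then w i else 0).
under [RHS]eq_bigr => s _ do under eq_bigr => t _ do rewrite scaler_suml.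
under [RHS]eq_bigr => s _ do rewrite exchange_big /=.
rewrite [RHS]exchange_big; apply: eq_bigr => i _ /=.
rewrite (bigD1 (S i)) //= [X in _ + X]big1 ?addr0 => [|s /negPf sS]; last first.
  by rewrite big1 // => t _; rewrite eq_sym sS scale0r.
rewrite (bigD1 (T i)) //= [X in _ + X]big1 ?addr0 => [|s /negPf sS]; last first.
  by rewrite [T i == s]eq_sym sS andbF scale0r.
by rewrite !eqxx /path_col /= mAA mAM eqxx hf.
Qed.

Lemma dchoice (I : Type) (F : I -> Type) (P : forall i, F i -> Prop) :
  (forall i, exists x, P i x) -> exists f : forall i, F i, forall i, P i (f i).
Proof. by move=> h; exists (fun i => projT1 (cid (h i))) => i; exact: (projT2 (cid (h i))). Qed.

(** p is approximated by a self-adjoint combination a of path columns. Diagonalizing a and rounding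
    its eigenvalues to 0 or 1 gives a projection q with |p - q| < 1. The columns H z with eigenvalue
    rounded to 1 have degree n and carry q to the vertex projections at the ends of their paths. *)
Lemma projection_rel (p : OAK) : (forall v, PA v != 0) -> projection p -> fixed actA p ->
  exists (n : nat) (J : finType) (rho : J -> V), rel actA n%:Z (fun _ : unit => p) (std rho).
Proof.
move=> P0 pp pfix; have [ppp pa] := pp.
(* With 1/32 one gets |a^2 - a| <= 3/32 + 1/32^2 < 1/10, which puts each eigenvalue within 1/4 of 0
   or 1; and 1/32 + 1/4 < 1. *)
have [n [a0 ha0 pa0]] := @degree0_approx _ _ _ E _ _ _ _ p (32%:R^-1) pfix (ltac:(by rewrite invr_gt0 ltr0n)).
have [N [c0 a0E]] := stab_diag_coords ha0.
pose X : finType := ('I_N * @lev _ _ _ OA n)%type.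
pose g (s : X) : OAK := path_col s.
pose c (s t : X) : R[i] := 2^-1 * (c0 s t + conjC (c0 t s)).
have half : conjC (2^-1 : R[i]) = 2^-1 by rewrite fmorphV rmorph_nat.
have ch s t : c t s = conjC (c s t).
  have -> : conjC (c s t) = conjC (2^-1 : R[i]) * (conjC (c0 s t) + c0 t s).
    by rewrite /c rmorphM rmorphD; congr (_ * (_ + _)); exact: conjCK.
  by rewrite half addrC.
pose a := (2^-1 : R[i]) *: (a0 + adj a0).
have aE : a = \sum_s \sum_t c s t *: (g s ** adj (g t)).
  rewrite /a; have -> : adj a0 = \sum_s \sum_t conjC (c0 t s) *: (g s ** adj (g t)).
    rewrite a0E adj_sum exchange_big; apply: eq_bigr => s _; rewrite adj_sum; apply: eq_bigr => t _.
    by rewrite adjZ adjM adjK.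
  rewrite {1}a0E -big_split scaler_sumr; apply: eq_bigr => s _ /=.
  rewrite -big_split scaler_sumr; apply: eq_bigr => t _ /=.
  by rewrite -scalerDl scalerA.
have pna : nrm (p - a) <= 32%:R^-1.
  have -> : p - a = (2^-1 : R[i]) *: ((p - a0) + adj (p - a0)) by rewrite /a adjB pa; lmod.
  rewrite nrmZ cabs_half; have := nrmD (p - a0) (adj (p - a0)); rewrite nrm_adj; lra.
(* Only columns of paths with the same end w interact, and those share the initial projection p_w,
   as [diagonalization] requires; so a is diagonalized block by block. *)
pose Xw w : finType := {s : X | s \in [pred s : X | rng s.2 == w]}.
have valw w (x : Xw w) : rng (val x).2 = w by have := valP x; rewrite inE => /eqP.
have gw w (s t : Xw w) : adj (g (val s)) ** g (val t) = if s == t then mA 0 0 (PA w) else 0.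
  by rewrite path_col_orth valw val_eqE.
have dg w : exists hd : (Xw w -> OAK) * (Xw w -> R),
    [/\ exists U : Xw w -> Xw w -> R[i], forall k, hd.1 k = \sum_s U k s *: g (val s),
        forall k l, adj (hd.1 k) ** hd.1 l = if k == l then mA 0 0 (PA w) else 0 &
        \sum_(s : Xw w) \sum_(t : Xw w) c (val s) (val t) *: (g (val s) ** adj (g (val t))) =
          \sum_k (hd.2 k)%:C *: (hd.1 k ** adj (hd.1 k))].
  have [h [d [U [h1 h2 h3]]]] := diagonalization (gw w) (fun s t : Xw w => ch (val s) (val t)).
  by exists (h, d); split; [exists U|exact: h2|exact: h3].
have [f hf] := dchoice dg.
pose Z : finType := {w : V & Xw w}.
pose H (z : Z) : OAK := (f (tag z)).1 (tagged z).
pose d (z : Z) : R := (f (tag z)).2 (tagged z).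
pose e (z : Z) : OAK := H z ** adj (H z).
have HH y z : adj (H y) ** H z = if y == z then mA 0 0 (PA (tag y)) else 0.
  case: y z => [w x] [w' x']; rewrite /H /=; case: (w =P w') => [ww|/eqP ww].
    by subst w'; have [_ -> _] := hf w; rewrite eq_Tagged.
  rewrite (_ : (_ == _) = false); last first.
    by apply/negP => /eqP /(congr1 (@tag _ _)) /= h; rewrite h eqxx in ww.
  have [[U ->] _ _] := hf w; have [[U' ->] _ _] := hf w'.
  rewrite adj_sum amul_suml big1 // => s _; rewrite amul_sumr big1 // => t _.
  rewrite adjZ amulZl amulZr path_col_orth; case: eqP => [st|_]; last by rewrite !scaler0.
  by have := valw _ s; rewrite st valw => h; rewrite h eqxx in ww.
have Hgauge z x : `|z| = 1 -> actA z (H x) = z ^+ n *: H x.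
  move=> z1; rewrite /H; have [[U ->] _ _] := hf (tag x).
  rewrite (star_hom_sum (acth z1)) scaler_sumr; apply: eq_bigr => s _.
  by rewrite (star_homZ (acth z1)) path_col_gauge // !scalerA mulrC.
have HP z : H z ** mA 0 0 (PA (tag z)) = H z.
  apply/esym/eqP; rewrite -subr_eq0; apply/eqP; apply: adjM_eq0.
  rewrite adjB adjM mAA (ckPa CKA) amulBl !amulBr -!amulA !(amulA _ (H z)) HH !eqxx.
  by rewrite !mAM !eqxx !(ckP CKA) subrr.
have ea z : adj (e z) = e z by rewrite /e adjM adjK.
have ee y z : e y ** e z = if y == z then e y else 0.
  rewrite /e -amulA (amulA (adj (H y))) HH; case: (y =P z) => [<-|_]; last by rewrite amul0l amul0r.
  by rewrite amulA HP.
have aZ : a = \sum_z (d z)%:C *: e z.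
  transitivity (\sum_w \sum_(k : Xw w) ((f w).2 k)%:C *: ((f w).1 k ** adj ((f w).1 k))); last first.
    by rewrite sig_big_dep.
  rewrite aE (partition_big (fun s : X => rng s.2) xpredT) //=; apply: eq_bigr => w _.
  have [_ _ <-] := hf w.
  transitivity (\sum_(s in [pred s : X | rng s.2 == w]) \sum_(t in [pred s : X | rng s.2 == w])
      c s t *: (g s ** adj (g t))).
    apply: eq_big => s; rewrite ?inE // => /eqP sw; rewrite [RHS]big_mkcond; apply: eq_bigr => t _.
    rewrite inE; case: eqP => // /eqP tw.
    by rewrite /g path_col_cross ?scaler0 // sw eq_sym.
  by rewrite big_sub; apply: eq_bigr => s _; rewrite big_sub.
(* Since the e z have norm 1, bounds on a^2 - a can be read off as bounds on the eigenvalues. *)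
have e0 z : e z != 0.
  apply: contraNneq (P0 (tag z)) => ez.
  have : adj (H z) ** e z ** H z = 0 by rewrite ez amul0r amul0l.
  rewrite /e !amulA HH eqxx -amulA HH eqxx mAM eqxx (ckP CKA) => m0.
  by apply/eqP/(mu_inj (munitsN E) (OAK := OAK) (i := 0%N)); rewrite mu0.
have nrme z : nrm (e z) = 1 by apply: (nrm_projection1 ea ee).
have aa : a ** a - a = \sum_z (d z * d z - d z)%:C *: e z.
  rewrite {1 2}aZ (diag_mul ee) {1}aZ -sumrB; apply: eq_bigr => z _.
  by rewrite rmorphB scalerBl.
have naa : nrm (a ** a - a) <= 10%:R^-1.
  pose y := a - p; have ny : nrm y <= 32%:R^-1 by rewrite /y nrmBC.
  have -> : a ** a - a = p ** y + y ** p + (y ** y - y).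
    have -> : a = p + y by rewrite /y addrC subrK.
    by move: (y) => y'; rewrite amulDl !amulDr ppp; lmod.
  have np := nrm_projection pp.
  have h1 := nrmD (p ** y + y ** p) (y ** y - y); have h2 := nrmD (p ** y) (y ** p).
  have h3 := nrmD (y ** y) (- y); rewrite nrmN in h3.
  have h4 := nrmM p y; have h5 := nrmM y p; have h6 := nrmM y y.
  have := nrm_ge0 y; have := nrm_ge0 p; clear -ny np h1 h2 h3 h4 h5 h6.
  move: (nrm _) (nrm _) (nrm _) ny np h1 h2 h3 h4 h5 h6 => x1 x2 x3.
  nra.
have dd z : `|d z * d z - d z| <= 10%:R^-1.
  have h : (a ** a - a) ** e z = (d z * d z - d z)%:C *: e z.
    rewrite aa amul_suml (bigD1 z) //= big1 ?addr0 => [|y yz]; rewrite amulZl ee.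
      by rewrite eqxx.
    by rewrite (negPf yz) scaler0.
  have := nrmM (a ** a - a) (e z); rewrite h nrmZ cabsC nrme !mulr1 => h1.
  exact: le_trans h1 naa.
pose b z : R := if 1 / 2%:R < d z then 1 else 0.
have db z : `|d z - b z| <= 4%:R^-1.
  rewrite /b; have := dd z; rewrite !ler_norml => /andP[h1 h2]; case: ifP => [h|/negbT]; first by apply/andP; split; nra.
  by rewrite -leNgt => h; apply/andP; split; nra.
pose q := \sum_z (b z)%:C *: e z.
have bb z : b z * b z = b z by rewrite /b; case: ifP; rewrite ?mulr1 ?mulr0.
have pq : projection q.
  split; last exact: diag_adj.
  by rewrite /q (diag_mul ee); apply: eq_bigr => z _; rewrite bb.
have npq : nrm (p - q) < 1.
  have naq : nrm (a - q) <= 4%:R^-1.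
    have -> : a - q = \sum_z (d z - b z)%:C *: e z.
      by rewrite aZ /q -sumrB; apply: eq_bigr => z _; rewrite rmorphB scalerBl.
    by apply: (diag_norm_le ea ee) => //; rewrite invr_gt0 ltr0n.
  have := nrm_tri a p q; lra.
have qfix : fixed actA q.
  move=> z z1; have hz := acth z1; rewrite /q (star_hom_sum hz); apply: eq_bigr => x _.
  rewrite (star_homZ hz) /e (star_homM hz) (star_homV hz) Hgauge // adjZ amulZl amulZr scalerA.
  have zz : z * conjC z = 1 by rewrite -normCK z1 expr1n.
  suff -> : z ^+ n * conjC (z ^+ n) = 1 by rewrite scale1r.
  by rewrite rmorphXn /= -exprMn zz expr1n.
pose J : finType := {z : Z | z \in [pred z | 1 / 2%:R < d z]}.
exists n, J, (fun z => tag (val z)).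
rewrite -[n%:Z]add0r.
have qq : idem (fun _ : unit => p) by move=> _; exact: ppp.
apply: (rel_trans acth qq (std_idem E _) (close_projections_rel acth pp pq pfix qfix npq)).
exists (fun _ z => H (val z)), (fun z _ => adj (H (val z))); split.
- by move=> z _ x z1; rewrite Hgauge.
- move=> z _ x z1; rewrite (star_homV (acth z1)) Hgauge // adjZ rmorphXn /=.
  by rewrite unit_exprz_conj.
- move=> [] []; rewrite /q /=.
  transitivity (\sum_(z in [pred z : Z | 1 / 2%:R < d z]) e z).
    by rewrite [RHS]big_sub.
  rewrite big_mkcond; apply: eq_bigr => z _; rewrite inE /b.
  by case: ifP; rewrite ?scale1r ?scale0r.
- move=> x y; rewrite (big_pred1 tt) => [|[]//]; rewrite HH val_eqE.
  by [].
Qed.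

End ProjectionsAreStandard.

(** * From homotopy equivalence to shift equivalence *)

Section MatrixAlgebra.

Lemma matmulA (T U V W : finType) (A : T -> U -> nat) (B : U -> V -> nat) (C : V -> W -> nat) :
  matmul (matmul A B) C = matmul A (matmul B C).
Proof.
apply: funext => t; apply: funext => w; rewrite /matmul.
under eq_bigr do rewrite big_distrl /=.
rewrite exchange_big; apply: eq_bigr => u _; rewrite big_distrr /=.
by apply: eq_bigr => v _; rewrite mulnA.
Qed.

Lemma matmul1l (V W : finType) (A : V -> W -> nat) : matmul (fun v w => (v == w) : nat) A = A.
Proof.
apply: funext => v; apply: funext => w; rewrite /matmul (bigD1 v) //= eqxx mul1n big1 ?addn0 // => u.
by rewrite eq_sym => /negPf ->.
Qed.

Lemma matpowD (V : finType) (A : V -> V -> nat) m n :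
  matpow A (m + n) = matmul (matpow A m) (matpow A n).
Proof. by elim: m => [|m IH]; [rewrite matmul1l|rewrite addSn /= matmulA -IH]. Qed.

Lemma matmul1r (V W : finType) (A : V -> W -> nat) : matmul A (fun v w => (v == w) : nat) = A.
Proof.
apply: funext => v; apply: funext => w; rewrite /matmul (bigD1 w) //= eqxx muln1 big1 ?addn0 // => u.
by move=> /negPf ->; rewrite muln0.
Qed.

Lemma matpow1 (V : finType) (A : V -> V -> nat) : matpow A 1 = A.
Proof. exact: matmul1r. Qed.

Lemma matpow_comm (V : finType) (A : V -> V -> nat) n : matmul A (matpow A n) = matmul (matpow A n) A.
Proof. by rewrite -{1 4}(matpow1 A) -!matpowD addnC. Qed.

(** B S = S A is known only in front of A^k. As powers of A commute, A^k can be kept next to S while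
    the factors B pass one at a time. *)
Lemma matpow_intertwine (V W : finType) (A : V -> V -> nat) (B : W -> W -> nat) (S : W -> V -> nat) k :
  matmul (matmul B S) (matpow A k) = matmul (matmul S A) (matpow A k) ->
  forall j, matmul (matpow B j) (matmul S (matpow A k)) = matmul S (matmul (matpow A j) (matpow A k)).
Proof.
move=> h; elim=> [|j IH]; first by rewrite !matmul1l.
rewrite /= matmulA IH -matpowD addnC matpowD -2![in LHS]matmulA h.
by rewrite !matmulA -!matpowD addnC.
Qed.

(** R B^k and S A^k are a shift equivalence with lag m + 2 k: R B^k S A^k = R S A^k A^k = A^(m + 2
    k), and symmetrically. *)
Lemma shift_equivalent_eventually (V W : finType) (A : V -> V -> nat) (B : W -> W -> nat)
    (R : V -> W -> nat) (S : W -> V -> nat) m k : (0 < k)%N ->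
  matmul (matpow A m) (matpow A k) = matmul (matmul R S) (matpow A k) ->
  matmul (matpow B m) (matpow B k) = matmul (matmul S R) (matpow B k) ->
  matmul (matmul A R) (matpow B k) = matmul (matmul R B) (matpow B k) ->
  matmul (matmul B S) (matpow A k) = matmul (matmul S A) (matpow A k) ->
  shift_equivalent A B.
Proof.
move=> k0 AR BS ARB BSA; exists (m + k + k)%N; first by rewrite addn_gt0 k0 orbT.
exists (matmul R (matpow B k)), (matmul S (matpow A k)); split.
- rewrite matmulA (matpow_intertwine BSA) -!matmulA -AR.
  by rewrite !matpowD.
- rewrite matmulA (matpow_intertwine ARB) -!matmulA -BS.
  by rewrite !matpowD.
- by rewrite -matmulA BSA !matmulA matpow_comm.
- by rewrite -matmulA ARB !matmulA matpow_comm.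
Qed.

Lemma sum_count (J V : finType) (rho : J -> V) (M : V -> nat) :
  (\sum_j M (rho j) = \sum_v #|[pred j | rho j == v]| * M v)%N.
Proof.
rewrite (partition_big rho xpredT) //=; apply: eq_bigr => v _.
rewrite -sum1_card big_distrl /=; apply: eq_big => j; rewrite ?inE // => /eqP ->.
by rewrite mul1n.
Qed.

End MatrixAlgebra.

Section Realization.
Context {R : realType} {K : compact_operators R}.
Variable eps : nat -> nat -> K.
Hypothesis E : munits eps.
Context {V : finType} {A : V -> V -> nat} {OA : graph_algebra R A} {OAK : stabilization OA K}.
Context {W : finType} {B : W -> W -> nat} {OB : graph_algebra R B} {OBK : stabilization OB K}.
Notation mA := (mu OAK eps).
Notation PA := (vertex_proj OA).
Notation actA := (@stab_gauge _ _ _ _ _ OAK).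
Notation QB := (vertex_proj OB).
Notation actB := (@stab_gauge _ _ _ _ _ OBK).
Notation stdA := (std (OA := OA) (OAK := OAK) eps).
Notation stdB := (std (OA := OB) (OAK := OBK) eps).
Let actBh := fun z => @stab_gauge_hom _ _ _ _ _ OBK z.

Definition realizes (N : nat) (tau : OAK -> OBK) (M : V -> W -> nat) : Prop :=
  forall v, exists (J : finType) (rho : J -> W),
    rel actB N%:Z (fun _ : unit => tau (mA 0 0 (PA v))) (stdB rho) /\
    forall w, #|[pred j | rho j == w]| = M v w.

(** The degrees found for the finitely many vertices differ; [bump_rel] raises each of them to a
    common N. *)
Lemma realizes_exists (tau : OAK -> OBK) : (forall w, QB w != 0) -> equivariant_star_hom actA actB tau ->
  exists N0, forall N, (N0 <= N)%N -> exists M, realizes N tau M.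
Proof.
move=> Q0 [ht et].
have h v : exists n, exists (J : finType) (rho : J -> W),
    rel actB n%:Z (fun _ : unit => tau (mA 0 0 (PA v))) (stdB rho).
  have [mm ma] : projection (mA 0 0 (PA v)).
    split; first by rewrite (muM OAK (munitsM E)) eqxx (ckP (graph_family OA)).
    by rewrite (muA OAK (munitsA E)) (ckPa (graph_family OA)).
  apply: (projection_rel E Q0); first by split; rewrite -?(star_homM ht) -?(star_homV ht) ?mm ?ma.
  by move=> z z1; rewrite -et // stab_gauge_P.
have [n hn] := choice h; exists (\sum_v n v)%N => N nN.
have h2 v : exists M : W -> nat, exists (J : finType) (rho : J -> W),
    rel actB N%:Z (fun _ : unit => tau (mA 0 0 (PA v))) (stdB rho) /\
    forall w, #|[pred j | rho j == w]| = M w.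
  have [J [rho hr]] := hn v.
  exists (fun w => #|[pred x | @bump _ _ _ OB (N - n v) J rho x == w]|), (bump_idx (OA := OB) (N - n v) rho), (bump (OA := OB) (n := N - n v) (rho := rho)); split=> //.
  have -> : N%:Z = (n v)%:Z + (N - n v)%N%:Z.
    by rewrite -PoszD subnKC // (leq_trans _ nN) // (bigD1 v) //= leq_addr.
  apply: (rel_trans actBh _ _ hr (bump_rel E _ _)); last exact: std_idem.
  by move=> _; rewrite -(star_homM ht) (muM OAK (munitsM E)) eqxx (ckP (graph_family OA)).
by have [M hM] := choice h2; exists M.
Qed.

Lemma realizes_push N (tau : OAK -> OBK) M (I : finType) (phi : I -> V) : realizes N tau M ->
  exists (L : finType) (psi : L -> W), rel actB N%:Z (tau \o stdA phi) (stdB psi) /\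
    forall w, #|[pred l | psi l == w]| = (\sum_i M (phi i) w)%N.
Proof.
move=> h.
have [J hJ] := dchoice (fun v => h v).
have [rho hr] := dchoice hJ.
exists {i : I & J (phi i)}, (fun x => rho (phi (tag x)) (tagged x)); split.
  exact: (rel_sum actBh (q := fun i => stdB (rho (phi i))) (fun i => (hr (phi i)).1)).
move=> w; rewrite -sum1_card.
transitivity (\sum_i \sum_(j : J (phi i) | rho (phi i) j == w) 1)%N; first by rewrite sig_big_dep.
by apply: eq_bigr => i _; rewrite -(hr (phi i)).2 -sum1_card.
Qed.

Lemma std_rel_eq (J L : finType) (rho : J -> W) (rho' : L -> W) : (forall w, QB w != 0) ->
  rel actB 0 (stdB rho) (stdB rho') ->
  exists N, forall n w, (N <= n)%N ->
    (\sum_v #|[pred j | rho j == v]| * matpow B n v w = \sum_v #|[pred j | rho' j == v]| * matpow B n v w)%N.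
Proof.
move=> Q0 h; have [N1 h1] := std_rel_le E Q0 h.
have h' : rel actB 0 (stdB rho') (stdB rho) by rewrite -oppr0; exact: rel_sym.
have [N2 h2] := std_rel_le E Q0 h'; exists (N1 + N2)%N => n w Nn.
apply/eqP; rewrite -!(sum_count _ (fun v => matpow B n v w)) eqn_leq h1 ?h2 //.
  by apply: leq_trans Nn; rewrite leq_addl.
by apply: leq_trans Nn; rewrite leq_addr.
Qed.

(** tau (p_v) is decomposed in two ways by elements of degree N + 1: splitting p_v along the edges
    of A before applying tau gives A M, splitting the result along the edges of B gives M B. The two
    sums are thus equivalent in degree 0. *)
Lemma realizes_intertwine N (tau : OAK -> OBK) M v : (forall w, QB w != 0) ->
  equivariant_star_hom actA actB tau -> realizes N tau M ->
  exists K0, forall n w, (K0 <= n)%N ->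
    matmul (matmul A M) (matpow B n) v w = matmul (matmul M B) (matpow B n) v w.
Proof.
move=> Q0 et hM; have [ht _] := et.
have r1 := rel_hom et (vertex_rel E 1 v (OAK := OAK)).
have [L [psi [r2 c2]]] := realizes_push (fun x : lev_from (OA := OA) 1 v => rng (val x)) hM.
have [J [rho [r3 c3]]] := hM v.
have r4 := bump_rel E 1 rho (OAK := OBK).
have i1 : idem (fun _ : unit => tau (mA 0 0 (PA v))).
  by move=> _; rewrite -(star_homM ht) (muM OAK (munitsM E)) eqxx (ckP (graph_family OA)).
have r12 := rel_trans actBh i1 (std_idem E _) r1 r2.
have r34 := rel_trans actBh i1 (std_idem E _) r3 r4.
have r := rel_trans actBh (std_idem E _) (std_idem E _) (rel_sym r12) r34.
have {}r : rel actB 0 (stdB psi) (stdB (bump (OA := OB) (n := 1) (rho := rho))).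
  by move: r; rewrite [1%:Z + _]addrC addNr.
have [N1 h] := std_rel_eq Q0 r; exists N1 => n w /h hw.
rewrite /matmul; move: (hw w).
have AM u : #|[pred j | psi j == u]| = matmul A M v u.
  rewrite c2 (sum_count _ (fun t => M t u)) /matmul; apply: eq_bigr => t _; congr (_ * _)%N.
  by rewrite -[in RHS](matpow1 A) -(lev_from_count (OA := OA)).
have MB u : #|[pred x | bump (OA := OB) (n := 1) (rho := rho) x == u]| = matmul M B v u.
  rewrite bump_count (sum_count rho (fun t => matpow B 1 t u)) matpow1 /matmul.
  by apply: eq_bigr => t _; rewrite c3.
by under eq_bigr do rewrite AM; under [in RHS]eq_bigr do rewrite MB.
Qed.

End Realization.

Section HomotopyImpliesShift.
Context {R : realType} {K : compact_operators R}.
Variable eps : nat -> nat -> K.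
Hypothesis E : munits eps.
Context {V : finType} {A : V -> V -> nat} {OA : graph_algebra R A} {OAK : stabilization OA K}.
Context {W : finType} {B : W -> W -> nat} {OB : graph_algebra R B} {OBK : stabilization OB K}.
Notation mA := (mu OAK eps).
Notation PA := (vertex_proj OA).
Notation actA := (@stab_gauge _ _ _ _ _ OAK).
Notation actB := (@stab_gauge _ _ _ _ _ OBK).
Let actAh := fun z => @stab_gauge_hom _ _ _ _ _ OAK z.

(** The homotopy makes rho (tau p_v) equivalent to p_v in degree 0. The first is decomposed in
    degree 2 N with multiplicities M M', the second with A^(2 N); this is where the lag comes
    from. *)
Lemma realizes_composite N (tau : OAK -> OBK) (rho : OBK -> OAK) M M' v : (forall v, PA v != 0) ->
  equivariant_star_hom actA actB tau -> equivariant_star_hom actB actA rho ->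
  realizes eps N tau M -> realizes eps N rho M' ->
  equivariantly_homotopic actA actA (rho \o tau) id ->
  exists K0, forall n w, (K0 <= n)%N ->
    matmul (matpow A (N + N)) (matpow A n) v w = matmul (matmul M M') (matpow A n) v w.
Proof.
move=> P0 et er hM hM' [h [h1 h2 h3 h4]].
have [J [phi [r1 c1]]] := hM v.
have r2 := rel_hom er r1.
have [L [psi [r3 c3]]] := realizes_push phi hM'.
have mm : mA 0 0 (PA v) ** mA 0 0 (PA v) = mA 0 0 (PA v).
  by rewrite (muM OAK (munitsM E)) eqxx (ckP (graph_family OA)).
have ma : adj (mA 0 0 (PA v)) = mA 0 0 (PA v).
  by rewrite (muA OAK (munitsA E)) (ckPa (graph_family OA)).
have i1 : idem (fun _ : unit => rho (tau (mA 0 0 (PA v)))).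
  by move=> _; rewrite -(star_homM er.1) -(star_homM et.1) mm.
have r5 : rel actA 0 (fun _ : unit => rho (tau (mA 0 0 (PA v)))) (fun _ : unit => mA 0 0 (PA v)).
  have : rel actA 0 (fun _ : unit => h 0 (mA 0 0 (PA v))) (fun _ : unit => h 1 (mA 0 0 (PA v))).
    apply: (path_rel actAh (g := fun s => h s (mA 0 0 (PA v)))) (h2 _) => s s01.
    have [hs es] := h1 s s01; split; first by split; rewrite -?(star_homM hs) -?(star_homV hs) ?mm ?ma.
    by move=> z z1; rewrite -es // stab_gauge_P.
  by rewrite h3 h4.
have r6 := vertex_rel E (N + N) v (OAK := OAK).
have r56 := rel_trans actAh i1 (std_idem E _) r5 r6.
have r23 := rel_trans actAh i1 (std_idem E _) r2 r3.
have r := rel_trans actAh (std_idem E _) (std_idem E _) (rel_sym r56) r23.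
have {}r : rel actA 0 (std (OA := OA) (OAK := OAK) eps (fun x : lev_from (OA := OA) (N + N) v => rng (val x)))
    (std (OA := OA) (OAK := OAK) eps psi).
  by move: r; rewrite add0r -PoszD addNr.
have [N1 hN] := std_rel_eq E P0 r; exists N1 => n w Nn.
rewrite /matmul; move: (hN n w Nn).
under eq_bigr do rewrite lev_from_count.
move=> ->; apply: eq_bigr => u _; congr (_ * _)%N.
by rewrite c3 (sum_count phi (fun t => M' t u)); apply: eq_bigr => t _; rewrite c1.
Qed.

End HomotopyImpliesShift.

Lemma eventually_all (I : finType) (P : I -> nat -> Prop) :
  (forall i, exists N, forall n, (N <= n)%N -> P i n) -> exists N, forall n, (N <= n)%N -> forall i, P i n.
Proof.
move=> h; have [N hN] := choice h; exists (\sum_i N i)%N => n Nn i; apply: hN.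
by apply: leq_trans Nn; rewrite (bigD1 i) //= leq_addr.
Qed.

Lemma homotopy_shift_equivalent {R : realType} {V W : finType}
    {A : V -> V -> nat} {B : W -> W -> nat} {OA : graph_algebra R A} {OB : graph_algebra R B}
    {K : compact_operators R} {OAK : stabilization OA K} {OBK : stabilization OB K} :
  essential A -> essential B -> stably_equivariantly_homotopy_equivalent OAK OBK ->
  shift_equivalent A B.
Proof.
move=> [rowA colA] [rowB colB] [tau [rho [et er htr hrt]]].
have [eps E0] := matrix_units K; have {E0}E : munits eps by case: E0.
have PA0 v : vertex_proj OA v != 0 by exact: (vertex_proj_neq0 K rowA).
have QB0 w : vertex_proj OB w != 0 by exact: (vertex_proj_neq0 K rowB).
have [N1 h1] := realizes_exists E QB0 et; have [N2 h2] := realizes_exists E PA0 er.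
pose N := (N1 + N2)%N.
have [M hM] := h1 N (leq_addr _ _); have [S hS] := h2 N (leq_addl _ _).
have ev (I J : finType) (F G : nat -> I -> J -> nat) :
    (forall i, exists K0, forall n j, (K0 <= n)%N -> F n i j = G n i j) ->
    exists K0, forall n, (K0 <= n)%N -> F n = G n.
  move=> h; have [K0 hK] := eventually_all (P := fun i n => forall j, F n i j = G n i j)
    (fun i => let: ex_intro k hk := h i in ex_intro _ k (fun n nk j => hk n j nk)).
  by exists K0 => n /hK hn; apply: funext => i; apply: funext => j; exact: hn.
have [k1 e1] := ev _ _ _ _ (fun v => realizes_composite E v PA0 et er hM hS hrt).
have [k2 e2] := ev _ _ _ _ (fun w => realizes_composite E w QB0 er et hS hM htr).
have [k3 e3] := ev _ _ _ _ (fun v => realizes_intertwine E v QB0 et hM).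
have [k4 e4] := ev _ _ _ _ (fun w => realizes_intertwine E w PA0 er hS).
(* A power beyond all four thresholds, and positive so that the lag is. *)
pose k := (k1 + k2 + k3 + k4).+1.
by apply: (@shift_equivalent_eventually V W A B M S (N + N) k) => //;
  [apply: e1|apply: e2|apply: e3|apply: e4]; rewrite /k; lia.
Qed.

(* O_A, O_B, K and the tensor products are unique up to canonical (equivariant)
   isomorphism; the theorem is stated for every choice of them. *)
Theorem theorem1 (R : realType) (V W : finType)
    (A : V -> V -> nat) (B : W -> W -> nat)
    (A_essential : essential A) (B_essential : essential B)
    (OA : graph_algebra R A) (OB : graph_algebra R B)
    (K : compact_operators R)
    (OAK : stabilization OA K) (OBK : stabilization OB K) :
  shift_equivalent A B <-> stably_equivariantly_homotopy_equivalent OAK OBK.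
Proof.
by split; [exact: shift_equivalent_homotopy|exact: homotopy_shift_equivalent].
Qed.
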